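(* Assume that the Lagrangians $L_1,\dots,L_N$ satisfy (A1) and (A2) (stated in the context). Let $T>0$ and let $u_0:J\to\mathbb{R}$ be Lipschitz continuous. Let $w$ be the solution of the semi-Lagrangian scheme $w(t_{n+1},x)=S[\hat w^n](x)$, $w(0,x)=u_0(x)$, $x\in J^{\Delta x}$, with mesh $\Delta=(\Delta x,\Delta t)$. Assume that $\frac{\Delta x^2}{\Delta t}\to0$ as $\Delta\to(0,0)$. Then $w$ converges locally uniformly, as $\Delta\to(0,0)$, to the unique viscosity (flux-limited) solution $u$ of $$\partial_t u+H_i(x,u_x)=0 \ \text{ in } (0,T)\times (J_i\setminus\{0\}),\ i=1,\dots,N,\qquad \partial_t u+F_A(u_x)=0\ \text{ in } (0,T)\times\{0\},\qquad u(0,\cdot)=u_0;$$ that is, for every compact set $\mathcal K\subset(0,T)\times J$, $$\limsup_{\Delta x,\Delta t\to0}\ \sup_{(t,x)\in\mathcal K\cap\mathcal G^{\Delta}}|w(t,x)-u(t,x)|=0.$$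
   Context: Junction: fix $N\ge1$ and distinct unit vectors $e_1,\dots,e_N$; $J_i=\{k e_i: k\ge 0\}$ (isometric to $[0,+\infty)$), $J=\bigcup_{i=1}^N J_i$, with $J_i\cap J_j=\{0\}$ for $i\ne j$. For $x=ke_i$ write $|x|=k$, and $L_i(x,\alpha)$ means $L_i(|x|,\alpha)$. $\partial_i\varphi$ is the derivative along $J_i$ with respect to $k$; $\varphi_x(x)=\partial_i\varphi(x)$ if $x\in J_i\setminus\{0\}$ and $\varphi_x(0)=(\partial_1\varphi(0),\dots,\partial_N\varphi(0))$. The distance on $J$ is $d(x,y)=|x-y|$ if $x,y$ lie on a common $J_i$ and $|x|+|y|$ otherwise. $C^1((0,T)\times J)$ is the set of continuous functions on $(0,T)\times J$ whose restriction to each $(0,T)\times J_i$ is $C^1$. Assumptions: (A1) the functions $L_i:[0,\infty)\times\mathbb{R}\to\mathbb{R}$ are strictly convex with respect to the second argument and uniformly Lipschitz continuous; (A2) $L_i(x,\alpha)/|\alpha|\to+\infty$ as $|\alpha|\to+\infty$, uniformly in $x\in[0,\infty)$. A constant $\bar L_0\in\mathbb{R}$ is the running cost for staying at the junction point. Hamiltonians: $H_i(x,p)=\sup_{\alpha\in\mathbb{R}}\{\alpha p-L_i(x,\alpha)\}$, $H_i^-(x,p)=\sup_{\alpha\le0}\{\alpha p-L_i(x,\alpha)\}$ (the non-increasing part), $A=-\bar L_0$, $F_A(p_1,\dots,p_N)=\max\big(A,\max_iH_i^-(0,p_i)\big)$. Flux-limited solution: $u$ is a sub-solution (resp. super-solution)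 if for every $\varphi\in C^1((0,T)\times J)$ such that $u^*-\varphi$ has a local maximum (resp. $u_*-\varphi$ a local minimum) at $(t_0,x_0)\in(0,T)\times J$, one has $\varphi_t+H_i(x_0,\varphi_x)\le0$ (resp. $\ge0$) at $(t_0,x_0)$ if $x_0\in J_i\setminus\{0\}$, and $\varphi_t+F_A(\varphi_x)\le0$ (resp. $\ge0$) if $x_0=0$, and moreover $u^*(0,x)\le u_0(x)$ (resp. $u_*(0,x)\ge u_0(x)$); $u^*,u_*$ are the upper/lower semicontinuous envelopes. A solution is both. Scheme: given $\Delta t,\Delta x>0$, $N_T=\lfloor T/\Delta t\rfloor$, $t_n=n\Delta t$, $J^{\Delta x}=\bigcup_i\{k\Delta x\,e_i:k\in\mathbb{N}\}$ (with $0\in J^{\Delta x}$), $\mathcal G^{\Delta}=\{t_n:n=0,\dots,N_T\}\times J^{\Delta x}$. $\mathbb{I}[\hat v](z)$, $z\in J$, is the continuous piecewise linear (on each arc) interpolation of the grid values $\hat v=\{v(x)\}_{x\in J^{\Delta x}}$. For $x\in J^{\Delta x}\cap(J_i\setminus\{0\})$, $S[\hat v](x)=\min(\mathcal I_1,\mathcal I_2)$ with $$\mathcal I_1=\inf_{\alpha_i<|x|/\Delta t}\big\{\mathbb{I}[\hat v](x-\alpha_i\Delta t\,e_i)+\Delta t\,L_i(x,\alpha_i)\big\},$$ $$\mathcal I_2=\inf_{\alpha_i\ge |x|/\Delta t}\ \inf_{s_0\in[0,\Delta t-|x|/\alpha_i]}\ \inf_{j\in\{1,\dots,N\},\,\alpha_j\le0}\Big\{\mathbb{I}[\hat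 v](-\theta\alpha_je_j)+\theta L_j(0,\alpha_j)+s_0\bar L_0+\tfrac{|x|}{\alpha_i}L_i(x,\alpha_i)\Big\},\quad \theta=\Delta t-s_0-\tfrac{|x|}{\alpha_i},$$ and $$S[\hat v](0)=\inf_{s_0\in[0,\Delta t]}\ \inf_{j,\,\alpha_j\le0}\big\{\mathbb{I}[\hat v](-(\Delta t-s_0)\alpha_je_j)+(\Delta t-s_0)L_j(0,\alpha_j)+s_0\bar L_0\big\}.$$ (In $\mathcal I_2$ the control $\alpha_j$ is chosen independently of $\alpha_i$, also when $j=i$.) The discrete solution is $w(0,x)=u_0(x)$, $w(t_{n+1},x)=S[\hat w^n](x)$, where $w^n=\{w(t_n,x)\}_{x\in J^{\Delta x}}$.
   Formalization: Uniqueness of the flux-limited solution is asserted among solutions with |u(t,x)| ≤ C(1+|x|), since it fails without a growth condition; ''uniformly Lipschitz'' in (A1) is read as Lipschitz in x uniformly in α, because joint Lipschitz continuity contradicts (A2). *)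

(* Defs.v *)
From HB Require Import structures.
From mathcomp Require Import all_boot all_order all_algebra.
From mathcomp Require Import all_classical all_reals all_analysis.
From mathcomp Require Import lra.
Set Implicit Arguments.
Unset Strict Implicit.
Unset Printing Implicit Defensive.
Import Order.TTheory GRing.Theory Num.Theory.
Import numFieldNormedType.Exports.
Local Open Scope classical_set_scope.
Local Open Scope ring_scope.

Section Junction.
Context {R : realType} {V : normedModType R} {N : nat}.
Variable e : 'I_N -> V.

Definition unit_directions : Prop :=
  injective e /\ (forall i, `|e i| = 1).

Definition branch (i : 'I_N) : set V :=
  [set x | exists2 k : R, 0 <= k & x = k *: e i].

Definition open_branch (i : 'I_N) : set V := branch i `\ 0.

(* Functions on the junction are functions on V of which only the values on
   the set below matter; |x| is the norm of V, as `|k *: e i| = k for 0 <= k. *)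
Definition junction : set V := \bigcup_(i in [set: 'I_N]) branch i.

Definition jdist (x y : V) : R :=
  if `[< exists i, branch i x /\ branch i y >] then `|x - y| else `|x| + `|y|.

(* jdist and the norm of V are equivalent distances on the junction. Its
   topology is therefore the subspace topology, which the definitions below
   use through [within]. *)
Lemma jdist_equiv : unit_directions ->
  exists2 c : R, 0 < c & forall x y, junction x -> junction y ->
    c * jdist x y <= `|x - y| <= jdist x y.
Proof.
move=> [e_inj e_unit].
pose del (p : 'I_N * 'I_N) := if p.1 == p.2 then 1 else `|e p.1 - e p.2|.
have del0 p : 0 < del p.
  rewrite /del; case: eqP => // np.
  by rewrite normr_gt0 subr_eq0; apply/eqP => /e_inj.
pose m := \big[Num.min/1]_p del p.
have m0 : 0 < m.
  by rewrite /m; elim/big_ind: _ => // a b a0 b0; rewrite lt_min a0 b0.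
have mle p : m <= del p by exact: bigmin_le_cond.
have m1 : m <= 1 by exact: bigmin_le_id.
have scaleE i j (k l : R) : 0 <= l -> l <= k ->
    m * (k + l) <= 5 * `|k *: e i - l *: e j| \/ i = j.
  move=> l0 lk; have [->|ij] := eqVneq i j; [by right|left].
  have hm := mle (i, j); rewrite /del /= (negbTE ij) in hm.
  have d1 : k - l <= `|k *: e i - l *: e j|.
    apply: le_trans (lerB_dist _ _).
    by rewrite !normrZ !e_unit !mulr1 !ger0_norm //; exact: le_trans lk.
  have d2 : l * `|e i - e j| - (k - l) <= `|k *: e i - l *: e j|.
    have -> : l * `|e i - e j| = `|l *: e i - l *: e j|.
      by rewrite -scalerBr normrZ (ger0_norm l0).
    have -> : k - l = `|l *: e i - k *: e i|.
      by rewrite -scalerBl normrZ e_unit mulr1 distrC ger0_norm // subr_ge0.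
    by rewrite lerBlDl; exact: ler_distD.
  have h1 : l * m <= l * `|e i - e j| by exact: ler_wpM2l.
  have h2 : m * (k - l) <= 1 * (k - l) by rewrite ler_wpM2r // subr_ge0.
  lra.
exists (m / 5); first by rewrite divr_gt0.
move=> x y [i _ [k k0 ->]] [j _ [l l0 ->]]; rewrite /jdist.
case: asboolP => [_|nij].
  rewrite lexx andbT; apply: ler_piMl => //.
  by rewrite ler_pdivrMr // mul1r; lra.
rewrite ler_normB andbT !normrZ !e_unit !mulr1 !ger0_norm //.
have nej : i <> j by move=> ij; apply: nij; exists j; rewrite ij; split;
  [exists k | exists l].
rewrite mulrAC ler_pdivrMr // [leRHS]mulrC.
have [lk|/ltW kl] := leP l k.
- by have [//|/nej] := scaleE i j _ _ l0 lk.
- rewrite distrC [k + l]addrC.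
  by have [//|/esym/nej] := scaleE j i _ _ k0 kl.
Qed.

Definition jlipschitz (u : V -> R) : Prop :=
  exists C : R, forall x y, junction x -> junction y ->
    `|u x - u y| <= C * jdist x y.

Variable L : 'I_N -> R -> R -> R.

(* The Lipschitz bound is in the position, uniformly in the velocity: a bound
   in the velocity would contradict [superlinear_lagrangian]. *)
Definition convex_lipschitz_lagrangian : Prop :=
  (forall i (x a b t : R), 0 <= x -> a != b -> 0 < t -> t < 1 ->
     L i x (t * a + (1 - t) * b) < t * L i x a + (1 - t) * L i x b) /\
  (exists C : R, forall i (x y a : R), 0 <= x -> 0 <= y ->
     `|L i x a - L i y a| <= C * `|x - y|).

Definition superlinear_lagrangian : Prop :=
  forall i (M : R), exists B : R, forall x a : R,
    0 <= x -> B <= `|a| -> M <= L i x a / `|a|.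

Definition hamiltonian (i : 'I_N) (x p : R) : R :=
  sup [set a * p - L i x a | a in [set: R]].

Definition hamiltonian_dec (i : 'I_N) (x p : R) : R :=
  sup [set a * p - L i x a | a in [set a | a <= 0]].

Variable L0 : R.

Definition flux_limiter (p : 'I_N -> R) : R :=
  \big[Num.max/- L0]_(i < N) hamiltonian_dec i 0 (p i).

Variable T : R.

Definition closed_domain : set (R * V) := `[0, T[ `*` junction.
Definition open_domain : set (R * V) := `]0, T[ `*` junction.

(* [test_function phi phit phix]: phi is C^1 on (0, T) x J, phit is its time
   derivative and phix i t x its derivative along the i-th branch at x. The
   restriction of the increment h to 0 <= k + h makes it one-sided at k = 0. *)
Definition test_function (phi phit : R -> V -> R) (phix : 'I_N -> R -> V -> R)
    : Prop :=
  {within open_domain, continuous (fun z : R * V => phi z.1 z.2)} /\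
  forall i : 'I_N,
    [/\ forall t x, 0 < t < T -> branch i x ->
          is_derive t (1 : R) (fun s => phi s x) (phit t x),
        forall t k, 0 < t < T -> 0 <= k ->
          h^-1 * (phi t ((k + h) *: e i) - phi t (k *: e i))
            @[h --> within [set h | 0 <= k + h] (0 : R)^']
            --> phix i t (k *: e i),
        {within `]0, T[ `*` branch i,
           continuous (fun z : R * V => phit z.1 z.2)} &
        {within `]0, T[ `*` branch i,
           continuous (fun z : R * V => phix i z.1 z.2)}].

Definition upper_envelope (u : R -> V -> R) (z : R * V) : \bar R :=
  limf_esup (fun y : R * V => (u y.1 y.2)%:E) (within closed_domain (nbhs z)).

Definition lower_envelope (u : R -> V -> R) (z : R * V) : \bar R :=
  limf_einf (fun y : R * V => (u y.1 y.2)%:E) (within closed_domain (nbhs z)).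

Definition local_max (f : R * V -> \bar R) (z : R * V) : Prop :=
  \forall y \near within open_domain (nbhs z), (f y <= f z)%E.

Definition local_min (f : R * V -> \bar R) (z : R * V) : Prop :=
  \forall y \near within open_domain (nbhs z), (f z <= f y)%E.

Variable u0 : V -> R.

Definition subsolution (u : R -> V -> R) : Prop :=
  (forall phi phit phix, test_function phi phit phix ->
    forall t x, open_domain (t, x) ->
    local_max (fun z => upper_envelope u z - (phi z.1 z.2)%:E)%E (t, x) ->
    (forall i, open_branch i x ->
       phit t x + hamiltonian i `|x| (phix i t x) <= 0) /\
    (x = 0 -> phit t x + flux_limiter (fun i => phix i t x) <= 0)) /\
  (forall x, junction x -> (upper_envelope u (0%R, x) <= (u0 x)%:E)%E).

Definition supersolution (u : R -> V -> R) : Prop :=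
  (forall phi phit phix, test_function phi phit phix ->
    forall t x, open_domain (t, x) ->
    local_min (fun z => lower_envelope u z - (phi z.1 z.2)%:E)%E (t, x) ->
    (forall i, open_branch i x ->
       0 <= phit t x + hamiltonian i `|x| (phix i t x)) /\
    (x = 0 -> 0 <= phit t x + flux_limiter (fun i => phix i t x))) /\
  (forall x, junction x -> ((u0 x)%:E <= lower_envelope u (0%R, x))%E).

Definition flux_limited_solution (u : R -> V -> R) : Prop :=
  subsolution u /\ supersolution u.

(* The class in which the comparison principle, hence uniqueness, holds.
   Without it there can be further discontinuous solutions: from a solution,
   lower the values along a curve coming from infinity at a positive time. *)
Definition linear_growth (u : R -> V -> R) : Prop :=
  exists C : R, forall t x, 0 <= t < T -> junction x ->
    `|u t x| <= C * (1 + `|x|).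

Definition jgrid (dx : R) : set V :=
  [set x | exists i (k : nat), x = (k%:R * dx) *: e i].

(* With z = y *: e i and y > 0, `|z|^-1 *: z is e i; for z = 0 the value is
   v 0, as 0^-1 = 0. Only the values of v on the grid are used. *)
Definition interp (dx : R) (v : V -> R) (z : V) : R :=
  let k := Num.truncn (`|z| / dx) in
  let r := `|z| / dx - k%:R in
  let node (m : nat) := (m%:R * dx) *: (`|z|^-1 *: z) in
  (1 - r) * v (node k) + r * v (node k.+1).

(* The infima are over nonempty sets, which are bounded below if v has at most
   linear growth and L is superlinear. *)

Definition scheme_inner (dx dt : R) (v : V -> R) (x : V) : R :=
  inf [set r | exists (i : 'I_N) (a : R),
    [/\ branch i x, a < `|x| / dt &
        r = interp dx v (x - (a * dt) *: e i) + dt * L i `|x| a]].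

Definition scheme_cross (dx dt : R) (v : V -> R) (x : V) : R :=
  inf [set r | exists (i : 'I_N) (a s0 : R) (j : 'I_N) (b : R),
    let theta := dt - s0 - `|x| / a in
    [/\ branch i x, `|x| / dt <= a, 0 <= s0 <= dt - `|x| / a, b <= 0 &
        r = interp dx v (- (theta * b) *: e j) + theta * L j 0 b
            + s0 * L0 + `|x| / a * L i `|x| a]].

Definition scheme_vertex (dx dt : R) (v : V -> R) : R :=
  inf [set r | exists (s0 : R) (j : 'I_N) (b : R),
    [/\ 0 <= s0 <= dt, b <= 0 &
        r = interp dx v (- ((dt - s0) * b) *: e j)
            + (dt - s0) * L j 0 b + s0 * L0]].

Definition scheme (dx dt : R) (v : V -> R) (x : V) : R :=
  if x == 0 then scheme_vertex dx dt v
  else Num.min (scheme_inner dx dt v x) (scheme_cross dx dt v x).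

(* discrete_solution dx dt n x is w(n dt, x); it is meaningful for x in
   [jgrid dx]. *)
Fixpoint discrete_solution (dx dt : R) (n : nat) : V -> R :=
  if n is m.+1 then scheme dx dt (discrete_solution dx dt m) else u0.

(* The union with [set 0] gives the value 0 when K does not meet the grid. *)
Definition grid_error (K : set (R * V)) (u : R -> V -> R) (dx dt : R) : \bar R :=
  ereal_sup ([set 0%E] `|`
    [set r | exists (n : nat) (x : V),
      [/\ (n <= Num.truncn (T / dt))%N, jgrid dx x, K (n%:R * dt, x) &
          r = (`|discrete_solution dx dt n x - u (n%:R * dt) x|)%:E]]).

Definition scheme_converges (F : set_system (R * R)) (u : R -> V -> R) : Prop :=
  forall K : set (R * V), compact K -> K `<=` open_domain ->
    limf_esup (fun d : R * R => grid_error K u d.1 d.2) F = 0%E.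

End Junction.

Definition admissible_meshes {R : realType} (F : set_system (R * R)) : Prop :=
  [/\ \forall d \near F, 0 < d.1 /\ 0 < d.2,
      d.1 @[d --> F] --> (0 : R), d.2 @[d --> F] --> (0 : R) &
      d.1 ^+ 2 / d.2 @[d --> F] --> (0 : R)].

(* Main.v *)
(* The solution is the value function U of the control problem behind the
   equation: the infimum of initial value plus running cost over the
   trajectories made of straight runs on the branches and stays at the vertex.
   It is the largest function below u0 at time 0 that is suboptimal, that is,
   grows along every run by at most the cost of the run. Hence it is a
   supersolution: if it were not, a small bump could be added to it. The
   subsolution property is read off from the runs that arrive at the contact
   point.

   From above, subsolutions and the scheme are compared with paraboloids around
   a run, steep on the other branches, and one run after the other is added
   along a nearly optimal trajectory. From below, U is approximated by C^1
   suboptimal functions with Lipschitz derivatives (averages in time and space,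
   corrected at the vertex). These are test functions for the supersolutions
   and nearly satisfy the scheme. In both comparisons one step of the scheme
   costs an interpolation error O(dx^2), so that the total error is
   O(dx^2 / dt). *)
Require Import Defs.
From mathcomp Require Import all_boot all_order all_algebra.
From mathcomp Require Import all_classical all_reals all_analysis.
From mathcomp Require Import lra ring.
Import Order.TTheory GRing.Theory Num.Theory.
Import numFieldNormedType.Exports.
Local Open Scope classical_set_scope.
Local Open Scope ring_scope.
Set Implicit Arguments.
Unset Strict Implicit.
Unset Printing Implicit Defensive.

(** * Calculus *)

(* [lra_goal] is [lra] without the hypotheses introduced after a hypothesis of
   type True, which must be moved to the goal if they are to be used. *)
Ltac focus_goal :=
  lazymatch goal with H : ?T |- _ =>
    lazymatch T with
    | True => idtac
    | _ => (first [clear H | revert H]); focus_goal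
    end
  end.
Ltac lra_goal := focus_goal; intros; lra.

(** Sub- and supersolutions are never compared with each other: doubling of variables would meet, at
    the vertex, a Hamiltonian that changes from branch to branch. Each is compared with the value
    function instead, and the same two comparisons, run step by step, treat the scheme.
    Suboptimality is an inequality along finite runs, so it involves no derivatives, and it is
    stable under maxima, minima, convex combinations, time shifts and gluing in time; averaging
    disturbs it only slightly. Gluing cuts runs in two, which is why the cost of a run has a term
    quadratic in its duration. Averages must not cross the vertex, so they look ahead in space and
    back in time; a correction depending on time alone restores the common value at the vertex. A
    run leaving the vertex has no counterpart in the flux limiter, which only sees nonpositive
    speeds; it is replaced by a run from a nearby point of the branch. The bounds on [L] deteriorate
    linearly at infinity; truncation by barriers and growth bounds confine all comparisons to
    compact sets. *)

Section RealTools.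
Context {R : realType}.
Implicit Types (f g : R -> R) (x y : R).

Lemma derive_continuous f df : (forall x, is_derive x (1 : R) f (df x)) ->
  continuous f.
Proof.
move=> fdf x; apply: differentiable_continuous; apply/derivable1_diffP.
by case: (fdf x).
Qed.

Lemma MVT_line f df x y : (forall z, is_derive z (1 : R) f (df z)) -> x <= y ->
  exists2 z, x <= z <= y & f y - f x = df z * (y - x).
Proof.
move=> fdf xy; have [z zi e] : exists2 c, c \in `[x, y]%R & f y - f x = df c * (y - x).
  apply: MVT_segment => //.
  exact/continuous_subspaceT/(derive_continuous fdf).
by exists z => //; move: zi; rewrite in_itv.
Qed.

Lemma derive_eq_zero_at f df a b x : a < 0 < b -> a < x < b ->
  (forall z, a < z < b -> is_derive z (1 : R) f (df z)) ->
  (forall z, a < z < b -> df z = 0) -> f x = f 0.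
Proof.
move=> /andP[a0 b0] /andP[ax xb] fdf df0.
have cf z : a < z < b -> {for z, continuous f}.
  move=> /fdf[fz _]; apply: differentiable_continuous.
  exact/derivable1_diffP.
have key u v : a < u -> v < b -> u <= v -> f v - f u = 0.
  move=> au vb uv.
  have [||z] := @MVT_segment _ f df u v uv.
  - move=> z; rewrite in_itv /= => /andP[uz zv]; apply: fdf.
    by rewrite (lt_trans au uz) (lt_trans zv vb).
  - apply: continuous_in_subspaceT => z; rewrite inE /= in_itv /= => /andP[uz zv].
    by apply: cf; rewrite (lt_le_trans au uz) (le_lt_trans zv vb).
  - rewrite in_itv /= => /andP[uz zv] ->; rewrite df0 ?mul0r //.
    by rewrite (lt_le_trans au uz) (le_lt_trans zv vb).
have [x0|/ltW x0] := leP x 0.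
- by apply/eqP; rewrite eq_sym -subr_eq0 key.
- by apply/eqP; rewrite -subr_eq0 key.
Qed.

Lemma FTC_gt f a x : continuous f -> a < x ->
  is_derive x (1 : R) (fun z => \int[lebesgue_measure]_(t in `[a, z]) (f t)) (f x).
Proof.
move=> cf ax.
have [||//|//|d e] := @continuous_FTC1_closed R f a x (x + 1).
- by rewrite ltrDl.
- apply: continuous_compact_integrable; first exact: segment_compact.
  exact: continuous_subspaceT.
- exact: cf.
by move: e; rewrite derive1E => e; exact: DeriveDef d e.
Qed.

(* The integral from a base point only gives a primitive to its right; the
   part to the left is obtained by reflection. *)
Lemma primitive_exists f : continuous f ->
  exists F : R -> R, forall x, is_derive x (1 : R) F (f x).
Proof.
move=> cf.
pose A (z : R) : R := \int[lebesgue_measure]_(t in `[(-1)%R, z]) (f t).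
pose fN := f \o -%R.
have cfN : continuous fN by move=> z; apply: continuous_comp; [exact: opp_continuous|exact: cf].
pose B (z : R) : R := \int[lebesgue_measure]_(t in `[(-1)%R, z]) (fN t).
have dA x : -1 < x -> is_derive x (1 : R) A (f x) by exact: FTC_gt.
have dB x : x < 1 -> is_derive x (1 : R) (fun z : R => - B (- z)) (f x).
  move=> x1; have x1' : -1 < - x by lra.
  have dB1 : is_derive (- x) (1 : R) B (fN (- x)) by exact: FTC_gt.
  have dN : is_derive x (1 : R) (fun z : R => - z) (- 1) by exact: is_deriveN.
  have h : is_derive x (1 : R) (B \o (fun z : R => - z)) (fN (- x) * - 1).
    exact: is_derive1_comp.
  have h2 := is_deriveN h.
  by apply: is_derive_eq h2 _; rewrite /fN /= opprK mulrN1 opprK.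
have AB x : -1 < x < 1 -> A x - A 0 = - B (- x) + B 0.
  move=> xx.
  have := @derive_eq_zero_at (fun z : R => A z - (- B (- z))) (fun z : R => f z - f z) (-1) 1 x.
  have h01 : (-1 : R) < 0 < (1 : R). by apply/andP; split; lra.
  move=> /(_ h01 xx) H; have := H _ _; rewrite oppr0 => E.
  have {H}E : A x - (- B (- x)) = A 0 - (- B 0).
    apply: E => [z /andP[z1 z2]|z _]; last by rewrite subrr.
    by have := dA _ z1; have := dB _ z2 => *; apply: is_deriveB.
  by move: E; lra.
pose P x := if 0 <= x then A x - A 0 else - B (- x) + B 0.
exists P => x.
have [x1|x1] := ltP (-1/2%:R) x.
- have xm : -1 < x by lra.
  have dA' : is_derive x (1 : R) (fun z => A z - A 0) (f x).
    by have := dA _ xm => ?; apply: is_derive_eq; rewrite subr0.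
  apply: near_eq_is_derive dA' => //.
  near=> z; rewrite /P; case: leP => // z0; rewrite AB //.
  have -> : -1 < z by near: z; apply: lt_nbhsr; lra.
  by rewrite (lt_trans z0).
- have xm : x < 1 by lra.
  have dB' : is_derive x (1 : R) (fun z => - B (- z) + B 0) (f x).
    by have := dB _ xm => ?; apply: is_derive_eq; rewrite addr0.
  apply: near_eq_is_derive dB' => //.
  near=> z; rewrite /P leNgt (_ : z < 0) //.
  by near: z; apply: lt_nbhsl; lra.
Unshelve. all: by end_near. Qed.

End RealTools.

(** * Averages over intervals, by means of primitives *)

Section Averages.
Context {R : realType}.
Implicit Types (f g : R -> R) (x y d : R).

Lemma lipschitz_continuous f (M : R) :
  (forall x y, `|f x - f y| <= M * `|x - y|) -> continuous f.
Proof.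
move=> fM x; apply/cvgrPdist_le => /= eps eps0.
pose N := `|M| + 1; have N0 : 0 < N by rewrite ltr_wpDl.
near=> y; apply: le_trans (fM x y) _.
apply: (@le_trans _ _ (N * `|x - y|)).
  by rewrite ler_wpM2r // (le_trans (ler_norm _)) // lerDl.
rewrite mulrC -ler_pdivlMr //.
near: y; apply: cvgr_dist_le => //; exact: divr_gt0.
Unshelve. all: by end_near. Qed.

(** Quadratic remainders are what the averaging estimates deliver, so derivatives with respect to a
    parameter are obtained without differentiating under an integral. *)
Lemma is_derive_quadratic f x (df M : R) :
  (forall h, `|f (x + h) - f x - h * df| <= M * h ^+ 2) ->
  is_derive x (1 : R) f df.
Proof.
move=> fM; have cvg : h^-1 *: (f (h *: (1 : R) + x) - f x) @[h --> (0 : R)^'] --> df.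
  apply/cvgrPdist_le => /= eps eps0.
  pose N := `|M| + 1; have N0 : 0 < N by rewrite ltr_wpDl.
  near=> h; have h0 : h != 0 by near: h; exact: nbhs_dnbhs_neq.
  have hN : `|h| <= eps / N.
    near: h; apply: dnbhs0_le; exact: divr_gt0.
  have hh : 0 < `|h| by rewrite normr_gt0.
  have -> : df - h^-1 *: (f (h *: (1 : R) + x) - f x)
      = - (h^-1 * (f (x + h) - f x - h * df)).
    rewrite /GRing.scale /= mulr1 [h + x]addrC; field.
    exact: h0.
  rewrite normrN normrM normfV mulrC ler_pdivrMr //.
  apply: le_trans (fM h) _; rewrite -(@real_normK _ h) ?num_real // expr2 mulrA.
  rewrite ler_wpM2r //.
  apply: (@le_trans _ _ (N * `|h|)).
    by rewrite ler_wpM2r // (le_trans (ler_norm _)) // lerDl.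
  by rewrite mulrC -ler_pdivlMr.
apply: DeriveDef; first by apply/cvg_ex; exists df.
exact/cvg_lim.
Unshelve. all: by end_near. Qed.

(** An antiderivative picked by choice stands in for the integral: only its increments occur, and
    estimates on averages reduce to the mean value theorem. The default [fun=> 0] is for integrands
    without a primitive. *)
Definition primitive f : R -> R :=
  xget (fun=> 0) [set F | forall x, is_derive x (1 : R) F (f x)].

Lemma primitiveP f : continuous f ->
  forall x, is_derive x (1 : R) (primitive f) (f x).
Proof.
move=> cf; have [F dF] := primitive_exists cf.
exact: (@xgetPex _ (fun=> 0) [set F | forall x, is_derive x (1 : R) F (f x)] (ex_intro _ F dF)).
Qed.

Definition average f x d : R := (primitive f (x + d) - primitive f x) / d.

Lemma is_derive_comp_shift f (df : R) x c : is_derive (x + c) (1 : R) f df ->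
  is_derive x (1 : R) (fun z => f (z + c)) df.
Proof.
move=> fdf; have dc : is_derive x (1 : R) (fun z : R => z + c) 1.
  by apply: is_derive_eq; rewrite addr0.
have := @is_derive1_comp R f (fun z : R => z + c) x df 1 fdf dc.
by rewrite mulr1.
Qed.

(** The difference of the two sides, times [d], is the increment over [0, d] of [D], whose
    derivative is nonnegative there by assumption. The factor [h] may have either sign, which is
    used for expansions in time. *)
Lemma average_le (f g k : R -> R) x y z d h c :
  continuous f -> continuous g -> continuous k -> 0 < d ->
  (forall s, 0 <= s <= d -> f (x + s) <= g (y + s) + h * k (z + s) + c) ->
  average f x d <= average g y d + h * average k z d + c.
Proof.
move=> cf cg ck d0 fg.
pose D (s : R) := primitive g (s + y) + h * primitive k (s + z) + c * s - primitive f (s + x).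
pose dD (s : R) := g (s + y) + h * k (s + z) + c - f (s + x).
have DD s : is_derive s (1 : R) D (dD s).
  have := is_derive_comp_shift (primitiveP cf (s + x)).
  have := is_derive_comp_shift (primitiveP cg (s + y)).
  have := is_derive_comp_shift (primitiveP ck (s + z)) => dk dg df.
  rewrite /D /dD; apply: is_derive_eq; rewrite /GRing.scale /=; ring.
have [s sd] := MVT_line DD (ltW d0).
rewrite /D subr0 !add0r mulr0 addr0 !(addrC d) => E.
have := fg _ sd; rewrite ![_ + s]addrC => ge0.
have : 0 <= dD s * d by rewrite mulr_ge0 ?(ltW d0) // /dD; lra.
rewrite -E => H; rewrite /average ler_pdivrMr //.
set a := primitive g (y + d) in H *; set b := primitive g y in H *.
set a' := primitive k (z + d) in H *; set b' := primitive k z in H *.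
have -> : ((a - b) / d + h * ((a' - b') / d) + c) * d
    = a - b + h * a' - h * b' + c * d by field; rewrite gt_eqF.
lra.
Qed.

Lemma average_mean f x d : continuous f -> 0 < d ->
  exists2 z, x <= z <= x + d & average f x d = f z.
Proof.
move=> cf d0; have [|z zi E] := MVT_line (primitiveP cf) (_ : x <= x + d).
  by rewrite lerDl ltW.
exists z => //; rewrite /average E addrAC subrr add0r mulfK ?gt_eqF //.
Qed.

Lemma average_le2 f g x y d c : continuous f -> continuous g -> 0 < d ->
  (forall s, 0 <= s <= d -> f (x + s) <= g (y + s) + c) ->
  average f x d <= average g y d + c.
Proof.
move=> cf cg d0 fg; have := @average_le f g g x y y d 0 c cf cg cg d0.
by rewrite !mul0r addr0; apply => s /fg; rewrite mul0r addr0.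
Qed.

Lemma average_dist f g x y d c : continuous f -> continuous g -> 0 < d ->
  (forall s, 0 <= s <= d -> `|f (x + s) - g (y + s)| <= c) ->
  `|average f x d - average g y d| <= c.
Proof.
move=> cf cg d0 fg; rewrite ler_distlC lerBlDr; apply/andP; split.
  by apply: average_le2 => // s /fg; rewrite ler_norml => /andP[]; lra.
by apply: average_le2 => // s /fg; rewrite ler_norml => /andP[]; lra.
Qed.

Lemma average_derive f x d : continuous f ->
  is_derive x (1 : R) (fun x => average f x d) ((f (x + d) - f x) / d).
Proof.
move=> cf; have := is_derive_comp_shift (primitiveP cf (x + d)).
have := primitiveP cf x => d1 d2.
rewrite /average; apply: is_derive_eq; rewrite /GRing.scale /=; ring.
Qed.

End Averages.

(** * Regularization of Lipschitz functions of time and position *)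

Section Regularization.
Context {R : realType}.
Implicit Types (z : R -> R -> R) (t s k l x y h Lam eps del : R).

Definition lipschitz2 Lam z : Prop :=
  forall t s k l, `|z t k - z s l| <= Lam * (`|t - s| + `|k - l|).

(** The average reaches back in time, hence before time 0: suboptimal functions are extended to
    negative times for this purpose. The average in space reaches forward, so as to stay on the
    branch. *)
Definition time_average eps z t k := average (fun s => z s k) (t - eps) eps.

Definition time_average_dt eps z t k := (z t k - z (t - eps) k) / eps.

Definition space_average del z t k := average (z t) k del.

Definition space_average_dx del z t k := (z t (k + del) - z t k) / del.

(* Averaging forward in space moves the value at the vertex; the correction,
   constant in space, restores it. *)
Definition regularize eps del z t k :=
  space_average del (time_average eps z) t k
  - space_average del (time_average eps z) t 0 + time_average eps z t 0.

Definition regularize_dt eps del z t k :=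
  space_average del (time_average_dt eps z) t k
  - space_average del (time_average_dt eps z) t 0 + time_average_dt eps z t 0.

Definition regularize_dx eps del z := space_average_dx del (time_average eps z).

Lemma lipschitz2_ge0 Lam z : lipschitz2 Lam z -> 0 <= Lam.
Proof.
move=> /(_ 1 0 0 0); rewrite !subr0 normr1 normr0 addr0 mulr1.
exact: le_trans.
Qed.

Lemma lipschitz2_continuous_x Lam z t : lipschitz2 Lam z -> continuous (z t).
Proof.
move=> zL; apply: (@lipschitz_continuous _ _ Lam) => x y.
by apply: le_trans (zL _ _ _ _) _; rewrite subrr normr0 add0r.
Qed.

Lemma lipschitz2_continuous_t Lam z k : lipschitz2 Lam z -> continuous (z^~ k).
Proof.
move=> zL; apply: (@lipschitz_continuous _ _ Lam) => x y.
by apply: le_trans (zL _ _ _ _) _; rewrite subrr normr0 addr0.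
Qed.

Lemma lipschitz2_continuous Lam z : lipschitz2 Lam z ->
  continuous (fun p : R * R => z p.1 p.2).
Proof.
move=> zL p; apply/cvgrPdist_le => /= eps eps0.
pose N := Lam + 1; have N0 : 0 < N by rewrite ltr_wpDl // (lipschitz2_ge0 zL).
have e0 : 0 < eps / N / 2 by rewrite !divr_gt0.
near=> q; apply: le_trans (zL _ _ _ _) _.
apply: (@le_trans _ _ (N * (`|p.1 - q.1| + `|p.2 - q.2|))).
  by rewrite ler_wpM2r ?addr_ge0 // lerDl.
rewrite mulrC -ler_pdivlMr //.
have -> : eps / N = eps / N / 2 + eps / N / 2 by field; rewrite gt_eqF.
rewrite lerD //.
- near: q; have /cvgrPdist_le/(_ _ e0) : (fst @ p --> p.1) by exact: cvg_fst.
  by [].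
- near: q; have /cvgrPdist_le/(_ _ e0) : (snd @ p --> p.2) by exact: cvg_snd.
  by [].
Unshelve. all: by end_near. Qed.

Arguments lipschitz2_continuous_x {Lam z} t.
Arguments lipschitz2_continuous_t {Lam z} k.

Section Fixed.
Context (z : R -> R -> R) (Lam eps del : R).
Hypothesis zL : lipschitz2 Lam z.
Hypotheses (eps0 : 0 < eps) (del0 : 0 < del).
Let ub := time_average eps z.
Let ubt := time_average_dt eps z.
Let Lam0 : 0 <= Lam := lipschitz2_ge0 zL.

Lemma time_average_lipschitz : lipschitz2 Lam ub.
Proof.
move=> t s k l; apply: average_dist => //; try exact: lipschitz2_continuous_t zL.
move=> r _; apply: le_trans (zL _ _ _ _) _.
by have -> : t - eps + r - (s - eps + r) = t - s by ring.
Qed.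

Lemma time_average_dt_lipschitz : lipschitz2 (2 * Lam / eps) ubt.
Proof.
rewrite /ubt /time_average_dt => t s k l; rewrite -mulrBl normrM normfV (gtr0_norm eps0).
rewrite [leRHS]mulrAC ler_pM2r ?invr_gt0 //.
have h1 := zL t s k l; have h2 := zL (t - eps) (s - eps) k l.
rewrite opprB addrA subrK in h2.
have -> : z t k - z (t - eps) k - (z s l - z (s - eps) l)
  = (z t k - z s l) - (z (t - eps) k - z (s - eps) l) by ring.
by apply: le_trans (ler_normB _ _) _; lra.
Qed.

Lemma time_average_derive t k : is_derive t (1 : R) (ub^~ k) (ubt t k).
Proof.
have cz := lipschitz2_continuous_t k zL.
have := @average_derive _ (z^~ k) (t - eps) eps cz; rewrite subrK => dz.
have := @is_derive_comp_shift _ _ _ t (- eps) dz; rewrite /ub /ubt /time_average /time_average_dt /=.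
by [].

Qed.

Lemma time_average_dist t k : `|ub t k - z t k| <= Lam * eps.
Proof.
have [s /andP[s1 s2] E] := average_mean (t - eps) (lipschitz2_continuous_t k zL) eps0.
rewrite /ub /time_average E; apply: le_trans (zL _ _ _ _) _.
rewrite subrr normr0 addr0 ler_wpM2l // ler_norml; apply/andP; split; lra.
Qed.

Lemma time_average_taylor t h k :
  `|ub (t + h) k - ub t k - h * ubt t k| <= 2 * Lam / eps * h ^+ 2.
Proof.
wlog h0 : t h / 0 <= h.
  move=> H; have [/H//|/ltW h0] := leP 0 h.
  have D s := time_average_derive s k.
  have le_st : t + h <= t by lra.
have [s /andP[s1 s2] E] := MVT_line D le_st.
  have -> : ub (t + h) k - ub t k - h * ubt t k = h * (ubt s k - ubt t k).
    by rewrite mulrBr; lra.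
  rewrite normrM; have := time_average_dt_lipschitz s t k k.
  rewrite subrr normr0 addr0 => H1.
  rewrite -(@real_normK _ h) ?num_real // expr2 mulrA mulrC ler_wpM2r //.
  apply: le_trans H1 _; rewrite ler_wpM2l ?divr_ge0 ?mulr_ge0 ?(ltW eps0) //.
  by rewrite !ler0_norm; lra.
have D s := time_average_derive s k.
have le_st : t <= t + h by lra.
have [s /andP[s1 s2] E] := MVT_line D le_st.
have -> : ub (t + h) k - ub t k - h * ubt t k = h * (ubt s k - ubt t k).
  by rewrite mulrBr; lra.
rewrite normrM; have := time_average_dt_lipschitz s t k k.
rewrite subrr normr0 addr0 => H1.
rewrite -(@real_normK _ h) ?num_real // expr2 mulrA mulrC ler_wpM2r //.
apply: le_trans H1 _; rewrite ler_wpM2l ?divr_ge0 ?mulr_ge0 ?(ltW eps0) //.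
by rewrite !ger0_norm; lra.
Qed.

End Fixed.

Lemma space_average_lipschitz z Lam del : lipschitz2 Lam z -> 0 < del ->
  lipschitz2 Lam (space_average del z).
Proof.
move=> zL del0 t s k l.
apply: average_dist => //; try exact: lipschitz2_continuous_x zL.
move=> r _; apply: le_trans (zL _ _ _ _) _.
by have -> : k + r - (l + r) = k - l by ring.
Qed.

Lemma space_average_dist z Lam del t k : lipschitz2 Lam z -> 0 < del ->
  `|space_average del z t k - z t k| <= Lam * del.
Proof.
move=> zL del0.
have [s /andP[s1 s2] E] := average_mean k (lipschitz2_continuous_x t zL) del0.
rewrite /space_average E; apply: le_trans (zL _ _ _ _) _.
by rewrite subrr normr0 add0r ler_wpM2l ?(lipschitz2_ge0 zL) // ger0_norm; lra.
Qed.

Section Regularize.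
Context (z : R -> R -> R) (Lam eps del : R).
Hypothesis zL : lipschitz2 Lam z.
Hypotheses (eps0 : 0 < eps) (del0 : 0 < del).
Let ub := time_average eps z.
Let ubt := time_average_dt eps z.
Let Lam0 : 0 <= Lam := lipschitz2_ge0 zL.
Let ubL : lipschitz2 Lam ub := time_average_lipschitz zL eps0.
Let ubtL : lipschitz2 (2 * Lam / eps) ubt := time_average_dt_lipschitz zL eps0.

(** The remainder of the expansion in time is uniform in the position, so the expansion can be
    averaged in space; [average_le] with the coefficients [h] and [- h] gives the two
    inequalities. *)
Lemma space_average_derive_t t k :
  is_derive t (1 : R) ((space_average del ub)^~ k) (space_average del ubt t k).
Proof.
have c1 s := lipschitz2_continuous_x s ubL.
have c2 s := lipschitz2_continuous_x s ubtL.
apply: (@is_derive_quadratic _ _ _ _ (2 * Lam / eps)) => h.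
have key s := @time_average_taylor z Lam eps zL eps0 t h s.
rewrite -/ub -/ubt in key.
have h1 : space_average del ub (t + h) k <= space_average del ub t k
    + h * space_average del ubt t k + 2 * Lam / eps * h ^+ 2.
  apply: average_le => // s _.
  by have := key (k + s); rewrite ler_norml => /andP[]; lra.
have h2 : space_average del ub t k <= space_average del ub (t + h) k
    + (- h) * space_average del ubt t k + 2 * Lam / eps * h ^+ 2.
  apply: average_le => // s _.
  by have := key (k + s); rewrite ler_norml => /andP[]; lra.
by rewrite ler_norml; apply/andP; split; lra.
Qed.

Lemma regularize_derive_t t k :
  is_derive t (1 : R) ((regularize eps del z)^~ k) (regularize_dt eps del z t k).
Proof.
have d1 := space_average_derive_t t k.
have d2 := space_average_derive_t t 0.
have d3 := time_average_derive eps zL t 0.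
exact: is_deriveD (is_deriveB d1 d2) d3.
Qed.

Lemma regularize_derive_x t k :
  is_derive k (1 : R) (regularize eps del z t) (regularize_dx eps del z t k).
Proof.
have d1 := average_derive k del (lipschitz2_continuous_x t ubL).
pose c := - space_average del ub t 0 + ub t 0.
have dc : is_derive k (1 : R) (fun _ : R => c) 0 by exact: is_derive_cst.
have -> : regularize eps del z t = (fun y => average (ub t) y del) + (fun=> c).
  by apply/funext => y; rewrite /regularize -/ub -addrA.
by apply: is_derive_eq (is_deriveD d1 dc) _; rewrite addr0.
Qed.

Lemma regularize_lipschitz : lipschitz2 (3 * Lam) (regularize eps del z).
Proof.
have h1 := space_average_lipschitz ubL del0.
move=> t s k l; have a1 := h1 t s k l; have a2 := h1 t s 0 0; have a3 := ubL t s 0 0.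
rewrite subrr normr0 addr0 in a2 a3.
have : 0 <= Lam * `|k - l| by rewrite mulr_ge0.
move: a1 a2 a3; rewrite /regularize -/ub !mulrDr !ler_norml => /andP[? ?] /andP[? ?] /andP[? ?] ?.
by apply/andP; split; lra.
Qed.

Lemma regularize_dx_lipschitz : lipschitz2 (2 * Lam / del) (regularize_dx eps del z).
Proof.
move=> t s k l; rewrite /regularize_dx /space_average_dx -/ub.
rewrite -mulrBl normrM normfV (gtr0_norm del0) [leRHS]mulrAC ler_pM2r ?invr_gt0 //.
have h1 := ubL t s k l; have := ubL t s (k + del) (l + del).
rewrite (_ : k + del - (l + del) = k - l); last by ring.
have -> : ub t (k + del) - ub t k - (ub s (l + del) - ub s l)
  = (ub t (k + del) - ub s (l + del)) - (ub t k - ub s l) by ring.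
by move=> h2; apply: le_trans (ler_normB _ _) _; lra.
Qed.

Lemma regularize_dt_lipschitz :
  lipschitz2 (3 * (2 * Lam / eps)) (regularize_dt eps del z).
Proof.
have h1 := space_average_lipschitz ubtL del0.
move=> t s k l; have a1 := h1 t s k l; have a2 := h1 t s 0 0; have a3 := ubtL t s 0 0.
rewrite subrr normr0 addr0 in a2 a3.
have : 0 <= (2 * Lam / eps) * `|k - l| by rewrite !mulr_ge0 ?invr_ge0 ?(ltW eps0).
move: a1 a2 a3; rewrite /regularize_dt -/ubt -mulrA !mulrDr.
rewrite !ler_norml => /andP[? ?] /andP[? ?] /andP[? ?] ?.
by apply/andP; split; lra.
Qed.

Lemma regularize_dist t k : `|regularize eps del z t k - z t k| <= Lam * eps + 2 * Lam * del.
Proof.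
have a1 := space_average_dist t k ubL del0.
have a2 := space_average_dist t 0 ubL del0.
have a3 := time_average_dist zL eps0 t k.
move: a1 a2 a3; rewrite /regularize -/ub !ler_norml => /andP[? ?] /andP[? ?] /andP[? ?].
by apply/andP; split; lra.
Qed.

Lemma regularize_vertex t : regularize eps del z t 0 = ub t 0.
Proof. by rewrite /regularize subrr add0r. Qed.

Lemma regularize_dt_vertex t : regularize_dt eps del z t 0 = ubt t 0.
Proof. by rewrite /regularize_dt subrr add0r. Qed.

Lemma time_average_increment t k l h c :
  (forall r, t - eps <= r <= t -> z (r + h) l <= z r k + c) ->
  ub (t + h) l <= ub t k + c.
Proof.
move=> H; apply: average_le2 => //; try exact: lipschitz2_continuous_t zL.
move=> r /andP[r0 re]; have := H (t - eps + r).
rewrite (_ : t - eps + r + h = t + h - eps + r); last by ring.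
by apply; apply/andP; split; lra.
Qed.

(* The correction varies slowly because the time derivative of the time
   average is Lipschitz in space. *)
Lemma regularize_increment t h x y c : 0 <= h ->
  (forall r l, t - eps <= r <= t -> 0 <= l <= del -> z (r + h) (y + l) <= z r (x + l) + c) ->
  regularize eps del z (t + h) y <= regularize eps del z t x + c
    + 2 * Lam / eps * del * h.
Proof.
move=> h0 H.
have cub s : continuous (ub s) := lipschitz2_continuous_x s ubL.
have h1 : space_average del ub (t + h) y <= space_average del ub t x + c.
  apply: average_le2 => // l ld; apply: time_average_increment => // r rt; exact: H.
(* [m] bounds from below the increment in time of [ub] at all positions up to [del], in terms of the
   increment at the vertex. *)
pose m := ub (t + h) 0 - ub t 0 - 2 * Lam / eps * del * h.
have h2 : space_average del ub t 0 <= space_average del ub (t + h) 0 - m + 0.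
  have := @average_le2 _ (ub t) (ub (t + h)) 0 0 del (- m) (cub _) (cub _) del0.
  rewrite addr0; apply => l /andP[l0 ld]; rewrite !add0r.
  pose q (s : R) := ub s l - ub s 0.
  have dq s : is_derive s (1 : R) q (ubt s l - ubt s 0).
    by apply: is_deriveB; exact: time_average_derive zL _ _.
  have le_st : t <= t + h by lra.
have [s _ E] := MVT_line dq le_st.
  have b := ubtL s s l 0.
  rewrite subrr normr0 add0r subr0 (ger0_norm l0) ler_norml in b.
  case/andP: b => b _.
  have b2 : - (2 * Lam / eps * del) <= ubt s l - ubt s 0.
    apply: le_trans b; rewrite lerN2 ler_wpM2l // divr_ge0 ?mulr_ge0 ?(ltW eps0) //.
  have b3 : - (2 * Lam / eps * del) * h <= (ubt s l - ubt s 0) * h by rewrite ler_wpM2r.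
  rewrite (_ : t + h - t = h) in E; last by ring.
  by rewrite -E mulNr /q in b3; rewrite /m; lra.
rewrite /regularize -/ub; rewrite /m in h2; lra.
Qed.

End Regularize.
End Regularization.

(** * Lagrangians *)

(** Requiring [P i] for all larger bounds makes the sum of the individual thresholds a common
    one. *)
Lemma ord_uniform_bound {R : realType} {N : nat} (P : 'I_N -> R -> Prop) :
  (forall i, exists K : R, forall K', K <= K' -> P i K') ->
  exists2 K : R, 0 <= K & forall i K', K <= K' -> P i K'.
Proof.
move=> H; have [K HK] := choice H.
exists (\sum_i `|K i|); first by rewrite sumr_ge0.
move=> i K' KK'; apply: HK; apply: le_trans KK'.
rewrite (bigD1 i) //=; apply: (le_trans (ler_norm _)).
by rewrite lerDl sumr_ge0.
Qed.

(** * Convex functions on the line *)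

Section ConvexLine.
Context {R : realType} (q : R -> R).
Hypothesis q_convex : forall a b t : R, 0 <= t <= 1 ->
  q (t * a + (1 - t) * b) <= t * q a + (1 - t) * q b.

Lemma convex_segment_le (a b c : R) : a <= c <= b ->
  (b - a) * q c <= (b - c) * q a + (c - a) * q b.
Proof.
move=> /andP[ac cb]; have [ba|ba] := eqVneq b a.
  have -> : c = a by apply/eqP; rewrite eq_le ac -ba cb.
  by rewrite ba !subrr !mul0r addr0.
have ba0 : 0 < b - a.
  by rewrite subr_gt0 lt_neqAle eq_sym ba (le_trans ac).
pose t := (b - c) / (b - a).
have t01 : 0 <= t <= 1.
  apply/andP; split; rewrite /t; first by apply: divr_ge0; lra.
  by rewrite ler_pdivrMr //; lra.
have e1 : (b - a) * t = b - c by rewrite /t; field; rewrite gt_eqF.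
have e2 : (b - a) * (1 - t) = c - a by rewrite mulrBr e1 mulr1; ring.
have e : t * a + (1 - t) * b = c.
  have -> : t * a + (1 - t) * b = b - (b - a) * t by ring.
  by rewrite e1; ring.
have := q_convex a b t01; rewrite e => H; clearbody t.
have := ler_wpM2l (ltW ba0) H.
by rewrite mulrDr 2!(mulrA (b - a)) e1 e2.
Qed.

Lemma convex_interval_le (B a : R) : `|a| <= B -> q a <= `|q B| + `|q (- B)|.
Proof.
move=> aB; have B0 : 0 <= B by apply: le_trans aB.
move: (aB); rewrite ler_norml => /andP[a1 a2].
have := convex_segment_le (_ : - B <= a <= B); rewrite a1 a2 => /(_ isT).
have [BE|B0'] := eqVneq B 0.
  move: aB; rewrite BE normr_le0 => /eqP ->.
  by move=> _; rewrite (le_trans (ler_norm _)) // lerDl.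
have Bp : 0 < B by rewrite lt_neqAle eq_sym B0'.
move=> H; have h1 : (B - a) * q (- B) <= (2 * B) * `|q (- B)|.
  apply: (@le_trans _ _ ((B - a) * `|q (- B)|)).
    by apply: ler_wpM2l; [lra|exact: ler_norm].
  by apply: ler_wpM2r => //; lra.
have h2 : (a - (- B)) * q B <= (2 * B) * `|q B|.
  apply: (@le_trans _ _ ((a - (- B)) * `|q B|)).
    by apply: ler_wpM2l; [lra|exact: ler_norm].
  by apply: ler_wpM2r => //; lra.
have B2 : 0 < 2 * B by lra.
rewrite -(ler_pM2l B2) mulrDr; move: H h1 h2.
have -> : B - - B = 2 * B by ring.
lra.
Qed.

Lemma convex_midpoint (a : R) : 2 * q 0 <= q a + q (- a).
Proof.
have h : (0 : R) <= (1 / 2 : R) <= (1 : R) by apply/andP; split; lra.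
have := q_convex a (- a) h.
have -> : 1 / 2 * a + (1 - 1 / 2) * (- a) = 0 by field.
lra.
Qed.

(** The slope from [a] to [b] lies between the slopes to [a - 1] and [a + 1]. This is the source of
    the continuity of [L] in the velocity. *)
Lemma convex_local_lipschitz (a b : R) : `|b - a| <= 1 ->
  `|q b - q a| <= `|b - a| * (`|q (a + 1) - q a| + `|q (a - 1) - q a|).
Proof.
move=> ba.
have key (s : R) : s = 1 \/ s = -1 -> forall h, 0 <= h <= 1 -> b = a + s * h ->
    `|q b - q a| <= h * (`|q (a + s) - q a| + `|q (a - s) - q a|).
  move=> s1 h /andP[h0 h1] bE.
  have u1 : q b <= h * q (a + s) + (1 - h) * q a.
    have := q_convex (a + s) a (_ : 0 <= h <= 1); rewrite h0 h1 => /(_ isT).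
    by have -> : h * (a + s) + (1 - h) * a = b by rewrite bE; ring.
  have u2 : (1 + h) * q a <= q b + h * q (a - s).
    have hp : 0 < 1 + h by lra.
    have t01 : 0 <= (1 + h)^-1 <= 1.
      by rewrite invr_ge0 (ltW hp) invf_le1 //; lra.
    have := q_convex b (a - s) t01.
    have -> : (1 + h)^-1 * b + (1 - (1 + h)^-1) * (a - s) = a.
      by rewrite bE; field; rewrite gt_eqF.
    move=> /(ler_wpM2l (ltW hp)); congr (_ <= _); field; rewrite gt_eqF //.
  have v1 : h * (q (a + s) - q a) <= h * `|q (a + s) - q a|.
    by rewrite ler_wpM2l // ler_norm.
  have v2 : h * (q (a - s) - q a) <= h * `|q (a - s) - q a|.
    by rewrite ler_wpM2l // ler_norm.
  have v3 : 0 <= h * `|q (a + s) - q a| by rewrite mulr_ge0.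
  have v4 : 0 <= h * `|q (a - s) - q a| by rewrite mulr_ge0.
  by rewrite ler_norml; apply/andP; split; lra.
have [b0|b0] := leP a b.
  have e : `|b - a| = b - a by rewrite ger0_norm // subr_ge0.
  rewrite e in ba *; apply: (key 1); [by left| |by ring].
  by rewrite ba subr_ge0 b0.
have e : `|b - a| = a - b by rewrite distrC ger0_norm // subr_ge0 ltW.
rewrite e in ba *; rewrite [X in _ * X]addrC.
have := key (-1) (or_intror erefl) (a - b); rewrite opprK; apply; last by ring.
by rewrite ba subr_ge0 ltW.
Qed.

(** The right derivative at 0, written as an infimum of difference quotients; the quotients on the
    left are lower bounds for it. *)
Lemma convex_subgradient : exists p : R, forall a : R, q 0 + p * a <= q a.
Proof.
have key (a b : R) : 0 < a -> 0 < b -> (q 0 - q (- b)) / b <= (q a - q 0) / a.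
  move=> a0 b0; rewrite ler_pdivrMr // mulrAC ler_pdivlMr //.
  have h : - b <= (0 : R) <= a by apply/andP; split; lra.
  have := convex_segment_le h; lra.
pose S := [set r | exists2 a : R, 0 < a & r = (q a - q 0) / a].
have S0 : S !=set0 by exists ((q 1 - q 0) / 1), 1.
have Slb : has_lbound S by exists ((q 0 - q (- 1)) / 1) => _ [a a0 ->]; exact: key.
exists (inf S) => a; have [a0|a0|->] := ltgtP a 0; last by rewrite mulr0 addr0.
- have : (q 0 - q a) / (- a) <= inf S.
    apply: lb_le_inf => // _ [c c0 ->].
    by have := key c (- a) c0; rewrite opprK; apply; lra.
  rewrite ler_pdivrMr; lra.
- have : inf S <= (q a - q 0) / a by apply: ge_inf => //; exists a.
  rewrite ler_pdivlMr //; lra.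
Qed.

End ConvexLine.

Section Lagrangian.
Context {R : realType} {N : nat} (L : 'I_N -> R -> R -> R) (L0 C : R).

Definition lipschitz_position : Prop :=
  forall i (x y a : R), 0 <= x -> 0 <= y -> `|L i x a - L i y a| <= C * `|x - y|.

Hypotheses (L_conv : convex_lipschitz_lagrangian L).
Hypotheses (L_super : superlinear_lagrangian L).
Hypotheses (C0 : 0 <= C) (L_lip : lipschitz_position).

Lemma lagrangian_convex i x : 0 <= x -> forall a b t : R, 0 <= t <= 1 ->
  L i x (t * a + (1 - t) * b) <= t * L i x a + (1 - t) * L i x b.
Proof.
move=> x0 a b t /andP[t0 t1]; have [->|ab] := eqVneq a b.
  by rewrite -!mulrDl addrC subrK !mul1r.
have [->|t0'] := eqVneq t 0; first by rewrite subr0 !mul0r !mul1r !add0r.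
have [->|t1'] := eqVneq t 1; first by rewrite subrr !mul0r !mul1r !addr0.
have tp : 0 < t by rewrite lt_neqAle eq_sym t0'.
have tp1 : t < 1 by rewrite lt_neqAle t1'.
by case: L_conv => H _; exact/ltW/H.
Qed.

Lemma lagrangian_superlinear M : exists2 B : R, 0 < B &
  forall i x a, 0 <= x -> B <= `|a| -> M * `|a| <= L i x a.
Proof.
have [|B B0 HB] := @ord_uniform_bound R N (fun i B => forall x a,
    0 <= x -> B <= `|a| -> 0 < `|a| -> M * `|a| <= L i x a).
  move=> i; have [B HB] := L_super i M.
  exists B => B' BB' x a x0 aB a0; rewrite -ler_pdivlMr //.
  by apply: HB => //; apply: le_trans aB.
exists (B + 1); first by lra.
move=> i x a x0 aB; apply: (HB i (B + 1)) => //; lra.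
Qed.

(** Superlinearity takes care of [B <= |a|]. For slower speeds, convexity gives
    [L i 0 a >= 2 * L i 0 0 - L i 0 (- a)], and the last term is bounded by the values at [B] and
    [- B]; then the position is moved from 0 to [x]. *)
Lemma lagrangian_lower M : exists2 K : R, 0 <= K /\ - L0 <= K &
  forall i x a, 0 <= x -> M * `|a| - K - C * x <= L i x a.
Proof.
have [B B0 HB] := lagrangian_superlinear M.
have [|K K0 HK] := @ord_uniform_bound R N (fun i K => forall x a,
    0 <= x -> M * `|a| - K - C * x <= L i x a).
  move=> i; exists (`|M| * B + 2 * `|L i 0 0| + `|L i 0 B| + `|L i 0 (- B)|).
  move=> K hK x a x0; have Cx : 0 <= C * x by rewrite mulr_ge0.
  have MB : 0 <= `|M| * B by rewrite mulr_ge0 // ltW.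
  have nn (r : R) : 0 <= `|r| by [].
  have [aB|aB] := leP B `|a|.
    have := HB i x a x0 aB; have := nn (L i 0 0); have := nn (L i 0 B).
    by have := nn (L i 0 (- B)); lra.
  have := convex_midpoint (lagrangian_convex i (lexx 0)) a.
  have := @convex_interval_le _ _ (lagrangian_convex i (lexx 0)) B (- a).
  rewrite normrN => /(_ (ltW aB)) h1 h2.
  have := L_lip i a x0 (lexx 0); rewrite subr0 (ger0_norm x0) ler_norml => /andP[h3 _].
  have h4 : M * `|a| <= `|M| * B.
    apply: (@le_trans _ _ (`|M| * `|a|)); first by rewrite ler_wpM2r // ler_norm.
    by rewrite ler_wpM2l // ltW.
  have : - `|L i 0 0| <= L i 0 0 by rewrite lerNl -normrN ler_norm.
  lra.
exists (K + `|L0|).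
  have : - L0 <= `|L0| by rewrite -normrN ler_norm.
  have : 0 <= `|L0| by []. split; lra.
by move=> i; apply: HK; rewrite lerDl.
Qed.

Lemma lagrangian_upper : exists2 K : R, 0 <= K /\ L0 <= K &
  forall i x a, 0 <= x -> `|a| <= 1 -> L i x a <= K + C * x.
Proof.
have [|K K0 HK] := @ord_uniform_bound R N (fun i K => forall x a,
    0 <= x -> `|a| <= 1 -> L i x a <= K + C * x).
  move=> i; exists (`|L i 0 1| + `|L i 0 (- 1)|) => K hK x a x0 a1.
  have := convex_interval_le (lagrangian_convex i (lexx 0)) a1.
  have := L_lip i a x0 (lexx 0); rewrite subr0 (ger0_norm x0) ler_norml => /andP[_].
  lra.
exists (K + `|L0|).
  have : L0 <= `|L0| by rewrite ler_norm.
  have : 0 <= `|L0| by []. split; lra.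
by move=> i; apply: HK; rewrite lerDl.
Qed.

End Lagrangian.

(** * The value function *)

Section Suboptimal.
Context {R : realType} {N : nat} (L : 'I_N -> R -> R -> R) (L0 C : R).
Implicit Types (z : 'I_N -> R -> R -> R) (i j : 'I_N) (t x a h al be : R).

(* A bound for the cost of running along a branch from x for a time h at the
   speed a; the quadratic term makes it superadditive in h. *)
Definition move_cost i x a h : R := h * L i x a + C * `|a| * h ^+ 2.

(* On the branch i, z i t k is the value at time t and at distance k from the
   vertex. *)
Definition suboptimal al be z : Prop :=
  [/\ forall i j t, al <= t <= be -> z i t 0 = z j t 0,
      forall i t x a h, al <= t -> 0 <= h -> t + h <= be -> 0 <= x ->
        0 <= x + a * h -> z i (t + h) (x + a * h) <= z i t x + move_cost i x a h &
      forall i t h, al <= t -> 0 <= h -> t + h <= be ->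
        z i (t + h) 0 <= z i t 0 + h * L0].

Hypotheses (C0 : 0 <= C) (L_lip : lipschitz_position L C).

(** Starting the second part at the new position changes [L] by at most [C * |a| * h1], hence its
    cost by [C * |a| * h1 * h2]; the cross term of the square provides twice that. *)
Lemma move_cost_split i x a h1 h2 : 0 <= h1 -> 0 <= h2 -> 0 <= x ->
  0 <= x + a * h1 ->
  move_cost i x a h1 + move_cost i (x + a * h1) a h2 <= move_cost i x a (h1 + h2).
Proof.
move=> h10 h20 x0 xa0; rewrite /move_cost.
have := L_lip i a xa0 x0; rewrite addrAC subrr add0r normrM (ger0_norm h10) => H.
have {}H : L i (x + a * h1) a <= L i x a + C * (`|a| * h1).
  by move: H; rewrite ler_norml => /andP[]; lra.
have := ler_wpM2l h20 H; rewrite mulrDr => {}H.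
have : 0 <= C * `|a| * (h1 * h2) by rewrite !mulr_ge0.
have -> : C * `|a| * (h1 + h2) ^+ 2
  = C * `|a| * h1 ^+ 2 + C * `|a| * h2 ^+ 2 + 2 * (C * `|a| * (h1 * h2)) by ring.
have -> : C * `|a| * (h1 * h2) = h2 * (C * (`|a| * h1)) by ring.
lra.
Qed.

Lemma suboptimalS al be al' be' z : al <= al' -> be' <= be ->
  suboptimal al be z -> suboptimal al' be' z.
Proof.
move=> aa bb [z1 z2 z3]; split.
- by move=> i j t /andP[at' tb]; apply: z1; rewrite (le_trans aa at') (le_trans tb bb).
- by move=> i t x a h at' h0 tb; apply: z2 => //; [exact: le_trans at'|exact: le_trans bb].
- by move=> i t h at' h0 tb; apply: z3 => //; [exact: le_trans at'|exact: le_trans bb].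
Qed.

Lemma suboptimal_min al be z1 z2 : suboptimal al be z1 -> suboptimal al be z2 ->
  suboptimal al be (fun i t x => Num.min (z1 i t x) (z2 i t x)).
Proof.
move=> [a1 a2 a3] [b1 b2 b3]; split=> [i j t tab|i t x a h ? ? ? ? ?|i t h ? ? ?].
- by rewrite (a1 i j t tab) (b1 i j t tab).
- by rewrite addr_minl le_min !ge_min a2 // b2 // orbT.
- by rewrite addr_minl le_min !ge_min a3 // b3 // orbT.
Qed.

Lemma suboptimal_max al be z1 z2 : suboptimal al be z1 -> suboptimal al be z2 ->
  suboptimal al be (fun i t x => Num.max (z1 i t x) (z2 i t x)).
Proof.
move=> [a1 a2 a3] [b1 b2 b3]; split=> [i j t tab|i t x a h ? ? ? ? ?|i t h ? ? ?].
- by rewrite (a1 i j t tab) (b1 i j t tab).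
- by rewrite addr_maxl ge_max !le_max a2 // b2 // orbT.
- by rewrite addr_maxl ge_max !le_max a3 // b3 // orbT.
Qed.

Lemma suboptimal_convex al be (th : R) z1 z2 : 0 <= th <= 1 ->
  suboptimal al be z1 -> suboptimal al be z2 ->
  suboptimal al be (fun i t x => (1 - th) * z1 i t x + th * z2 i t x).
Proof.
move=> /andP[th0 th1] [a1 a2 a3] [b1 b2 b3].
have th1' : 0 <= 1 - th by rewrite subr_ge0.
split=> [i j t tab|i t x a h h1 h2 h3 h4 h5|i t h h1 h2 h3].
- by rewrite (a1 i j t tab) (b1 i j t tab).
- have := ler_wpM2l th1' (a2 i t x a h h1 h2 h3 h4 h5).
  have := ler_wpM2l th0 (b2 i t x a h h1 h2 h3 h4 h5); lra.
- have := ler_wpM2l th1' (a3 i t h h1 h2 h3).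
  have := ler_wpM2l th0 (b3 i t h h1 h2 h3); lra.
Qed.

Lemma suboptimal_shift al be s z : suboptimal al be z ->
  suboptimal (al + s) (be + s) (fun i t x => z i (t - s) x).
Proof.
move=> [a1 a2 a3]; split=> [i j t /andP[h1 h2]|i t x a h h1 h2 h3 h4 h5|i t h h1 h2 h3].
- by apply: a1; apply/andP; split; lra.
- by rewrite (addrAC t h); apply: a2 => //; lra.
- by rewrite (addrAC t h); apply: a3 => //; lra.
Qed.

(** A run across [tau] is cut there: the parts cost at most as much as the whole by
    [move_cost_split], and passing from [z1] down to [z2] goes in the right direction. *)
Lemma suboptimal_concat al tau be z1 z2 :
  suboptimal al tau z1 -> suboptimal tau be z2 ->
  (forall i x, 0 <= x -> z2 i tau x <= z1 i tau x) ->
  suboptimal al be (fun i t x => if t < tau then z1 i t x else z2 i t x).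
Proof.
move=> [a1 a2 a3] [b1 b2 b3] H.
split=> [i j t /andP[h1 h2]|i t x a h h1 h2 h3 h4 h5|i t h h1 h2 h3].
- case: ltP => tt; first by apply: a1; rewrite h1 ltW.
  by apply: b1; rewrite tt h2.
- have [tt|tt] := ltP t tau; have [tht|tht] := ltP (t + h) tau.
  + by apply: a2 => //; exact: ltW.
  + pose h' := tau - t.
    have h'0 : 0 <= h' by rewrite subr_ge0 ltW.
    have hh' : h' <= h by rewrite /h'; lra.
    have xx : 0 <= x + a * h'.
      have [a0|a0] := leP 0 a; first by rewrite addr_ge0 // mulr_ge0.
      by apply: (le_trans h5); rewrite lerD2l ler_wnM2l // ltW.
    have e1 : t + h' = tau by rewrite /h'; ring.
    have e2 : tau + (h - h') = t + h by rewrite /h'; ring.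
    have e3 : x + a * h' + a * (h - h') = x + a * h by ring.
    have := a2 i t x a h' h1 h'0; rewrite e1 => /(_ (lexx _) h4 xx) s1.
    have := b2 i tau (x + a * h') a (h - h') (lexx _).
    rewrite e2 e3 => /(_ _ h3 xx h5) s2; have {}s2 := s2 (ltac:(by rewrite subr_ge0)).
    have hd : 0 <= h - h' by rewrite subr_ge0.
    have := move_cost_split i h'0 hd h4 xx.
    rewrite (_ : h' + (h - h') = h); last by ring.
    have := H i _ xx; lra.
  + by lra.
  + exact: b2.
- have [tt|tt] := ltP t tau; have [tht|tht] := ltP (t + h) tau.
  + by apply: a3 => //; exact: ltW.
  + pose h' := tau - t.
    have h'0 : 0 <= h' by rewrite subr_ge0 ltW.
    have e1 : t + h' = tau by rewrite /h'; ring.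
    have e2 : tau + (h - h') = t + h by rewrite /h'; ring.
    have := a3 i t h' h1 h'0; rewrite e1 => /(_ (lexx _)) s1.
    have hd : 0 <= h - h' by rewrite /h'; lra.
    have := b3 i tau (h - h') (lexx _) hd; rewrite e2 => /(_ h3) s2.
    have := H i _ (lexx 0).
    have -> : h * L0 = h' * L0 + (h - h') * L0 by ring.
    lra.
  + by lra.
  + exact: b3.
Qed.

(** The rate grows linearly in [x] because the lower bound on [L] falls like [C * x]. In exchange
    the slope in space grows by [C * |t|], which is why [barrier_suboptimal] asks for a bound on [L]
    whose slope [M] exceeds that of the data by this amount. *)
Definition barrier (g : 'I_N -> R -> R) (K : R) i t x : R := g i x - (K + C * x) * t.

Definition lipschitz_data (M : R) (g : 'I_N -> R -> R) : Prop :=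
  (forall i j, g i 0 = g j 0) /\
  (forall i x y, 0 <= x -> 0 <= y -> `|g i x - g i y| <= M * `|x - y|).

Lemma barrier_suboptimal al be (M0 M : R) g (K : R) :
  lipschitz_data M0 g -> (forall t, al <= t <= be -> M0 + C * `|t| <= M) ->
  (forall i x a, 0 <= x -> M * `|a| - K - C * x <= L i x a) -> - L0 <= K ->
  suboptimal al be (barrier g K).
Proof.
move=> [g1 g2] tM low KL0; split=> [i j t tt|i t x a h h1 h2 h3 h4 h5|i t h h1 h2 h3].
- by rewrite /barrier (g1 i j).
- rewrite /barrier /move_cost.
  have := g2 i _ _ h5 h4; rewrite addrAC subrr add0r normrM (ger0_norm h2) ler_norml.
  move=> /andP[_ gg].
  have tb : al <= t + h <= be by rewrite h3 andbT; lra.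
  have ah0 : 0 <= `|a| * h by rewrite mulr_ge0.
  have := ler_wpM2l ah0 (tM _ tb).
  have := ler_wpM2l h2 (low i x a h4).
  have : 0 <= C * `|a| * h ^+ 2 by rewrite !mulr_ge0 // exprn_ge0.
  have : - (`|a| * h * (C * `|t + h|)) <= a * h * (C * (t + h)).
    have -> : `|a| * h * (C * `|t + h|) = `|a * h * (C * (t + h))|.
      by rewrite !normrM (ger0_norm h2) (ger0_norm C0).
    by rewrite lerNl -normrN ler_norm.
  lra.
- rewrite /barrier !mulr0 !addr0; have := ler_wpM2l h2 KL0; lra.
Qed.

Section ValueFunction.
Context (g0 : 'I_N -> R -> R) (Lam : R).

(** Trajectories as an inductive predicate, [c] being the initial value plus the cost so far, so
    that bounds along trajectories are proved by induction. Runs are charged [move_cost]; its excess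
    over the running cost is quadratic in the duration, so subdividing runs removes it in the
    infimum. *)
Inductive reach : 'I_N -> R -> R -> R -> Prop :=
| reach_start i x : 0 <= x -> reach i 0 x (g0 i x)
| reach_move i t x c a h : reach i t x c -> 0 <= h -> 0 <= x + a * h ->
    reach i (t + h) (x + a * h) (c + move_cost i x a h)
| reach_stay i t c h : reach i t 0 c -> 0 <= h -> reach i (t + h) 0 (c + h * L0)
| reach_switch i j t c : reach i t 0 c -> reach j t 0 c.

Definition value_function i t x : R := inf [set c | reach i t x c].

Let U := value_function.

Lemma reach_ge0 i t x c : reach i t x c -> 0 <= t /\ 0 <= x.
Proof.
elim=> // {i t x c}.
- by move=> i t x c a h _ [t0 x0] h0 xa; split => //; exact: addr_ge0.
- by move=> i t c h _ [t0 _] h0; split => //; exact: addr_ge0.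
Qed.

Lemma suboptimal_le_reach be z i t x c : suboptimal 0 be z ->
  (forall i x, 0 <= x -> z i 0 x <= g0 i x) ->
  reach i t x c -> t <= be -> z i t x <= c.
Proof.
move=> [z1 z2 z3] z0 r; elim: r => {i t x c}.
- by move=> i x x0 _; exact: z0.
- move=> i t x c a h r IH h0 xa tb; have [t0 x0] := reach_ge0 r.
  have tb' : t <= be by apply: le_trans tb; rewrite lerDl.
  by apply: le_trans (z2 _ _ _ _ _ t0 h0 tb x0 xa) _; rewrite lerD2r IH.
- move=> i t c h r IH h0 tb; have [t0 _] := reach_ge0 r.
  have tb' : t <= be by apply: le_trans tb; rewrite lerDl.
  by apply: le_trans (z3 _ _ _ t0 h0 tb) _; rewrite lerD2r IH.
- move=> i j t c r IH tb; have [t0 _] := reach_ge0 r.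
  by rewrite (z1 j i) ?IH // t0.
Qed.

Lemma reach_rest i t x : 0 <= t -> 0 <= x -> reach i t x (g0 i x + t * L i x 0).
Proof.
move=> t0 x0; have := @reach_move i 0 x _ 0 t (reach_start i x0) t0.
by rewrite mul0r addr0 add0r /move_cost normr0 mulr0 mul0r addr0; apply.
Qed.

Hypotheses (L_conv : convex_lipschitz_lagrangian L).
Hypotheses (L_super : superlinear_lagrangian L).
Hypothesis g0_lip : lipschitz_data Lam g0.

Lemma lipschitz_data_le M M' g : M <= M' -> lipschitz_data M g -> lipschitz_data M' g.
Proof.
move=> MM [g1 g2]; split=> // i x y x0 y0; apply: le_trans (g2 i x y x0 y0) _.
by rewrite ler_wpM2r.
Qed.

(** The allowance [C * T] in the slope covers all times in [- T, T], so that one [K] serves all data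
    of slope at most [M0]. *)
Lemma barrier_exists (M0 T : R) : exists2 K : R, 0 <= K /\ - L0 <= K &
  (forall i x a, 0 <= x -> (M0 + C * T) * `|a| - K - C * x <= L i x a) /\
  forall (al be : R) g (M : R), M <= M0 -> lipschitz_data M g -> - T <= al -> be <= T ->
    suboptimal al be (barrier g K).
Proof.
have [K [K0 KL0] HK] := lagrangian_lower L0 L_conv L_super C0 L_lip (M0 + C * T).
exists K => //; split=> // al be g M MM gL alT beT.
apply: barrier_suboptimal (lipschitz_data_le MM gL) _ HK KL0 => t /andP[t1 t2].
rewrite lerD2l ler_wpM2l // ler_norml; apply/andP; split; lra.
Qed.

Lemma has_inf_reach i t x : 0 <= t -> 0 <= x -> has_inf [set c | reach i t x c].
Proof.
move=> t0 x0; split; first by exists (g0 i x + t * L i x 0); exact: reach_rest.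
have [K _ [_ /(_ 0 t g0 _ (lexx _) g0_lip)]] := barrier_exists Lam t.
rewrite oppr_le0 => /(_ t0 (lexx _)) H.
exists (barrier g0 K i t x) => c r; apply: (suboptimal_le_reach H _ r) => // j y y0.
by rewrite /barrier mulr0 subr0.
Qed.

Lemma value_le_reach i t x c : reach i t x c -> U i t x <= c.
Proof.
move=> r; have [t0 x0] := reach_ge0 r.
by apply: ge_inf => //; case: (has_inf_reach i t0 x0).
Qed.

Lemma value_suboptimal be : suboptimal 0 be U.
Proof.
split=> [i j t _|i t x a h t0 h0 _ x0 xa|i t h t0 h0 _].
- rewrite /U /value_function; congr inf; apply/seteqP; split=> c; exact: reach_switch.
- rewrite -lerBlDr; apply: lb_le_inf; first by case: (has_inf_reach i t0 x0).
  by move=> c r; rewrite lerBlDr; apply: value_le_reach; exact: reach_move.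
- rewrite -lerBlDr; apply: lb_le_inf; first by case: (has_inf_reach i t0 (lexx 0)).
  by move=> c r; rewrite lerBlDr; apply: value_le_reach; exact: reach_stay.
Qed.

Lemma value_max be z : suboptimal 0 be z ->
  (forall i x, 0 <= x -> z i 0 x <= g0 i x) ->
  forall i t x, 0 <= t <= be -> 0 <= x -> z i t x <= U i t x.
Proof.
move=> zs z0 i t x /andP[t0 tb] x0; apply: lb_le_inf; first by case: (has_inf_reach i t0 x0).
by move=> c r; exact: suboptimal_le_reach zs z0 r tb.
Qed.

Lemma value_init i x : 0 <= x -> U i 0 x = g0 i x.
Proof.
move=> x0; apply/eqP; rewrite eq_le value_le_reach /=; last exact: reach_start.
have [K _ [_ /(_ 0 0 g0 _ (lexx _) g0_lip)]] := barrier_exists Lam 0.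
rewrite oppr0 => /(_ (lexx _) (lexx _)) H.
have := value_max H _ i (t := 0) (x := x); rewrite lexx /barrier mulr0 subr0; apply => //.
by move=> j y _; rewrite /barrier mulr0 subr0.
Qed.

Lemma value_near_reach i t x eta : 0 <= t -> 0 <= x -> 0 < eta ->
  exists2 c : R, reach i t x c & c < U i t x + eta.
Proof. by move=> t0 x0 e0; have [c] := inf_adherent e0 (has_inf_reach i t0 x0); exists c. Qed.

Lemma value_rest i t x : 0 <= t -> 0 <= x -> U i t x <= g0 i x + t * L i x 0.
Proof. by move=> t0 x0; apply: value_le_reach; exact: reach_rest. Qed.

End ValueFunction.
End Suboptimal.

Arguments value_init {R N L L0 C} C0 L_lip {g0 Lam} L_conv L_super g0_lip i {x} _.
Arguments value_suboptimal {R N L L0 C} C0 L_lip {g0 Lam} L_conv L_super g0_lip be.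
Arguments value_rest {R N L L0 C} C0 L_lip {g0 Lam} L_conv L_super g0_lip i {t x} _ _.
Arguments value_near_reach {R N L L0 C} C0 L_lip {g0 Lam} L_conv L_super g0_lip i {t x eta} _ _ _.

(** * Local Lipschitz continuity of the value function *)

Section ValueRegularity.
Context {R : realType} {N : nat} (L : 'I_N -> R -> R -> R) (L0 C : R).
Context (g0 : 'I_N -> R -> R) (Lam : R).
Hypotheses (C0 : 0 <= C) (L_lip : lipschitz_position L C).
Hypotheses (L_conv : convex_lipschitz_lagrangian L).
Hypotheses (L_super : superlinear_lagrangian L).
Hypotheses (Lam0 : 0 <= Lam) (g0_lip : lipschitz_data Lam g0).
Implicit Types (i : 'I_N) (t s x y h T r : R).

Let U := value_function L L0 C g0.

(* Running the value function with a delay h, after a barrier on [0, h], and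
   mixing in a small multiple of a barrier to absorb the loss on the initial
   data, gives a competitor for the value function itself. *)
Lemma value_delay T : 0 <= T -> exists2 K : R, 0 <= K & exists K' : R, forall i t x h,
  0 <= t -> 0 <= x -> 0 <= h -> t + h <= T -> K * h <= 1 ->
  (1 - K * h) * U i t x + K * h * (g0 i x - 1 - x - (K' + C * x) * t) <= U i (t + h) x.
Proof.
move=> T0; have [K [K0 KL0] [low bar]] := barrier_exists L0 C0 L_lip L_conv L_super (Lam + 1) T.
pose g i x := g0 i x - 1 - x.
have gL : lipschitz_data (Lam + 1) g.
  case: g0_lip => g1 g2; split=> [i j|i x y x0 y0]; first by rewrite /g (g1 i j).
  rewrite (_ : g i x - g i y = g0 i x - g0 i y - (x - y)); last by rewrite /g; ring.
  by apply: le_trans (ler_normB _ _) _; rewrite mulrDl mul1r lerD2r g2.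
exists (K + C); first exact: addr_ge0.
exists K => i t x h t0 x0 h0 thT Kh1.
(* The barrier loses up to [(K + C * y) * h] on the data, at most [(K + C) * h * (1 + y)]; mixing in
   the lower datum [g], which is [g0 - 1 - y] at [y], with weight [th] takes off exactly
   [th * (1 + y)]. *)
pose th := (K + C) * h.
have th01 : 0 <= th <= 1 by rewrite Kh1 andbT mulr_ge0 // addr_ge0.
pose z1 := barrier C g0 K.
pose z2 i t x := (1 - th) * U i t x + th * barrier C g K i t x.
have hT : h <= T by lra.
have z1s : suboptimal L L0 C 0 h z1.
  by apply: bar g0_lip _ hT; rewrite ?lerDl // oppr_le0.
have z2s : suboptimal L L0 C 0 T z2.
  apply: suboptimal_convex => //; first exact: value_suboptimal g0_lip _.
  by apply: bar gL _ _; rewrite ?oppr_le0.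
have z2s' : suboptimal L L0 C h T (fun i t x => z2 i (t - h) x).
  have := suboptimal_shift h z2s; rewrite add0r; apply: suboptimalS => //.
  by rewrite lerDl.
have zs := suboptimal_concat C0 L_lip z1s z2s'.
have z21 : forall i x, 0 <= x -> z2 i (h - h) x <= z1 i h x.
  move=> j y y0; rewrite subrr /z2 /z1 /barrier mulr0 subr0 /U (value_init C0 L_lip L_conv L_super g0_lip) //.
  have Cy : 0 <= C * y by rewrite mulr_ge0.
  have Ky : 0 <= K * y by rewrite mulr_ge0.
  have e : K + C * y <= (K + C) * (1 + y).
    by have := C0; lra.
  have := ler_wpM2r h0 e; rewrite /g /th. lra.
have := value_max C0 L_lip L_conv L_super g0_lip (zs z21) _ i (t := t + h) (x := x).
have tth : (t + h < h) = false by rewrite ltNge lerDr t0.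
rewrite addr_ge0 // thT tth addrK => H.
apply: H => // j y y0; case: ltP => h00; first by rewrite /z1 /barrier mulr0 subr0.
have hE : h = 0 by apply/eqP; rewrite eq_le h00.
by have := z21 j y y0; rewrite subrr /z1 /barrier hE mulr0 !subr0.
Qed.

Lemma value_time_up : exists2 K : R, 0 <= K & forall i t x h, 0 <= t -> 0 <= x -> 0 <= h ->
  U i (t + h) x <= U i t x + h * (K + C * x).
Proof.
have [K [K0 _] HK] := lagrangian_upper L0 L_conv L_lip.
exists K => // i t x h t0 x0 h0.
have [_ vm _] := value_suboptimal (L0 := L0) C0 L_lip L_conv L_super g0_lip (t + h).
have := vm i t x 0 h t0 h0 (lexx _) x0; rewrite mul0r addr0 => /(_ x0).
rewrite /move_cost normr0 mulr0 mul0r addr0 => H; apply: le_trans H _.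
by rewrite lerD2l ler_wpM2l // HK // normr0.
Qed.

Lemma value_bounded T r : 0 <= T -> 0 <= r -> exists2 M : R, 0 <= M & forall i t x,
  0 <= t <= T -> 0 <= x <= r -> `|U i t x| <= M.
Proof.
move=> T0 r0; have [K [K0 _] HK] := lagrangian_upper L0 L_conv L_lip.
have [K' [K'0 _] [_ bar]] := barrier_exists L0 C0 L_lip L_conv L_super Lam T.
have [|M M0 HM] := @ord_uniform_bound R N (fun i M => `|g0 i 0| <= M).
  by move=> i; exists `|g0 i 0|.
exists (M + Lam * r + (K + K' + C * r) * T).
  by rewrite !addr_ge0 ?mulr_ge0 // !addr_ge0 // mulr_ge0.
move=> i t x /andP[t0 tT] /andP[x0 xr].
have g0x : `|g0 i x| <= M + Lam * r.
  have -> : g0 i x = g0 i 0 + (g0 i x - g0 i 0) by ring.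
  apply: le_trans (ler_normD _ _) _; rewrite lerD ?HM //.
  case: g0_lip => _ /(_ i x 0 x0 (lexx _)); rewrite subr0 (ger0_norm x0) => H.
  by apply: le_trans H _; rewrite ler_wpM2l.
have up := value_rest (L0 := L0) C0 L_lip L_conv L_super g0_lip i t0 x0.
have xL : t * L i x 0 <= t * (K + C * x).
  by rewrite ler_wpM2l // HK // normr0.
have lo : barrier C g0 K' i t x <= U i t x.
  apply: (value_max C0 L_lip L_conv L_super g0_lip (be := T)); rewrite ?t0 //.
    by apply: bar g0_lip _ _; rewrite ?oppr_le0.
  by move=> j y y0; rewrite /barrier mulr0 subr0.
have a1 : (K + C * x) * t <= (K + C * r) * T.
  by apply: ler_pM; rewrite ?addr_ge0 ?mulr_ge0 // lerD2l ler_wpM2l.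
have a2 : (K' + C * x) * t <= (K' + C * r) * T.
  by apply: ler_pM; rewrite ?addr_ge0 ?mulr_ge0 // lerD2l ler_wpM2l.
have a3 : 0 <= K * T by rewrite mulr_ge0.
have a4 : 0 <= K' * T by rewrite mulr_ge0.
rewrite -/U in up; move: g0x lo up; rewrite /barrier ler_norml => /andP[? ?] ? ?.
rewrite ler_norml; apply/andP; split; rewrite -?/U; lra.
Qed.

(** Resting bounds the increase and [value_delay] the decrease. The latter asks for [K * h <= 1];
    for longer delays the bound on [U] already suffices. *)
Lemma value_lipschitz_time T r : 0 <= T -> 0 <= r -> exists2 M : R, 0 <= M &
  forall i t s x, 0 <= t <= T -> 0 <= s <= T -> 0 <= x <= r ->
  `|U i t x - U i s x| <= M * `|t - s|.
Proof.
move=> T0 r0; have [M M0 HM] := value_bounded T0 r0.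
have [K K0 [K' HK]] := value_delay T0.
have [K1 K10 HK1] := value_time_up.
pose M1 := 2 * M + 1 + r + (`|K'| + C * r) * T.
have M10 : 0 <= M1 by rewrite !addr_ge0 ?mulr_ge0 // addr_ge0 // mulr_ge0.
exists (K1 + C * r + K * M1); first by rewrite !addr_ge0 ?mulr_ge0.
move=> i t s x; wlog ts : t s / t <= s.
  move=> H tT sT xr; have [ts|/ltW st] := leP t s; first exact: H.
  by rewrite distrC (distrC t); exact: H.
move=> /andP[t0 tT] /andP[s0 sT] /andP[x0 xr].
pose h := s - t; have h0 : 0 <= h by rewrite subr_ge0.
have sE : s = t + h by rewrite /h; ring.
have -> : `|t - s| = h by rewrite distrC ger0_norm.
have up := HK1 i t x h t0 x0 h0; rewrite -sE in up.
have xC : h * (C * x) <= h * (C * r) by rewrite !ler_wpM2l.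
have bt := HM i t x; have bs := HM i s x; have b0 := HM i 0 x.
rewrite t0 tT x0 xr in bt; rewrite s0 sT x0 xr in bs; rewrite lexx T0 x0 xr in b0.
move: (bt isT isT) (bs isT isT) (b0 isT isT); rewrite !ler_norml => /andP[? ?] /andP[? ?].
rewrite {1 2}/U (value_init C0 L_lip L_conv L_super g0_lip) // => /andP[? ?].
have KM : 0 <= h * (K * M1) by rewrite !mulr_ge0.
have K1h : 0 <= h * K1 by rewrite mulr_ge0.
have Crh : 0 <= h * (C * r) by rewrite !mulr_ge0.
suff : - (h * (K * M1)) <= U i s x - U i t x by move=> ?; apply/andP; split; lra.
have [Kh|Kh] := leP (K * h) 1; last first.
  have : M1 <= K * h * M1 by rewrite -[leLHS]mul1r ler_wpM2r // ltW.
  have : 0 <= (`|K'| + C * r) * T by rewrite mulr_ge0 // addr_ge0 // mulr_ge0.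
  rewrite /M1; lra.
have := HK i t x h t0 x0 h0; rewrite -sE => /(_ sT Kh) lo.
have Kh0 : 0 <= K * h by rewrite mulr_ge0.
have Kt : (K' + C * x) * t <= (`|K'| + C * r) * T.
  apply: (@le_trans _ _ ((`|K'| + C * r) * t)).
    by rewrite ler_wpM2r // lerD ?ler_norm // ler_wpM2l.
  by rewrite ler_wpM2l // addr_ge0 // mulr_ge0.
have e : U i t x - (g0 i x - 1 - x - (K' + C * x) * t) <= M1 by rewrite /M1; lra.
have := ler_wpM2l Kh0 e; lra.
Qed.

(** To pass from [x] to [y], move at unit speed for the time [|x - y|] and undo the delay by the
    Lipschitz bound in time. The delay is at most [r], which is why that bound is taken up to the
    time [T + r]. *)
Lemma value_lipschitz T r : 0 <= T -> 0 <= r -> exists2 M : R, 0 <= M &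
  forall i t s x y, 0 <= t <= T -> 0 <= s <= T -> 0 <= x <= r -> 0 <= y <= r ->
  `|U i t x - U i s y| <= M * (`|t - s| + `|x - y|).
Proof.
move=> T0 r0.
have [M M0 HM] := value_lipschitz_time (addr_ge0 T0 r0) r0.
have [K [K0 _] HK] := lagrangian_upper L0 L_conv L_lip.
pose M1 := M + K + 2 * (C * r).
have Cr : 0 <= C * r by rewrite mulr_ge0.
have key i t x y : 0 <= t <= T -> 0 <= x <= r -> 0 <= y <= r ->
    U i t y <= U i t x + M1 * `|x - y|.
  move=> /andP[t0 tT] /andP[x0 xr] /andP[y0 yr].
  pose h := `|x - y|; have h0 : 0 <= h by exact: normr_ge0.
  have hr : h <= r by rewrite /h ler_norml; apply/andP; split; lra.
  have := HM i t (t + h) y; rewrite t0 y0 yr (_ : t <= T + r); last by lra.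
  rewrite (_ : 0 <= t + h <= T + r); last by apply/andP; split; lra.
  rewrite (_ : t - (t + h) = - h); last by ring.
  rewrite normrN (ger0_norm h0) ler_norml => /(_ isT isT isT) /andP[_ b1].
  have [_ vm _] := value_suboptimal (L0 := L0) C0 L_lip L_conv L_super g0_lip (t + h).
  have [a a1 ya] : exists2 a : R, `|a| = 1 & y = x + a * h.
    have [xy|xy] := leP x y.
      by exists 1; rewrite ?normr1 // /h distrC ger0_norm ?subr_ge0 //; ring.
    by exists (-1); rewrite ?normrN1 // /h ger0_norm ?subr_ge0 ?ltW //; ring.
  have := vm i t x a h t0 h0 (lexx _) x0; rewrite -ya => /(_ y0).
  rewrite /move_cost a1 mulr1.
  have := HK i x a x0; rewrite a1 => /(_ (lexx _)) /(ler_wpM2l h0).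
  have : h * (C * x) <= h * (C * r) by rewrite !ler_wpM2l.
  have : C * h ^+ 2 <= C * r * h by rewrite expr2 mulrA ler_wpM2r // ler_wpM2l.
  rewrite /M1 -/h -/U; lra.
exists (M + M1); first by rewrite !addr_ge0 ?mulr_ge0.
move=> i t s x y tT sT xr yr.
have a1 : `|U i t x - U i s x| <= M * `|t - s|.
  by apply: HM => //; move: tT sT => /andP[? ?] /andP[? ?]; apply/andP; split; lra.
have a2 := key i s x y sT xr yr; have a3 := key i s y x sT yr xr.
rewrite (distrC y) in a3.
have b1 : 0 <= M1 * `|t - s| by rewrite mulr_ge0 // !addr_ge0 // mulr_ge0.
have b2 : 0 <= M * `|x - y| by rewrite mulr_ge0.
move: a1; rewrite !ler_norml => /andP[? ?]; apply/andP; split; lra.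
Qed.

End ValueRegularity.

Arguments value_bounded {R N L L0 C g0 Lam} C0 L_lip L_conv L_super Lam0 g0_lip {T r} _ _.
Arguments value_lipschitz {R N L L0 C g0 Lam} C0 L_lip L_conv L_super Lam0 g0_lip {T r} _ _.

(** * Smooth suboptimal functions below the value function *)

Section TruncatedValue.
Context {R : realType} {N : nat} (L : 'I_N -> R -> R -> R) (L0 C : R).
Context (g0 : 'I_N -> R -> R) (Lam : R).
Hypotheses (C0 : 0 <= C) (L_lip : lipschitz_position L C).
Hypotheses (L_conv : convex_lipschitz_lagrangian L).
Hypotheses (L_super : superlinear_lagrangian L).
Hypotheses (Lam0 : 0 <= Lam) (g0_lip : lipschitz_data Lam g0).
Implicit Types (i j : 'I_N) (t s x y a h T r B M al be : R) (z : 'I_N -> R -> R -> R).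

Let U := value_function L L0 C g0.

Definition lipschitz_on al be r M z : Prop :=
  forall i t s x y, al <= t <= be -> al <= s <= be -> 0 <= x <= r -> 0 <= y <= r ->
  `|z i t x - z i s y| <= M * (`|t - s| + `|x - y|).

Lemma lipschitz_on_le al be r M M' z : M <= M' -> lipschitz_on al be r M z ->
  lipschitz_on al be r M' z.
Proof.
move=> MM zL i t s x y ti si xi yi; apply: le_trans (zL i t s x y ti si xi yi) _.
by rewrite ler_wpM2r // addr_ge0.
Qed.

Lemma lipschitz_on_min al be r M z1 z2 : lipschitz_on al be r M z1 ->
  lipschitz_on al be r M z2 ->
  lipschitz_on al be r M (fun i t x => Num.min (z1 i t x) (z2 i t x)).
Proof.
move=> z1L z2L i t s x y ti si xi yi.
move: (z1L i t s x y ti si xi yi) (z2L i t s x y ti si xi yi).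
move: (M * _) => m; rewrite !ler_norml => /andP[? ?] /andP[? ?].
by rewrite /Num.min; case: ltP => ?; case: ltP => ?; apply/andP; split; lra.
Qed.

Lemma lipschitz_on_max al be r M z1 z2 : lipschitz_on al be r M z1 ->
  lipschitz_on al be r M z2 ->
  lipschitz_on al be r M (fun i t x => Num.max (z1 i t x) (z2 i t x)).
Proof.
move=> z1L z2L i t s x y ti si xi yi.
move: (z1L i t s x y ti si xi yi) (z2L i t s x y ti si xi yi).
move: (M * _) => m; rewrite !ler_norml => /andP[? ?] /andP[? ?].
by rewrite /Num.max; case: ltP => ?; case: ltP => ?; apply/andP; split; lra.
Qed.

Lemma barrier_lipschitz al be r M0 g K : 0 <= K -> 0 <= r -> 0 <= M0 -> lipschitz_data M0 g ->
  exists2 M : R, 0 <= M & lipschitz_on al be r M (barrier C g K).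
Proof.
move=> K0 r0 M00 [_ gL]; pose b := `|al| + `|be|.
have Cr : 0 <= C * r by rewrite mulr_ge0.
have b0 : 0 <= b by rewrite addr_ge0.
exists (M0 + K + C * r + C * b); first by rewrite !addr_ge0 // mulr_ge0.
move=> i t s x y /andP[t1 t2] _ /andP[x0 xr] /andP[y0 yr]; rewrite /barrier.
have -> : g i x - (K + C * x) * t - (g i y - (K + C * y) * s)
  = g i x - g i y - (K + C * y) * (t - s) - C * t * (x - y) by ring.
have tb : `|t| <= b.
  rewrite /b; have := ler_norm be; have : - `|al| <= al by rewrite lerNl -normrN ler_norm.
  have := normr_ge0 al; have := normr_ge0 be => ? ? ? ?.
  by rewrite ler_norml; apply/andP; split; lra.
apply: le_trans (ler_normB _ _) _; apply: le_trans (lerD (ler_normB _ _) (lexx _)) _.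
have h1 := gL i x y x0 y0.
have h2 : `|(K + C * y) * (t - s)| <= (K + C * r) * `|t - s|.
  rewrite normrM ger0_norm ?addr_ge0 ?mulr_ge0 // ler_wpM2r // lerD2l ler_wpM2l //.
have h3 : `|C * t * (x - y)| <= C * b * `|x - y|.
  by rewrite !normrM (ger0_norm C0) ler_wpM2r // ler_wpM2l.
have h4 : 0 <= (M0 + C * b) * `|t - s| by rewrite mulr_ge0 // addr_ge0 // mulr_ge0.
have h5 : 0 <= (K + C * r) * `|x - y| by rewrite mulr_ge0 // addr_ge0.
lra.
Qed.

Lemma concat_lipschitz al be r M z1 z2 : 0 <= M -> al <= 0 -> 0 <= be ->
  lipschitz_on al 0 r M z1 -> lipschitz_on 0 be r M z2 ->
  (forall i x, 0 <= x -> z1 i 0 x = z2 i 0 x) ->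
  lipschitz_on al be r M (fun i t x => if t < 0 then z1 i t x else z2 i t x).
Proof.
move=> M0 al0 be0 z1L z2L e i t s x y /andP[t1 t2] /andP[s1 s2] xi yi.
case: ltP => t0; case: ltP => s0.
- by apply: z1L => //; rewrite ?t1 ?s1 ltW.
- have h1 := z1L i t 0 x x; have h2 := z2L i 0 s x y.
  rewrite t1 (ltW t0) lexx al0 xi in h1; rewrite s0 s2 lexx be0 xi yi in h2.
  have := h2 isT isT isT isT; have := h1 isT isT isT isT.
  have x0 : 0 <= x by case/andP: xi.
  rewrite subrr normr0 addr0 subr0 sub0r normrN e // (ltr0_norm t0) (ger0_norm s0) => a1 a2.
  have -> : `|t - s| = s - t by rewrite ler0_norm; lra.
  have -> : z1 i t x - z2 i s y = (z1 i t x - z2 i 0 x) + (z2 i 0 x - z2 i s y) by ring.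
  apply: le_trans (ler_normD _ _) _; lra.
- have h1 := z1L i 0 s y y; have h2 := z2L i t 0 x y.
  rewrite s1 (ltW s0) lexx al0 yi in h1; rewrite t0 t2 lexx be0 xi yi in h2.
  have := h2 isT isT isT isT; have := h1 isT isT isT isT.
  have y0 : 0 <= y by case/andP: yi.
  rewrite subrr normr0 addr0 subr0 sub0r normrN e // (ltr0_norm s0) (ger0_norm t0) => a1 a2.
  have -> : `|t - s| = t - s by rewrite ger0_norm; lra.
  have -> : z2 i t x - z1 i s y = (z2 i 0 y - z1 i s y) + (z2 i t x - z2 i 0 y) by ring.
  apply: le_trans (ler_normD _ _) _; lra.
- by apply: z2L => //; rewrite ?t0 ?s0 ?t2 ?s2.
Qed.

(** Clamping both arguments extends a function from a box to the plane with the same Lipschitz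
    constant, so that averages can be taken anywhere. *)
Definition clamp al be x : R := Num.max al (Num.min x be).

Lemma clamp_bounds al be x : al <= be -> al <= clamp al be x <= be.
Proof. by move=> ab; rewrite /clamp le_max lexx ge_max ab ge_min lexx orbT. Qed.

Lemma clamp_id al be x : al <= x <= be -> clamp al be x = x.
Proof. by move=> /andP[ax xb]; rewrite /clamp min_l // max_r. Qed.

Lemma clamp_dist al be x y : al <= be -> `|clamp al be x - clamp al be y| <= `|x - y|.
Proof.
move=> _; apply: (@le_trans _ _ `|Num.min x be - Num.min y be|).
  rewrite /clamp; move: (Num.min x be) (Num.min y be) => u v; rewrite /Num.max.
  have := ler_norm (u - v); have := ler_norm (v - u); rewrite distrC => ? ?.
  have := normr_ge0 (u - v) => ?.
  by case: ltP => ?; case: ltP => ?; rewrite ler_norml; apply/andP; split; lra.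
have := ler_norm (x - y); have := ler_norm (y - x); rewrite distrC => ? ?.
have := normr_ge0 (x - y) => ?; rewrite /Num.min.
by case: ltP => ?; case: ltP => ?; rewrite ler_norml; apply/andP; split; lra.
Qed.

Lemma clamp_lipschitz al be r M z i : al <= be -> 0 <= r -> 0 <= M ->
  lipschitz_on al be r M z ->
  lipschitz2 M (fun t x => z i (clamp al be t) (clamp 0 r x)).
Proof.
move=> ab r0 M0 zL t s x y; apply: le_trans (zL i _ _ _ _ _ _ _ _) _;
  try exact: clamp_bounds.
by rewrite ler_wpM2l // lerD // clamp_dist.
Qed.

(** [U] is capped by [b1], which lies above it on [0, r] and falls with slope [B1], and the result
    is supported by [b2], which starts below the data and falls with the smaller slope [B2]. From
    [r1 = D1 + D2] on, [b1] is below [b2], so only [b2] is left, and it lies below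
    [- (B * (1 + x))]; this makes comparison with functions of linear growth a compact problem. At
    negative times [U] is continued by the barrier [b0]. *)
Lemma truncated_value T r B : 0 <= T -> 0 <= r -> 0 <= B -> exists2 r1 : R, r <= r1 &
  forall r2, r1 <= r2 -> exists z, exists Lz : R,
  [/\ forall i, lipschitz2 Lz (z i),
      (exists2 zz, suboptimal L L0 C (- 1) T zz &
        forall i t x, - 1 <= t <= T -> 0 <= x <= r2 -> z i t x = zz i t x),
      forall i t x, 0 <= t <= T -> 0 <= x <= r -> U i t x <= z i t x,
      forall i x, 0 <= x <= r2 -> z i 0 x <= g0 i x &
      forall i t x, 0 <= t <= T -> r1 <= x <= r2 -> z i t x <= - (B * (1 + x))].
Proof.
move=> T0 r0 B0.
pose B2 : R := B + Lam.
pose B1 : R := B2 + 1.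
have [|c c0 Hc] := @ord_uniform_bound R N (fun i c => `|g0 i 0| <= c).
  by move=> i; exists `|g0 i 0|.
have {}Hc i : `|g0 i 0| <= c by exact: Hc.
pose D2 : R := B + c.
have [K [K0 KL0] [low bar]] := barrier_exists L0 C0 L_lip L_conv L_super B1 (T + 1).
have [M M0 HM] := value_bounded (L0 := L0) C0 L_lip L_conv L_super Lam0 g0_lip T0 r0.
(* With this height [b1] is at least the bound [M] on [U] for distances up to [r] and times up to
   [T]. *)
pose D1 : R := M + B1 * r + (K + C * r) * T.
pose g1 := fun (_ : 'I_N) (x : R) => D1 - B1 * x.
pose g2 := fun (_ : 'I_N) (x : R) => - D2 - B2 * x.
have B20 : 0 <= B2 by rewrite addr_ge0.
have B10 : 0 <= B1 by rewrite addr_ge0.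
have D20 : 0 <= D2 by rewrite addr_ge0.
have D10 : 0 <= D1 by rewrite !addr_ge0 // mulr_ge0 // addr_ge0 // mulr_ge0.
have g1L : lipschitz_data B1 g1.
  split=> // i x y _ _; rewrite /g1.
  rewrite (_ : _ - _ = - B1 * (x - y)); last by ring.
  by rewrite normrM normrN (ger0_norm B10).
have g2L : lipschitz_data B2 g2.
  split=> // i x y _ _; rewrite /g2.
  rewrite (_ : _ - _ = - B2 * (x - y)); last by ring.
  by rewrite normrM normrN (ger0_norm B20).
have T1 : (0 : R) <= T + 1 by rewrite addr_ge0.
have m1 : - (T + 1) <= -1 :> R by lra.
have TT : T <= T + 1 by lra.
have LB : Lam <= B1 by have := Lam0; rewrite /B1 /B2; lra.
have B2B1 : B2 <= B1 by rewrite /B1; lra.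
pose b0 := barrier C g0 K.
pose b1 := barrier C g1 K.
pose b2 := barrier C g2 K.
have b0s : suboptimal L L0 C (-1) 0 b0 by apply: bar LB g0_lip m1 T1.
have b1s : suboptimal L L0 C (-1) T b1 by apply: bar (lexx _) g1L m1 TT.
have b2s : suboptimal L L0 C (-1) T b2 by apply: bar B2B1 g2L m1 TT.
have Us := value_suboptimal (L0 := L0) C0 L_lip L_conv L_super g0_lip T.
have U0 i x : 0 <= x -> U i 0 x = b0 i 0 x.
  by move=> x0; rewrite /U (value_init C0 L_lip L_conv L_super g0_lip) // /b0 /barrier mulr0 subr0.
pose Z i t x := if t < 0 then b0 i t x else U i t x.
have Zs : suboptimal L L0 C (-1) T Z.
  by apply: (suboptimal_concat C0 L_lip b0s Us) => i x x0; rewrite -/U U0.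
pose zz i t x := Num.max (b2 i t x) (Num.min (Z i t x) (b1 i t x)).
have zzs : suboptimal L L0 C (-1) T zz.
  by apply: suboptimal_max => //; exact: suboptimal_min.
have rD : r <= D1 + D2.
  have : 0 <= B2 * r by rewrite mulr_ge0.
  have : 0 <= (K + C * r) * T by rewrite mulr_ge0 // addr_ge0 // mulr_ge0.
  by rewrite /D1 /B1; lra.
exists (D1 + D2) => // r2 r2D.
have r20 : 0 <= r2 by lra.
have [M1 M10 b0L] := barrier_lipschitz (-1) 0 K0 r20 Lam0 g0_lip.
have [M2 M20 b1L] := barrier_lipschitz (-1) T K0 r20 B10 g1L.
have [M3 M30 b2L] := barrier_lipschitz (-1) T K0 r20 B20 g2L.
have [M4 M40 UL] := value_lipschitz (L0 := L0) C0 L_lip L_conv L_super Lam0 g0_lip T0 r20.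
pose MM : R := M1 + M2 + M3 + M4.
have ZL : lipschitz_on (-1) T r2 MM Z.
  apply: concat_lipschitz => //.
  - by rewrite !addr_ge0.
  - by apply: lipschitz_on_le b0L; rewrite /MM; lra.
  - by apply: (@lipschitz_on_le _ _ _ M4) UL; rewrite /MM; lra.
  - by move=> i x x0; rewrite U0.
have zzL : lipschitz_on (-1) T r2 MM zz.
  apply: lipschitz_on_max; first by apply: lipschitz_on_le b2L; rewrite /MM; lra.
  by apply: lipschitz_on_min => //; apply: lipschitz_on_le b1L; rewrite /MM; lra.
pose z i t x := zz i (clamp (-1) T t) (clamp 0 r2 x).
have zE i t x : -1 <= t <= T -> 0 <= x <= r2 -> z i t x = zz i t x.
  by move=> ti xi; rewrite /z !clamp_id.
have T1' : -1 <= T :> R by lra.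
exists z, MM; split.
- by move=> i; apply: clamp_lipschitz => //; rewrite !addr_ge0.
- by exists zz.
- move=> i t x /andP[t0 tT] /andP[x0 xr]; rewrite zE ?tT ?x0 ?andbT /=; [|lra|lra].
  rewrite /zz le_max le_min /Z ltNge t0 /= lexx /=.
  have := HM i t x; rewrite t0 tT x0 xr ler_norml => /(_ isT isT) /andP[_ Ub].
  have : B1 * x <= B1 * r by rewrite ler_wpM2l.
  have : (K + C * x) * t <= (K + C * r) * T.
    by apply: ler_pM; rewrite ?addr_ge0 ?mulr_ge0 // lerD2l ler_wpM2l.
  move=> a1 a2; apply/orP; right; rewrite /b1 /barrier /g1 /D1 /U; lra.
- move=> i x /andP[x0 xr]; rewrite zE ?x0 ?xr //; last by rewrite T0 andbT; lra.
  rewrite /zz ge_max ge_min /Z ltxx U0 // /b0 /b2 /barrier !mulr0 !subr0 lexx andbT /g2.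
  have := Hc i; rewrite ler_norml => /andP[c1 _].
  case: g0_lip => _ /(_ i x 0 x0 (lexx _)); rewrite subr0 (ger0_norm x0) ler_norml => /andP[c2 _].
  have : 0 <= B * x by rewrite mulr_ge0.
  by rewrite /D2 /B2; lra.
- move=> i t x /andP[t0 tT] /andP[x1 x2]; have x0 : 0 <= x by lra.
  rewrite zE ?tT ?x0 ?andbT //=; last by lra.
  have bb : b1 i t x <= b2 i t x by rewrite /b1 /b2 /barrier /g1 /g2 /B1; lra.
  rewrite /zz max_l; last by rewrite ge_min bb orbT.
  have : 0 <= (K + C * x) * t by rewrite mulr_ge0 // addr_ge0 // mulr_ge0.
  have : 0 <= Lam * x by rewrite mulr_ge0.
  by rewrite /b2 /barrier /g2 /D2 /B2; lra.
Qed.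

End TruncatedValue.

Arguments truncated_value {R N L L0 C g0 Lam} C0 L_lip L_conv L_super Lam0 g0_lip {T r B} _ _ _.

Section SmoothSubsolution.
Context {R : realType} {N : nat} (L : 'I_N -> R -> R -> R) (L0 C : R).
Context (g0 : 'I_N -> R -> R) (Lam : R).
Hypotheses (C0 : 0 <= C) (L_lip : lipschitz_position L C).
Hypotheses (L_conv : convex_lipschitz_lagrangian L).
Hypotheses (L_super : superlinear_lagrangian L).
Hypotheses (Lam0 : 0 <= Lam) (g0_lip : lipschitz_data Lam g0).
Implicit Types (i j : 'I_N) (t s x y a h T r B M al be : R) (z : 'I_N -> R -> R -> R).

Let U := value_function L L0 C g0.

(** [eps] is fixed before [del], because the correction at the vertex drifts at the rate
    [2 * Lz / eps * del]. The move inequality is averaged over shifted starting points, where [L]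
    differs by at most [C * del]; the inequality for stays survives unchanged, since at the vertex
    the regularization is the time average alone. *)
Lemma smooth_subsolution T r B eta : 0 <= T -> 0 <= r -> 0 <= B -> 0 < eta ->
  exists2 r1 : R, r <= r1 & forall r2, r1 <= r2 ->
  exists F : 'I_N -> R -> R -> R, exists Ft : 'I_N -> R -> R -> R,
  exists Fx : 'I_N -> R -> R -> R, exists M : R,
  [/\ forall i, [/\ lipschitz2 M (F i), lipschitz2 M (Ft i) & lipschitz2 M (Fx i)],
      forall i t x, is_derive t (1 : R) ((F i)^~ x) (Ft i t x) /\
                    is_derive x (1 : R) (F i t) (Fx i t x),
      forall i j t, - 1 / 2 <= t <= T -> F i t 0 = F j t 0 /\ Ft i t 0 = Ft j t 0,
      (forall i t x a h, 0 <= t -> 0 <= h -> t + h <= T -> 0 <= x <= r2 ->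
         0 <= x + a * h <= r2 ->
         F i (t + h) (x + a * h) <= F i t x + move_cost L C i x a h + eta * h) /\
      (forall i t h, 0 <= t -> 0 <= h -> t + h <= T ->
         F i (t + h) 0 <= F i t 0 + h * L0) &
      [/\ forall i t x, 0 <= t <= T -> 0 <= x <= r -> U i t x <= F i t x + eta,
          forall i x, 0 <= x <= r2 -> F i 0 x <= g0 i x + eta &
          forall i t x, 0 <= t <= T -> r1 <= x <= r2 ->
            F i t x <= - (B * (1 + x)) + eta]].
Proof.
move=> T0 r0 B0 eta0; have [r1 rr1 H] := truncated_value (L0 := L0) C0 L_lip L_conv L_super Lam0 g0_lip T0 r0 B0.
exists r1 => // r2 r12.
(* The space average looks up to [del <= 1] ahead, so the truncation must hold on a longer
   interval. *)
have r23 : r1 <= r2 + 1 by lra.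
have [z [Lz [zL [zz [zz1 zz2 zz3] zzE] zU zg zB]]] := H _ r23.
case: (pselect (exists i : 'I_N, True)) => [[i0 _]|no]; last first.
  exists (fun=> fun=> fun=> 0), (fun=> fun=> fun=> 0), (fun=> fun=> fun=> 0), 0.
  have F0 (i : 'I_N) : False by apply: no; exists i.
  by split=> [i|i|i||]; [case: (F0 i)..| |]; split=> i; case: (F0 i).
have Lz0 : 0 <= Lz := lipschitz2_ge0 (zL i0).
pose eps : R := Num.min (1 / 4) (eta / (2 * (Lz + 1))).
have eps0 : 0 < eps.
  by rewrite lt_min divr_gt0 // ?divr_gt0 // mulr_gt0 // ltr_wpDl.
have epsLz : Lz * eps <= eta / 2.
  have : eps <= eta / (2 * (Lz + 1)) by rewrite ge_min lexx orbT.
  rewrite ler_pdivlMr; last by rewrite mulr_gt0 // ltr_wpDl.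
  have := eps0; lra.
have eps4 : eps <= 1 / 4 by rewrite ge_min lexx.
(* Multiplied by [del], the summands account for the shifted position in [L], the distance to the
   space average and the drift of the correction at the vertex; the 1 keeps [q] positive. *)
pose q : R := C + 2 * Lz + 2 * Lz / eps + 1.
have q1 : 1 <= q.
  have := C0; have : 0 <= 2 * Lz / eps by rewrite divr_ge0 ?mulr_ge0 // ltW.
  by rewrite /q; lra.
have q0 : 0 < q by lra.
pose del : R := Num.min 1 (eta / 2 / q).
have del0 : 0 < del by rewrite lt_min ltr01 !divr_gt0.
have del1 : del <= 1 by rewrite ge_min lexx.
have delq : del * q <= eta / 2 by rewrite -ler_pdivlMr // ge_min lexx orbT.
have del_C : 0 <= C * del by rewrite mulr_ge0 // ltW.
have del_L : 0 <= 2 * Lz * del by rewrite !mulr_ge0 // ltW.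
have del_e : 0 <= 2 * Lz / eps * del by rewrite !mulr_ge0 ?invr_ge0 // ltW.
have delE : del * q = C * del + 2 * Lz * del + 2 * Lz / eps * del + del.
  by rewrite /q; ring.
rewrite delE in delq.
have dist i t x : `|regularize eps del (z i) t x - z i t x| <= eta.
  apply: le_trans (regularize_dist (zL i) eps0 del0 t x) _; lra.
have dist1 i t x : regularize eps del (z i) t x <= z i t x + eta.
  by have := dist i t x; rewrite ler_norml => /andP[_]; lra.
have dist2 i t x : z i t x <= regularize eps del (z i) t x + eta.
  by have := dist i t x; rewrite ler_norml => /andP[? _]; lra.
pose M : R := 3 * Lz + 3 * (2 * Lz / eps) + 2 * Lz / del.
have Me : 0 <= 2 * Lz / eps by rewrite divr_ge0 ?mulr_ge0 // ltW.
have Md : 0 <= 2 * Lz / del by rewrite divr_ge0 ?mulr_ge0 // ltW.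
have lipW (M1 M2 : R) f : M1 <= M2 -> lipschitz2 M1 f -> lipschitz2 M2 f.
  move=> M12 fL t s k l; apply: le_trans (fL t s k l) _.
  by rewrite ler_wpM2r // addr_ge0.
have r20 : 0 <= r2 by lra.
have vert i j t : -1 <= t <= T -> z i t 0 = z j t 0.
  by move=> tT; rewrite !zzE ?lexx //=; [exact: zz1|lra|lra].
exists (fun i => regularize eps del (z i)), (fun i => regularize_dt eps del (z i)),
  (fun i => regularize_dx eps del (z i)), M; split.
- move=> i; split.
  + by apply: lipW (regularize_lipschitz (zL i) eps0 del0); rewrite /M; lra.
  + by apply: lipW (regularize_dt_lipschitz (zL i) eps0 del0); rewrite /M; lra.
  + by apply: lipW (regularize_dx_lipschitz (zL i) eps0 del0); rewrite /M; lra.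
- move=> i t x; split; first exact: regularize_derive_t (zL i) eps0 del0 t x.
  exact: regularize_derive_x (zL i) eps0 t x.
- move=> i j t /andP[t1 t2]; rewrite !regularize_vertex !regularize_dt_vertex.
  split; last first.
    rewrite /time_average_dt (vert i j t) ?(vert i j (t - eps)) //; apply/andP; split; lra.
  have le_vert k l : time_average eps (z k) t 0 <= time_average eps (z l) t 0.
    rewrite -[leRHS]addr0; apply: average_le2 => //;
      try exact: lipschitz2_continuous_t (zL _).
    by move=> s /andP[s1 s2]; rewrite addr0 (vert k l) //; apply/andP; split; lra.
  by apply/eqP; rewrite eq_le !le_vert.
- split=> [i t x a h t0 h0 tT /andP[x0 xr] /andP[y0 yr]|i t h t0 h0 tT].
  + have := @regularize_increment _ (z i) Lz eps del (zL i) eps0 del0 t h x (x + a * h)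
      (move_cost L C i x a h + h * (C * del)) h0.
    move=> inc; have {inc}: regularize eps del (z i) (t + h) (x + a * h)
      <= regularize eps del (z i) t x + (move_cost L C i x a h + h * (C * del))
        + 2 * Lz / eps * del * h.
      apply: inc => s l /andP[s1 s2] /andP[l0 ld].
      rewrite !zzE; [|lra|lra|lra|lra].
      have := zz2 i s (x + l) a h _ h0 _ _ _.
      rewrite (_ : x + l + a * h = x + a * h + l); last by ring.
      move=> mv; apply: le_trans (mv _ _ _ _) _; [lra|lra|lra|lra|].
      rewrite -addrA lerD2l /move_cost.
      have := L_lip i a (_ : 0 <= x + l) x0; rewrite addr_ge0 // => /(_ isT).
      rewrite addrAC subrr add0r (ger0_norm l0) ler_norml => /andP[_ e].
      have e2 : C * l <= C * del by rewrite ler_wpM2l.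
      have e3 : L i (x + l) a <= L i x a + C * del by lra.
      have := ler_wpM2l h0 e3; lra.
    move=> inc; apply: le_trans inc _; rewrite -!addrA lerD2l lerD2l.
    have e : C * del + 2 * Lz / eps * del <= eta by lra.
    have := ler_wpM2l h0 e; lra.
  + rewrite !regularize_vertex.
    have inc := time_average_increment (zL i) eps0 (t := t) (k := 0) (l := 0) (h := h) (c := h * L0).
    apply: inc => s /andP[s1 s2].
    rewrite !zzE; [|lra|lra|lra|lra].
    by apply: zz3; lra.
- split=> [i t x ti xi|i x /andP[x0 xr]|i t x ti /andP[x1 x2]].
  + exact: le_trans (zU i t x ti xi) (dist2 _ _ _).
  + by apply: le_trans (dist1 _ _ _) _; rewrite lerD2r zg // x0; lra.
  + by apply: le_trans (dist1 _ _ _) _; rewrite lerD2r zB // x1; lra.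
Qed.

End SmoothSubsolution.

Arguments smooth_subsolution {R N L L0 C g0 Lam} C0 L_lip L_conv L_super Lam0 g0_lip {T r B eta} _ _ _ _.

(** * Semicontinuous envelopes and test functions in coordinates *)

Section Maxima.

(** Without a maximum, the upper parts of [K] form a filter along which each point is beaten by its
    successors, uniformly in a neighbourhood. Compactness in its near-covering form then yields a
    [q] in [K] that beats itself. *)
Lemma usc_max {R : realType} {X : topologicalType} (K : set X) (g : X -> R) :
  compact K -> K !=set0 ->
  (forall x eta, K x -> 0 < eta -> \forall x' \near x, K x' -> g x' < g x + eta) ->
  exists2 x, K x & forall y, K y -> g y <= g x.
Proof.
move=> cK [x0 Kx0] gusc; apply: contrapT => noMax.
have above p : K p -> exists2 q, K q & g p < g q.
  move=> Kp; apply: contrapT => nq; apply: noMax; exists p => // y Ky.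
  by rewrite leNgt; apply/negP => lt; apply: nq; exists y.
pose F : set_system X := [set S | exists2 q, K q & forall p, K p -> g q <= g p -> S p].
have FF : Filter F.
  split=> [|A B [p Kp pA] [q Kq qB]|A B AB [q Kq qA]].
  - by exists x0.
  - have [pq|/ltW qp] := leP (g p) (g q).
      by exists q => // r Kr qr; split; [apply: pA => //; exact: le_trans pq qr|exact: qB].
    by exists p => // r Kr pr; split; [exact: pA|apply: qB => //; exact: le_trans qp pr].
  - by exists q => // p Kp qp; apply: AB; exact: qA.
have := (compact_near_coveringP K).1 cK X F (fun q x => K x -> g x < g q) FF.
move=> /(_ _) [x Kx|q Kq qK]; last by have := qK q Kq (lexx _) q Kq Kq; rewrite ltxx.
have [q Kq xq] := above x Kx.
have e0 : 0 < g q - g x by rewrite subr_gt0.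
exists ([set x' | K x' -> g x' < g x + (g q - g x)], [set p | K p /\ g q <= g p]) => /=.
  by split; [exact: gusc|exists q].
move=> [x' p] /= [xx [Kp qp]] Kx'; apply: lt_le_trans qp.
by have := xx Kx'; rewrite addrC subrK.
Qed.

Context {R : realType}.
Implicit Types (a b r t s x y eta rho G c : R).

Lemma usc_max_rectangle {N : nat} (g : 'I_N -> R -> R -> R) (i0 : 'I_N) a b r :
  a <= b -> 0 <= r ->
  (forall i t x eta, a <= t <= b -> 0 <= x <= r -> 0 < eta ->
    exists2 rho : R, 0 < rho & forall s y, a <= s <= b -> 0 <= y <= r ->
      `|t - s| < rho -> `|x - y| < rho -> g i s y < g i t x + eta) ->
  exists i t x, [/\ a <= t <= b, 0 <= x <= r &
    forall j s y, a <= s <= b -> 0 <= y <= r -> g j s y <= g i t x].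
Proof.
move=> ab r0 gusc; pose K := (`[a, b] `*` `[0, r])%classic : set (R * R).
have cK : compact K by apply: compact_setX; exact: segment_compact.
have K0 : K !=set0 by exists (a, 0); split; rewrite /= in_itv /= ?lexx ?ab ?r0.
have H i : exists p : R * R, K p /\ forall q, K q -> g i q.1 q.2 <= g i p.1 p.2.
  have [|p Kp pmax] := @usc_max R _ K (fun p => g i p.1 p.2) cK K0; last by exists p.
  move=> [t x] eta [/=]; rewrite !in_itv /= => ti xi eta0.
  have [rho rho0 Hrho] := gusc i t x eta ti xi eta0.
  exists (ball t rho, ball x rho) => /=; first by split; exact: nbhsx_ballx.
  move=> [s y] [/= sb yb] [/=]; rewrite !in_itv /= => si yi.
  exact: Hrho.
have [p Hp] := choice H.
have [i _ iM] := @Order.TotalTheory.arg_maxP _ _ _ i0 xpredT (fun i => g i (p i).1 (p i).2) isT.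
have [[/=]] := Hp i; rewrite !in_itv /= => p1 p2 p3.
exists i, (p i).1, (p i).2; split=> // j s y si yi.
apply: le_trans (iM j isT); have [_ /(_ (s, y))] := Hp j; apply.
by split; rewrite /= in_itv.
Qed.

(** It vanishes up to the time [c], is C^1 and nondecreasing, and exceeds any given bound at a later
    time if [G] is large: combined with a test function it keeps an extremum away from the final
    time without affecting the values up to [c]. *)
Definition late_penalty G c t : R := G * Num.max 0 (t - c) ^+ 2.

Definition late_penalty_dt G c t : R := G * (2 * Num.max 0 (t - c)).

Lemma late_penalty_derive G c t :
  is_derive t (1 : R) (late_penalty G c) (late_penalty_dt G c t).
Proof.
apply: (@is_derive_quadratic _ _ _ _ `|G|) => h.
pose m t := Num.max 0 (t - c).
have -> : late_penalty G c (t + h) - late_penalty G c t - h * late_penalty_dt G c t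
  = G * (m (t + h) ^+ 2 - m t ^+ 2 - 2 * h * m t).
  by rewrite /late_penalty /late_penalty_dt /m; ring.
rewrite normrM ler_wpM2l //.
have h2 : 0 <= h ^+ 2 by rewrite sqr_ge0.
rewrite /m /Num.max; case: ltP => t1; case: ltP => t2; rewrite ?expr0n /=.
- have -> : (t + h - c) ^+ 2 - (t - c) ^+ 2 - 2 * h * (t - c) = h ^+ 2 by ring.
  by rewrite ger0_norm.
- rewrite ger0_norm; last by rewrite mulr0 !subr0 sqr_ge0.
  have : 0 <= (c - t) * (h + (t + h - c)) by apply: mulr_ge0; lra.
  by rewrite mulr0 !subr0; lra.
- have p1 : 0 <= (t - c) * - (t + h - c) by apply: mulr_ge0; lra.
  have p2 : 0 <= (t - c) ^+ 2 by rewrite sqr_ge0.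
  have p3 : 0 <= (t + h - c) ^+ 2 by rewrite sqr_ge0.
  by rewrite ler_norml; apply/andP; split; lra.
- by rewrite !mulr0 !subr0 normr0.
Qed.

Lemma late_penalty_dt_continuous G c : continuous (late_penalty_dt G c).
Proof.
apply: (@lipschitz_continuous _ _ (2 * `|G|)) => x y.
rewrite /late_penalty_dt -!mulrBr !normrM (ger0_norm (_ : 0 <= 2 :> R)) //.
rewrite mulrA [`|G| * 2]mulrC ler_wpM2l ?mulr_ge0 //.
have := ler_norm (x - y); have := ler_norm (y - x); rewrite distrC => ? ?.
have := normr_ge0 (x - y) => ?; rewrite /Num.max.
by case: ltP => ?; case: ltP => ?; rewrite ler_norml; apply/andP; split; lra.
Qed.

Lemma late_penalty_early G c t : t <= c -> late_penalty G c t = 0.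
Proof. by move=> tc; rewrite /late_penalty max_l ?subr_le0 // expr0n mulr0. Qed.

Lemma late_penalty_ge0 G c t : 0 <= G -> 0 <= late_penalty G c t.
Proof. by move=> G0; rewrite mulr_ge0 // sqr_ge0. Qed.

Lemma late_penalty_dt_ge0 G c t : 0 <= G -> 0 <= late_penalty_dt G c t.
Proof. by move=> G0; rewrite !mulr_ge0 // le_max lexx. Qed.

Lemma late_penalty_big c b m : c < b -> exists2 G : R, 0 <= G & m < late_penalty G c b.
Proof.
move=> cb; have bc : 0 < (b - c) ^+ 2 by rewrite exprn_gt0 // subr_gt0.
exists ((`|m| + 1) / (b - c) ^+ 2); first by rewrite divr_ge0 ?addr_ge0 // ltW.
rewrite /late_penalty max_r ?subr_ge0 ?(ltW cb) // divfK ?gt_eqF //.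
by rewrite (le_lt_trans (ler_norm m)) // ltrDl.
Qed.

End Maxima.

(** * Coordinates on the junction *)

Section Geometry.
Context {R : realType} {V : normedModType R} {N : nat} (e : 'I_N -> V).
Hypothesis e_unit : unit_directions e.
Implicit Types (i j : 'I_N) (t s k l rho eta : R) (x : V).

Lemma norm_point i k : 0 <= k -> `|k *: e i| = k.
Proof. by move=> k0; case: e_unit => _ eu; rewrite normrZ eu mulr1 ger0_norm. Qed.

Lemma branch_point i k : 0 <= k -> branch e i (k *: e i).
Proof. by move=> k0; exists k. Qed.

Lemma branchE i x : branch e i x -> x = `|x| *: e i.
Proof. by move=> [k k0 ->]; rewrite norm_point. Qed.

Lemma junction_point i k : 0 <= k -> junction e (k *: e i).
Proof. by move=> k0; exists i => //; exact: branch_point. Qed.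

Lemma junctionE x : junction e x -> exists i, x = `|x| *: e i.
Proof. by move=> [i _ /branchE]; exists i. Qed.

Lemma point_inj i j k l : 0 < k -> 0 <= l -> k *: e i = l *: e j -> i = j /\ k = l.
Proof.
move=> k0 l0 kl; have kE : k = l by rewrite -(norm_point i (ltW k0)) kl norm_point.
split=> //; case: e_unit => e_inj _; apply: e_inj.
by apply: (scalerI (a := k)); rewrite ?gt_eqF // kl kE.
Qed.

Lemma point_neq0 i k : 0 < k -> k *: e i != 0.
Proof. by move=> k0; rewrite -normr_gt0 norm_point // ltW. Qed.

(* The distance between k e_i and l e_j is less than rho. *)
Definition jclose rho i k j l : Prop := (i = j /\ `|k - l| < rho) \/ k + l < rho.

Lemma jclose_le rho rho' i k j l : rho <= rho' -> jclose rho i k j l -> jclose rho' i k j l.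
Proof. by move=> r [[ij kl]|kl]; [left; split=> //|right]; exact: lt_le_trans r. Qed.

Lemma jclose_norm rho i k j l : 0 <= k -> 0 <= l -> jclose rho i k j l ->
  `|k *: e i - l *: e j| < rho.
Proof.
move=> k0 l0 [[<- kl]|kl].
  by case: e_unit => _ eu; rewrite -scalerBl normrZ eu mulr1.
by apply: le_lt_trans kl; apply: le_trans (ler_normB _ _) _; rewrite !norm_point.
Qed.

Lemma norm_jclose : exists2 c : R, 0 < c & forall rho i k j l, 0 <= k -> 0 <= l ->
  `|k *: e i - l *: e j| < c * rho -> jclose rho i k j l.
Proof.
have [c c0 H] := jdist_equiv e_unit; exists c => // rho i k j l k0 l0 d.
have /andP[h _] := H _ _ (junction_point i k0) (junction_point j l0).
have {H} := le_lt_trans h d; rewrite ltr_pM2l // /jdist.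
have [<- |ij] := eqVneq i j.
  case: asboolP => [_|[]]; last by exists i; split; exact: branch_point.
  by case: e_unit => _ eu; rewrite -scalerBl normrZ eu mulr1; left.
case: asboolP => [[m [[a a0 ka] [b b0 lb]]]|_]; last by rewrite !norm_point //; right.
have [kp|k0'] := ltP 0 k.
  have [lp|l0'] := ltP 0 l.
    have [im _] := point_inj kp a0 ka; have [jm _] := point_inj lp b0 lb.
    by move: ij; rewrite im jm eqxx.
  have -> : l = 0 by apply/eqP; rewrite eq_le l0'.
  by rewrite scale0r subr0 norm_point // => ?; right; rewrite addr0.
have -> : k = 0 by apply/eqP; rewrite eq_le k0'.
by rewrite scale0r sub0r normrN norm_point // => ?; right; rewrite add0r.
Qed.

(** The passage from neighbourhoods in [R * V] to coordinates; two points on different branches are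
    close only through the vertex, as [jclose] records. *)
Lemma near_withinP (A : set R) t i k (P : R * V -> Prop) : 0 <= k ->
  (\forall y \near within (A `*` junction e) (nbhs (t, k *: e i)), P y) <->
  exists2 rho : R, 0 < rho & forall s j l, A s -> `|t - s| < rho -> 0 <= l ->
    jclose rho i k j l -> P (s, l *: e j).
Proof.
move=> k0; split=> [[[B1 B2] /= [/nbhs_ballP[r1 r10 b1] /nbhs_ballP[r2 r20 b2]] HP]|].
  exists (Num.min r1 r2); first by rewrite lt_min r10.
  move=> s j l As ts l0 kl; apply: (HP (s, l *: e j)) => /=.
    split=> /=; first by apply: b1; rewrite /ball /= (lt_le_trans ts) // ge_min lexx.
    apply: b2; rewrite -ball_normE /=; apply: jclose_norm => //.
    by apply: jclose_le kl; rewrite ge_min lexx orbT.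
  by split=> //=; exact: junction_point.
move=> [rho rho0 H]; have [c c0 Hc] := norm_jclose.
exists (ball t rho, ball (k *: e i) (c * rho)) => /=.
  by split; apply: nbhsx_ballx => //; exact: mulr_gt0.
move=> [s x] [/= ts tx] [/= As /junctionE[j xE]].
rewrite xE; apply: H => //; apply: Hc => //; rewrite -xE.
by rewrite -ball_normE in tx.
Qed.

End Geometry.

Section Envelopes.
Context {R : realType} {V : normedModType R} {N : nat} (e : 'I_N -> V) (T : R).
Hypothesis e_unit : unit_directions e.
Implicit Types (i j : 'I_N) (t s k l rho eta m : R) (x : V) (v : R -> V -> R).

Lemma upper_envelope_le v i t k m : 0 <= k ->
  (exists2 rho : R, 0 < rho & forall s j l, 0 <= s < T -> `|t - s| < rho -> 0 <= l ->
     jclose rho i k j l -> v s (l *: e j) <= m) ->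
  (upper_envelope e T v (t, k *: e i) <= m%:E)%E.
Proof.
move=> k0 [rho rho0 H]; rewrite /upper_envelope /limf_esup.
pose S : set (R * V) := [set y | v y.1 y.2 <= m].
apply: (@le_trans _ _ (ereal_sup [set (v y.1 y.2)%:E | y in S])).
  apply: ereal_inf_lbound; exists S => //.
  apply: (near_withinP e_unit `[0, T[ t i S k0).2; exists rho => //.
by apply: ge_ereal_sup => _ [y yS <-]; rewrite lee_fin.
Qed.

Lemma upper_envelope_near v i t k m : 0 <= k ->
  (upper_envelope e T v (t, k *: e i) < m%:E)%E ->
  exists2 rho : R, 0 < rho & forall s j l, 0 <= s < T -> `|t - s| < rho -> 0 <= l ->
     jclose rho i k j l -> v s (l *: e j) < m.
Proof.
move=> k0; rewrite /upper_envelope /limf_esup => /ereal_inf_lt[_ [S FS <-] Sm].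
have [rho rho0 H] := (near_withinP e_unit `[0, T[ t i S k0).1 FS.
exists rho => // s j l sT ts l0 kl; rewrite -lte_fin; apply: le_lt_trans Sm.
apply: ereal_sup_ubound; exists (s, l *: e j) => //; exact: H.
Qed.

Lemma upper_envelope_ge v i t k : 0 <= k -> 0 <= t < T ->
  ((v t (k *: e i))%:E <= upper_envelope e T v (t, k *: e i))%E.
Proof.
move=> k0 tT; rewrite leNgt; apply/negP => /(upper_envelope_near k0) [rho rho0].
move=> /(_ t i k tT); rewrite subrr normr0 => /(_ rho0 k0); rewrite ltxx => H.
by have : false by apply: H; left; rewrite subrr normr0.
Qed.

Lemma upper_envelope_cont v i t k : 0 <= k -> 0 <= t < T ->
  (forall eta, 0 < eta -> exists2 rho : R, 0 < rho & forall s j l, 0 <= s < T ->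
     `|t - s| < rho -> 0 <= l -> jclose rho i k j l ->
     v s (l *: e j) <= v t (k *: e i) + eta) ->
  upper_envelope e T v (t, k *: e i) = (v t (k *: e i))%:E.
Proof.
move=> k0 tT H; apply/eqP; rewrite eq_le upper_envelope_ge // andbT.
apply/lee_addgt0Pr => eta eta0; rewrite -EFinD.
by apply: upper_envelope_le => //; exact: H.
Qed.

Lemma lower_envelopeE v z :
  lower_envelope e T v z = (- upper_envelope e T (fun t x => (- v t x)%R) z)%E.
Proof. by []. Qed.

(** [fine] turns infinite values into 0; for functions of linear growth the envelope is finite at
    times in the domain, by [envelopeE]. *)
Definition envelope v i t k : R := fine (upper_envelope e T v (t, k *: e i)).

Section Growth.
Context (v : R -> V -> R) (B : R).
Hypothesis vB : forall t x, 0 <= t < T -> junction e x -> `|v t x| <= B * (1 + `|x|).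

Lemma growth_ge0 i : 0 < T -> 0 <= B.
Proof.
move=> T0; have := @vB 0 (0 *: e i); rewrite lexx T0 norm_point // addr0 mulr1.
by move=> /(_ isT (junction_point _ _ (lexx 0))); apply: le_trans.
Qed.

Lemma envelopeE i t k : 0 <= t < T -> 0 <= k ->
  upper_envelope e T v (t, k *: e i) = (envelope v i t k)%:E.
Proof.
move=> tT k0; rewrite /envelope fineK // fin_numElt; apply/andP; split.
  by apply: lt_le_trans (upper_envelope_ge v i k0 tT); rewrite ltNyr.
apply: le_lt_trans (ltry (B * (2 + k))); apply: upper_envelope_le => //.
have T0 : 0 < T by case/andP: tT; exact: le_lt_trans.
exists 1 => // s j l sT ts l0 kl.
have lk : l <= k + 1.
  case: kl => [[_]|]; last by lra.
  by rewrite distrC ltr_norml => /andP[_]; lra.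
have := @vB s (l *: e j) sT (junction_point _ _ l0).
rewrite norm_point // ler_norml => /andP[_] h; apply: le_trans h _.
by rewrite ler_wpM2l ?(growth_ge0 i) //; lra.
Qed.

Lemma envelope_ge i t k : 0 <= t < T -> 0 <= k -> v t (k *: e i) <= envelope v i t k.
Proof. by move=> tT k0; rewrite -lee_fin -envelopeE // upper_envelope_ge. Qed.

Lemma envelope_near i t k eta : 0 <= t < T -> 0 <= k -> 0 < eta ->
  exists2 rho : R, 0 < rho & forall s j l, 0 <= s < T -> `|t - s| < rho -> 0 <= l ->
     jclose rho i k j l -> v s (l *: e j) < envelope v i t k + eta.
Proof.
move=> tT k0 eta0; apply: upper_envelope_near => //.
by rewrite envelopeE // lte_fin ltrDl.
Qed.

Lemma envelope_le i t k m : 0 <= t < T -> 0 <= k ->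
  (exists2 rho : R, 0 < rho & forall s j l, 0 <= s < T -> `|t - s| < rho -> 0 <= l ->
     jclose rho i k j l -> v s (l *: e j) <= m) -> envelope v i t k <= m.
Proof. by move=> tT k0 H; rewrite -lee_fin -envelopeE //; exact: upper_envelope_le. Qed.

Lemma envelope_usc i t k eta : 0 <= t < T -> 0 <= k -> 0 < eta ->
  exists2 rho : R, 0 < rho & forall s j l, 0 <= s < T -> `|t - s| < rho -> 0 <= l ->
     jclose rho i k j l -> envelope v j s l <= envelope v i t k + eta.
Proof.
move=> tT k0 eta0; have [rho rho0 H] := envelope_near i tT k0 eta0.
have r2 : 0 < rho / 2 by rewrite divr_gt0.
exists (rho / 2) => // s j l sT ts l0 kl; apply: envelope_le => //.
exists (rho / 2) => // s' j' l' sT' ts' l0' kl'; apply/ltW/H => //.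
  have -> : t - s' = (t - s) + (s - s') by ring.
  by apply: le_lt_trans (ler_normD _ _) _; lra.
case: kl kl' => [[-> a]|a] [[<- b]|b].
- left; split=> //; have -> : k - l' = (k - l) + (l - l') by ring.
  by apply: le_lt_trans (ler_normD _ _) _; lra.
- by right; move: a; rewrite ltr_norml => /andP[? ?]; lra.
- by right; move: b; rewrite ltr_norml => /andP[? ?]; lra.
- by right; lra.
Qed.

Lemma envelope_growth i t k : 0 <= t < T -> 0 <= k -> envelope v i t k <= B * (1 + k).
Proof.
move=> tT k0; apply/ler_addgt0Pr => eta eta0.
have T0 : 0 < T by case/andP: tT; exact: le_lt_trans.
have B0 := growth_ge0 i T0.
have B1 : 0 < B + 1 by lra.
apply: envelope_le => //; exists (eta / (B + 1)); first exact: divr_gt0.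
move=> s j l sT ts l0 kl.
have lk : l <= k + eta / (B + 1).
  case: kl => [[_]|]; last by lra.
  by rewrite distrC ltr_norml => /andP[_]; lra.
have := @vB s (l *: e j) sT (junction_point _ _ l0).
rewrite norm_point // ler_norml => /andP[_] h; apply: le_trans h _.
have h1 : B * (1 + l) <= B * (1 + (k + eta / (B + 1))).
  by rewrite ler_wpM2l // lerD2l.
apply: le_trans h1 _; rewrite addrA mulrDr lerD2l mulrCA.
by rewrite ler_piMr ?(ltW eta0) // ler_pdivrMr // mul1r lerDl.
Qed.

End Growth.
End Envelopes.

Lemma ord_uniform_small {R : realType} {N : nat} (P : 'I_N -> R -> Prop) :
  (forall i, exists2 rho : R, 0 < rho & forall rho', 0 < rho' -> rho' <= rho -> P i rho') ->
  exists2 rho : R, 0 < rho & forall i, P i rho.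
Proof.
move=> H.
have H' i : exists r : R, 0 < r /\ forall rho', 0 < rho' -> rho' <= r -> P i rho'.
  by have [r r0 Hr] := H i; exists r.
have [rho Hrho] := choice H'.
have m0 : 0 < \big[Num.min/1]_i rho i.
  by elim/big_ind: _ => // [a b a0 b0|i _]; [rewrite lt_min a0|case: (Hrho i)].
exists (\big[Num.min/1]_i rho i) => // i; case: (Hrho i) => _; apply => //.
exact: bigmin_le_cond.
Qed.

Section CoordinateTests.
Context {R : realType} {V : normedModType R} {N : nat} (e : 'I_N -> V) (T : R).
Hypothesis e_unit : unit_directions e.
Implicit Types (i j : 'I_N) (t s k l rho eta m a : R) (x : V).

(** The choice is arbitrary at the vertex, which lies on every branch, and the default [i] is taken
    off the junction. This is harmless because the functions lifted by it agree at the vertex. *)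
Definition branch_index (i : 'I_N) x : 'I_N := xget i [set j | branch e j x].

Lemma branch_index_point i0 i k : 0 < k -> branch_index i0 (k *: e i) = i.
Proof.
move=> k0; rewrite /branch_index.
have H : exists j, [set j | branch e j (k *: e i)] j.
  by exists i; apply: branch_point; exact: ltW.
have := xgetPex i0 H => /= -[l l0] kl.
by have [/esym] := point_inj e_unit k0 l0 kl.
Qed.

Section Test.
Context (i0 : 'I_N) (F Ft Fx : 'I_N -> R -> R -> R).

(** The coordinate [k] ranges over the whole line: the derivatives are two-sided at the vertex, and
    restriction gives the one-sided ones of [test_function]. *)
Record coordinate_test : Prop := CoordinateTest {
  coordinate_dt : forall i t k, 0 < t < T -> is_derive t (1 : R) ((F i)^~ k) (Ft i t k);
  coordinate_dx : forall i t k, 0 < t < T -> is_derive k (1 : R) (F i t) (Fx i t k);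
  coordinate_continuous : forall i, continuous (fun p : R * R => F i p.1 p.2);
  coordinate_dt_continuous : forall i, continuous (fun p : R * R => Ft i p.1 p.2);
  coordinate_dx_continuous : forall i, continuous (fun p : R * R => Fx i p.1 p.2);
  coordinate_vertex : forall i j t, 0 < t < T -> F i t 0 = F j t 0;
  coordinate_dt_vertex : forall i j t, 0 < t < T -> Ft i t 0 = Ft j t 0 }.

Definition junction_fun (G : 'I_N -> R -> R -> R) t x : R := G (branch_index i0 x) t `|x|.

Lemma junction_funE G i t k : (forall i j, G i t 0 = G j t 0) -> 0 <= k ->
  junction_fun G t (k *: e i) = G i t k.
Proof.
move=> GG k0; rewrite /junction_fun norm_point //.
move: k0; rewrite le_eqVlt => /orP[/eqP <-|k0]; first by rewrite (GG _ i).
by rewrite branch_index_point.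
Qed.

Lemma norm_fun_continuous (G : R -> R -> R) : continuous (fun p : R * R => G p.1 p.2) ->
  continuous (fun z : R * V => G z.1 `|z.2|).
Proof.
move=> cG z.
have c1 : fst @ z --> z.1 by exact: cvg_fst.
have c2 : (fun z : R * V => `|z.2|) @ z --> `|z.2|.
  apply: (@cvg_comp _ _ _ snd (fun x : V => `|x|) (nbhs z) (nbhs z.2)).
    exact: cvg_snd.
  exact: norm_continuous.
exact: (cvg_comp2 c1 c2 (cG (z.1, `|z.2|))).
Qed.

Lemma coordinate_test_function : coordinate_test ->
  test_function e T (junction_fun F) (junction_fun Ft) (fun i t x => Fx i t `|x|).
Proof.
move=> [dt dx cF cFt cFx gF gFt]; split.
  apply/subspace_continuousP => -[t x] [/=]; rewrite in_itv /= => tT /junctionE[] // i xE.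
  have := normr_ge0 x; move: xE; set k := `|x| => xE k0; rewrite {}xE.
  apply/cvgrPdist_le => eta eta0; rewrite /from_subspace /=.
  rewrite (junction_funE _ (fun i j => gF i j t tT)) //.
  (* On a branch other than [i], nearby points are compared with the vertex; they only occur if [k]
     is 0, the case in which all branches must be controlled at once. *)
  have [|rho rho0 H] := @ord_uniform_small R N (fun j rho => forall s l,
      `|t - s| < rho -> `|(if i == j then k else 0) - l| < rho ->
      `|F j t (if i == j then k else 0) - F j s l| <= eta).
    move=> j; set p := if _ then _ else _.
    have /cvgrPdist_le/(_ _ eta0)/nbhs_ballP[rho rho0 Hb] := cF j (t, p).
    exists rho => // rho' rho'0 rr s l ts kl; apply: (Hb (s, l)).
    by split; rewrite /ball /=; [exact: lt_le_trans rr|exact: lt_le_trans rr].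
  apply: (near_withinP e_unit `]0, T[ t i
    (fun z => `|F i t k - junction_fun F z.1 z.2| <= eta) k0).2.
  have [kp|k0'] := ltP 0 k.
    exists (Num.min rho k); first by rewrite lt_min rho0.
    move=> s j l; rewrite /= in_itv /= => sT; rewrite !lt_min => /andP[ts _] l0 [[<-]|].
      rewrite lt_min => /andP[kl _]; rewrite (junction_funE _ (fun i j => gF i j s sT)) //.
      by have := H i s l; rewrite eqxx; apply.
    by rewrite lt_min => /andP[_]; rewrite ltNge lerDl l0.
  have kE : k = 0 by apply/eqP; rewrite eq_le k0'.
  exists rho => // s j l; rewrite /= in_itv /= => sT ts l0 kl.
  rewrite (junction_funE _ (fun i j => gF i j s sT)) // kE (gF i j t tT).
  have := H j s l; rewrite kE if_same; apply => //.
  by move: kl; rewrite kE sub0r normrN ger0_norm // => -[[_]|]; rewrite ?add0r ?sub0r ?normrN ?ger0_norm.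
move=> i; split.
- move=> t x tT /(branchE e_unit) xE; have := normr_ge0 x; move: xE; set k := `|x| => xE k0.
  rewrite {}xE (junction_funE _ (fun i j => gFt i j t tT)) //.
  apply: near_eq_is_derive (dt i t k tT) => //.
  have /andP[t0 tlT] := tT.
  near=> s.
  have gFs i' j' : F i' s 0 = F j' s 0.
    apply: gF; apply/andP; split; near: s; [exact: lt_nbhsr|exact: lt_nbhsl].
  by rewrite (junction_funE _ gFs).
- move=> t k tT k0; rewrite norm_point //.
  have [d1 d2] := dx i t k tT.
  have d3 : h^-1 *: (F i t (h *: (1 : R) + k) - F i t k) @[h --> (0 : R)^'] --> Fx i t k.
    by rewrite -d2; exact: d1.
  have d4 : h^-1 *: (F i t (h *: (1 : R) + k) - F i t k)
      @[h --> within [set h | 0 <= k + h] (0 : R)^'] --> Fx i t k.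
    by apply: cvg_trans d3; apply: cvg_app; exact: cvg_within.
  apply: cvg_trans d4; apply: near_eq_cvg.
  near=> h; have kh : 0 <= k + h by near: h; exact: withinT.
  rewrite !(junction_funE _ (fun i j => gF i j t tT)) //.
  by rewrite /GRing.scale /= mulr1 (addrC h k).
- apply: (@subspace_eq_continuous _ _ _ (fun z : R * V => Ft i z.1 `|z.2|)); last first.
    exact/continuous_subspaceT/norm_fun_continuous.
  move=> [t x]; rewrite inE => -[/=]; rewrite in_itv /= => tT /(branchE e_unit) xE.
  by have := junction_funE i (fun i j => gFt i j t tT) (normr_ge0 x); rewrite -xE => <-.
- exact/continuous_subspaceT/norm_fun_continuous.
Unshelve. all: by end_near. Qed.

End Test.
End CoordinateTests.

Section HamiltonianBounds.
Context {R : realType} {N : nat} (L : 'I_N -> R -> R -> R) (L0 C : R).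
Hypotheses (C0 : 0 <= C) (L_lip : lipschitz_position L C).
Hypotheses (L_conv : convex_lipschitz_lagrangian L).
Hypotheses (L_super : superlinear_lagrangian L).
Implicit Types (i j : 'I_N) (x p a m : R).

Lemma has_ubound_legendre i x p (A : set R) : 0 <= x ->
  has_ubound [set a * p - L i x a | a in A].
Proof.
move=> x0; have [K _ HK] := lagrangian_lower L0 L_conv L_super C0 L_lip `|p|.
exists (K + C * x) => _ [a _ <-].
have := HK i x a x0; have := ler_norm (a * p); rewrite normrM; lra.
Qed.

Lemma hamiltonian_ge i x p a : 0 <= x -> a * p - L i x a <= hamiltonian L i x p.
Proof. by move=> x0; apply: ub_le_sup; [exact: has_ubound_legendre|exists a]. Qed.

Lemma hamiltonian_dec_ge i x p a : 0 <= x -> a <= 0 ->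
  a * p - L i x a <= hamiltonian_dec L i x p.
Proof. by move=> x0 a0; apply: ub_le_sup; [exact: has_ubound_legendre|exists a]. Qed.

Lemma hamiltonian_le i x p m : (forall a, a * p - L i x a <= m) -> hamiltonian L i x p <= m.
Proof.
move=> H; apply: ge_sup; first by exists (0 * p - L i x 0), 0.
by move=> _ [a _ <-].
Qed.

Lemma hamiltonian_dec_le i x p m : (forall a, a <= 0 -> a * p - L i x a <= m) ->
  hamiltonian_dec L i x p <= m.
Proof.
move=> H; apply: ge_sup; first by exists (0 * p - L i x 0), 0 => //=.
by move=> _ [a a0 <-]; exact: H.
Qed.

Lemma flux_limiter_ge (p : 'I_N -> R) : - L0 <= flux_limiter L L0 p.
Proof. exact: bigmax_ge_id. Qed.

Lemma flux_limiter_ge_branch (p : 'I_N -> R) i :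
  hamiltonian_dec L i 0 (p i) <= flux_limiter L L0 p.
Proof. exact: le_bigmax_cond. Qed.

Lemma flux_limiter_le (p : 'I_N -> R) m : - L0 <= m ->
  (forall i, hamiltonian_dec L i 0 (p i) <= m) -> flux_limiter L L0 p <= m.
Proof. by move=> Lm H; apply: bigmax_le. Qed.

Section Coordinates.
Context {V : normedModType R} (e : 'I_N -> V) (T B : R) (u0 : V -> R) (v : R -> V -> R).
Hypothesis e_unit : unit_directions e.
Hypothesis vB : forall (t : R) (y : V), 0 <= t < T -> junction e y -> `|v t y| <= B * (1 + `|y|).
Context (F Ft Fx : 'I_N -> R -> R -> R).
Hypothesis Ftest : coordinate_test T F Ft Fx.

(** The suprema are unfolded into inequalities for each velocity. At the vertex there remain the
    velocities [a <= 0], which arrive there, and the stay with cost [L0]. *)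
Lemma subsolution_coordinates i (t k rho : R) : subsolution e L L0 T u0 v ->
  0 < t < T -> 0 <= k -> 0 < rho ->
  (forall j s l, 0 < s < T -> `|t - s| < rho -> 0 <= l -> jclose rho i k j l ->
    envelope e T v j s l - F j s l <= envelope e T v i t k - F i t k) ->
  (0 < k -> forall a, Ft i t k + a * Fx i t k <= L i k a) /\
  (k = 0 -> Ft i t 0 <= L0 /\ forall j a, a <= 0 -> Ft i t 0 + a * Fx j t 0 <= L j 0 a).
Proof.
move=> [vsub _] tT k0 rho0 vmax.
have cl (s : R) : 0 < s < T -> 0 <= s < T by move=> /andP[/ltW -> ->].
have gF s : 0 < s < T -> forall i j, F i s 0 = F j s 0.
  by move=> sT i' j'; exact: coordinate_vertex Ftest _ _ _ sT.
have gFt : forall i j, Ft i t 0 = Ft j t 0.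
  by move=> i' j'; exact: coordinate_dt_vertex Ftest _ _ _ tT.
have [||h1 h2] := vsub _ _ _ (coordinate_test_function e_unit i Ftest) t (k *: e i).
- by split; rewrite /= ?in_itv //; exact: junction_point.
- apply: (near_withinP e_unit `]0, T[ t i
    (fun z => (upper_envelope e T v z - (junction_fun e i F z.1 z.2)%:E
      <= upper_envelope e T v (t, k *: e i)
         - (junction_fun e i F (t, k *: e i).1 (t, k *: e i).2)%:E)%E) k0).2.
  exists rho => // s j l; rewrite /= in_itv /= => sT ts l0 kl.
  rewrite !(envelopeE e_unit vB) ?cl // (junction_funE e_unit i _ (gF _ sT)) //.
  rewrite (junction_funE e_unit i _ (gF _ tT)) //.
  by rewrite -!EFinB lee_fin; exact: vmax.
- split=> [kp a|kE].
  + have ob : open_branch e i (k *: e i).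
      split; first exact: branch_point.
      by move=> /=; apply/eqP; exact: point_neq0 e_unit _ _ kp.
    have := h1 i ob; rewrite (junction_funE e_unit i _ gFt) // norm_point //.
    by have := hamiltonian_ge i (Fx i t k) a k0; lra.
  + have := h2; rewrite kE scale0r => /(_ erefl).
    have := junction_funE e_unit i i gFt (lexx 0); rewrite scale0r => -> h.
    rewrite normr0 in h; split.
      by have := flux_limiter_ge (fun i => Fx i t 0); lra.
    move=> j a a0; have := hamiltonian_dec_ge j (Fx j t 0) (lexx 0) a0.
    by have := flux_limiter_ge_branch (fun i => Fx i t 0) j; lra.
Qed.

Definition lower_envelope_coord i t k := - envelope e T (fun t y => - v t y) i t k.

(** A lower bound on a supremum gives no maximizing velocity; it only excludes a uniform gap
    [th > 0] in the inequalities over all velocities, and this is the form needed for a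
    contradiction. *)
Lemma supersolution_coordinates i (t k rho : R) : supersolution e L L0 T u0 v ->
  0 < t < T -> 0 <= k -> 0 < rho ->
  (forall j s l, 0 < s < T -> `|t - s| < rho -> 0 <= l -> jclose rho i k j l ->
    lower_envelope_coord i t k - F i t k <= lower_envelope_coord j s l - F j s l) ->
  (0 < k -> forall th : R, (forall a, Ft i t k + a * Fx i t k <= L i k a - th) -> th <= 0) /\
  (k = 0 -> forall th : R, Ft i t 0 <= L0 - th ->
    (forall j a, a <= 0 -> Ft i t 0 + a * Fx j t 0 <= L j 0 a - th) -> th <= 0).
Proof.
move=> [vsup _] tT k0 rho0 vmin.
have cl (s : R) : 0 < s < T -> 0 <= s < T by move=> /andP[/ltW -> ->].
have vBN : forall (t : R) (y : V), 0 <= t < T -> junction e y -> `|- v t y| <= B * (1 + `|y|).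
  by move=> s y sT yJ; rewrite normrN vB.
have gF s : 0 < s < T -> forall i j, F i s 0 = F j s 0.
  by move=> sT i' j'; exact: coordinate_vertex Ftest _ _ _ sT.
have gFt : forall i j, Ft i t 0 = Ft j t 0.
  by move=> i' j'; exact: coordinate_dt_vertex Ftest _ _ _ tT.
have [||h1 h2] := vsup _ _ _ (coordinate_test_function e_unit i Ftest) t (k *: e i).
- by split; rewrite /= ?in_itv //; exact: junction_point.
- apply: (near_withinP e_unit `]0, T[ t i
    (fun z => (lower_envelope e T v (t, k *: e i)
         - (junction_fun e i F (t, k *: e i).1 (t, k *: e i).2)%:E
       <= lower_envelope e T v z - (junction_fun e i F z.1 z.2)%:E)%E) k0).2.
  exists rho => // s j l; rewrite /= in_itv /= => sT ts l0 kl.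
  rewrite !lower_envelopeE.
  rewrite !(envelopeE e_unit vBN) ?cl // (junction_funE e_unit i _ (gF _ sT)) //.
  rewrite (junction_funE e_unit i _ (gF _ tT)) //.
  by rewrite -!EFinN -!EFinD lee_fin; exact: vmin.
- split=> [kp th Hth|kE th H0 Hth].
  + have ob : open_branch e i (k *: e i).
      split; first exact: branch_point.
      by move=> /=; apply/eqP; exact: point_neq0 e_unit _ _ kp.
    have := h1 i ob; rewrite (junction_funE e_unit i _ gFt) // norm_point // => h.
    have : hamiltonian L i k (Fx i t k) <= - Ft i t k - th.
      by apply: hamiltonian_le => a; have := Hth a; lra.
    lra.
  + have := h2; rewrite kE scale0r => /(_ erefl).
    have := junction_funE e_unit i i gFt (lexx 0); rewrite scale0r => -> h.
    rewrite normr0 in h.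
    have : flux_limiter L L0 (fun i => Fx i t 0) <= - Ft i t 0 - th.
      apply: flux_limiter_le; first by lra.
      by move=> j; apply: hamiltonian_dec_le => a a0; have := Hth j a a0; lra.
    lra.
Qed.

End Coordinates.
End HamiltonianBounds.

(** * Comparison with supersolutions *)

Section Taylor.
Context {R : realType}.
Implicit Types (t x y h a D m K M : R).

Lemma MVT_increment (f df : R -> R) x h :
  (forall z, `|z - x| <= `|h| -> is_derive z (1 : R) f (df z)) ->
  exists2 z, `|z - x| <= `|h| & f (x + h) - f x = h * df z.
Proof.
move=> fdf.
have cf z : `|z - x| <= `|h| -> {for z, continuous f}.
  by move=> /fdf[fz _]; apply: differentiable_continuous; exact/derivable1_diffP.
have [h0|/ltW h0] := leP 0 h.
- have xh : x <= x + h by rewrite lerDl.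
  have sub z : x <= z <= x + h -> `|z - x| <= `|h|.
    by move=> /andP[z1 z2]; rewrite !ger0_norm ?subr_ge0 // lerBlDl.
  have [||z] := @MVT_segment _ f df _ _ xh.
  + move=> z; rewrite in_itv /= => /andP[z1 z2]; apply/fdf/sub; by rewrite !ltW.
  + apply: continuous_in_subspaceT => z; rewrite inE /= in_itv /= => zi.
    exact/cf/sub.
  + rewrite in_itv /= => zi ->; exists z; first exact: sub.
    by rewrite [x + h]addrC addrK mulrC.
- have xh : x + h <= x by rewrite gerDl.
  have sub z : x + h <= z <= x -> `|z - x| <= `|h|.
    by move=> /andP[z1 z2]; rewrite !ler0_norm ?subr_le0 // lerN2 lerBrDl.
  have [||z] := @MVT_segment _ f df _ _ xh.
  + move=> z; rewrite in_itv /= => /andP[z1 z2]; apply/fdf/sub; by rewrite !ltW.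
  + apply: continuous_in_subspaceT => z; rewrite inE /= in_itv /= => zi.
    exact/cf/sub.
  + rewrite in_itv /= => zi E; exists z; first exact: sub.
    by rewrite -[LHS]opprB E; ring.
Qed.

Lemma taylor_bound (F Ft Fx : R -> R -> R) M t x h y :
  (forall t x, is_derive t (1 : R) (F^~ x) (Ft t x) /\
               is_derive x (1 : R) (F t) (Fx t x)) ->
  lipschitz2 M Ft -> lipschitz2 M Fx ->
  `|F (t + h) (x + y) - F t x - (h * Ft t x + y * Fx t x)| <= M * (`|h| + `|y|) ^+ 2.
Proof.
move=> dF FtL FxL.
have [z1 z1h E1] := @MVT_increment (F^~ (x + y)) (Ft^~ (x + y)) t h (fun z _ => (dF z _).1).
have [z2 z2y E2] := @MVT_increment (F t) (Fx t) x y (fun z _ => (dF t z).2).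
have -> : F (t + h) (x + y) - F t x - (h * Ft t x + y * Fx t x)
  = h * (Ft z1 (x + y) - Ft t x) + y * (Fx t z2 - Fx t x).
  by rewrite !mulrBr -E1 -E2; ring.
have b1 := FtL z1 t (x + y) x; have b2 := FxL t t z2 x.
rewrite addrAC subrr add0r in b1; rewrite subrr normr0 add0r in b2.
have M0 := lipschitz2_ge0 FtL.
have c1 : `|Ft z1 (x + y) - Ft t x| <= M * (`|h| + `|y|).
  by apply: le_trans b1 _; rewrite ler_wpM2l // lerD2r.
have c2 : `|Fx t z2 - Fx t x| <= M * `|y|.
  by apply: le_trans b2 _; rewrite ler_wpM2l.
apply: le_trans (ler_normD _ _) _; rewrite !normrM.
have := ler_wpM2l (normr_ge0 h) c1; have := ler_wpM2l (normr_ge0 y) c2.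
have : 0 <= M * (`|h| * `|y|) by rewrite !mulr_ge0.
move: `|h| `|y| => p q; move: (`|Ft _ _ - _|) (`|Fx _ _ - _|) => u w.
rewrite expr2; lra.
Qed.

(** Inequalities along short runs are turned into inequalities between derivatives by this division
    by [h]. *)
Lemma le_of_quadratic D m K h0 : 0 < h0 ->
  (forall h, 0 < h <= h0 -> h * D <= h * m + K * h ^+ 2) -> D <= m.
Proof.
move=> h00 H; apply/ler_addgt0Pr => eps eps0.
pose N := `|K| + 1; have N0 : 0 < N by rewrite ltr_wpDl.
pose h := Num.min h0 (eps / N).
have h1 : 0 < h by rewrite lt_min h00 divr_gt0.
have h2 : h * N <= eps by rewrite -ler_pdivlMr // ge_min lexx orbT.
have := H h; rewrite h1 ge_min lexx => /(_ isT).
rewrite expr2 mulrCA -mulrDr ler_pM2l // => DK; apply: le_trans DK _.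
rewrite lerD2l; apply: le_trans h2; rewrite mulrC ler_wpM2l ?(ltW h1) //.
apply: le_trans (ler_norm K) _; by rewrite lerDl.
Qed.

End Taylor.

Section Comparison.
Context {R : realType} {N : nat} (L : 'I_N -> R -> R -> R) (L0 C : R).
Hypotheses (C0 : 0 <= C) (L_lip : lipschitz_position L C).
Implicit Types (i j : 'I_N) (t x a h : R).

(** The move inequality is expanded to first order along the run of speed [a] that arrives at
    [(t, x)]. Its starting point is on the branch for short durations, because [0 < x] or
    [a <= 0]. *)
Lemma smooth_move_derivative (F Ft Fx : 'I_N -> R -> R -> R) (M T r eta : R) i t x a :
  (forall i, [/\ lipschitz2 M (F i), lipschitz2 M (Ft i) & lipschitz2 M (Fx i)]) ->
  (forall i t x, is_derive t (1 : R) ((F i)^~ x) (Ft i t x) /\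
                 is_derive x (1 : R) (F i t) (Fx i t x)) ->
  (forall i t x a h, 0 <= t -> 0 <= h -> t + h <= T -> 0 <= x <= r ->
     0 <= x + a * h <= r ->
     F i (t + h) (x + a * h) <= F i t x + move_cost L C i x a h + eta * h) ->
  0 < t <= T -> 0 <= x < r -> 0 < x \/ a <= 0 ->
  Ft i t x + a * Fx i t x <= L i x a + eta.
Proof.
move=> FL dF mv /andP[t0 tT] /andP[x0 xr] xa.
have [_ FtL FxL] := FL i.
pose N1 := `|a| + 1; have N10 : 0 < N1 by rewrite ltr_wpDl.
pose q : R := Num.min (r - x) (if 0 < x then x else 1).
have q0 : 0 < q by rewrite lt_min subr_gt0 xr; case: ifP => // _; exact: ltr01.
apply: (@le_of_quadratic _ _ _ (2 * (C * `|a|) + M * (1 + `|a|) ^+ 2) (Num.min t (q / N1))).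
  by rewrite lt_min t0 divr_gt0.
move=> h; rewrite le_min => /andP[h0 /andP[ht hq]].
have ah : `|a * h| <= q.
  rewrite ler_pdivlMr // in hq; rewrite normrM (gtr0_norm h0).
  by apply: le_trans hq; rewrite mulrC ler_wpM2l ?(ltW h0) // lerDl.
have ahr : `|a * h| <= r - x by apply: le_trans ah _; rewrite ge_min lexx.
have y0 : 0 <= x - a * h.
  have [xp|xp] := ltP 0 x.
    have : `|a * h| <= x by apply: le_trans ah _; rewrite /q xp ge_min lexx orbT.
    by rewrite ler_norml => /andP[_]; rewrite subr_ge0.
  by case: xa => [|a0]; [rewrite ltNge xp|rewrite -mulNr addr_ge0 // mulr_ge0 ?oppr_ge0 // ltW].
have yr : x - a * h <= r by move: ahr; rewrite ler_norml => /andP[]; lra.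
have := mv i (t - h) (x - a * h) a h.
rewrite !subrK subr_ge0 ht (ltW h0) tT y0 yr x0 (ltW xr) => /(_ isT isT isT isT isT) mm.
have := @taylor_bound _ (F i) (Ft i) (Fx i) M t x (- h) (- (a * h)) (dF i) FtL FxL.
rewrite !normrN normrM (gtr0_norm h0) ler_norml => /andP[_ tb].
have := L_lip i a y0 x0.
have -> : x - a * h - x = - (a * h) by ring.
rewrite normrN normrM (gtr0_norm h0) ler_norml => /andP[_ ll].
have {}ll : L i (x - a * h) a <= L i x a + C * (`|a| * h) by lra.
have {}ll := ler_wpM2l (ltW h0) ll.
move: mm tb ll; rewrite /move_cost.
have -> : M * (h + `|a| * h) ^+ 2 = M * (1 + `|a|) ^+ 2 * h ^+ 2 by ring.
move: (L i (x - a * h) a) (L i x a) (F i (t - h) _) (F i t x) (Ft i t x) (Fx i t x).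
move: (M * _ ^+ 2) => MM l1 l2 f1 f2 ft fx; clear; rewrite !expr2; lra.
Qed.

End Comparison.

Section SupersolutionComparison.
Context {R : realType} {V : normedModType R} {N : nat} (e : 'I_N -> V).
Context (L : 'I_N -> R -> R -> R) (L0 C T : R) (u0 : V -> R) (Lam : R).
Hypothesis e_unit : unit_directions e.
Hypotheses (C0 : 0 <= C) (L_lip : lipschitz_position L C).
Hypotheses (L_conv : convex_lipschitz_lagrangian L).
Hypotheses (L_super : superlinear_lagrangian L).
Let g0 i k := u0 (k *: e i).
Hypotheses (Lam0 : 0 <= Lam) (g0_lip : lipschitz_data Lam g0).
Implicit Types (i j : 'I_N) (t s k l a rho eta : R).

Let U := value_function L L0 C g0.

(* The value function is compared with a supersolution through its smooth
   approximations, which are test functions for the supersolution. *)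
Lemma value_le_supersolution (v : R -> V -> R) (B : R) i1 t1 k1 :
  (forall t (y : V), 0 <= t < T -> junction e y -> `|v t y| <= B * (1 + `|y|)) ->
  supersolution e L L0 T u0 v -> 0 <= t1 < T -> 0 <= k1 ->
  U i1 t1 k1 <= lower_envelope_coord e T v i1 t1 k1.
Proof.
have marker : True by [].
move=> vB vsup t1T k10; pose lv := lower_envelope_coord e T v.
have T0 : 0 < T by case/andP: t1T; exact: le_lt_trans.
have B0 : 0 <= B := growth_ge0 e_unit vB i1 T0.
have vBN : forall t (y : V), 0 <= t < T -> junction e y -> `|- v t y| <= B * (1 + `|y|).
  by move=> s y sT yJ; rewrite normrN vB.
have init i k : 0 <= k -> g0 i k <= lv i 0 k.
  move=> k0; case: vsup => _ /(_ _ (junction_point e i k0)).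
  by rewrite lower_envelopeE (envelopeE e_unit vBN) ?lexx ?T0 // -EFinN lee_fin.
have low i t k : 0 <= t < T -> 0 <= k -> - (B * (1 + k)) <= lv i t k.
  by move=> tT k0; rewrite lerN2 (envelope_growth e_unit vBN).
have half s : 0 <= s <= T -> - 1 / 2 <= s <= T.
  by move=> /andP[s0 ->]; rewrite andbT (le_trans _ s0) //; lra_goal.
case/andP: t1T; rewrite le_eqVlt => /orP[/eqP <- _|t10 t1T].
  by rewrite /U (value_init C0 L_lip L_conv L_super g0_lip) //; exact: init.
rewrite leNgt; apply/negP => lt.
pose eta : R := Num.min 1 ((U i1 t1 k1 - lv i1 t1 k1) / 6).
have eta0 : 0 < eta by rewrite lt_min ltr01 divr_gt0 // subr_gt0.
have eta1 : eta <= 1 by rewrite ge_min lexx.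
have eta6 : 6 * eta <= U i1 t1 k1 - lv i1 t1 k1.
  by rewrite mulrC -ler_pdivlMr // ge_min lexx orbT.
(* The penalty [mu * t] costs at most [eta] up to time [T] and makes the test function strict. The
   error [th] of the approximation must stay below [mu] for the final contradiction. *)
pose mu : R := eta / T.
have mu0 : 0 < mu by rewrite divr_gt0.
pose th : R := Num.min eta (mu / 2).
have th0 : 0 < th by rewrite lt_min eta0 divr_gt0.
have th_eta : th <= eta by rewrite ge_min lexx.
have th_mu : th <= mu / 2 by rewrite ge_min lexx orbT.
have B1 : 0 <= B + 1 by rewrite addr_ge0.
(* The slope [B + 1] exceeds the growth [B] of the supersolution, so that beyond [r1] the
   approximation lies too low for the maximum of the difference. *)
have [r1 k1r1 H] := smooth_subsolution (L0 := L0) C0 L_lip L_conv L_super Lam0 g0_lip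
  (ltW T0) k10 B1 th0.
have r12 : r1 <= r1 + 1 by rewrite lerDl.
have r10 : 0 <= r1 := le_trans k10 k1r1.
have [F [Ft [Fx [M [FL dF gF [mv st] [F1 F2 F3]]]]]] := H _ r12.
set r2 : R := r1 + 1 in F2 F3 mv *.
pose t2 : R := (t1 + T) / 2.
have t12 : t1 < t2 by rewrite /t2; lra.
have t2T : t2 < T by rewrite /t2; lra.
pose m : R := `|F i1 0 0| + M * (T + r2) + B * (1 + r2).
have [G G0 Gm] := late_penalty_big m t12.
pose p t : R := mu * t + late_penalty G t1 t.
pose pt t : R := mu + late_penalty_dt G t1 t.
have p0 t : 0 <= t -> 0 <= p t.
  by move=> t0; rewrite addr_ge0 ?late_penalty_ge0 // mulr_ge0 // ltW.
pose f i t k := F i t k - p t.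
pose ft i t k := Ft i t k - pt t.
have M0 : 0 <= M by have [/lipschitz2_ge0] := FL i1.
have Fbig i t k : 0 <= t <= T -> 0 <= k <= r2 -> F i t k <= `|F i1 0 0| + M * (T + r2).
  move=> /andP[t0 tT] /andP[k0 kr]; have [FiL _ _] := FL i.
  have Fi : F i 0 0 = F i1 0 0 by apply: (gF i i1 0 _).1; apply: half; rewrite lexx ltW //.
  have := FiL t 0 k 0; rewrite !subr0 (ger0_norm t0) (ger0_norm k0) Fi.
  have : M * (t + k) <= M * (T + r2) by rewrite ler_wpM2l // lerD.
  have := ler_norm (F i1 0 0); rewrite ler_norml => + + /andP[_]; lra_goal.
have pC : continuous (fun q : R * R => p q.1).
  move=> q; apply: (@continuous_comp _ _ _ fst p); first exact: cvg_fst.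
  apply: differentiable_continuous; apply/derivable1_diffP.
  have d1 := late_penalty_derive G t1 q.1.
  have d2 : is_derive q.1 (1 : R) (fun t => mu * t) mu.
    by apply: is_derive_eq; rewrite /GRing.scale /= mulr1.
  by have [] := is_deriveD d2 d1.
have ptC : continuous (fun q : R * R => pt q.1).
  move=> q; apply: (@continuous_comp _ _ _ fst pt); first exact: cvg_fst.
  by apply: cvgD; [exact: cvg_cst|exact: late_penalty_dt_continuous].
have ftest : coordinate_test T f ft Fx.
  split.
  - move=> i t k tT; have [d1 _] := dF i t k.
    have d2 := late_penalty_derive G t1 t.
    have d3 : is_derive t (1 : R) (fun t => mu * t) mu.
      by apply: is_derive_eq; rewrite /GRing.scale /= mulr1.
    exact: is_deriveB d1 (is_deriveD d3 d2).
  - move=> i t k tT; have [_ d1] := dF i t k.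
    have d2 : is_derive k (1 : R) (fun _ : R => p t) 0 by exact: is_derive_cst.
    by have := is_deriveB d1 d2; rewrite subr0.
  - move=> i q; apply: cvgB; last exact: pC.
    by have [FiL _ _] := FL i; exact: (lipschitz2_continuous FiL).
  - move=> i q; apply: cvgB; last exact: ptC.
    by have [_ FiL _] := FL i; exact: (lipschitz2_continuous FiL).
  - by move=> i; have [_ _ FiL] := FL i; exact: (lipschitz2_continuous FiL).
  - move=> i j t /andP[s0 sT]; rewrite /f (gF i j t _).1 //; apply: half; rewrite !ltW //.
  - move=> i j t /andP[s0 sT]; rewrite /ft (gF i j t _).2 //; apply: half; rewrite !ltW //.
have t20 : 0 <= t2 by lra.
have r20 : 0 <= r2 by rewrite /r2; lra.
have tT' t : 0 <= t <= t2 -> 0 <= t < T by move=> /andP[-> /le_lt_trans ->].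
have tT'' t : 0 <= t <= t2 -> 0 <= t <= T.
  by move=> /tT' /andP[-> /ltW].
have [|i [t [k [ti ki fmax]]]] := @usc_max_rectangle R N (fun i t k => f i t k - lv i t k) i1 0 t2 r2 t20 r20.
  move=> i t k eps ti /andP[k0 kr] eps0.
  have eps2 : 0 < eps / 2 by rewrite divr_gt0.
  have [rho1 rho10 H1] := envelope_usc e_unit vBN i (tT' t ti) k0 eps2.
  have cf : continuous (fun q : R * R => f i q.1 q.2).
    by case: ftest => _ _ + _ _ _ _; apply.
  have /cvgrPdist_lt/(_ _ eps2)/nbhs_ballP[rho2 rho20 H2] := cf (t, k).
  exists (Num.min rho1 rho2); first by rewrite lt_min rho10.
  move=> s l si /andP[l0 lr]; rewrite !lt_min => /andP[ts1 ts2] /andP[kl1 kl2].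
  have := H1 s i l (tT' s si) ts1 l0 (or_introl (conj erefl kl1)).
  have /= := H2 (s, l) (conj ts2 kl2).
  rewrite /lv /lower_envelope_coord ltr_norml => /andP[]; lra_goal.
have /andP[t0 tt2] := ti; have /andP[k0 kr2] := ki.
have big : 4 * eta <= f i t k - lv i t k.
  have := fmax i1 t1 k1; rewrite (ltW t10) (ltW t12) k10 (_ : k1 <= r2); last by rewrite /r2; lra.
  move=> /(_ isT isT); have := F1 i1 t1 k1; rewrite (ltW t10) (ltW t1T) k10 lexx -/U => /(_ isT isT).
  have : mu * t1 <= eta by rewrite /mu mulrAC ler_pdivrMr // ler_wpM2l // ltW.
  rewrite /f /p late_penalty_early //; move: eta6 th_eta; lra_goal.
have pp := p0 t t0.
have kr1 : k < r1.
  rewrite ltNge; apply/negP => r1k.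
  have := F3 i t k (tT'' t ti); rewrite r1k kr2 => /(_ isT).
  have := low i t k (tT' t ti) k0.
  move: big pp th_eta eta0 eta1 k0; rewrite /f; lra_goal.
have tp : 0 < t.
  rewrite lt_neqAle t0 andbT; apply/negP => /eqP t0E.
  have := F2 i k; rewrite k0 kr2 => /(_ isT); have := init i k k0.
  move: big pp th_eta eta0; rewrite /f -t0E; lra_goal.
have tt2' : t < t2.
  rewrite lt_neqAle tt2 andbT; apply/negP => /eqP tE.
  have := Fbig i t k (tT'' t ti) ki; have := low i t k (tT' t ti) k0.
  have : 0 <= mu * t by rewrite mulr_ge0 // ltW.
  have : B * (1 + k) <= B * (1 + r2) by rewrite ler_wpM2l // lerD2l.
  by move: big Gm eta0; rewrite /f /p /m tE; lra_goal.
have tlT : 0 < t < T by rewrite tp (lt_trans tt2').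
pose rho : R := Num.min (Num.min t (t2 - t)) 1.
have rho0 : 0 < rho by rewrite !lt_min tp subr_gt0 tt2' ltr01.
have [|sup1 sup2] := supersolution_coordinates e_unit vB ftest
  (i := i) vsup tlT k0 rho0.
  move=> j s l sT; rewrite !lt_min => /andP[/andP[ts1 ts2] ts3] l0 kl.
  have lk : l <= r2.
    have : l < k + 1.
      have r1' : rho <= 1 by rewrite ge_min lexx orbT.
      case: kl => [[_]|]; last by move: k0 r1'; lra_goal.
      by rewrite distrC ltr_norml => /andP[_]; move: r1'; lra_goal.
    by move: kr1; rewrite /r2; lra_goal.
  have st2 : 0 <= s <= t2.
    move: ts2; rewrite ltr_norml => /andP[ts2 _].
    by rewrite (ltW (andP sT).1) /=; move: ts2; lra_goal.
  have := fmax j s l st2; rewrite l0 lk => /(_ isT); rewrite /lv; lra_goal.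
have dp : mu <= pt t by rewrite lerDl late_penalty_dt_ge0.
have tTle : 0 < t <= T by case/andP: tlT => -> /ltW.
have kr : 0 <= k < r2 by rewrite k0 /=; move: kr1; rewrite /r2; lra_goal.
have key j a : 0 < k \/ a <= 0 -> Ft j t k + a * Fx j t k <= L j k a + th.
  exact: (smooth_move_derivative L_lip j FL dF mv tTle kr).
have thmu : 0 < mu - th by move: th_mu mu0; lra_goal.
move: k0; rewrite le_eqVlt => /orP[/eqP k0|kp].
- suff : mu - th <= 0 by rewrite leNgt thmu.
  apply: (sup2 (esym k0)).
  + have FtL0 : Ft i t 0 <= L0.
      apply: (@le_of_quadratic _ _ _ M t) => // h /andP[h0 ht].
      have := st i (t - h) h; rewrite subr_ge0 ht (ltW h0) subrK (ltW (andP tlT).2).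
      move=> /(_ isT isT isT).
      have [_ FtL FxL] := FL i.
      have := @taylor_bound _ (F i) (Ft i) (Fx i) M t 0 (- h) 0 (dF i) FtL FxL.
      rewrite normr0 !addr0 mul0r addr0 normrN (gtr0_norm h0) ler_norml => /andP[_].
      lra_goal.
    by move: FtL0 dp th0; rewrite /ft; lra_goal.
  + move=> j a a0; have := key j a (or_intror a0); rewrite -k0.
    have [_ ->] := gF j i t (half _ (andb_true_intro (conj (ltW tp) (ltW (andP tlT).2)))).
    by move: dp; rewrite /ft; lra_goal.
- suff : mu - th <= 0 by rewrite leNgt thmu.
  apply: (sup1 kp) => a; have := key i a (or_introl kp).
  by move: dp; rewrite /ft; lra_goal.
Qed.

End SupersolutionComparison.

(** * Comparison with subsolutions *)

Section SubsolutionComparison.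
Context {R : realType} {V : normedModType R} {N : nat} (e : 'I_N -> V).
Context (L : 'I_N -> R -> R -> R) (L0 C T : R) (u0 : V -> R).
Hypothesis e_unit : unit_directions e.
Hypotheses (C0 : 0 <= C) (L_lip : lipschitz_position L C).
Hypotheses (L_conv : convex_lipschitz_lagrangian L).
Hypotheses (L_super : superlinear_lagrangian L).
Context (v : R -> V -> R) (B : R).
Hypothesis vB : forall (t : R) (y : V), 0 <= t < T -> junction e y -> `|v t y| <= B * (1 + `|y|).
Hypothesis vsub : subsolution e L L0 T u0 v.
Implicit Types (i j : 'I_N) (t s k l a rho eta : R).

Let z := envelope e T v.

(** A maximum of [z - F], penalized late in time, is excluded at the start by the initial
    inequality, beyond [r] by coercivity and at the end by the penalty. The strict inequalities are
    only asked where [F < z]: a comparison function may violate the equation wherever growth bounds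
    already put it above [z]. *)
Lemma subsolution_comparison (F Ft Fx : 'I_N -> R -> R -> R) (t tau r m : R) :
  coordinate_test T F Ft Fx -> 0 <= t -> tau <= T -> 0 <= r ->
  (forall j y, 0 <= y -> z j t y <= F j t y) ->
  (forall j s y, t <= s < tau -> r <= y -> z j s y <= F j s y) ->
  (forall j s y, t <= s < tau -> 0 <= y -> m <= F j s y) ->
  (forall j s y, t < s < tau -> 0 < y -> F j s y < z j s y ->
     exists a : R, L j y a < Ft j s y + a * Fx j s y) ->
  (forall j s, t < s < tau -> F j s 0 < z j s 0 -> L0 < Ft j s 0 \/
     exists j', exists2 a : R, a <= 0 & L j' 0 a < Ft j' s 0 + a * Fx j' s 0) ->
  forall j s y, t <= s < tau -> 0 <= y -> z j s y <= F j s y.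
Proof.
have marker : True by [].
move=> Ftest t0 tauT r0 init coer Fm strict strict0 j1 s1 y1 /andP[ts1 s1tau] y10.
rewrite leNgt; apply/negP => lt.
have T0 : 0 < T by exact: lt_le_trans (le_lt_trans (le_trans t0 ts1) s1tau) tauT.
have B0 : 0 <= B := growth_ge0 e_unit vB j1 T0.
pose t2 : R := (s1 + tau) / 2.
have t12 : s1 < t2 by move: s1tau; rewrite /t2; lra_goal.
have t2T : t2 < tau by move: s1tau; rewrite /t2; lra_goal.
have [G G0 Gm] := late_penalty_big (B * (1 + r) - m) t12.
pose p := late_penalty G s1.
pose pt := late_penalty_dt G s1.
pose f i t k := F i t k + p t.
pose ft i t k := Ft i t k + pt t.
have pC : continuous (fun q : R * R => p q.1).
  move=> q; apply: (@continuous_comp _ _ _ fst p); first exact: cvg_fst.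
  apply: differentiable_continuous; apply/derivable1_diffP.
  by have [] := late_penalty_derive G s1 q.1.
have ptC : continuous (fun q : R * R => pt q.1).
  move=> q; apply: (@continuous_comp _ _ _ fst pt); first exact: cvg_fst.
  exact: late_penalty_dt_continuous.
have [dt dx cF cFt cFx gF gFt] := Ftest.
have ftest : coordinate_test T f ft Fx.
  split=> //.
  - by move=> i t' k tT; exact: is_deriveD (dt i t' k tT) (late_penalty_derive G s1 t').
  - move=> i t' k tT.
    have d2 : is_derive k (1 : R) (fun _ : R => p t') 0 by exact: is_derive_cst.
    by have := is_deriveD (dx i t' k tT) d2; rewrite addr0.
  - by move=> i q; apply: cvgD; [exact: cF|exact: pC].
  - by move=> i q; apply: cvgD; [exact: cFt|exact: ptC].
  - by move=> i j t' tT; rewrite /f (gF i j).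
  - by move=> i j t' tT; rewrite /ft (gFt i j).
have tt2 : t <= t2 by apply: le_trans ts1 _; exact: ltW.
have stau s : t <= s <= t2 -> t <= s < tau by move=> /andP[-> /le_lt_trans ->].
have sT s : t <= s <= t2 -> 0 <= s < T.
  by move=> /stau /andP[ts sta]; rewrite (le_trans t0 ts) (lt_le_trans sta).
have [|i [s [k [si ki fmax]]]] := @usc_max_rectangle R N (fun i s k => z i s k - f i s k) j1 t t2 r tt2 r0.
  move=> i s k eps si /andP[k0 kr] eps0.
  have eps2 : 0 < eps / 2 by rewrite divr_gt0.
  have [rho1 rho10 H1] := envelope_usc e_unit vB i (sT s si) k0 eps2.
  have cf : continuous (fun q : R * R => f i q.1 q.2).
    by case: ftest => _ _ + _ _ _ _; apply.
  have /cvgrPdist_lt/(_ _ eps2)/nbhs_ballP[rho2 rho20 H2] := cf (s, k).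
  exists (Num.min rho1 rho2); first by rewrite lt_min rho10.
  move=> s' l si' /andP[l0 lr]; rewrite !lt_min => /andP[ts1' ts2] /andP[kl1 kl2].
  have := H1 s' i l (sT s' si') ts1' l0 (or_introl (conj erefl kl1)).
  have /= := H2 (s', l) (conj ts2 kl2).
  by rewrite ltr_norml -/z => /andP[]; lra_goal.
have s1i : t <= s1 <= t2 by rewrite ts1 ltW.
have /andP[ts st2] := si; have /andP[k0 kr] := ki.
have p0 s' : 0 <= p s' by exact: late_penalty_ge0.
have pos : 0 < z i s k - f i s k.
  have [yr|ry] := leP y1 r; last first.
    have : z j1 s1 y1 <= F j1 s1 y1 by apply: coer; rewrite ?ts1 // ltW.
    by rewrite leNgt lt.
  have := fmax j1 s1 y1 s1i; rewrite y10 yr => /(_ isT); apply: lt_le_trans.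
  by rewrite /f /p late_penalty_early // addr0 subr_gt0.
have Fz : F i s k < z i s k.
  by have := p0 s; move: pos; rewrite /f; lra_goal.
have tp : t < s.
  rewrite lt_neqAle ts andbT; apply/negP => /eqP tE.
  by have := init i k k0; rewrite tE leNgt Fz.
have st2' : s < t2.
  rewrite lt_neqAle st2 andbT; apply/negP => /eqP sE.
  have := envelope_growth e_unit vB i (sT s si) k0; have := Fm i s k (stau s si) k0.
  have : B * (1 + k) <= B * (1 + r) by rewrite ler_wpM2l // lerD2l.
  by move: pos Gm; rewrite /f /p sE -/z; lra_goal.
have kr1 : k < r.
  rewrite ltNge; apply/negP => rk.
  by have := coer i s k (stau s si) rk; rewrite leNgt Fz.
have stau' : t < s < tau by rewrite tp (lt_trans st2').
have slT : 0 < s < T by case/andP: stau' => a b; rewrite (le_lt_trans t0 a) (lt_le_trans b).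
pose rho : R := Num.min (Num.min (s - t) (t2 - s)) (r - k).
have rho0 : 0 < rho by rewrite !lt_min !subr_gt0 tp st2' kr1.
have [|sub1 sub2] := subsolution_coordinates C0 L_lip L_conv L_super e_unit vB ftest
  (i := i) vsub slT k0 rho0.
  move=> j s' l s'T; rewrite !lt_min => /andP[/andP[ts1' ts2] ts3] l0 kl.
  have lk : l <= r.
    have r1' : rho <= r - k by rewrite ge_min lexx orbT.
    case: kl => [[_]|]; last by move: k0 r1'; lra_goal.
    by rewrite distrC ltr_norml => /andP[_]; move: r1'; lra_goal.
  have s't : t <= s' <= t2.
    move: ts1' ts2; rewrite !ltr_norml => /andP[_ b1] /andP[b2 _].
    by apply/andP; split; move: b1 b2; lra_goal.
  by apply: fmax => //; rewrite l0.
have pt0 : 0 <= pt s by exact: late_penalty_dt_ge0.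
move: k0; rewrite le_eqVlt => /orP[/eqP k0|kp].
- have [h1 h2] := sub2 (esym k0); rewrite -k0 in Fz.
  have [Fl|[j' [a a0 Fl]]] := strict0 i s stau' Fz.
    by move: h1 pt0 Fl; rewrite /ft; lra_goal.
  have := h2 j' a a0; rewrite /ft (gFt i j' s slT).
  by move: pt0 Fl; lra_goal.
- have [a Fl] := strict i s k stau' kp Fz.
  by have := sub1 kp a; move: pt0 Fl; rewrite /ft; lra_goal.
Qed.

End SubsolutionComparison.

(** * Paraboloids around a run *)

Section Tube.
Context {R : realType} {N : nat}.
Implicit Types (i j : 'I_N) (s y t x a c ell K T S sig C : R).

(* A paraboloid around the line y = x + a (s - t), growing at the rate ell
   along this line. *)
Definition tube c ell K t x a s y : R :=
  c + ell * (s - t) + K * (1 + (s - t)) * ((y - x - a * (s - t)) * (y - x - a * (s - t))).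

(** The term with factor [K] alone comes from the growing coefficient [1 + (s - t)] of the
    paraboloid. It is what remains of the paraboloid in the derivative along the speed [a], and it
    pays for the variation of [L] away from the line. *)
Definition tube_dt ell K t x a s y : R :=
  ell + K * ((y - x - a * (s - t)) * (y - x - a * (s - t)))
  - 2 * a * K * (1 + (s - t)) * (y - x - a * (s - t)).

Definition tube_dx K t x a s y : R := 2 * K * (1 + (s - t)) * (y - x - a * (s - t)).

Lemma tube_derive_t c ell K t x a s y :
  is_derive s (1 : R) ((tube c ell K t x a)^~ y) (tube_dt ell K t x a s y).
Proof.
have d0 : is_derive s (1 : R) (fun s : R => s - t) 1.
  by apply: is_derive_eq; rewrite subr0.
have d1 : is_derive s (1 : R) (fun s : R => y - x - a * (s - t)) (- a).
  by apply: is_derive_eq; rewrite /GRing.scale /=; ring.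
rewrite /tube; apply: is_derive_eq; rewrite /tube_dt /GRing.scale /=; ring.
Qed.

Lemma tube_derive_x c ell K t x a s y :
  is_derive y (1 : R) (tube c ell K t x a s) (tube_dx K t x a s y).
Proof.
have d1 : is_derive y (1 : R) (fun y : R => y - x - a * (s - t)) 1.
  by apply: is_derive_eq; rewrite ?subr0.
rewrite /tube; apply: is_derive_eq; rewrite /tube_dx /GRing.scale /=; ring.
Qed.

Lemma tube_lines_continuous t x a (f : R * R -> R) : continuous f ->
  continuous (fun q : R * R => q.1 - t) /\
  continuous (fun q : R * R => f q - x - a * (q.1 - t)).
Proof.
move=> cf; have c0 : continuous (fun q : R * R => q.1 - t).
  by move=> q; apply: cvgB; [exact: cvg_fst|exact: cvg_cst].
split=> // q; apply: cvgB; first by apply: cvgB; [exact: cf|exact: cvg_cst].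
by apply: cvgM; [exact: cvg_cst|exact: c0].
Qed.

Lemma tube_continuous c ell K t x a (f : R * R -> R) : continuous f ->
  continuous (fun q : R * R => tube c ell K t x a q.1 (f q)).
Proof.
move=> /(tube_lines_continuous t x a)[c0 c1] q; rewrite /tube.
apply: cvgD; first by apply: cvgD; [exact: cvg_cst|apply: cvgM; [exact: cvg_cst|exact: c0]].
apply: cvgM; last by apply: cvgM; exact: c1.
apply: cvgM; first exact: cvg_cst.
by apply: cvgD; [exact: cvg_cst|exact: c0].
Qed.

Lemma tube_dt_continuous ell K t x a (f : R * R -> R) : continuous f ->
  continuous (fun q : R * R => tube_dt ell K t x a q.1 (f q)).
Proof.
move=> /(tube_lines_continuous t x a)[c0 c1] q; rewrite /tube_dt.
apply: cvgB.
  apply: cvgD; first exact: cvg_cst.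
  by apply: cvgM; [exact: cvg_cst|apply: cvgM; exact: c1].
apply: cvgM; last exact: c1.
apply: cvgM; first exact: cvg_cst.
by apply: cvgD; [exact: cvg_cst|exact: c0].
Qed.

Lemma tube_dx_continuous K t x a :
  continuous (fun q : R * R => tube_dx K t x a q.1 q.2).
Proof.
have csnd : continuous (@snd R R) by move=> q; exact: cvg_snd.
have [c0 c1] := tube_lines_continuous t x a csnd; move=> q; rewrite /tube_dx.
apply: cvgM; last exact: c1.
apply: cvgM; first exact: cvg_cst.
by apply: cvgD; [exact: cvg_cst|exact: c0].
Qed.

(* The branches in P carry the tube; the others are steep, so that touching
   there from above is excluded. *)
Section JunctionTube.
Context (P : pred 'I_N) (c ell K K1 t x a : R).

Definition junction_tube j s y : R :=
  if P j then tube c ell K t x a s y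
  else tube c ell K t x a s 0 + K1 * (1 + (s - t)) * y.

Definition junction_tube_dt j s y : R :=
  if P j then tube_dt ell K t x a s y else tube_dt ell K t x a s 0 + K1 * y.

Definition junction_tube_dx j s y : R :=
  if P j then tube_dx K t x a s y else K1 * (1 + (s - t)).

Lemma junction_tube_vertex j s : junction_tube j s 0 = tube c ell K t x a s 0.
Proof. by rewrite /junction_tube; case: ifP => // _; rewrite mulr0 addr0. Qed.

Lemma junction_tube_dt_vertex j s : junction_tube_dt j s 0 = tube_dt ell K t x a s 0.
Proof. by rewrite /junction_tube_dt; case: ifP => // _; rewrite mulr0 addr0. Qed.

Lemma junction_tube_test T :
  coordinate_test T junction_tube junction_tube_dt junction_tube_dx.
Proof.
have csnd : continuous (@snd R R) by move=> q; exact: cvg_snd.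
have ccst : continuous (fun _ : R * R => (0 : R)) by move=> q; exact: cvg_cst.
have [c0 _] := tube_lines_continuous t 0 0 ccst.
have ct : continuous (fun q : R * R => 1 + (q.1 - t)).
  by move=> q; apply: cvgD; [exact: cvg_cst|exact: c0].
split=> [i s y _|i s y _|i|i|i|i j s _|i j s _].
- rewrite /junction_tube /junction_tube_dt; case: ifP => _; first exact: tube_derive_t.
  have d1 := tube_derive_t c ell K t x a s 0.
  have d2 : is_derive s (1 : R) (fun s => K1 * (1 + (s - t)) * y) (K1 * y).
    by apply: is_derive_eq; rewrite /GRing.scale /=; ring.
  exact: is_deriveD d1 d2.
- rewrite /junction_tube /junction_tube_dx; case: ifP => _; first exact: tube_derive_x.
  by apply: is_derive_eq; rewrite /GRing.scale /=; ring.
- rewrite /junction_tube; case: (P i) => /=; first exact: (tube_continuous csnd).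
  move=> q; apply: cvgD; first exact: (tube_continuous ccst).
  apply: cvgM; last exact: cvg_snd.
  by apply: (@cvgM _ _ (nbhs q)); [exact: cvg_cst|exact: ct].
- rewrite /junction_tube_dt; case: (P i) => /=; first exact: (tube_dt_continuous csnd).
  move=> q; apply: cvgD; first exact: (tube_dt_continuous ccst).
  by apply: cvgM; [exact: cvg_cst|exact: cvg_snd].
- rewrite /junction_tube_dx; case: (P i) => /=; first exact: tube_dx_continuous.
  by move=> q; apply: cvgM; [exact: cvg_cst|exact: ct].
- by rewrite !junction_tube_vertex.
- by rewrite !junction_tube_dt_vertex.
Qed.

End JunctionTube.

Lemma tube_ge c ell K t x a s y S : 0 <= K -> t <= s <= t + S ->
  c - `|ell| * S <= tube c ell K t x a s y.
Proof.
have marker : True by [].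
move=> K0 /andP[ts sS]; rewrite /tube.
have s0 : 0 <= s - t by rewrite subr_ge0.
have h1 : 0 <= K * (1 + (s - t)) * ((y - x - a * (s - t)) * (y - x - a * (s - t))).
  by rewrite -expr2 mulr_ge0 ?sqr_ge0 // mulr_ge0 // addr_ge0.
have h2 : - (`|ell| * S) <= ell * (s - t).
  apply: (@le_trans _ _ (- (`|ell| * (s - t)))).
    by rewrite lerN2 ler_wpM2l // lerBlDl.
  by rewrite -mulNr ler_wpM2r // lerNl -normrN ler_norm.
by move: h1 h2; lra_goal.
Qed.

(* Young's inequality absorbs the variation of L between the line and y. *)
Lemma tube_speed_bound (L : 'I_N -> R -> R -> R) C i ell K t x a s y S sig :
  0 <= C -> lipschitz_position L C -> 0 < sig -> C ^+ 2 / (4 * sig) <= K ->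
  L i x a + C * `|a| * S + 2 * sig <= ell ->
  t <= s <= t + S -> 0 <= x -> 0 <= y ->
  L i y a + sig <= ell + K * ((y - x - a * (s - t)) * (y - x - a * (s - t))).
Proof.
have marker : True by [].
move=> C0 L_lip sig0 KC ellL /andP[ts sS] x0 y0.
set d := y - x - a * (s - t).
have yx : `|y - x| <= `|a| * S + `|d|.
  have -> : y - x = a * (s - t) + d by rewrite /d; ring.
  apply: le_trans (ler_normD _ _) _; rewrite lerD2r normrM ler_wpM2l //.
  by rewrite ger0_norm ?subr_ge0 // lerBlDl.
have h1 := L_lip i y x a y0 x0.
have {}h1 : L i y a <= L i x a + C * `|y - x| by move: h1; rewrite ler_norml => /andP[_]; lra_goal.
have h2 : C * `|y - x| <= C * (`|a| * S + `|d|) by rewrite ler_wpM2l.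
have s4 : 0 < 4 * sig by rewrite mulr_gt0.
have h3 : C * `|d| <= sig + K * (d * d).
  have -> : d * d = `|d| ^+ 2 by rewrite real_normK ?num_real // expr2.
  apply: (@le_trans _ _ (sig + C ^+ 2 / (4 * sig) * `|d| ^+ 2)); last first.
    by rewrite lerD2l ler_wpM2r // sqr_ge0.
  rewrite -subr_ge0.
  have -> : sig + C ^+ 2 / (4 * sig) * `|d| ^+ 2 - C * `|d|
      = (C * `|d| - 2 * sig) ^+ 2 / (4 * sig) by field; rewrite gt_eqF.
  by rewrite divr_ge0 ?sqr_ge0 // ltW.
by move: h1 h2 h3 ellL; lra_goal.
Qed.

End Tube.

Section SubsolutionBound.
Context {R : realType} {V : normedModType R} {N : nat} (e : 'I_N -> V).
Context (L : 'I_N -> R -> R -> R) (L0 C T : R) (u0 : V -> R).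
Hypothesis e_unit : unit_directions e.
Hypotheses (C0 : 0 <= C) (L_lip : lipschitz_position L C).
Hypotheses (L_conv : convex_lipschitz_lagrangian L).
Hypotheses (L_super : superlinear_lagrangian L).
Context (v : R -> V -> R) (B : R).
Hypothesis vB : forall (t : R) (y : V), 0 <= t < T -> junction e y -> `|v t y| <= B * (1 + `|y|).
Hypothesis vsub : subsolution e L L0 T u0 v.
Implicit Types (i j : 'I_N) (t s x y a h rho eps : R).

Let z := envelope e T v.

(** Beyond the distance [rho] a paraboloid of this curvature exceeds the given linear growth; the
    constants [K] of the tubes have summands of this shape. *)
Lemma quadratic_dominates (B1 M rho d : R) : 0 <= B1 -> 0 <= M -> 0 < rho -> rho <= d ->
  B1 * d + M <= (M / rho ^+ 2 + B1 / rho) * (d * d).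
Proof.
have marker : True by [].
move=> B0 M0 rho0 rd; have d0 : 0 < d by exact: lt_le_trans rd.
have h1 : M <= M / rho ^+ 2 * (d * d).
  rewrite -mulrA ler_peMr // mulrC ler_pdivlMr ?exprn_gt0 // mul1r -expr2.
  by rewrite ler_sqr ?nnegrE // ltW.
have h2 : B1 * d <= B1 / rho * (d * d).
  rewrite -mulrA ler_wpM2l // mulrC -mulrA ler_peMr ?(ltW d0) //.
  by rewrite ler_pdivlMr // mul1r.
by move: h1 h2; rewrite mulrDl; lra_goal.
Qed.

(* With a <= 0 the line runs into the vertex, where the speed a is allowed;
   with a > 0 the tube stays away from the vertex. *)
Lemma envelope_move_eps i t x a h eps : 0 <= t -> 0 < h -> t + h < T -> 0 <= x ->
  0 <= x + a * h -> a <= 0 \/ 0 < x -> 0 < eps ->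
  z i (t + h) (x + a * h) <= z i t x + move_cost L C i x a h + eps.
Proof.
have marker : True by [].
move=> t0 h0 thT x0 xa0 ax eps0.
have tT : 0 <= t < T by rewrite t0 (lt_trans _ thT) // ltrDl.
have T0 : 0 < T by case/andP: tT; exact: le_lt_trans.
have B0 : 0 <= B := growth_ge0 e_unit vB i T0.
have [KU [KU0 _] HKU] := lagrangian_upper L0 L_conv L_lip.
(* One [sig] is lost at the start and [2 * sig] per unit of time, in all
   [sig * (1 + 2 * h) = eps / 2]. *)
pose sig : R := eps / (2 * (1 + 2 * h)).
have h2 : 0 < 1 + 2 * h by rewrite addr_gt0 // mulr_gt0.
have sig0 : 0 < sig by rewrite divr_gt0 // mulr_gt0.
have Cah : 0 <= C * `|a| * h by rewrite !mulr_ge0 // ltW.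
have Cah1 : 0 < 2 * (C * `|a| * h + 1) by rewrite mulr_gt0 // ltr_wpDl.
(* The comparison holds on a half-open time interval, which must therefore extend beyond [t + h].
   The longer duration raises the cost by [C * |a| * h * del], the other half of [eps]. *)
pose del : R := Num.min (T - (t + h)) (eps / (2 * (C * `|a| * h + 1))).
have del0 : 0 < del by rewrite lt_min subr_gt0 thT divr_gt0.
pose S : R := h + del.
have S0 : 0 < S by rewrite addr_gt0.
pose ell : R := L i x a + C * `|a| * S + 2 * sig.
pose c : R := z i t x + sig.
have [rho rho0 near_c] := envelope_usc e_unit vB i tT x0 sig0.
pose M0 : R := `|c| + `|ell| * S.
have M00 : 0 <= M0 by rewrite addr_ge0 // mulr_ge0 // ltW.
have cM0 : - M0 <= c - `|ell| * S.
  by rewrite /M0 opprD lerD2r lerNl -normrN ler_norm.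
have cM0' : - M0 <= c.
  by rewrite (le_trans cM0) // lerBlDr lerDl mulr_ge0 // ltW.
(* The summands serve, in this order, Young's inequality, the initial comparison away from [x], the
   height of the tube at the vertex if [0 < x], and coercivity at infinity. For [x = 0] the third
   one is 0, as the inverse of 0 is 0. *)
pose K : R := C ^+ 2 / (4 * sig) + ((B * (1 + x) + M0) / rho ^+ 2 + B / rho)
  + (B + M0) / x ^+ 2 + (B + 1).
have p1 : 0 <= C ^+ 2 / (4 * sig) by rewrite divr_ge0 ?sqr_ge0 // mulr_ge0 // ltW.
have Bx0 : 0 <= B * (1 + x) + M0 by rewrite addr_ge0 // mulr_ge0 // addr_ge0.
have p2 : 0 <= (B * (1 + x) + M0) / rho ^+ 2 by rewrite divr_ge0 // sqr_ge0.
have p3 : 0 <= B / rho by rewrite divr_ge0 // ltW.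
have p4 : 0 <= (B + M0) / x ^+ 2 by rewrite divr_ge0 ?sqr_ge0 // addr_ge0.
have K0 : 0 <= K by move: p1 p2 p3 p4 B0; rewrite /K; lra_goal.
pose D0 : R := x + `|a| * S.
have aS0 : 0 <= `|a| * S by rewrite mulr_ge0 // ltW.
have D00 : 0 <= D0 by rewrite addr_ge0.
pose Gg : R := `|ell| + 2 * `|a| * K * (1 + S) * D0.
have Gg0 : 0 <= Gg by rewrite addr_ge0 // !mulr_ge0 // addr_ge0 // ltW.
(* [Gg] bounds the decrease of the tube at the vertex and [KU + C * y] the cost of unit speed, which
   makes the steep branches strict; the remaining summands dominate the growth of [z] at the initial
   time and at infinity. *)
pose K1 : R := Gg + KU + 1 + C + B + (B + M0) / rho.
have p5 : 0 <= (B + M0) / rho by apply: divr_ge0; [exact: addr_ge0|exact: ltW].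
have K10 : 0 <= K1 by move: Gg0 KU0 C0 B0 p5; rewrite /K1; lra_goal.
have BK1 : B <= K1 by move: p5 C0 KU0 Gg0; rewrite /K1; lra_goal.
pose F := junction_tube (pred1 i) c ell K K1 t x a.
pose Ft := junction_tube_dt (pred1 i) ell K K1 t x a.
pose Fx := junction_tube_dx (pred1 i) K K1 t x a.
have Fi s y : F i s y = tube c ell K t x a s y by rewrite /F /junction_tube /= eqxx.
have Fj j s y : j != i -> F j s y = tube c ell K t x a s 0 + K1 * (1 + (s - t)) * y.
  by move=> ji; rewrite /F /junction_tube /= (negbTE ji).
have zB j s y : 0 <= s < T -> 0 <= y -> z j s y <= B * (1 + y).
  exact: envelope_growth.
have tS_T : t + S <= T.
  have : del <= T - (t + h) by rewrite ge_min lexx.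
  by rewrite /S; lra_goal.
have sS s : t <= s < t + S -> t <= s <= t + S by move=> /andP[-> /ltW].
have sT s : t <= s < t + S -> 0 <= s < T.
  by move=> /andP[ts sS']; rewrite (le_trans t0 ts) (lt_le_trans sS').
have tube_lo s y : t <= s < t + S -> - M0 <= tube c ell K t x a s y.
  by move=> si; apply: le_trans cM0 _; apply: tube_ge => //; exact: sS.
have K1y s y : t <= s -> 0 <= y -> B * y <= K1 * (1 + (s - t)) * y.
  move=> ts y0; rewrite ler_wpM2r // (le_trans BK1) // ler_peMr // lerDl subr_ge0 //.
have escape s : t <= s < t + S -> 0 < x -> 0 < a -> B <= tube c ell K t x a s 0.
  move=> si xp ap; have /andP[ts _] := si.
  have st : 0 <= s - t by rewrite subr_ge0.
  have h3 : (B + M0) <= K * (x * x).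
    apply: (@le_trans _ _ ((B + M0) / x ^+ 2 * (x * x))).
      by rewrite -expr2 divfK // gt_eqF // exprn_gt0.
    by rewrite ler_wpM2r ?mulr_ge0 //; move: p1 p2 p3 B0; rewrite /K; lra_goal.
  have h4 : x * x <= (0 - x - a * (s - t)) * (0 - x - a * (s - t)).
    have -> : (0 - x - a * (s - t)) * (0 - x - a * (s - t)) = (x + a * (s - t)) * (x + a * (s - t)).
      by ring.
    by apply: ler_pM => //; rewrite lerDl mulr_ge0 // ltW.
  have h5 : K * (x * x) <= K * (1 + (s - t)) * ((0 - x - a * (s - t)) * (0 - x - a * (s - t))).
    by apply: ler_pM => //; rewrite ?mulr_ge0 // ler_peMr // lerDl.
  have h6 : - (`|ell| * S) <= ell * (s - t).
    apply: (@le_trans _ _ (- (`|ell| * (s - t)))).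
      by rewrite lerN2 ler_wpM2l // lerBlDl; case/andP: si => _ /ltW.
    by rewrite -mulNr ler_wpM2r // lerNl -normrN ler_norm.
  have h7 : - `|c| <= c by rewrite lerNl -normrN ler_norm.
  by move: h3 h5 h6 h7; rewrite /tube /M0; lra_goal.
have far_d d : rho <= `|d| -> B * (1 + x) + B * `|d| + M0 <= K * (d * d).
  move=> rd; have := quadratic_dominates B0 Bx0 rho0 rd.
  have -> : `|d| * `|d| = d * d by rewrite -normrM ger0_norm // -expr2 sqr_ge0.
  have dd : 0 <= d * d by rewrite -expr2 sqr_ge0.
  have : ((B * (1 + x) + M0) / rho ^+ 2 + B / rho) * (d * d) <= K * (d * d).
    by rewrite ler_wpM2r //; move: p1 p4 B0; rewrite /K; lra_goal.
  by lra_goal.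
have init j y : 0 <= y -> z j t y <= F j t y.
  move=> y0; have [ji|ji] := eqVneq j i.
    rewrite {}ji Fi /tube !subrr mulr0 !addr0 mulr1 mulr0 subr0.
    have [yx|yx] := ltP `|y - x| rho.
      apply: (@le_trans _ _ c).
        by apply: near_c => //; [rewrite subrr normr0|left; rewrite distrC].
      by rewrite lerDl mulr_ge0 // -expr2 sqr_ge0.
    apply: le_trans (zB i t y tT y0) _.
    have := far_d _ yx; have : y <= x + `|y - x| by rewrite -lerBlDl ler_norm.
    move=> yle; have : B * y <= B * (x + `|y - x|) by rewrite ler_wpM2l.
    by move: cM0'; lra_goal.
  rewrite Fj // /tube !subrr mulr0 !addr0 mulr1 mulr0 subr0 mulr1.
  have [xy|xy] := ltP (x + y) rho.
    apply: (@le_trans _ _ c).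
      by apply: near_c => //; [rewrite subrr normr0|right].
    rewrite -addrA lerDl; apply: addr_ge0; last exact: mulr_ge0.
    by rewrite mulr_ge0 // -expr2 sqr_ge0.
  apply: le_trans (zB j t y tT y0) _.
  have [xp|xp] := ltP 0 x.
    have h3 : B + M0 <= K * ((0 - x) * (0 - x)).
      have -> : (0 - x) * (0 - x) = x * x by ring.
      apply: (@le_trans _ _ ((B + M0) / x ^+ 2 * (x * x))).
        by rewrite -expr2 divfK // gt_eqF // exprn_gt0.
      by rewrite ler_wpM2r ?mulr_ge0 //; move: p1 p2 p3 B0; rewrite /K; lra_goal.
    have h4 : B * y <= K1 * y by rewrite ler_wpM2r.
    by move: h3 h4 cM0'; lra_goal.
  have xE : x = 0 by apply/eqP; rewrite eq_le xp.
  rewrite xE add0r in xy.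
  have h3 : (B + M0) + B * y <= K1 * y.
    have : B + M0 <= (B + M0) / rho * y.
      by rewrite mulrAC ler_pdivlMr // ler_wpM2l // addr_ge0.
    have : (B + M0) / rho * y + B * y <= K1 * y.
      by rewrite -mulrDl ler_wpM2r //; move: Gg0 KU0 C0; rewrite /K1; lra_goal.
    by lra_goal.
  rewrite xE subr0 !mulr0 addr0; move: h3 cM0'; lra_goal.
(* From [r] on, the deviation [d] from the line is at least [m], and the quadratic term, of
   coefficient at least [B + 1], beats the linear growth of [z]. *)
pose m : R := 2 + D0 + M0.
pose r : R := D0 + m + B + M0.
have m2 : 2 <= m by move: D00 M00; rewrite /m; lra_goal.
have r0 : 0 <= r by move: D00 M00 B0; rewrite /r /m; lra_goal.
have coer j s y : t <= s < t + S -> r <= y -> z j s y <= F j s y.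
  move=> si ry; have /andP[ts ss] := si.
  have y0 : 0 <= y := le_trans r0 ry.
  apply: le_trans (zB j s y (sT s si) y0) _.
  have [ji|ji] := eqVneq j i; last first.
    rewrite Fj //; have := tube_lo s 0 si.
    have : (K1 - 1) * y + y <= K1 * (1 + (s - t)) * y.
      have -> : (K1 - 1) * y + y = K1 * y by ring.
      by rewrite ler_wpM2r // ler_peMr // lerDl subr_ge0.
    have : B * y <= (K1 - 1) * y.
      by rewrite ler_wpM2r //; move: p5 C0 KU0 Gg0; rewrite /K1; lra_goal.
    by move: ry D00 m2; rewrite /r; lra_goal.
  rewrite {}ji Fi.
  pose d : R := y - x - a * (s - t).
  have ad : a * (s - t) <= `|a| * S.
    apply: (@le_trans _ _ (`|a| * (s - t))).
      by rewrite ler_wpM2r ?subr_ge0 // ler_norm.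
    by rewrite ler_wpM2l // lerBlDl ltW.
  have dm : m <= d by move: ry ad B0 M00; rewrite /r /D0 /d; lra_goal.
  have yd : y <= D0 + d by move: ad; rewrite /D0 /d; lra_goal.
  have h3 : K * (d * d) <= K * (1 + (s - t)) * (d * d).
    by rewrite ler_wpM2r -?expr2 ?sqr_ge0 // ler_peMr // lerDl subr_ge0.
  have dm2 : 1 <= d by move: dm m2; lra_goal.
  have d0 : 0 <= d by move: dm2; lra_goal.
  have h4 : (B + 1) * (d * m) <= K * (d * d).
    have m0 : 0 <= m by move: m2; lra_goal.
    apply: ler_pM; [exact: addr_ge0|exact: mulr_ge0| |exact: ler_wpM2l].
    by move: p1 p2 p3 p4; rewrite /K; lra_goal.
  have h5 : B * (1 + (D0 + d)) + M0 <= (B + 1) * (d * m).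
    have -> : (B + 1) * (d * m) = B * (d * (2 + D0 + M0)) + d * (2 + D0 + M0).
      by rewrite /m; ring.
    have e1 : 1 + (D0 + d) <= d * (2 + D0 + M0).
      have : D0 <= d * D0 by rewrite ler_peMl.
      have : 0 <= d * M0 by rewrite mulr_ge0.
      by move: dm2; lra_goal.
    have e2 : M0 <= d * (2 + D0 + M0).
      have : M0 <= d * M0 by rewrite ler_peMl.
      have : 0 <= d * D0 by rewrite mulr_ge0.
      by move: dm2; lra_goal.
    by have := ler_wpM2l B0 e1; move: e2; lra_goal.
  have h6 : - (`|ell| * S) <= ell * (s - t).
    apply: (@le_trans _ _ (- (`|ell| * (s - t)))).
      by rewrite lerN2 ler_wpM2l // lerBlDl ltW.
    by rewrite -mulNr ler_wpM2r ?subr_ge0 // lerNl -normrN ler_norm.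
  have h7 : - `|c| <= c by rewrite lerNl -normrN ler_norm.
  have h8 : B * y <= B * (D0 + d) by rewrite ler_wpM2l.
  by move: h3 h4 h5 h6 h7 h8; rewrite /tube -/d /M0; lra_goal.
have Flo j s y : t <= s < t + S -> 0 <= y -> - M0 <= F j s y.
  move=> si y0; have [->|ji] := eqVneq j i; first by rewrite Fi; exact: tube_lo.
  rewrite Fj //; apply: le_trans (tube_lo s 0 si) _; rewrite lerDl mulr_ge0 // mulr_ge0 //.
  by case/andP: si => ts _; rewrite addr_ge0 // subr_ge0.
have speed s y : t <= s < t + S -> 0 <= y ->
    L i y a < tube_dt ell K t x a s y + a * tube_dx K t x a s y.
  move=> si y0; have KC : C ^+ 2 / (4 * sig) <= K by move: p2 p3 p4 B0; rewrite /K; lra_goal.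
  have := tube_speed_bound C0 L_lip sig0 KC (lexx ell) (sS s si) x0 y0.
  by move: sig0; rewrite /tube_dt /tube_dx; lra_goal.
have steep s : t <= s < t + S -> - Gg <= tube_dt ell K t x a s 0.
  move=> si; have /andP[ts ss] := si; rewrite /tube_dt /Gg.
  have st0 : 0 <= s - t by rewrite subr_ge0.
  have b1 : 0 <= K * ((0 - x - a * (s - t)) * (0 - x - a * (s - t))).
    by rewrite mulr_ge0 // -expr2 sqr_ge0.
  have b2 : `|2 * a * K * (1 + (s - t)) * (0 - x - a * (s - t))| <= 2 * `|a| * K * (1 + S) * D0.
    have n2 : 0 <= 1 + (s - t) by rewrite addr_ge0.
    have n3 : 0 <= 2 :> R by [].
    rewrite !normrM (ger0_norm K0) (ger0_norm n3) (ger0_norm n2).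
    have n1 : 0 <= 2 * `|a| * K by rewrite !mulr_ge0.
    apply: ler_pM; [by rewrite mulr_ge0 // addr_ge0|exact: normr_ge0| |].
      by rewrite ler_wpM2l // lerD2l lerBlDl ltW.
    rewrite sub0r; apply: le_trans (ler_normB _ _) _; rewrite normrN (ger0_norm x0) lerD2l.
    by rewrite normrM (ger0_norm st0) ler_wpM2l // lerBlDl ltW.
  have b3 : - `|ell| <= ell by rewrite lerNl -normrN ler_norm.
  by move: b1 b3 b2; rewrite ler_norml => + + /andP[_]; lra_goal.
have cmp := @subsolution_comparison _ V N e L L0 C T u0 e_unit C0 L_lip L_conv L_super v B vB vsub
  F Ft Fx t (t + S) r (- M0) (junction_tube_test _ _ _ _ _ _ _ _ _) t0 tS_T r0 init coer Flo.
have thS : t <= t + h < t + S by rewrite lerDl (ltW h0) ltrD2l ltrDl.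
have {cmp} := cmp _ _ i (t + h) (x + a * h) thS xa0.
have -> : F i (t + h) (x + a * h) = c + ell * h by rewrite Fi /tube; ring.
move=> H; apply: le_trans (H _ _) _.
- move=> j s y /andP[/ltW ts ss] y0 Fz; have si : t <= s < t + S by rewrite ts.
  have [ji|ji] := eqVneq j i.
    exists a; rewrite {}ji /Ft /Fx /junction_tube_dt /junction_tube_dx /= eqxx.
    by apply: speed => //; exact: ltW.
  (* On a steep branch the outward unit speed gives the strict inequality: the slope outweighs both
     its cost and the decrease of the tube at the vertex. *)
  exists 1; rewrite /Ft /Fx /junction_tube_dt /junction_tube_dx /= (negbTE ji).
  have := HKU j y 1 (ltW y0); rewrite normr1 => /(_ (lexx _)).
  have := steep s si.
  have : C * y <= K1 * y.
    by rewrite ler_wpM2r ?(ltW y0) //; move: p5 B0 KU0 Gg0; rewrite /K1; lra_goal.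
  have : K1 <= K1 * (1 + (s - t)) by rewrite ler_peMr // lerDl subr_ge0.
  have : Gg + KU + 1 <= K1 by move: p5 B0 C0; rewrite /K1; lra_goal.
  by lra_goal.
- move=> j s /andP[/ltW ts ss] Fz; have si : t <= s < t + S by rewrite ts.
  have [a0|a0] := leP a 0.
    right; exists i, a => //; rewrite /Ft /Fx /junction_tube_dt /junction_tube_dx /= eqxx.
    exact: speed.
  have xp : 0 < x by case: ax; rewrite // leNgt a0.
  have := escape s si xp a0; have := zB j s 0 (sT s si) (lexx 0).
  rewrite /F junction_tube_vertex addr0 mulr1 in Fz * => zB1 B1.
  by have := le_lt_trans B1 (lt_le_trans Fz zB1); rewrite ltxx.
rewrite /c /ell /move_cost /S.
have e1 : sig * (1 + 2 * h) = eps / 2 by rewrite /sig; field; rewrite gt_eqF.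
have e2 : (C * `|a| * h) * del <= eps / 2.
  have : del <= eps / (2 * (C * `|a| * h + 1)) by rewrite ge_min lexx orbT.
  rewrite ler_pdivlMr //; have := ltW del0; lra_goal.
by move: e1 e2; lra_goal.
Qed.

End SubsolutionBound.

Section SubsolutionLeValue.
Context {R : realType} {V : normedModType R} {N : nat} (e : 'I_N -> V).
Context (L : 'I_N -> R -> R -> R) (L0 C T : R) (u0 : V -> R).
Hypothesis e_unit : unit_directions e.
Hypotheses (C0 : 0 <= C) (L_lip : lipschitz_position L C).
Hypotheses (L_conv : convex_lipschitz_lagrangian L).
Hypotheses (L_super : superlinear_lagrangian L).
Implicit Types (i j : 'I_N) (t s x y a h rho eps : R).

(** A run leaving the vertex is replaced by one from a nearby point [x] with the same end, at the
    speed [a - x / h]. The change of cost is small because [L] is Lipschitz in the position and, by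
    convexity, locally Lipschitz in the velocity. *)
Lemma move_cost_vertex_limit i a h eps : 0 < a -> 0 < h -> 0 < eps ->
  exists2 del : R, 0 < del & forall x, 0 < x < del -> exists2 a' : R,
    x + a' * h = a * h & move_cost L C i x a' h <= move_cost L C i 0 a h + eps.
Proof.
have marker : True by [].
move=> a0 h0 eps0.
pose D : R := `|L i 0 (a + 1) - L i 0 a| + `|L i 0 (a - 1) - L i 0 a|.
have D0 : 0 <= D by rewrite addr_ge0.
have hCD : 0 < h * C + D + 1.
  by have := mulr_ge0 (ltW h0) C0; move: D0; lra_goal.
exists (Num.min (Num.min h (a * h)) (eps / (h * C + D + 1))).
  by rewrite !lt_min h0 mulr_gt0 // divr_gt0.
move=> x; rewrite !lt_min => /andP[x0 /andP[/andP[xh xah] xe]].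
have hn0 : h != 0 by rewrite gt_eqF.
pose a' : R := a - x / h.
have a'0 : 0 <= a' by rewrite subr_ge0 ler_pdivrMr // ltW.
have a'a : a' <= a by rewrite gerBl divr_ge0 // ltW.
exists a'; first by rewrite /a'; field.
have aa : `|a' - a| = x / h.
  by rewrite /a' addrAC subrr sub0r normrN ger0_norm // divr_ge0 // ltW.
have a1 : `|a' - a| <= 1 by rewrite aa ler_pdivrMr // mul1r ltW.
have := convex_local_lipschitz (lagrangian_convex L_conv i (lexx 0)) a1.
rewrite aa -/D => l1.
have := L_lip i a' (ltW x0) (lexx 0); rewrite subr0 (gtr0_norm x0) => l2.
have l3 : L i x a' <= L i 0 a + (C * x + x / h * D).
  by move: l1 l2; rewrite !ler_norml => /andP[_ b1] /andP[_ b2]; move: b1 b2; lra_goal.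
have := ler_wpM2l (ltW h0) l3.
have -> : h * (L i 0 a + (C * x + x / h * D)) = h * L i 0 a + x * (h * C + D) by field.
have xe' : x * (h * C + D) <= eps.
  rewrite ltr_pdivlMr // in xe; move: xe x0; lra_goal.
have l4 : C * `|a'| * h ^+ 2 <= C * `|a| * h ^+ 2.
  by rewrite ler_wpM2r ?sqr_ge0 // ler_wpM2l // !ger0_norm // ltW.
by move: xe' l4; rewrite /move_cost; lra_goal.
Qed.

Section Subsolution.
Context (v : R -> V -> R) (B : R).
Hypothesis vB : forall (t : R) (y : V), 0 <= t < T -> junction e y -> `|v t y| <= B * (1 + `|y|).
Hypothesis vsub : subsolution e L L0 T u0 v.

Let z := envelope e T v.

Lemma envelope_vertex i j t : z i t 0 = z j t 0.
Proof. by rewrite /z /envelope !scale0r. Qed.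

(** The comparison function is a tube with [K = 0] and all branches steep, that is, a cone. Its rate
    at the vertex is [L0 + sig], and off the vertex the outward unit speed makes it strict. *)
Lemma envelope_stay_eps i t h eps : 0 <= t -> 0 < h -> t + h < T -> 0 < eps ->
  z i (t + h) 0 <= z i t 0 + h * L0 + eps.
Proof.
have marker : True by [].
move=> t0 h0 thT eps0.
have tT : 0 <= t < T by rewrite t0 (lt_trans _ thT) // ltrDl.
have T0 : 0 < T by case/andP: tT; exact: le_lt_trans.
have B0 : 0 <= B := growth_ge0 e_unit vB i T0.
have [KU [KU0 _] HKU] := lagrangian_upper L0 L_conv L_lip.
pose sig : R := eps / (1 + h).
have h1 : 0 < 1 + h by rewrite addr_gt0.
have sig0 : 0 < sig by rewrite divr_gt0.
pose S : R := T - t.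
have S0 : 0 < S by rewrite subr_gt0; case/andP: tT.
pose ell : R := L0 + sig.
pose c : R := z i t 0 + sig.
have [rho rho0 near_c] := envelope_usc e_unit vB i tT (lexx 0) sig0.
pose M0 : R := `|c| + `|ell| * S.
have M00 : 0 <= M0 by rewrite addr_ge0 // mulr_ge0 // ltW.
have cM0 : - M0 <= c - `|ell| * S.
  by rewrite /M0 opprD lerD2r lerNl -normrN ler_norm.
have cM0' : - M0 <= c.
  by rewrite (le_trans cM0) // lerBlDr lerDl mulr_ge0 // ltW.
pose K1 : R := `|ell| + KU + 1 + C + B + (B + M0) / rho.
have ell0 : 0 <= `|ell| by [].
have p5 : 0 <= (B + M0) / rho by apply: divr_ge0; [exact: addr_ge0|exact: ltW].
have K10 : 0 <= K1 by move: ell0 KU0 C0 B0 p5; rewrite /K1; lra_goal.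
have BK1 : B <= K1 by move: p5 C0 KU0 ell0; rewrite /K1; lra_goal.
pose F := junction_tube (pred0 : pred 'I_N) c ell 0 K1 t 0 0.
pose Ft := junction_tube_dt (pred0 : pred 'I_N) ell 0 K1 t 0 0.
pose Fx := junction_tube_dx (pred0 : pred 'I_N) 0 K1 t 0 0.
have FE j s y : F j s y = c + ell * (s - t) + K1 * (1 + (s - t)) * y.
  by rewrite /F /junction_tube /tube /= mul0r mul0r addr0.
have FtE j s y : Ft j s y = ell + K1 * y.
  by rewrite /Ft /junction_tube_dt /tube_dt /=; ring.
have FxE j s y : Fx j s y = K1 * (1 + (s - t)) by [].
have tST : t + S = T by rewrite /S; ring.
have zB j s y : 0 <= s < T -> 0 <= y -> z j s y <= B * (1 + y).
  exact: envelope_growth.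
have sT s : t <= s < T -> 0 <= s < T by move=> /andP[ts ->]; rewrite (le_trans t0 ts).
have lo s : t <= s < T -> - M0 <= c + ell * (s - t).
  move=> /andP[ts sS]; apply: le_trans cM0 _; rewrite lerD2l.
  apply: (@le_trans _ _ (- (`|ell| * (s - t)))).
    by rewrite lerN2 ler_wpM2l // lerD2r ltW.
  by rewrite -mulNr ler_wpM2r ?subr_ge0 // lerNl -normrN ler_norm.
have K1y s y : t <= s -> 0 <= y -> K1 * y <= K1 * (1 + (s - t)) * y.
  by move=> ts y0; rewrite ler_wpM2r // ler_peMr // lerDl subr_ge0.
have init j y : 0 <= y -> z j t y <= F j t y.
  move=> y0; rewrite FE subrr mulr0 !addr0 mulr1.
  have [yr|ry] := ltP y rho.
    apply: (@le_trans _ _ c); last by rewrite lerDl mulr_ge0.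
    by apply: near_c => //; [rewrite subrr normr0|right; rewrite add0r].
  apply: le_trans (zB j t y tT y0) _.
  have h3 : B + M0 <= (B + M0) / rho * y.
    by rewrite mulrAC ler_pdivlMr // ler_wpM2l // addr_ge0.
  have h4 : (B + M0) / rho * y + B * y <= K1 * y.
    by rewrite -mulrDl ler_wpM2r //; move: ell0 KU0 C0; rewrite /K1; lra_goal.
  by move: h3 h4 cM0'; lra_goal.
pose r : R := B + M0.
have r0 : 0 <= r by rewrite addr_ge0.
have coer j s y : t <= s < T -> r <= y -> z j s y <= F j s y.
  move=> si ry; have /andP[ts _] := si; have y0 : 0 <= y := le_trans r0 ry.
  apply: le_trans (zB j s y (sT s si) y0) _; rewrite FE.
  have h3 : B * y <= (K1 - 1) * y.
    by rewrite ler_wpM2r //; move: p5 C0 KU0 ell0; rewrite /K1; lra_goal.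
  by move: h3 (lo s si) (K1y s y ts y0) ry; rewrite /r; lra_goal.
have Flo j s y : t <= s < T -> 0 <= y -> - M0 <= F j s y.
  move=> si y0; have /andP[ts _] := si.
  by have := mulr_ge0 K10 y0; move: (lo s si) (K1y s y ts y0); rewrite FE; lra_goal.
have cmp := @subsolution_comparison _ V N e L L0 C T u0 e_unit C0 L_lip L_conv L_super v B vB vsub
  F Ft Fx t T r (- M0) (junction_tube_test _ _ _ _ _ _ _ _ _) t0 (lexx T) r0 init coer Flo.
have thS : t <= t + h < T by rewrite lerDl (ltW h0).
have {cmp} := cmp _ _ i (t + h) 0 thS (lexx 0).
have -> : F i (t + h) 0 = c + ell * h by rewrite FE; ring.
move=> H; apply: le_trans (H _ _) _.
- move=> j s y /andP[/ltW ts ss] y0 Fz; have si : t <= s < T by rewrite ts.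
  exists 1; rewrite FtE FxE.
  have := HKU j y 1 (ltW y0); rewrite normr1 => /(_ (lexx _)).
  have : C * y <= K1 * y.
    by rewrite ler_wpM2r ?(ltW y0) //; move: p5 B0 KU0 ell0; rewrite /K1; lra_goal.
  have : K1 <= K1 * (1 + (s - t)) by rewrite ler_peMr // lerDl subr_ge0.
  have : `|ell| + KU + 1 <= K1 by move: p5 B0 C0; rewrite /K1; lra_goal.
  have : - `|ell| <= ell by rewrite lerNl -normrN ler_norm.
  by lra_goal.
- by move=> j s _ _; left; rewrite FtE mulr0 addr0 /ell ltrDl.
have e1 : sig * (1 + h) = eps by rewrite /sig; field; rewrite gt_eqF.
by move: e1; rewrite /c /ell; lra_goal.
Qed.

(** The errors [eps] disappear in the limit. For a run leaving the vertex, upper semicontinuity of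
    [z] at the vertex permits the start to be shifted to a nearby [x']. *)
Lemma envelope_suboptimal be : be < T -> suboptimal L L0 C 0 be z.
Proof.
move=> beT; split=> [i j t _|i t x a h t0 h0 tb x0 xa|i t h t0 h0 tb].
- exact: envelope_vertex.
- move: h0; rewrite le_eqVlt => /orP[/eqP <-|h0].
    by rewrite /move_cost mulr0 !addr0 mul0r expr0n mulr0 !addr0.
  have thT : t + h < T by apply: le_lt_trans beT.
  have tT : 0 <= t < T by rewrite t0 (lt_trans _ thT) // ltrDl.
  apply/ler_addgt0Pr => eps eps0.
  have [ax|/not_orP[a0 x0']] := pselect (a <= 0 \/ 0 < x).
    exact: (envelope_move_eps e_unit C0 L_lip L_conv L_super vB vsub).
  have ap : 0 < a by rewrite ltNge; exact/negP.
  have xE : x = 0 by apply/eqP; rewrite eq_le x0 andbT leNgt; exact/negP.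
  have eps3 : 0 < eps / 3 by rewrite divr_gt0.
  have [del del0 Hdel] := move_cost_vertex_limit i ap h0 eps3.
  have [rho rho0 usc] := envelope_usc e_unit vB i tT (lexx 0) eps3.
  pose x' : R := Num.min del rho / 2.
  have m0 : 0 < Num.min del rho by rewrite lt_min del0.
  have x'0 : 0 < x' by rewrite divr_gt0.
  have x'm : x' < Num.min del rho by rewrite /x'; lra.
  have x'd : 0 < x' < del by rewrite x'0 (lt_le_trans x'm) // ge_min lexx.
  have x'r : x' < rho by rewrite (lt_le_trans x'm) // ge_min lexx orbT.
  have [a' a'E cost] := Hdel x' x'd.
  have u : z i t x' <= z i t 0 + eps / 3.
    by apply: usc => //; [rewrite subrr normr0|exact: ltW|right; rewrite add0r].
  have xa' : 0 <= x' + a' * h by rewrite a'E mulr_ge0 // ltW.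
  have := envelope_move_eps e_unit C0 L_lip L_conv L_super vB vsub i
    t0 h0 thT (ltW x'0) xa' (or_intror x'0) eps3.
  rewrite xE add0r a'E -/z; lra.
- move: h0; rewrite le_eqVlt => /orP[/eqP <-|h0]; first by rewrite addr0 mul0r addr0.
  have thT : t + h < T by apply: le_lt_trans beT.
  by apply/ler_addgt0Pr => eps eps0; exact: envelope_stay_eps.
Qed.

Lemma subsolution_le_value Lam i t k :
  lipschitz_data Lam (fun i k => u0 (k *: e i)) -> 0 <= t < T -> 0 <= k ->
  z i t k <= value_function L L0 C (fun i k => u0 (k *: e i)) i t k.
Proof.
move=> gL /andP[t0 tT] k0; have T0 : 0 < T by exact: le_lt_trans tT.
apply: (value_max C0 L_lip L_conv L_super gL (envelope_suboptimal tT)); rewrite ?t0 ?lexx //.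
move=> j x x0; case: vsub => _ /(_ _ (junction_point e j x0)).
by rewrite (envelopeE e_unit vB) ?lexx ?T0 // lee_fin.
Qed.

End Subsolution.
End SubsolutionLeValue.

(** * The scheme *)

Section Scheme.
Context {R : realType} {V : normedModType R} {N : nat} (e : 'I_N -> V).
Context (L : 'I_N -> R -> R -> R) (L0 C : R).
Hypothesis e_unit : unit_directions e.
Context (dx dt : R).
Hypotheses (dx0 : 0 < dx) (dt0 : 0 < dt).
Implicit Types (i j : 'I_N) (m n : nat) (y k a b r s : R) (v : V -> R).

Lemma interp_point v i k : 0 <= k -> exists m, exists2 r : R, 0 <= r <= 1 &
  k = (m%:R + r) * dx /\
  interp dx v (k *: e i) = (1 - r) * v ((m%:R * dx) *: e i) + r * v ((m.+1%:R * dx) *: e i).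
Proof.
move=> k0; rewrite /interp (norm_point e_unit) //.
have kdx : 0 <= k / dx by rewrite divr_ge0 // ltW.
have /andP[t1 t2] := truncn_itv kdx.
exists (Num.truncn (k / dx)), (k / dx - (Num.truncn (k / dx))%:R).
  by rewrite subr_ge0 t1 /= lerBlDl natr1 ltW.
split; first by rewrite addrC subrK divfK // gt_eqF.
move: k0; rewrite le_eqVlt => /orP[/eqP k0|k0].
  by rewrite -k0 mul0r truncn0 subrr !mul0r !addr0 !scale0r.
have -> // : k^-1 *: (k *: e i) = e i.
by rewrite scalerA mulVf ?gt_eqF // scale1r.
Qed.

Lemma interp_le v i k (f : R -> R) (E : R) : 0 <= k ->
  (forall m, v ((m%:R * dx) *: e i) <= f (m%:R * dx)) ->
  (forall p r, 0 <= p -> 0 <= r <= 1 -> k = p + r * dx ->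
    (1 - r) * f p + r * f (p + dx) <= f k + E) ->
  interp dx v (k *: e i) <= f k + E.
Proof.
move=> k0 vf fE; have [m [r r01 [kE ->]]] := interp_point v i k0.
have /andP[r0 r1] := r01.
apply: le_trans (fE (m%:R * dx) r _ r01 _); last by rewrite kE mulrDl.
  apply: lerD; rewrite ler_wpM2l ?subr_ge0 //.
  by have := vf m.+1; rewrite -natr1 mulrDl mul1r.
by rewrite mulr_ge0 // ltW.
Qed.

Lemma interp_grid v i m : interp dx v ((m%:R * dx) *: e i) = v ((m%:R * dx) *: e i).
Proof.
have m0 : 0 <= m%:R * dx by rewrite mulr_ge0 // ltW.
rewrite /interp (norm_point e_unit) // mulfK ?gt_eqF // natrK subrr subr0 mul0r addr0 mul1r.
case: m m0 => [|m] m0; first by rewrite mul0r !scale0r.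
by rewrite scalerA divff ?scale1r // mulf_neq0 ?pnatr_eq0 // gt_eqF.
Qed.

Lemma interp_affine_le v i k (A B : R) : 0 <= k ->
  (forall m, v ((m%:R * dx) *: e i) <= A + B * (m%:R * dx)) ->
  interp dx v (k *: e i) <= A + B * k.
Proof.
move=> k0 vf; have := @interp_le v i k (fun y => A + B * y) 0 k0 vf.
by rewrite addr0; apply => p r _ _ ->; lra.
Qed.

Lemma interp_ge v i k (f : R -> R) (E : R) : 0 <= k ->
  (forall m, f (m%:R * dx) <= v ((m%:R * dx) *: e i)) ->
  (forall p r, 0 <= p -> 0 <= r <= 1 -> k = p + r * dx ->
    f k - E <= (1 - r) * f p + r * f (p + dx)) ->
  f k - E <= interp dx v (k *: e i).
Proof.
move=> k0 vf fE; have [m [r r01 [kE ->]]] := interp_point v i k0.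
have /andP[r0 r1] := r01.
apply: (le_trans (fE (m%:R * dx) r _ r01 _)); last 1 first.
- apply: lerD; rewrite ler_wpM2l ?subr_ge0 //.
  by have := vf m.+1; rewrite -natr1 mulrDl mul1r.
- by rewrite mulr_ge0 // ltW.
- by rewrite kE mulrDl.
Qed.

Definition grid_lower (D B : R) v : Prop :=
  forall j m, - (D + B * (m%:R * dx)) <= v ((m%:R * dx) *: e j).

Lemma interp_lower D B v i k : grid_lower D B v -> 0 <= k ->
  - (D + B * k) <= interp dx v (k *: e i).
Proof.
move=> vl k0; have := @interp_ge v i k (fun y => - (D + B * y)) 0 k0 (vl i).
by rewrite subr0; apply => p r _ _ ->; lra.
Qed.

Section LowerBound.
Context (D B K : R) (v : V -> R).
Hypotheses (B0 : 0 <= B) (C0 : 0 <= C) (KL0 : - L0 <= K) (vl : grid_lower D B v).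
Hypothesis low : forall i x a, 0 <= x -> B * `|a| - K - C * x <= L i x a.

(** The distance gained by a fast backward step is repaid by the term [B * |a|] in the bound on [L].
    These bounds for single controls serve twice: they make the infima of the scheme meaningful and
    they propagate [grid_lower] by one step. *)
Lemma inner_ge i y a : 0 < y -> a < y / dt ->
  - (D + B * y) - dt * (K + C * y) <= interp dx v ((y - a * dt) *: e i) + dt * L i y a.
Proof.
have marker : True by [].
move=> y0 ay; have ya : 0 <= y - a * dt by rewrite subr_ge0 -ler_pdivlMr // ltW.
have := interp_lower i vl ya.
have := ler_wpM2l (ltW dt0) (low i a (ltW y0)).
have : B * dt * a <= B * dt * `|a| by rewrite ler_wpM2l ?ler_norm // mulr_ge0 // ltW.
have : - (B * dt * a) <= B * dt * `|a|.
  by rewrite -mulrN ler_wpM2l ?mulr_ge0 ?(ltW dt0) // -normrN ler_norm.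
lra_goal.
Qed.

Lemma vertex_ge j s0 b : 0 <= s0 -> s0 <= dt -> b <= 0 ->
  - D - dt * K <= interp dx v (- ((dt - s0) * b) *: e j) + (dt - s0) * L j 0 b + s0 * L0.
Proof.
have marker : True by [].
move=> s00 s0d b0; have d0 : 0 <= dt - s0 by rewrite subr_ge0.
have fb : 0 <= - ((dt - s0) * b) by rewrite -mulrN mulr_ge0 // oppr_ge0.
have := interp_lower j vl fb.
have := ler_wpM2l d0 (low j b (lexx 0)); rewrite (ler0_norm b0) mulr0 subr0.
have := ler_wpM2l s00 KL0; lra_goal.
Qed.

Lemma cross_ge i j y a s0 b : 0 < y -> y / dt <= a -> 0 <= s0 <= dt - y / a -> b <= 0 ->
  - (D + B * y) - dt * (K + C * y) <=
  interp dx v (- ((dt - s0 - y / a) * b) *: e j) + (dt - s0 - y / a) * L j 0 b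
    + s0 * L0 + y / a * L i y a.
Proof.
have marker : True by [].
move=> y0 ya /andP[s00 s0d] b0.
have a0 : 0 < a by apply: lt_le_trans ya; rewrite divr_gt0.
pose tau : R := y / a; have tau0 : 0 <= tau by rewrite divr_ge0 // ltW.
have tauE : tau * a = y by rewrite /tau divfK // gt_eqF.
rewrite -/tau in s0d *; have d0 : 0 <= dt - s0 - tau.
  by move: s0d; rewrite -/tau; lra_goal.
have fb : 0 <= - ((dt - s0 - tau) * b) by rewrite -mulrN mulr_ge0 // oppr_ge0.
have h1 := interp_lower j vl fb.
have h2 := ler_wpM2l d0 (low j b (lexx 0)); rewrite (ler0_norm b0) mulr0 subr0 in h2.
have h3 := ler_wpM2l s00 KL0.
have h4 := ler_wpM2l tau0 (low i a (ltW y0)); rewrite (gtr0_norm a0) in h4.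
have h5 : tau * (B * a) = B * y by rewrite mulrCA tauE.
have h6 : tau * (C * y) <= dt * (C * y).
  by rewrite ler_wpM2r ?mulr_ge0 ?(ltW y0) //; move: s0d s00; lra_goal.
have h7 : 0 <= B * y by rewrite mulr_ge0 // ltW.
by move: h1 h2 h3 h4 h5 h6 h7; rewrite -/tau; lra_goal.
Qed.

Lemma scheme_le_inner i y a : 0 < y -> a < y / dt ->
  scheme e L L0 dx dt v (y *: e i) <= interp dx v ((y - a * dt) *: e i) + dt * L i y a.
Proof.
move=> y0 ay; rewrite /scheme (negbTE (point_neq0 e_unit i y0)) ge_min; apply/orP; left.
apply: ge_inf.
  exists (- (D + B * y) - dt * (K + C * y)) => _ [j [b [[l l0 yl] + ->]]].
  have [ij kl] := point_inj e_unit y0 l0 yl; rewrite -{}ij (norm_point e_unit) ?(ltW y0) // => by_.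
  by rewrite -scalerBl; exact: inner_ge.
exists i, a; rewrite (norm_point e_unit) ?(ltW y0) // -scalerBl; split=> //.
exact/branch_point/ltW.
Qed.

Lemma scheme_le_cross i j y a s0 b : 0 < y -> y / dt <= a -> 0 <= s0 <= dt - y / a ->
  b <= 0 ->
  scheme e L L0 dx dt v (y *: e i) <=
  interp dx v (- ((dt - s0 - y / a) * b) *: e j) + (dt - s0 - y / a) * L j 0 b
    + s0 * L0 + y / a * L i y a.
Proof.
move=> y0 ay s0i b0; rewrite /scheme (negbTE (point_neq0 e_unit i y0)) ge_min; apply/orP; right.
apply: ge_inf.
  exists (- (D + B * y) - dt * (K + C * y)) => q [i' [a' [s' [j' [b' /=]]]]] [[l l0 yl]].
  have [ij kl] := point_inj e_unit y0 l0 yl; rewrite -{}ij (norm_point e_unit) ?(ltW y0) //.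
  by move=> ya' s0' b0' ->; exact: cross_ge.
exists i, a, s0, j, b; rewrite (norm_point e_unit) ?(ltW y0) //; split=> //.
exact/branch_point/ltW.
Qed.

Lemma scheme_le_vertex j s0 b : 0 <= s0 <= dt -> b <= 0 ->
  scheme e L L0 dx dt v 0 <=
  interp dx v (- ((dt - s0) * b) *: e j) + (dt - s0) * L j 0 b + s0 * L0.
Proof.
move=> s0i b0; rewrite /scheme eqxx; apply: ge_inf; last by exists s0, j, b.
exists (- D - dt * K) => _ [s' [j' [b' [/andP[s1 s2] b'0 ->]]]]; exact: vertex_ge.
Qed.

End LowerBound.

Lemma scheme_ge i y v mm : 0 < y ->
  (forall a, a < y / dt -> mm <= interp dx v ((y - a * dt) *: e i) + dt * L i y a) ->
  (forall j a s0 b, y / dt <= a -> 0 <= s0 <= dt - y / a -> b <= 0 ->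
     mm <= interp dx v (- ((dt - s0 - y / a) * b) *: e j) + (dt - s0 - y / a) * L j 0 b
             + s0 * L0 + y / a * L i y a) ->
  mm <= scheme e L L0 dx dt v (y *: e i).
Proof.
move=> y0 H1 H2; rewrite /scheme (negbTE (point_neq0 e_unit i y0)) le_min; apply/andP; split.
- apply: lb_le_inf.
    exists (interp dx v ((y - 0 * dt) *: e i) + dt * L i y 0), i, 0.
    rewrite (norm_point e_unit) ?(ltW y0) // -scalerBl; split=> //; last by rewrite divr_gt0.
    exact/branch_point/ltW.
  move=> _ [j [b [[l l0 yl] + ->]]].
  have [ij kl] := point_inj e_unit y0 l0 yl; rewrite -{}ij (norm_point e_unit) ?(ltW y0) // => by_.
  by rewrite -scalerBl; exact: H1.
- have ydt : 0 < y / dt by rewrite divr_gt0.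
  apply: lb_le_inf.
    pose a := y / dt.
    exists (interp dx v (- ((dt - 0 - y / a) * 0) *: e i) + (dt - 0 - y / a) * L i 0 0
      + 0 * L0 + y / a * L i y a), i, a, 0, i, 0.
    rewrite (norm_point e_unit) ?(ltW y0) //; split=> //; first exact/branch_point/ltW.
    rewrite lexx /= subr_ge0 /a invf_div mulrCA mulfV ?mulr1 // gt_eqF //.
  move=> q [i' [a' [s' [j' [b' /=]]]]] [[l l0 yl]].
  have [ij kl] := point_inj e_unit y0 l0 yl; rewrite -{}ij (norm_point e_unit) ?(ltW y0) //.
  by move=> ya' s0' b0' ->; exact: H2.
Qed.

Lemma scheme_ge_vertex v mm (i0 : 'I_N) :
  (forall j s0 b, 0 <= s0 <= dt -> b <= 0 ->
     mm <= interp dx v (- ((dt - s0) * b) *: e j) + (dt - s0) * L j 0 b + s0 * L0) ->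
  mm <= scheme e L L0 dx dt v 0.
Proof.
move=> H; rewrite /scheme eqxx; apply: lb_le_inf.
  exists (interp dx v (- ((dt - 0) * 0) *: e i0) + (dt - 0) * L i0 0 0 + 0 * L0), 0, i0, 0.
  by rewrite lexx (ltW dt0).
by move=> _ [s' [j' [b' [s1 b'0 ->]]]]; exact: H.
Qed.

End Scheme.

(** * Upper bound for the scheme *)

Section TubeBounds.
Context {R : realType} {N : nat}.
Implicit Types (i j : 'I_N) (s y t x a c ell K T S sig C : R).

Lemma tube_steep ell K t x a s S : 0 <= K -> 0 <= x -> t <= s <= t + S ->
  - (`|ell| + 2 * `|a| * K * (1 + S) * (x + `|a| * S)) <= tube_dt ell K t x a s 0.
Proof.
have marker : True by [].
move=> K0 x0 /andP[ts ss]; rewrite /tube_dt.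
have st0 : 0 <= s - t by rewrite subr_ge0.
have stS : s - t <= S by rewrite lerBlDl.
have S0 : 0 <= S by apply: le_trans stS.
have b1 : 0 <= K * ((0 - x - a * (s - t)) * (0 - x - a * (s - t))).
  by rewrite mulr_ge0 // -expr2 sqr_ge0.
have b2 : `|2 * a * K * (1 + (s - t)) * (0 - x - a * (s - t))|
    <= 2 * `|a| * K * (1 + S) * (x + `|a| * S).
  have n2 : 0 <= 1 + (s - t) by rewrite addr_ge0.
  have n3 : 0 <= 2 :> R by [].
  rewrite !normrM (ger0_norm K0) (ger0_norm n3) (ger0_norm n2).
  have n1 : 0 <= 2 * `|a| * K by rewrite !mulr_ge0.
  apply: ler_pM; [by rewrite mulr_ge0 // addr_ge0|exact: normr_ge0| |].
    by rewrite ler_wpM2l // lerD2l.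
  rewrite sub0r; apply: le_trans (ler_normB _ _) _; rewrite normrN (ger0_norm x0) lerD2l.
  by rewrite normrM (ger0_norm st0) ler_wpM2l.
have b3 : - `|ell| <= ell by rewrite lerNl -normrN ler_norm.
by move: b1 b3 b2; rewrite ler_norml => + + /andP[_]; lra_goal.
Qed.

Lemma tube_increment c ell K t x a s h S : 0 <= K -> 0 <= x -> 0 <= h ->
  t <= s -> s + h <= t + S ->
  - (`|ell| + 2 * `|a| * K * (1 + S) * (x + `|a| * S)) * h
    <= tube c ell K t x a (s + h) 0 - tube c ell K t x a s 0.
Proof.
move=> K0 x0 h0 ts sS.
have ssh : s <= s + h by rewrite lerDl.
have [u /andP[u1 u2] ->] := MVT_line (fun u => tube_derive_t c ell K t x a u 0) ssh.
rewrite addrAC subrr add0r ler_wpM2r // tube_steep //.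
by rewrite (le_trans ts u1) (le_trans u2 sS).
Qed.

(** The deviation from the line is the same at both ends of a run of speed [a], so the increment is
    exact and the only error of a scheme step inside the tube is that of interpolation. *)
Lemma tube_line c ell K t x a s y h :
  tube c ell K t x a (s + h) y - tube c ell K t x a s (y - a * h)
  = h * (ell + K * ((y - x - a * (s + h - t)) * (y - x - a * (s + h - t)))).
Proof. by rewrite /tube; ring. Qed.

(** Near [x] the bound [c] applies; elsewhere [K] and [K1] dominate the growth. On a steep branch
    away from the start, the height of the tube at the vertex is used if [0 < x], and the slope
    alone if [x = 0]. *)
Lemma tube_initial (P : pred 'I_N) i j x y z c ell K K1 t a B M rho :
  (P j -> j = i) -> 0 <= B -> 0 <= M -> 0 < rho ->
  0 <= x -> 0 <= y -> - M <= c ->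
  (B * (1 + x) + M) / rho ^+ 2 + B / rho + (B + M) / x ^+ 2 <= K ->
  (B + M) / rho + B <= K1 ->
  z <= B * (1 + y) -> (jclose rho i x j y -> z <= c) ->
  z <= junction_tube P c ell K K1 t x a j t y.
Proof.
have marker : True by [].
move=> Pi B0 M0 rho0 x0 y0 cM KB KB1 zB zc.
have Bx0 : 0 <= B * (1 + x) + M by rewrite addr_ge0 // mulr_ge0 // addr_ge0.
have p2 : 0 <= (B * (1 + x) + M) / rho ^+ 2 by rewrite divr_ge0 // sqr_ge0.
have p3 : 0 <= B / rho by rewrite divr_ge0 // ltW.
have p4 : 0 <= (B + M) / x ^+ 2 by rewrite divr_ge0 ?sqr_ge0 // addr_ge0.
have p5 : 0 <= (B + M) / rho by apply: divr_ge0; [exact: addr_ge0|exact: ltW].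
have K0 : 0 <= K by move: p2 p3 p4 KB; lra_goal.
have K10 : 0 <= K1 by move: p5 B0 KB1; lra_goal.
rewrite /junction_tube /= /tube !subrr mulr0 !addr0 mulr1 mulr0 !subr0 mulr1.
case: ifPn => [/Pi ji|_].
  have [yx|yx] := ltP `|y - x| rho.
    apply: (@le_trans _ _ c); first by apply: zc; left; rewrite ji distrC.
    by rewrite lerDl mulr_ge0 // -expr2 sqr_ge0.
  apply: le_trans zB _.
  have := quadratic_dominates B0 Bx0 rho0 yx.
  have -> : `|y - x| * `|y - x| = (y - x) * (y - x).
    by rewrite -normrM ger0_norm // -expr2 sqr_ge0.
  have dd : 0 <= (y - x) * (y - x) by rewrite -expr2 sqr_ge0.
  have : ((B * (1 + x) + M) / rho ^+ 2 + B / rho) * ((y - x) * (y - x)) <= K * ((y - x) * (y - x)).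
    by rewrite ler_wpM2r //; move: p4 KB; lra_goal.
  have yle : y <= x + `|y - x| by rewrite -lerBlDl ler_norm.
  have : B * y <= B * (x + `|y - x|) by rewrite ler_wpM2l.
  by move: cM; lra_goal.
have [xy|xy] := ltP (x + y) rho.
  apply: (@le_trans _ _ c); first by apply: zc; right.
  rewrite -addrA lerDl; apply: addr_ge0; last exact: mulr_ge0.
  by rewrite mulr_ge0 // -expr2 sqr_ge0.
apply: le_trans zB _.
have [xp|xp] := ltP 0 x.
  have h3 : B + M <= K * ((0 - x) * (0 - x)).
    have -> : (0 - x) * (0 - x) = x * x by ring.
    apply: (@le_trans _ _ ((B + M) / x ^+ 2 * (x * x))).
      by rewrite -expr2 divfK // gt_eqF // exprn_gt0.
    by rewrite ler_wpM2r ?mulr_ge0 //; move: p2 p3 KB; lra_goal.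
  have h4 : B * y <= K1 * y by rewrite ler_wpM2r //; move: p5 KB1; lra_goal.
  by move: h3 h4 cM; lra_goal.
have xE : x = 0 by apply/eqP; rewrite eq_le xp.
rewrite xE add0r in xy.
have h3 : (B + M) + B * y <= K1 * y.
  have : B + M <= (B + M) / rho * y.
    by rewrite mulrAC ler_pdivlMr // ler_wpM2l // addr_ge0.
  have : (B + M) / rho * y + B * y <= K1 * y by rewrite -mulrDl ler_wpM2r.
  by lra_goal.
rewrite xE subr0 !mulr0 addr0; move: h3 cM; lra_goal.
Qed.

End TubeBounds.

Section SchemeStep.
Context {R : realType} {V : normedModType R} {N : nat} (e : 'I_N -> V).
Context (L : 'I_N -> R -> R -> R) (L0 C : R).
Hypothesis e_unit : unit_directions e.
Hypotheses (C0 : 0 <= C) (L_lip : lipschitz_position L C).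
Context (dx dt D B K0 KU : R) (v : V -> R).
Hypotheses (dx0 : 0 < dx) (dt0 : 0 < dt).
Hypotheses (B0 : 0 <= B) (K0L : - L0 <= K0) (vl : grid_lower e dx D B v).
Hypothesis low : forall i x a, 0 <= x -> B * `|a| - K0 - C * x <= L i x a.
Hypotheses (KU0 : 0 <= KU).
Hypothesis up : forall i x a, 0 <= x -> `|a| <= 1 -> L i x a <= KU + C * x.
Implicit Types (i j : 'I_N) (m n : nat) (y a s : R).

(* If the step reaches the vertex, g bounds the outcome of the remaining time. *)
Lemma steep_step j (g : R -> R) (K1 G sig t s : R) y : 0 <= G -> 0 <= sig -> 0 <= K1 ->
  G + KU + C + sig <= K1 -> dt <= 1 -> t <= s ->
  (forall m, v ((m%:R * dx) *: e j) <= g s + K1 * (1 + (s - t)) * (m%:R * dx)) ->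
  (forall h, 0 <= h <= dt -> g (s + dt) - g (s + h) >= - G * (dt - h)) ->
  0 < y ->
  (forall h, 0 <= h <= dt -> exists s0 j' b, [/\ 0 <= s0 <= h, b <= 0 &
     interp dx v (- ((h - s0) * b) *: e j') + (h - s0) * L j' 0 b + s0 * L0
       <= g (s + h) + sig * (dt - h)]) ->
  scheme e L L0 dx dt v (y *: e j) <= g (s + dt) + K1 * (1 + (s + dt - t)) * y.
Proof.
have marker : True by [].
move=> G0 sig0 K10 K1G dt1 ts vg gG y0 run.
have dtp := dt0; have C0' := C0; have KU0' := KU0.
have st0 : 0 <= s - t by rewrite subr_ge0.
have [ydt|ydt] := leP y dt.
(* At unit speed the vertex is reached after the time [y], and the remaining time [dt - y] is spent
   as [run] provides; [G] bounds the decrease of [g] over the time [y]. *)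
- have h0dt : 0 <= dt - y <= dt by rewrite subr_ge0 ydt gerBl ltW.
  have [s0 [j' [b [s0h b0 rle]]]] := run _ h0dt.
  have a1 : y / dt <= 1 by rewrite ler_pdivrMr // mul1r.
  have s0i : 0 <= s0 <= dt - y / 1 by rewrite divr1.
  have := scheme_le_cross e_unit dx0 dt0 B0 C0 K0L vl low j j' y0 a1 s0i b0.
  rewrite divr1 (addrAC dt) => H; apply: le_trans H _.
  have := up j (ltW y0) (_ : `|1 : R| <= 1); rewrite normr1 => /(_ (lexx _)) u1.
  have u2 := ler_wpM2l (ltW y0) u1.
  have := gG _ h0dt; rewrite (_ : dt - (dt - y) = y); last by ring.
  rewrite (_ : dt - (dt - y) = y) in rle; last by ring.
  have k1 : K1 * y <= K1 * (1 + (s + dt - t)) * y.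
    rewrite ler_wpM2r ?(ltW y0) // ler_peMr // lerDl; move: st0 dtp; lra_goal.
  have y1 : y <= 1 := le_trans ydt dt1.
  have k2 : y * (C * y) <= y * C.
    by rewrite ler_wpM2l ?(ltW y0) // ler_piMr.
  have := ler_wpM2r (ltW y0) K1G.
  by move: rle u2 k1 k2; lra_goal.
- have a1 : 1 < y / dt by rewrite ltr_pdivlMr // mul1r.
  have ydt0 : 0 <= y - 1 * dt by rewrite mul1r subr_ge0 ltW.
  have := scheme_le_inner L0 e_unit dx0 dt0 B0 vl low j y0 a1.
  move=> H; apply: le_trans H _.
  have := interp_affine_le e_unit dx0 ydt0 vg; rewrite mul1r => int.
  have := up j (ltW y0) (_ : `|1 : R| <= 1); rewrite normr1 => /(_ (lexx _)) u1.
  have u2 := ler_wpM2l (ltW dt0) u1.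
  have hd : 0 <= (0 : R) <= dt by rewrite lexx ltW.
  have := gG _ hd; rewrite addr0 subr0.
  have k1 : C * y <= K1 * y.
    by rewrite ler_wpM2r ?(ltW y0) //; move: K1G G0 sig0 KU0'; lra_goal.
  have k2 := ler_wpM2l (ltW dt0) k1.
  have k3 : dt * (G + KU) <= dt * (K1 * (1 + (s - t))).
    rewrite ler_wpM2l ?(ltW dt0) //; apply: (@le_trans _ _ K1).
      by move: K1G sig0 C0'; lra_goal.
    by rewrite ler_peMr // lerDl.
  by move: int u2 k2 k3; lra_goal.
Qed.

Section TubeStep.
Context (P : pred 'I_N) (i0 : 'I_N) (c ell K K1 t x a S sig Bg M s : R).
Hypotheses (Pi : forall j, P j -> j = i0).
Hypotheses (x0 : 0 <= x) (sig0 : 0 < sig) (dt1 : dt <= 1).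
Hypotheses (ts : t <= s) (sS : s + dt <= t + S).
Hypotheses (cM : - M <= c - `|ell| * S) (M0 : 0 <= M) (Bg0 : 0 <= Bg).
Hypotheses (Kx : 0 < x -> 4 * (Bg * (1 + x) + M) / x ^+ 2 <= K) (K0' : 0 <= K).
Hypotheses (KC : C ^+ 2 / (4 * sig) <= K).
Hypotheses (KB : Bg <= K1).
Hypotheses (K1G : (`|ell| + 2 * `|a| * K * (1 + S) * (x + `|a| * S)) + KU + C + sig <= K1).
Hypotheses (mesh : K * (1 + S) * dx ^+ 2 <= sig * dt).
Hypotheses (mesh_a : 0 < x -> `|a| * dt <= x / 2).
(** Two kinds of pieces: a run along [i0], which carries the tube, or a stay at the vertex. In the
    second case [Pi] leaves no branch in [P], so that all are steep. *)
Hypothesis mode :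
  [/\ P i0, L i0 x a + C * `|a| * S + 2 * sig <= ell & a <= 0 \/ 0 < x] \/
  [/\ ~~ P i0, x = 0, a = 0 & L0 <= ell].
Hypothesis v_le : forall j m,
  v ((m%:R * dx) *: e j) <= junction_tube P c ell K K1 t x a j s (m%:R * dx).
Hypothesis growth : forall j m,
  scheme e L L0 dx dt v ((m%:R * dx) *: e j) <= Bg * (1 + m%:R * dx).

Let tS : t <= s <= t + S.
Proof. by rewrite ts (le_trans _ sS) // lerDl ltW. Qed.

Let S0 : 0 <= S.
Proof. by have /andP[_] := tS; rewrite -lerBlDl; apply: le_trans; rewrite subr_ge0. Qed.

(** Interpolating the parabola costs at most [K * (1 + S) * dx ^+ 2], hence [sig * dt] by the mesh
    condition. The rate [ell] is generous enough to win back [sig * h] along the run, so nothing is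
    lost in a full step. *)
Lemma tube_interp h y : 0 <= h <= dt -> 0 <= y -> 0 <= y - a * h -> P i0 ->
  L i0 x a + C * `|a| * S + 2 * sig <= ell ->
  interp dx v ((y - a * h) *: e i0) + h * L i0 y a
    <= tube c ell K t x a (s + h) y + sig * (dt - h).
Proof.
have marker : True by [].
move=> /andP[h0 hdt] y0 ya P0 Lell.
have sh : t <= s + h <= t + S.
  by rewrite (le_trans ts) ?lerDl //= (le_trans _ sS) // lerD2l.
have := tube_speed_bound C0 L_lip sig0 KC Lell sh x0 y0.
move=> /(ler_wpM2l h0); rewrite mulrDr -(tube_line c) => h1.
have int : interp dx v ((y - a * h) *: e i0) <= tube c ell K t x a s (y - a * h) + sig * dt.
  apply: (interp_le e_unit dx0 ya) => [m|p r _ /andP[r0 r1] ->].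
    by have := v_le i0 m; rewrite /junction_tube P0.
  have st0 : 0 <= s - t by rewrite subr_ge0.
  have st1 : 1 + (s - t) <= 1 + S by rewrite lerD2l lerBlDl; case/andP: tS.
  have m1 : K * (1 + (s - t)) * dx ^+ 2 <= sig * dt.
    by apply: le_trans mesh; rewrite ler_wpM2r ?sqr_ge0 // ler_wpM2l.
  have m2 : (r * (1 - r)) * (K * (1 + (s - t)) * dx ^+ 2) <= sig * dt.
    apply: le_trans m1; apply: ler_piMl.
      by apply: mulr_ge0; [apply: mulr_ge0 => //; exact: addr_ge0|exact: sqr_ge0].
    have r2 : 0 <= r ^+ 2 by rewrite sqr_ge0.
    by rewrite -[X in _ <= X]subr0 mulrBr mulr1 -expr2 lerB.
  by move: m2; rewrite /tube expr2; lra_goal.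
by move: h1 int; lra_goal.
Qed.

(** For runs leaving the vertex: up to distance [x / 2], and on the steep branches, the tube lies
    above the growth bound of the scheme, so these points need no step. The factor 4 in [Kx] comes
    from this half distance. *)
Lemma tube_escape j s' y : t <= s' <= t + S -> 0 < x -> 0 <= a -> 0 <= y ->
  y <= x / 2 \/ ~~ P j -> Bg * (1 + y) <= junction_tube P c ell K K1 t x a j s' y.
Proof.
have marker : True by [].
move=> /andP[ts' s'S] xp a0 y0 yx.
have st0 : 0 <= s' - t by rewrite subr_ge0.
have key w : 0 <= w -> w <= x / 2 -> Bg * (1 + x) <= tube c ell K t x a s' w.
  move=> w0 wx; rewrite /tube.
  have d1 : w - x - a * (s' - t) <= - (x / 2).
    by have := mulr_ge0 a0 st0; move: wx; lra_goal.
  have d2 : x ^+ 2 / 4 <= (w - x - a * (s' - t)) * (w - x - a * (s' - t)).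
    have x2 : 0 <= x / 2 by rewrite divr_ge0 // ltW.
    rewrite lerNr in d1; have := ler_pM x2 x2 d1 d1; rewrite mulrNN.
    by apply: le_trans; rewrite le_eqVlt; apply/orP; left; apply/eqP; field.
  have k1 : Bg * (1 + x) + M <= K * (x ^+ 2 / 4).
    apply: (@le_trans _ _ (4 * (Bg * (1 + x) + M) / x ^+ 2 * (x ^+ 2 / 4))).
      rewrite le_eqVlt; apply/orP; left; apply/eqP; field; exact: lt0r_neq0.
    by rewrite ler_wpM2r ?Kx // divr_ge0 ?sqr_ge0.
  have k2 : K * (x ^+ 2 / 4) <= K * (1 + (s' - t)) *
      ((w - x - a * (s' - t)) * (w - x - a * (s' - t))).
    by apply: ler_pM; rewrite ?divr_ge0 ?sqr_ge0 // ler_peMr // lerDl.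
  have k3 : - (`|ell| * S) <= ell * (s' - t).
    apply: (@le_trans _ _ (- (`|ell| * (s' - t)))).
      by rewrite lerN2 ler_wpM2l // lerBlDl.
    by rewrite -mulNr ler_wpM2r // lerNl -normrN ler_norm.
  by move: k1 k2 k3 cM; lra_goal.
have Bx : Bg <= Bg * (1 + x) by rewrite ler_peMr // lerDl ltW.
rewrite /junction_tube; case: ifPn => Pj.
  case: yx => [yx|]; last by rewrite Pj.
  apply: le_trans (key y y0 yx); rewrite ler_wpM2l // lerD2l (le_trans yx) //.
  by rewrite ler_pdivrMr // ler_peMr ?ltW // ltr1n.
have h0 : 0 <= x / 2 by rewrite divr_ge0 // ltW.
have := key 0 (lexx 0) h0.
have : Bg * y <= K1 * (1 + (s' - t)) * y.
  rewrite ler_wpM2r //; apply: (le_trans KB); rewrite ler_peMr ?lerDl //.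
  exact: le_trans KB.
by move: Bx; lra_goal.
Qed.

Lemma tube_run h : 0 <= h <= dt -> a <= 0 \/ ~~ P i0 ->
  exists s0 j' b, [/\ 0 <= s0 <= h, b <= 0 &
     interp dx v (- ((h - s0) * b) *: e j') + (h - s0) * L j' 0 b + s0 * L0
       <= tube c ell K t x a (s + h) 0 + sig * (dt - h)].
Proof.
have marker : True by [].
move=> hi an; have /andP[h0 hdt] := hi.
case: mode => [[P0 Lell ax]|[P0 xE aE Lell]].
- have a0 : a <= 0 by case: an => //; rewrite P0.
  exists 0, i0, a; rewrite lexx h0; split=> //.
  rewrite subr0 mul0r addr0 mulrC -[- (a * h)]sub0r; apply: tube_interp => //.
  by rewrite sub0r -mulNr mulr_ge0 // oppr_ge0.
- exists h, i0, 0; rewrite lexx h0; split=> //.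
  rewrite subrr !mul0r oppr0 addr0.
  have := interp_affine_le e_unit dx0 (lexx 0) (A := tube c ell K t x a s 0)
    (B := K1 * (1 + (s - t))) (v := v) (i := i0).
  rewrite mulr0 addr0 => int; have {int} := int _.
  rewrite /tube xE aE !mul0r !subr0 !mulr0 !addr0 => int.
  have : interp dx v (0 *: e i0) <= c + ell * (s - t).
    apply: int => m; have := v_le i0 m; rewrite /junction_tube (negbTE P0).
    by rewrite /tube xE aE !mul0r !subr0 !mulr0 !addr0.
  have := ler_wpM2l h0 Lell; have : 0 <= sig * (dt - h).
    by rewrite mulr_ge0 ?subr_ge0 // ltW.
  lra_goal.
Qed.

(** If the run leaves the vertex, [tube_escape] covers all points but those of the branch beyond
    [x / 2], and by [mesh_a] the backward step from these stays on the branch. Otherwise [tube_run]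
    says how to continue after a backward step has reached the vertex. *)
Lemma tube_step j m : scheme e L L0 dx dt v ((m%:R * dx) *: e j)
  <= junction_tube P c ell K K1 t x a j (s + dt) (m%:R * dx).
Proof.
have marker : True by [].
have dtp : 0 <= dt <= dt by rewrite lexx ltW.
have sdt : t <= s + dt <= t + S by rewrite sS (le_trans ts) // lerDl ltW.
have md0 : 0 <= m%:R * dx by rewrite mulr_ge0 // ltW.
have [an|an] := pselect (a <= 0 \/ ~~ P i0); last first.
  have /not_orP[/negP ap Pi0] := an; rewrite -ltNge in ap.
  have xp : 0 < x by case: mode => [[_ _ [a0|//]]|[_ _ aE _]]; move: ap; rewrite ?aE ?ltxx // ltNge a0.
  have [yx|xy] := leP (m%:R * dx) (x / 2).
    by apply: le_trans (growth j m) _; apply: tube_escape => //; [exact: ltW|left].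
  have [Pj|Pj] := boolP (P j); last first.
    by apply: le_trans (growth j m) _; apply: tube_escape => //; [exact: ltW|right].
  have y0 : 0 < m%:R * dx by apply: le_lt_trans xy; rewrite divr_ge0 // ltW.
  have ady : a < m%:R * dx / dt.
    rewrite ltr_pdivlMr //; apply: le_lt_trans xy; rewrite -(gtr0_norm ap); exact: mesh_a.
  apply: le_trans (scheme_le_inner L0 e_unit dx0 dt0 B0 vl low j y0 ady) _.
  rewrite /junction_tube Pj (Pi Pj).
  case: mode => [[_ Lell _]|[P0]]; last by rewrite -(Pi Pj) Pj in P0.
  have := @tube_interp dt _ dtp md0; rewrite subrr mulr0 addr0; apply => //.
    by rewrite subr_ge0 -ler_pdivlMr // ltW.
  by rewrite -(Pi Pj).
have run h hi := @tube_run h hi an.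
have [y0|y0] := ltP 0 (m%:R * dx); last first.
  have -> : m%:R * dx = 0 by apply/eqP; rewrite eq_le y0.
  rewrite junction_tube_vertex scale0r.
  have [s0 [j' [b [s0i b0 rle]]]] := run dt dtp.
  rewrite subrr mulr0 addr0 in rle; apply: le_trans rle.
  exact: (scheme_le_vertex e_unit dx0 K0L vl low).
rewrite /junction_tube; case: ifPn => Pj; last first.
  have Gg : 0 <= `|ell| + 2 * `|a| * K * (1 + S) * (x + `|a| * S).
    rewrite addr_ge0 // mulr_ge0 //; last by rewrite addr_ge0 // mulr_ge0.
    by rewrite mulr_ge0 ?addr_ge0 // !mulr_ge0.
  have K10 : 0 <= K1 by exact: le_trans KB.
  apply: (@steep_step j (fun u => tube c ell K t x a u 0) K1 _ sig t s (m%:R * dx) Gg (ltW sig0)) => //.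
    by move=> m'; have := v_le j m'; rewrite /junction_tube (negbTE Pj).
  move=> h /andP[h0 hdt].
  have dh : 0 <= dt - h by rewrite subr_ge0.
  have := @tube_increment R c ell K t x a (s + h) (dt - h) S K0' x0 dh.
  rewrite (_ : s + h + (dt - h) = s + dt); last by ring.
  by rewrite mulNr; apply => //; rewrite (le_trans ts) // lerDl.
rewrite (Pi Pj).
have a0 : a <= 0 by case: an => //; rewrite -(Pi Pj) Pj.
have ady : a < m%:R * dx / dt by apply: le_lt_trans a0 _; rewrite divr_gt0.
apply: le_trans (scheme_le_inner L0 e_unit dx0 dt0 B0 vl low i0 y0 ady) _.
case: mode => [[_ Lell _]|[P0]]; last by rewrite -(Pi Pj) Pj in P0.
have := @tube_interp dt _ dtp md0; rewrite subrr mulr0 addr0; apply => //.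
  by rewrite subr_ge0 -ler_pdivlMr // ltW.
by rewrite -(Pi Pj).
Qed.

End TubeStep.
End SchemeStep.

Section SchemeUpper.
Context {R : realType} {V : normedModType R} {N : nat} (e : 'I_N -> V).
Context (L : 'I_N -> R -> R -> R) (L0 C T : R) (u0 : V -> R) (Lam : R).
Hypothesis e_unit : unit_directions e.
Hypotheses (C0 : 0 <= C) (L_lip : lipschitz_position L C).
Hypotheses (L_conv : convex_lipschitz_lagrangian L).
Hypotheses (L_super : superlinear_lagrangian L).
Hypotheses (T0 : 0 <= T) (Lam0 : 0 <= Lam).

Let g0 (i : 'I_N) (k : R) := u0 (k *: e i).
Hypothesis g0_lip : lipschitz_data Lam g0.

Implicit Types (i j : 'I_N) (m n : nat) (t x y a c h s dx dt rho eps : R).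

Let W := discrete_solution e L L0 u0.

Lemma initial_growth j y : 0 <= y -> `|g0 j y - u0 0| <= Lam * y.
Proof.
move=> y0; case: g0_lip => _ /(_ j y 0 y0 (lexx _)).
by rewrite subr0 (ger0_norm y0) /g0 scale0r.
Qed.

(** [L] is bounded below only up to [C * x], so the slope of the lower bound grows by [C * dt] in
    each step, and its height by [K * dt]. The induction runs with [B n] and [D n]; their values for
    the time [T] then serve all [n]. *)
Lemma scheme_lower_growth : exists B D K : R, [/\ 0 <= B, - L0 <= K,
  forall i x a, 0 <= x -> B * `|a| - K - C * x <= L i x a &
  forall dx dt n, 0 < dx -> 0 < dt -> n%:R * dt <= T -> grid_lower e dx D B (W dx dt n)].
Proof.
have marker : True by [].
have [K [K0 KL0] HK] := lagrangian_lower L0 L_conv L_super C0 L_lip (Lam + C * T).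
have CT : 0 <= C * T by rewrite mulr_ge0.
exists (Lam + C * T), (`|u0 0| + K * T), K; split => //; first exact: addr_ge0.
move=> dx dt n dx0 dt0.
pose D n : R := `|u0 0| + K * (n%:R * dt); pose B n : R := Lam + C * (n%:R * dt).
have Bn0 k : 0 <= B k by rewrite addr_ge0 // mulr_ge0 // mulr_ge0 // ltW.
suff H : n%:R * dt <= T -> grid_lower e dx (D n) (B n) (W dx dt n).
  move=> nT j m; apply: le_trans (H nT j m).
  have m0 : 0 <= m%:R * dx by rewrite mulr_ge0 // ltW.
  by rewrite lerN2 /D /B; apply: lerD; rewrite ?ler_wpM2r // lerD2l ler_wpM2l.
elim: n => [_ j m|n IH nT j m].
  have m0 : 0 <= m%:R * dx by rewrite mulr_ge0 // ltW.
  rewrite /D /B mul0r !mulr0 !addr0 /= -/(g0 j _).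
  have := initial_growth j m0; have := ler_norm (- u0 0); rewrite normrN.
  by rewrite ler_norml => + /andP[]; lra_goal.
have nE : n.+1%:R * dt = n%:R * dt + dt by rewrite -natr1 mulrDl mul1r.
have nT' : n%:R * dt <= T by apply: le_trans nT; rewrite nE lerDl ltW.
have {IH} vl := IH nT'.
have low i x a : 0 <= x -> B n * `|a| - K - C * x <= L i x a.
  move=> x0; apply: le_trans (HK i x a x0); rewrite -!addrA lerD2r ler_wpM2r //.
  by rewrite lerD2l ler_wpM2l.
have m0 : 0 <= m%:R * dx by rewrite mulr_ge0 // ltW.
have E : - (D n.+1 + B n.+1 * (m%:R * dx))
    = - (D n + B n * (m%:R * dx)) - dt * (K + C * (m%:R * dx)).
  by rewrite /D /B nE; ring.
rewrite E /=; move: m0; set y := m%:R * dx; rewrite le_eqVlt => /orP[/eqP <-|y0].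
  rewrite scale0r !mulr0 !addr0. apply: (scheme_ge_vertex dt0 j) => j' s0 b /andP[s00 s0d] b0.
  exact: (vertex_ge e_unit dx0 KL0 vl low).
apply: (scheme_ge e_unit dt0 y0) => [a ay|j' a s0 b ay s0i b0].
  exact: (inner_ge e_unit dx0 dt0 (Bn0 n) vl low).
exact: (cross_ge e_unit dx0 dt0 (Bn0 n) C0 KL0 vl low).
Qed.

(** The control 0 leaves a grid point in place, and there the interpolation is exact. *)
Lemma scheme_upper_growth : exists2 K : R, 0 <= K &
  forall dx dt n j m, 0 < dx -> 0 < dt -> n%:R * dt <= T ->
    W dx dt n ((m%:R * dx) *: e j)
      <= g0 j (m%:R * dx) + (K + C * (m%:R * dx)) * (n%:R * dt).
Proof.
have marker : True by [].
have [K [K0 _] HK] := lagrangian_upper L0 L_conv L_lip.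
have [B [D [KL [B0 KL0 low vl]]]] := scheme_lower_growth.
exists K => // dx dt n j m dx0 dt0.
elim: n j m => [j m _|n IH j m nT]; first by rewrite mul0r mulr0 addr0.
have nE : n.+1%:R * dt = n%:R * dt + dt by rewrite -natr1 mulrDl mul1r.
have nT' : n%:R * dt <= T by apply: le_trans nT; rewrite nE lerDl ltW.
have {}vl := vl _ _ _ dx0 dt0 nT'.
have IHm := IH j m nT'.
rewrite nE mulrDr addrA /=.
have m0 : 0 <= m%:R * dx by rewrite mulr_ge0 // ltW.
have := HK j _ 0 m0; rewrite normr0 => /(_ ler01) /(ler_wpM2l (ltW dt0)) L1.
have := interp_grid e_unit dx0 (W dx dt n) j m; move: m0 IHm L1.
set y := m%:R * dx; rewrite le_eqVlt => /orP[/eqP yE|y0] IHm L1 int.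
  have d0 : (0 : R) <= 0 <= dt by rewrite lexx ltW.
  have := scheme_le_vertex e_unit dx0 KL0 vl low j d0 (lexx 0).
  move: int IHm L1; rewrite -!yE !scale0r !mulr0 oppr0 !scale0r !mul0r !addr0 /W => ->.
  by lra_goal.
have := scheme_le_inner L0 e_unit dx0 dt0 B0 vl low j y0 (_ : 0 < y / dt).
rewrite divr_gt0 // mul0r subr0 int => /(_ isT).
by move: IHm L1; rewrite /W; lra_goal.
Qed.

Lemma scheme_growth : exists2 B : R, 0 <= B &
  forall dx dt n j m, 0 < dx -> 0 < dt -> n%:R * dt <= T ->
    W dx dt n ((m%:R * dx) *: e j) <= B * (1 + m%:R * dx).
Proof.
have marker : True by [].
have [K K0 H] := scheme_upper_growth.
have CT : 0 <= C * T by rewrite mulr_ge0.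
have KT : 0 <= K * T by rewrite mulr_ge0.
exists (`|u0 0| + K * T + Lam + C * T); first by rewrite !addr_ge0.
move=> dx dt n j m dx0 dt0 nT; apply: le_trans (H _ _ _ _ _ dx0 dt0 nT) _.
have m0 : 0 <= m%:R * dx by rewrite mulr_ge0 // ltW.
have := initial_growth j m0; rewrite ler_norml => /andP[_ h1].
have h2 : (K + C * (m%:R * dx)) * (n%:R * dt) <= (K + C * (m%:R * dx)) * T.
  by rewrite ler_wpM2l // addr_ge0 // mulr_ge0.
have h3 := mulr_ge0 KT m0; have h4 := mulr_ge0 (normr_ge0 (u0 0)) m0.
have h5 := ler_norm (u0 0).
have Lam0' := Lam0.
by move: h1 h2 h3 h4 h5 CT Lam0'; lra_goal.
Qed.

(** A form of the statement that the upper relaxed limit of the scheme at [(t, x)] is at most [c]. A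
    single [rho] measures the nearness of the grid point, the mesh sizes and the ratio
    [dx ^+ 2 / dt]. *)
Definition scheme_near_le i t x c : Prop :=
  exists2 rho : R, 0 < rho & forall dx dt, 0 < dx < rho -> 0 < dt < rho ->
    dx ^+ 2 <= rho * dt -> forall n j m, n%:R * dt <= T -> `|t - n%:R * dt| < rho ->
    jclose rho i x j (m%:R * dx) -> W dx dt n ((m%:R * dx) *: e j) <= c.

Lemma scheme_near_start i x eps : 0 <= x -> 0 < eps -> scheme_near_le i 0 x (g0 i x + eps).
Proof.
have marker : True by [].
move=> x0 eps0; have [K K0 H] := scheme_upper_growth.
pose q : R := Lam + K + C * (x + 1).
have q0 : 0 <= q.
  by apply: addr_ge0; [exact: addr_ge0|rewrite mulr_ge0 // addr_ge0].
have q1 : 0 < q + 1 by rewrite ltr_wpDl.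
pose rho : R := Num.min 1 (eps / (q + 1)).
have rho0 : 0 < rho by rewrite lt_min ltr01 divr_gt0.
have rho1 : rho <= 1 by rewrite ge_min lexx.
have rhoE : rho * (q + 1) <= eps by rewrite -ler_pdivlMr // ge_min lexx orbT.
exists rho => // dx dt /andP[dx0 _] /andP[dt0 _] _ n j m nT.
rewrite sub0r normrN => tn cl.
have m0 : 0 <= m%:R * dx by rewrite mulr_ge0 // ltW.
apply: le_trans (H _ _ _ _ _ dx0 dt0 nT) _.
have n0 : 0 <= n%:R * dt by rewrite mulr_ge0 // ltW.
have {}tn : n%:R * dt <= rho by apply: le_trans (ltW tn); exact: ler_norm.
move: cl m0; set y := m%:R * dx => cl m0.
have [gg yx] : g0 j y <= g0 i x + Lam * rho /\ y <= x + rho.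
  have [g1 g2] := g0_lip; case: cl => [[ij xy]|xy].
    rewrite -ij; have := g2 i y x m0 x0; rewrite distrC ler_norml => /andP[G _].
    have G3 : Lam * `|y - x| <= Lam * rho by rewrite ler_wpM2l // distrC ltW.
    move: xy; rewrite ltr_norml => /andP[xy _].
    by split; move: xy G G3; lra_goal.
  have := g2 i x 0 x0 (lexx _); have := g2 j y 0 m0 (lexx _).
  rewrite (g1 i j) !subr0 (ger0_norm x0) (ger0_norm m0) !ler_norml => /andP[_ G1] /andP[G2 _].
  have G3 : Lam * (x + y) <= Lam * rho by rewrite ler_wpM2l // ltW.
  by split; move: xy m0 x0 G1 G2 G3; lra_goal.
have h2 : (K + C * y) * (n%:R * dt) <= (K + C * (x + 1)) * rho.
  apply: ler_pM => //; first by rewrite addr_ge0 // mulr_ge0.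
  by rewrite lerD2l ler_wpM2l // (le_trans yx) // lerD2l.
by move: gg h2 rhoE rho0; rewrite /q; lra_goal.
Qed.

Lemma scheme_near_le_c i t x c c' : c <= c' -> scheme_near_le i t x c -> scheme_near_le i t x c'.
Proof.
move=> cc [rho rho0 H]; exists rho => // dx dt d1 d2 d3 n j m nT tn cl.
by apply: le_trans cc; exact: H.
Qed.

(** Close to the vertex the branch does not matter; this serves both the switch of branches and the
    runs that leave the vertex. *)
Lemma scheme_near_vertex i t c : scheme_near_le i t 0 c ->
  exists2 rho : R, 0 < rho & forall j y, 0 <= y < rho -> scheme_near_le j t y c.
Proof.
move=> [rho rho0 H]; exists (rho / 2); first by rewrite divr_gt0.
have r2 : rho / 2 + rho / 2 = rho by field.
have rr : rho / 2 <= rho by lra.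
move=> j y /andP[y0 yr]; exists (rho / 2); first by rewrite divr_gt0.
move=> dx dt /andP[dx0 dx1] /andP[dt0 dt1] mesh n j' m nT tn cl; apply: (H dx dt) => //.
- by rewrite dx0 (lt_le_trans dx1).
- by rewrite dt0 (lt_le_trans dt1).
- by apply: (le_trans mesh); rewrite ler_wpM2r // ltW.
- exact: lt_le_trans rr.
right; rewrite add0r; case: cl => [[_]|].
  by rewrite ltr_norml => /andP[]; lra.
by lra.
Qed.

End SchemeUpper.

(** * Propagation of upper bounds along a trajectory *)

Section SchemeReach.
Context {R : realType} {V : normedModType R} {N : nat} (e : 'I_N -> V).
Context (L : 'I_N -> R -> R -> R) (L0 C T : R) (u0 : V -> R) (Lam : R).
Hypothesis e_unit : unit_directions e.
Hypotheses (C0 : 0 <= C) (L_lip : lipschitz_position L C).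
Hypotheses (L_conv : convex_lipschitz_lagrangian L).
Hypotheses (L_super : superlinear_lagrangian L).
Hypotheses (T0 : 0 <= T) (Lam0 : 0 <= Lam).

Let g0 (i : 'I_N) (k : R) := u0 (k *: e i).
Hypothesis g0_lip : lipschitz_data Lam g0.

Implicit Types (i j : 'I_N) (m n : nat) (t x y a c h s dx dt rho eps ell sig : R).

Let W := discrete_solution e L L0 u0.
Let near_le := scheme_near_le e L L0 T u0.

Lemma junction_tube_end (P : pred 'I_N) i j c ell K K1 t x a s h y S r :
  0 <= K -> 0 <= K1 -> 0 <= S -> 0 <= r <= 1 -> t <= s <= t + S -> `|s - t - h| <= 2 * r ->
  0 <= x + a * h -> 0 <= y -> (forall k, P k -> k = i) -> P i \/ x = 0 /\ a = 0 ->
  jclose r i (x + a * h) j y ->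
  junction_tube P c ell K K1 t x a j s y <= c + ell * h
    + r * (2 * `|ell| + K * (1 + S) * (2 + 2 * `|a|) ^+ 2 + K1 * (1 + S)).
Proof.
have marker : True by [].
move=> K0 K10 S0 /andP[r0 r1] /andP[ts sS] sh xa0 y0 Pi mode cl.
have st0 : 0 <= s - t by rewrite subr_ge0.
have st1 : 1 + (s - t) <= 1 + S by rewrite lerD2l lerBlDl.
have st2 : 0 <= 1 + (s - t) by rewrite addr_ge0.
have key w : `|w - (x + a * h)| <= r -> tube c ell K t x a s w <= c + ell * h
    + r * (2 * `|ell| + K * (1 + S) * (2 + 2 * `|a|) ^+ 2).
  move=> wr; rewrite /tube.
  have e1 : ell * (s - t) <= ell * h + `|ell| * (2 * r).
    have -> : ell * (s - t) = ell * h + ell * (s - t - h) by ring.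
    by rewrite lerD2l (le_trans (ler_norm _)) // normrM ler_wpM2l.
  have d1 : `|w - x - a * (s - t)| <= r * (2 + 2 * `|a|).
    have -> : w - x - a * (s - t) = (w - (x + a * h)) - a * (s - t - h) by ring.
    apply: le_trans (ler_normB _ _) _; rewrite normrM.
    have := ler_wpM2l (normr_ge0 a) sh; move: wr r0; lra_goal.
  have d2 : (w - x - a * (s - t)) * (w - x - a * (s - t)) <= r * (2 + 2 * `|a|) ^+ 2.
    have n0 : 0 <= `|w - x - a * (s - t)| by [].
    have := ler_pM n0 n0 d1 d1.
    rewrite -normrM ger0_norm; last by rewrite -expr2 sqr_ge0.
    move=> /le_trans; apply; rewrite mulrACA -expr2 ler_wpM2r ?sqr_ge0 //.
    by rewrite expr2 ler_piMl.
  have d3 : K * (1 + (s - t)) * ((w - x - a * (s - t)) * (w - x - a * (s - t)))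
      <= K * (1 + S) * (r * (2 + 2 * `|a|) ^+ 2).
    apply: ler_pM => //; [exact: mulr_ge0|by rewrite -expr2 sqr_ge0|].
    by rewrite ler_wpM2l.
  by move: e1 d3; lra_goal.
have y1 : K1 * (1 + (s - t)) * y <= K1 * (1 + S) * y.
  by rewrite ler_wpM2r // ler_wpM2l.
have K1S : 0 <= K1 * (1 + S) by rewrite mulr_ge0 // addr_ge0.
have K1Sr : 0 <= r * (K1 * (1 + S)) by rewrite mulr_ge0.
rewrite /junction_tube; case: ifPn => Pj.
  have yr : `|y - (x + a * h)| <= r.
    case: cl => [[_]|xy]; first by rewrite distrC => /ltW.
    by rewrite ler_norml; apply/andP; split; move: xy xa0 y0; lra_goal.
  by have := key y yr; move: K1Sr; lra_goal.
have [xr yr] : x + a * h <= r /\ y <= r.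
  case: cl => [[ij xy]|xy]; last by split; move: xy xa0 y0; lra_goal.
  case: mode => [|[x0 a0]]; first by rewrite ij (negbTE Pj).
  move: xy; rewrite x0 a0 mul0r addr0 sub0r normrN (ger0_norm y0) => /ltW.
  by [].
have := key 0 _; rewrite sub0r normrN ger0_norm // => /(_ xr).
by have := ler_wpM2l K1S yr; move: y1; lra_goal.
Qed.

(** The tube is propagated by the grid steps between [t] and [t + h]: [near_c] and the growth bound
    start it, [tube_step] carries it on, and at the end it differs from [c + ell * h] by at most
    [r * Q]. *)
Lemma scheme_near_run (P : pred 'I_N) i t x a h del c ell sig eps :
  0 <= t -> 0 <= x -> 0 < h -> 0 <= x + a * h -> 0 < del -> 0 < sig -> 0 < eps ->
  (forall k, P k -> k = i) ->
  [/\ P i, L i x a + C * `|a| * (h + del) + 2 * sig <= ell & a <= 0 \/ 0 < x] \/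
  [/\ ~~ P i, x = 0, a = 0 & L0 <= ell] ->
  near_le i t x c -> near_le i (t + h) (x + a * h) (c + ell * h + eps).
Proof.
have marker : True by [].
move=> t0 x0 h0 xa0 del0 sig0 eps0 Pi mode [rho rho0 near_c].
have [B [D [KL [B0 KL0 low vl]]]] :=
  scheme_lower_growth L0 e_unit C0 L_lip L_conv L_super T0 Lam0 g0_lip.
have [Bg Bg0 growth] := scheme_growth L0 e_unit C0 L_lip L_conv L_super T0 Lam0 g0_lip.
have [KU [KU0 _] up] := lagrangian_upper L0 L_conv L_lip.
pose S : R := h + del.
have S0 : 0 < S by rewrite addr_gt0.
pose M : R := `|c| + `|ell| * S.
have ellS : 0 <= `|ell| * S by rewrite mulr_ge0 // ltW.
have M0 : 0 <= M by rewrite addr_ge0.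
have cM : - M <= c - `|ell| * S by rewrite opprD lerD2r lerNl -normrN ler_norm.
have cM' : - M <= c by rewrite (le_trans cM) // gerBl.
pose K : R := (Bg * (1 + x) + M) / rho ^+ 2 + Bg / rho + (Bg + M) / x ^+ 2
  + 4 * (Bg * (1 + x) + M) / x ^+ 2 + C ^+ 2 / (4 * sig).
have BxM : 0 <= Bg * (1 + x) + M by rewrite addr_ge0 // mulr_ge0 // addr_ge0.
have k1 : 0 <= (Bg * (1 + x) + M) / rho ^+ 2 by rewrite divr_ge0 // sqr_ge0.
have k2 : 0 <= Bg / rho by rewrite divr_ge0 // ltW.
have k3 : 0 <= (Bg + M) / x ^+ 2 by rewrite divr_ge0 ?sqr_ge0 // addr_ge0.
have k4 : 0 <= 4 * (Bg * (1 + x) + M) / x ^+ 2 by rewrite divr_ge0 ?sqr_ge0 // mulr_ge0.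
have k5 : 0 <= C ^+ 2 / (4 * sig) by rewrite divr_ge0 ?sqr_ge0 // mulr_ge0 // ltW.
have K0 : 0 <= K by move: k1 k2 k3 k4 k5; rewrite /K; lra_goal.
pose G : R := `|ell| + 2 * `|a| * K * (1 + S) * (x + `|a| * S).
have G0 : 0 <= G.
  have aS : 0 <= `|a| * S by rewrite mulr_ge0 // ltW.
  have S1 : 0 <= 1 + S by rewrite addr_ge0 // ltW.
  have aK : 0 <= 2 * `|a| * K by rewrite mulr_ge0 // mulr_ge0.
  by rewrite /G addr_ge0 // mulr_ge0 ?addr_ge0 // mulr_ge0.
pose K1 : R := (Bg + M) / rho + Bg + (G + KU + C + sig).
have k6 : 0 <= (Bg + M) / rho by rewrite divr_ge0 ?(ltW rho0) // addr_ge0.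
have K10 : 0 <= K1 by move: k6 Bg0 G0 KU0 C0 (ltW sig0); rewrite /K1; lra_goal.
have BK1 : Bg <= K1 by move: k6 Bg0 G0 KU0 C0 (ltW sig0); rewrite /K1; lra_goal.
pose Q : R := 2 * `|ell| + K * (1 + S) * (2 + 2 * `|a|) ^+ 2 + K1 * (1 + S).
have KS : 0 <= K * (1 + S) by rewrite mulr_ge0 // addr_ge0 // ltW.
have Q0 : 0 <= Q.
  by rewrite !addr_ge0 // ?mulr_ge0 ?sqr_ge0 // addr_ge0 // ltW.
have Q1 : 0 < Q + 1 by rewrite ltr_wpDl.
have KS1 : 0 < K * (1 + S) + 1 by rewrite ltr_wpDl.
have a1 : 0 < 2 * (`|a| + 1) by rewrite mulr_gt0 // ltr_wpDl.
pose xx : R := if 0 < x then x else 1.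
have xx0 : 0 < xx by rewrite /xx; case: ifP.
(* The entries keep the start within [rho], the end within the duration [S], the final error [r * Q]
   below [eps], the interpolation error below [sig * dt] and one step shorter than [x / 2]; [h / 2]
   ensures that the first grid time precedes the last. *)
pose r : R := Num.min (Num.min (Num.min 1 rho) (Num.min del (h / 2)))
  (Num.min (eps / (Q + 1)) (Num.min (sig / (K * (1 + S) + 1)) (xx / (2 * (`|a| + 1))))).
have r0 : 0 < r by rewrite !lt_min ltr01 rho0 del0 !divr_gt0.
have /and4P[r1 rrho rdel rh] : [&& r <= 1, r <= rho, r <= del & r <= h / 2].
  by rewrite /r !ge_min !lexx !orbT.
have /and3P[] : [&& r <= eps / (Q + 1), r <= sig / (K * (1 + S) + 1) & r <= xx / (2 * (`|a| + 1))].
  by rewrite /r !ge_min !lexx !orbT.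
rewrite !ler_pdivlMr // => req rsig rxx.
exists r => // dx dt /andP[dx0 dxr] /andP[dt0 dtr] mesh n j m nT tn cl.
(* The first grid time strictly after [t], hence at most [dt] later, where [near_c] applies. *)
pose n1 := (Num.truncn (t / dt)).+1; pose t1 : R := n1%:R * dt.
have tdt : 0 <= t / dt by rewrite divr_ge0 // ltW.
have /andP[tr1 tr2] := truncn_itv tdt.
have t1t : t < t1 by rewrite -ltr_pdivrMr.
have t1dt : t1 <= t + dt.
  by rewrite /t1 /n1 -natr1 mulrDl mul1r lerD2r -ler_pdivlMr.
move: (tn); rewrite ltr_norml => /andP[tn1 tn2].
have n1n : (n1 <= n)%N.
  rewrite ltnW // -(ltr_nat R) -(ltr_pM2r dt0) -/t1.
  by move: t1dt tn2 rh dtr; lra_goal.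
have stepS k : (k <= n)%N -> k%:R * dt <= t1 + S.
  move=> kn; apply: (@le_trans _ _ (n%:R * dt)); first by rewrite ler_wpM2r ?(ltW dt0) // ler_nat.
  by move: tn1 t1t rdel; rewrite /S; lra_goal.
have kT k : (k <= n)%N -> k%:R * dt <= T.
  by move=> kn; apply: le_trans nT; rewrite ler_wpM2r ?(ltW dt0) // ler_nat.
have grid0 l : 0 <= l%:R * dx by rewrite mulr_ge0 // ltW.
have mesh1 : K * (1 + S) * dx ^+ 2 <= sig * dt.
  apply: (@le_trans _ _ (K * (1 + S) * (r * dt))); first exact: ler_wpM2l.
  have rd : 0 <= r by exact: ltW.
  by rewrite mulrA ler_wpM2r ?(ltW dt0) //; move: rsig rd; lra_goal.
have mesh_a : 0 < x -> `|a| * dt <= x / 2.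
  move=> xp; move: rxx; rewrite /xx xp => rxx.
  have : `|a| * dt <= `|a| * r by rewrite ler_wpM2l // ltW.
  by move: rxx (ltW r0); lra_goal.
have dt1 : dt <= 1 by exact: le_trans (ltW dtr) r1.
have run k : (n1 + k <= n)%N -> forall j m, W dx dt (n1 + k) ((m%:R * dx) *: e j)
    <= junction_tube P c ell K K1 t1 x a j ((n1 + k)%:R * dt) (m%:R * dx).
  elim: k => [|k IH] kn j' m'.
    rewrite addn0 -/t1; apply: (@tube_initial R N P i j' x _ _ c ell K K1 t1 a Bg M rho) => //.
    - exact: Pi.
    - by move: k4 k5; rewrite /K; lra_goal.
    - by move: G0 KU0 C0 (ltW sig0); rewrite /K1; lra_goal.
    - by apply: growth => //; exact: kT.
    - apply: near_c; rewrite ?dx0 ?dt0 ?(lt_le_trans dxr) ?(lt_le_trans dtr) //.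
      + by apply: (le_trans mesh); rewrite ler_wpM2r // ltW.
      + exact: kT.
      + by rewrite -/t1 ltr_norml; apply/andP; split; move: t1t t1dt dtr rrho rho0; lra_goal.
  have kn' : (n1 + k < n)%N by rewrite -addnS.
  have sE : (n1 + k.+1)%:R * dt = (n1 + k)%:R * dt + dt.
    by rewrite addnS -natr1 mulrDl mul1r.
  rewrite sE addnS /=.
  apply: (@tube_step _ _ _ e L L0 C e_unit C0 L_lip dx dt D B KL KU _ dx0 dt0 B0 KL0
    (vl _ _ _ dx0 dt0 (kT _ (ltnW kn'))) low KU0 up P i c ell K K1 t1 x a S sig Bg M) => //.
  - by rewrite /t1 ler_wpM2r ?(ltW dt0) // ler_nat leq_addr.
  - by rewrite -sE stepS.
  - by move=> _; move: k1 k2 k3 k5; rewrite /K; lra_goal.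
  - by move: k1 k2 k3 k4; rewrite /K; lra_goal.
  - by move: k6 Bg0; rewrite /K1 /G; lra_goal.
  - exact: IH (ltnW kn').
  - by move=> j'' m''; apply: (growth dx dt (n1 + k).+1) => //; exact: kT.
have := run (n - n1)%N; rewrite subnKC // => /(_ (leqnn _) j m) /le_trans; apply.
have sh : `|n%:R * dt - t1 - h| <= 2 * r.
  by rewrite ler_norml; apply/andP; split; move: t1t t1dt dtr tn1 tn2 r0; lra_goal.
have si : t1 <= n%:R * dt <= t1 + S.
  by rewrite stepS // andbT /t1 ler_wpM2r ?(ltW dt0) // ler_nat.
have mode' : P i \/ x = 0 /\ a = 0 by case: mode => [[]|[]]; [left|right].
have r01 : 0 <= r <= 1 by rewrite (ltW r0).
apply: le_trans (junction_tube_end c ell K0 K10 (ltW S0) r01 si sh xa0 (grid0 m) Pi mode' cl) _.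
by rewrite -/Q lerD2l; move: req (ltW r0); lra_goal.
Qed.

Lemma scheme_near_stay i t h c eps : 0 <= t -> 0 <= h -> 0 < eps ->
  near_le i t 0 c -> near_le i (t + h) 0 (c + h * L0 + eps).
Proof.
move=> t0; rewrite le_eqVlt => /orP[/eqP <-|h0] eps0 near_c.
  by rewrite mul0r !addr0; apply: scheme_near_le_c near_c; rewrite lerDl ltW.
have := @scheme_near_run pred0 i t 0 0 h 1 c L0 1 eps t0 (lexx _) h0.
by rewrite mul0r addr0 (mulrC h); apply => //; right.
Qed.

Lemma scheme_near_move i t x a h c eps : 0 <= t -> 0 <= x -> 0 < h -> 0 <= x + a * h ->
  a <= 0 \/ 0 < x -> 0 < eps -> near_le i t x c ->
  near_le i (t + h) (x + a * h) (c + move_cost L C i x a h + eps).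
Proof.
have marker : True by [].
move=> t0 x0 h0 xa0 ax eps0 near_c.
(* With [del = eps / q] as both excess duration and slack, the additional cost
   [del * h * (C * |a| + 2)] is at most [eps / 2]. *)
pose q : R := 2 * (h * (C * `|a| + 2) + 1).
have q1 : 0 < q.
  by rewrite mulr_gt0 // ltr_wpDl // mulr_ge0 ?(ltW h0) // addr_ge0 // mulr_ge0.
pose del : R := eps / q.
have del0 : 0 < del by rewrite divr_gt0.
have eps2 : 0 < eps / 2 by rewrite divr_gt0.
have := scheme_near_run (P := pred1 i) (del := del) (c := c) t0 x0 h0 xa0 del0 del0 eps2.
move=> /(_ i (L i x a + C * `|a| * (h + del) + 2 * del)) H.
apply: scheme_near_le_c (H _ _ near_c).
- have : del * q = eps by rewrite /del divfK // gt_eqF.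
  by rewrite /q /move_cost expr2; move: del0; lra_goal.
- by move=> k /= /eqP.
- by left; split => //=.
Qed.

(** Induction on the trajectory with [eps] kept general, so that each piece can ask for a fraction
    of the error. A run leaving the vertex is started at a nearby point, where [scheme_near_vertex]
    transfers the bound. *)
Lemma scheme_near_reach i t x c eps : reach L L0 C g0 i t x c -> 0 < eps ->
  near_le i t x (c + eps).
Proof.
have marker : True by [].
move=> r; elim: r eps => {i t x c} [i x x0|i t x c a h r IH h0 xa|i t c h r IH h0|i j t c r IH] eps eps0.
- exact: (scheme_near_start L0 e_unit C0 L_lip L_conv L_super T0 Lam0 g0_lip).
- have [t0 x0] := reach_ge0 r.
  have eps3 : 0 < eps / 3 by rewrite divr_gt0.
  move: h0; rewrite le_eqVlt => /orP[/eqP hE|h0].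
    rewrite -hE mulr0 !addr0 /move_cost mul0r expr0n mulr0 !addr0; exact: IH.
  have [ax|/not_orP[/negP a0 /negP x0']] := pselect (a <= 0 \/ 0 < x).
    apply: scheme_near_le_c (scheme_near_move t0 x0 h0 xa ax eps3 (IH _ eps3)).
    by move: eps3; lra_goal.
  have ap : 0 < a by rewrite ltNge.
  have xE : x = 0 by apply/eqP; rewrite eq_le x0 andbT leNgt.
  have [del del0 Hdel] := move_cost_vertex_limit C0 L_lip L_conv i ap h0 eps3.
  move: IH; rewrite xE => IH.
  have [rho rho0 near_c] := scheme_near_vertex (IH _ eps3).
  pose x' : R := Num.min del rho / 2.
  have m0 : 0 < Num.min del rho by rewrite lt_min del0.
  have x'0 : 0 < x' by rewrite divr_gt0.
  have x'm : x' < Num.min del rho by rewrite /x'; lra.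
  have x'd : 0 < x' < del by rewrite x'0 (lt_le_trans x'm) // ge_min lexx.
  have x'r : 0 <= x' < rho by rewrite (ltW x'0) (lt_le_trans x'm) // ge_min lexx orbT.
  have [a' a'E cost] := Hdel x' x'd.
  have xa' : 0 <= x' + a' * h by rewrite a'E mulr_ge0 // ltW.
  have := scheme_near_move t0 (ltW x'0) h0 xa' (or_intror x'0) eps3 (near_c i x' x'r).
  rewrite add0r a'E; apply: scheme_near_le_c; move: cost; lra_goal.
- have [t0 _] := reach_ge0 r.
  have eps2 : 0 < eps / 2 by rewrite divr_gt0.
  by apply: scheme_near_le_c (scheme_near_stay t0 h0 eps2 (IH _ eps2)); move: eps2; lra_goal.
- have [rho rho0 H] := scheme_near_vertex (IH _ eps0).
  by apply: H; rewrite lexx.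
Qed.

Lemma scheme_near_le_value i t x eps : 0 <= t -> 0 <= x -> 0 < eps ->
  near_le i t x (value_function L L0 C g0 i t x + eps).
Proof.
move=> t0 x0 eps0; have eps2 : 0 < eps / 2 by rewrite divr_gt0.
have [c r cU] := value_near_reach (L0 := L0) C0 L_lip L_conv L_super g0_lip i t0 x0 eps2.
have cc : c + eps / 2 <= value_function L L0 C g0 i t x + eps by lra.
exact: scheme_near_le_c cc (scheme_near_reach r eps2).
Qed.

End SchemeReach.

(** * Lower bound for the scheme *)

Section SchemeLower.
Context {R : realType} {V : normedModType R} {N : nat} (e : 'I_N -> V).
Context (L : 'I_N -> R -> R -> R) (L0 C : R).
Hypothesis e_unit : unit_directions e.
Hypotheses (C0 : 0 <= C) (L_lip : lipschitz_position L C).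
Implicit Types (i j : 'I_N) (m n : nat) (t x y z a b c h s dx dt rho eps r eta : R).

(** Both nodes are expanded around the interpolation point, where the first order terms cancel. *)
Lemma interp_error (F Ft Fx : R -> R -> R) M t p d r :
  (forall t x, is_derive t (1 : R) (F^~ x) (Ft t x) /\
               is_derive x (1 : R) (F t) (Fx t x)) ->
  lipschitz2 M Ft -> lipschitz2 M Fx -> 0 <= r <= 1 -> 0 <= d ->
  F t (p + r * d) - M * d ^+ 2 <= (1 - r) * F t p + r * F t (p + d).
Proof.
have marker : True by [].
move=> dF FtL FxL /andP[r0 r1] d0; have M0 := lipschitz2_ge0 FtL.
have r2 : 0 <= 1 - r by rewrite subr_ge0.
have b1 := taylor_bound t (p + r * d) 0 (- (r * d)) dF FtL FxL.
have b2 := taylor_bound t (p + r * d) 0 ((1 - r) * d) dF FtL FxL.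
move: b1 b2; rewrite addrK addr0 !normr0 !mul0r !add0r.
rewrite (_ : p + r * d + (1 - r) * d = p + d); last by ring.
rewrite !real_normK ?num_real // !ler_norml => /andP[+ _] /andP[+ _].
move=> /(ler_wpM2l r2) b1 /(ler_wpM2l r0) b2.
have b3 : M * d ^+ 2 * (r * (1 - r)) <= M * d ^+ 2.
  rewrite ler_piMr ?mulr_ge0 ?sqr_ge0 //.
  by rewrite -[X in _ <= X]mulr1; apply: ler_pM => //; rewrite gerBl.
by move: b1 b2 b3; rewrite !expr2; lra_goal.
Qed.

Section LowerStep.
Context (F Ft Fx : 'I_N -> R -> R -> R) (M T r1 r2 eta : R).
Context (dx dt D B K KM A s E : R) (v : V -> R).
Hypotheses (dx0 : 0 < dx) (dx1 : dx <= 1) (dt0 : 0 < dt) (dt1 : dt <= 1).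
Hypotheses (eta0 : 0 < eta) (E0 : 0 <= E).
Hypothesis F_smooth :
  forall i, [/\ lipschitz2 M (F i), lipschitz2 M (Ft i) & lipschitz2 M (Fx i)].
Hypothesis F_derive : forall i t x, is_derive t (1 : R) ((F i)^~ x) (Ft i t x) /\
                    is_derive x (1 : R) (F i t) (Fx i t x).
Hypothesis F_vertex : forall i j t, 0 <= t <= T -> F i t 0 = F j t 0.
Hypothesis F_move : forall i t x a h, 0 <= t -> 0 <= h -> t + h <= T -> 0 <= x <= r2 ->
  0 <= x + a * h <= r2 ->
  F i (t + h) (x + a * h) <= F i t x + move_cost L C i x a h + eta * h.
Hypothesis F_stay : forall i t h, 0 <= t -> 0 <= h -> t + h <= T ->
  F i (t + h) 0 <= F i t 0 + h * L0.
Hypotheses (B0 : 0 <= B) (K0 : 0 <= K) (K0L : - L0 <= K) (vl : grid_lower e dx D B v).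
Hypothesis low : forall i x a, 0 <= x -> (B + 1) * `|a| - K - C * x <= L i x a.
Hypothesis low_M : forall i x a, 0 <= x -> (M + 1) * `|a| - KM - C * x <= L i x a.
Hypotheses (A_big : M + KM + C * r2 <= A) (A_dt : 2 * (C * A) * dt <= eta).
Hypotheses (s0 : 0 <= s) (sT : s + dt <= T) (mesh : M * dx ^+ 2 <= eta * dt).
Hypotheses (r10 : 0 <= r1) (r12 : r1 <= r2 - 1).
Hypothesis far : forall i t y, 0 <= t <= T -> 0 <= y <= r1 ->
  F i t y <= - (D + B * y) + (r2 - 1 - y) - (K + C * y).
Hypothesis v_ge : forall j m, m%:R * dx <= r2 -> F j s (m%:R * dx) - E <= v ((m%:R * dx) *: e j).

Let sT' : 0 <= s <= T.
Proof. by rewrite s0 /=; apply: le_trans sT; rewrite lerDl ltW. Qed.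

(** The upper node may lie [dx <= 1] beyond [z], whence the restriction to [r2 - 1]; the
    interpolation error [M * dx ^+ 2] is within [eta * dt] by the mesh condition. *)
Lemma interp_ge_smooth i z : 0 <= z <= r2 - 1 ->
  F i s z - (E + eta * dt) <= interp dx v (z *: e i).
Proof.
have marker : True by [].
move=> /andP[z0 zr]; have [m [r r01 [zE ->]]] := interp_point e_unit dx0 v i z0.
have [F1 F2 F3] := F_smooth i; have /andP[rr0 rr1] := r01.
have := interp_error s (m%:R * dx) (F_derive i) F2 F3 r01 (ltW dx0).
rewrite -mulrDl -zE.
have mE : m.+1%:R * dx = m%:R * dx + dx by rewrite -natr1 mulrDl mul1r.
have rdx : 0 <= r * dx by rewrite mulr_ge0 // ltW.
have m1 : m.+1%:R * dx <= r2.
  by rewrite mE; move: zE zr dx1 rdx; rewrite mulrDl; lra_goal.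
have m0 : m%:R * dx <= r2 by apply: le_trans m1; rewrite mE lerDl ltW.
have r1' : 0 <= 1 - r by rewrite subr_ge0.
have := ler_wpM2l r1' (v_ge i m0); have := ler_wpM2l rr0 (v_ge i m1).
by rewrite mE; move: mesh; lra_goal.
Qed.

(* Fast motions are excluded by the superlinear growth of L. *)
Lemma smooth_arrival i t y a h : 0 <= t -> 0 <= h -> t + h <= T -> h <= dt -> 0 <= y <= r2 ->
  0 <= y - a * h <= r2 ->
  F i (t + h) y <= F i t (y - a * h) + h * L i y a + 2 * eta * h.
Proof.
have marker : True by [].
move=> t0 h0 hT hdt /andP[y0 yr] zr; have /andP[z0 _] := zr.
have eta0' := ltW eta0.
have [aA|aA] := leP `|a| A.
  have := F_move i (a := a) t0 h0 hT zr; rewrite subrK y0 yr => /(_ isT).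
  have := L_lip i a z0 y0; rewrite addrAC subrr sub0r normrN normrM (ger0_norm h0).
  rewrite ler_norml => /andP[_ /(ler_wpM2l h0) h1].
  have p1 : C * `|a| * h <= C * A * dt.
    by apply: ler_pM => //; [exact: mulr_ge0|rewrite ler_wpM2l].
  have h2 := ler_wpM2l h0 p1; have h3 := ler_wpM2l h0 A_dt.
  by move: h1 h2 h3; rewrite /move_cost expr2; lra_goal.
have [F1 _ _] := F_smooth i.
have := F1 (t + h) t y (y - a * h).
rewrite addrAC subrr add0r (_ : y - (y - a * h) = a * h); last by ring.
rewrite normrM (ger0_norm h0) ler_norml => /andP[_ h1].
have := low_M i a y0 => h2.
have h3 : C * y <= C * r2 by rewrite ler_wpM2l.
have h4 : M * (1 + `|a|) <= L i y a by move: A_big aA h2 h3; lra_goal.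
have := ler_wpM2l h0 h4; have := mulr_ge0 eta0' h0.
by move: h1; lra_goal.
Qed.

(** Backward steps ending within [r2 - 1] are estimated by the suboptimality of [F]. Those ending
    further out are expensive: the slope [B + 1] in the bound on [L] beats the growth [B] of [v] by
    the distance travelled, and [far] puts [F] below the result. *)
Lemma scheme_step_ge j m : 0 <= m%:R * dx <= r1 ->
  F j (s + dt) (m%:R * dx) - (E + 3 * eta * dt) <= scheme e L L0 dx dt v ((m%:R * dx) *: e j).
Proof.
have marker : True by [].
have dtp : 0 <= dt by exact: ltW.
have eta0' := ltW eta0; have eta_dt := mulr_ge0 eta0' dtp.
set y := m%:R * dx => /andP[y0 yr1].
have yr2 : y <= r2 - 1 by exact: le_trans r12.
have yr2' : 0 <= y <= r2 by rewrite y0; move: yr2; lra_goal.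
have sdt : 0 <= s + dt <= T by rewrite addr_ge0.
have yi : 0 <= y <= r1 by rewrite y0.
have Ffar := far j sdt yi.
have Cy : 0 <= C * y by rewrite mulr_ge0.
have dKC : dt * (K + C * y) <= K + C * y by rewrite ler_piMl // addr_ge0.
(* The part common to all steps through the vertex: [th] is the time on the branch [i] before the
   vertex, [s0'] the stay, and [rest] the cost of the remaining time, spent between the vertex and
   [y]. *)
have vertex i th s0' b rest : b <= 0 -> 0 <= th -> 0 <= s0' -> th + s0' <= dt ->
   F j (s + dt) y <= F i (s + th + s0') 0 + rest + 2 * eta * (dt - th - s0') ->
   - ((dt - th - s0') * (K + C * y)) <= rest ->
   F j (s + dt) y - (E + 3 * eta * dt)
     <= interp dx v (- (th * b) *: e i) + th * L i 0 b + s0' * L0 + rest.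
  move=> b0 th0 s0'0 thdt Fr rest0.
  have z0 : 0 <= - (th * b) by rewrite -mulrN mulr_ge0 // oppr_ge0.
  have [zr|zr] := leP (- (th * b)) (r2 - 1).
    have zi : 0 <= - (th * b) <= r2 - 1 by rewrite z0.
    have f1 := interp_ge_smooth i zi.
    have ths : s + th + s0' <= T by move: thdt sT; lra_goal.
    have f2 := @F_stay i (s + th) s0' (addr_ge0 s0 th0) s0'0 ths.
    have r20 : 0 <= (0 : R) <= r2 by rewrite lexx; move: r10 r12; lra_goal.
    have zi2 : 0 <= 0 - b * th <= r2.
      by rewrite sub0r mulrC z0; move: zr; lra_goal.
    have sth : s + th <= T by move: ths s0'0; lra_goal.
    have thd : th <= dt by move: thdt s0'0; lra_goal.
    have := smooth_arrival i s0 th0 sth thd r20 zi2.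
    rewrite sub0r (mulrC b) => f3.
    have e1 := mulr_ge0 eta0' th0; have e2 := mulr_ge0 eta0' s0'0.
    by move: Fr f1 f2 f3 e1 e2; lra_goal.
  have f1 := interp_lower e_unit dx0 i vl z0.
  have := ler_wpM2l th0 (low i b (lexx 0)); rewrite (ler0_norm b0) mulr0 subr0 => f2.
  have f3 := ler_wpM2l s0'0 K0L.
  have By : 0 <= B * y by rewrite mulr_ge0.
  have ths : 0 <= (th + s0') * (C * y) by rewrite mulr_ge0 // addr_ge0.
  by move: Ffar f1 f2 f3 By ths rest0 dKC zr E0 eta_dt y0; lra_goal.
move: y0; rewrite le_eqVlt => /orP[/eqP yE|y0].
  rewrite -yE scale0r; apply: (scheme_ge_vertex dt0 j) => i s0' b /andP[s0'0 s0'd] b0.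
  have := @vertex i (dt - s0') s0' b 0 b0; rewrite -yE !addr0; apply => //.
  - by rewrite subr_ge0.
  - by rewrite subrK.
  - rewrite -addrA subrK (F_vertex j i sdt) (_ : dt - (dt - s0') - s0' = 0); last by ring.
    by rewrite mulr0 addr0.
  - by rewrite mulr0 addr0 (_ : dt - (dt - s0') - s0' = 0) ?mul0r ?oppr0 //; ring.
apply: (scheme_ge e_unit dt0 y0) => [a ay|i a s0' b ay /andP[s0'0 s0'd] b0].
  have z0 : 0 <= y - a * dt by rewrite subr_ge0 -ler_pdivlMr // ltW.
  have [zr|zr] := leP (y - a * dt) (r2 - 1).
    have zi : 0 <= y - a * dt <= r2 - 1 by rewrite z0.
    have f1 := interp_ge_smooth j zi.
    have zi2 : 0 <= y - a * dt <= r2 by rewrite z0; move: zr; lra_goal.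
    have f2 := smooth_arrival j s0 dtp sT (lexx _) yr2' zi2.
    by move: f1 f2; lra_goal.
  have f1 := interp_lower e_unit dx0 j vl z0.
  have f2 := ler_wpM2l dtp (low j a (ltW y0)).
  have f3 : - (a * dt) <= `|a| * dt by rewrite -mulNr ler_wpM2r // -normrN ler_norm.
  have f4 := ler_wpM2l B0 f3.
  by move: Ffar f1 f2 f3 f4 dKC zr E0 eta_dt; lra_goal.
have a0 : 0 < a by apply: lt_le_trans ay; rewrite divr_gt0.
pose tau : R := y / a; have tau0 : 0 <= tau by rewrite divr_ge0 // ltW.
have tauE : a * tau = y by rewrite /tau mulrC divfK // gt_eqF.
rewrite -/tau in s0'd *.
have th0 : 0 <= dt - s0' - tau by move: s0'd; rewrite -/tau; lra_goal.
apply: vertex => //.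
- by move: tau0; lra_goal.
- have z2 : 0 <= y - a * tau <= r2 by rewrite tauE subrr lexx; move: r10 r12; lra_goal.
  have taud : tau <= dt by move: th0 s0'0; lra_goal.
  have t1 : 0 <= s + (dt - s0' - tau) + s0' by apply: addr_ge0 => //; exact: addr_ge0.
  have t2 : s + (dt - s0' - tau) + s0' + tau = s + dt by ring.
  have t3 : s + (dt - s0' - tau) + s0' + tau <= T by rewrite t2.
  have := smooth_arrival j t1 tau0 t3 taud yr2' z2.
  rewrite t2 tauE subrr (F_vertex j i); last first.
    by rewrite t1; move: t3 tau0; lra_goal.
  by rewrite (_ : dt - (dt - s0' - tau) - s0' = tau) //; ring.
- rewrite (_ : dt - (dt - s0' - tau) - s0' = tau); last by ring.
  have := ler_wpM2l tau0 (low j a (ltW y0)).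
  have : 0 <= tau * ((B + 1) * `|a|).
    by apply: mulr_ge0 => //; apply: mulr_ge0 => //; exact: addr_ge0.
  by lra_goal.
Qed.

End LowerStep.
Section SchemeValue.
Context (T : R) (u0 : V -> R) (Lam : R).
Hypotheses (L_conv : convex_lipschitz_lagrangian L).
Hypotheses (L_super : superlinear_lagrangian L).
Hypotheses (T0 : 0 <= T) (Lam0 : 0 <= Lam).

Let g0 (i : 'I_N) (k : R) := u0 (k *: e i).
Hypothesis g0_lip : lipschitz_data Lam g0.

(** The order of the constants matters: [r1] does not depend on [r2], so [r2] can be taken large
    compared with the bounds on [0, r1]; the smoothness constant [M], and with it the admissible
    meshes, are known only after [r2]. *)
Lemma scheme_ge_value r eps : 0 <= r -> 0 < eps -> exists2 rho : R, 0 < rho &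
  forall dx dt, 0 < dx < rho -> 0 < dt < rho -> dx ^+ 2 <= rho * dt ->
  forall n j m, n%:R * dt <= T -> m%:R * dx <= r ->
    value_function L L0 C g0 j (n%:R * dt) (m%:R * dx) - eps
      <= discrete_solution e L L0 u0 dx dt n ((m%:R * dx) *: e j).
Proof.
have marker : True by [].
move=> r0 eps0.
have [B [D [K0 [B0 _ _ vl]]]] :=
  scheme_lower_growth L0 e_unit C0 L_lip L_conv L_super T0 Lam0 g0_lip.
(* One [eta] is lost at the initial time, one in the approximation of the value function, and
   [3 * eta * dt] in each step. *)
pose eta : R := eps / (2 + 3 * T).
have T2 : 0 < 2 + 3 * T by move: T0; rewrite -(ler_pM2l (ltr0Sn R 2)); lra_goal.
have eta0 : 0 < eta by rewrite divr_gt0.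
have etaE : eta * (2 + 3 * T) = eps by rewrite /eta divfK // gt_eqF.
pose B1 : R := `|D| + B.
have B10 : 0 <= B1 by rewrite addr_ge0.
have [r1 rr1 H] := smooth_subsolution (L0 := L0) C0 L_lip L_conv L_super Lam0 g0_lip T0 r0 B10 eta0.
have [KU [KU0 _] up] := lagrangian_upper L0 L_conv L_lip.
have [K [K0' K0L] low] := lagrangian_lower L0 L_conv L_super C0 L_lip (B + 1).
have r10 : 0 <= r1 by exact: le_trans rr1.
pose Phi : R := `|u0 0| + Lam * r1 + eta + T * (KU + C * r1) + eta * T.
have Phi0 : 0 <= Phi.
  have := mulr_ge0 Lam0 r10; have := mulr_ge0 C0 r10 => c1.
  have := mulr_ge0 T0 (addr_ge0 KU0 c1); have := mulr_ge0 (ltW eta0) T0.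
  by have := normr_ge0 (u0 0); move: (ltW eta0); rewrite /Phi; lra_goal.
(* [Phi] bounds [F] on [0, r1], and the terms added to it are those of [far]. *)
pose r2 : R := r1 + 1 + (Phi + `|D| + B * r1 + r1 + K + C * r1).
have r12 : r1 <= r2 - 1.
  have := mulr_ge0 B0 r10; have := mulr_ge0 C0 r10; have := normr_ge0 D.
  by move: Phi0 r10 K0'; rewrite /r2; lra_goal.
have r12' : r1 <= r2 by move: r12; lra_goal.
have [F [Ft [Fx [M [F_smooth F_derive F_vertex [F_move F_stay] [F_value F_init F_far]]]]]] := H r2 r12'.
have [M0|M0] := leP 0 M; last first.
  exists 1 => // dx dt _ _ _ n j m; have [Fl _ _] := F_smooth j.
  by have := lipschitz2_ge0 Fl; rewrite leNgt M0.
have [KM [KM0 _] low_M] := lagrangian_lower L0 L_conv L_super C0 L_lip (M + 1).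
pose A : R := M + KM + C * r2.
have r20 : 0 <= r2 by exact: le_trans r12'.
have A0 : 0 <= A.
  by have := mulr_ge0 C0 r20; move: M0 KM0; rewrite /A; lra_goal.
have CA : 0 <= 2 * (C * A) by rewrite mulr_ge0 // mulr_ge0.
have CA1 : 0 < 2 * (C * A) + 1 by rewrite ltr_wpDl.
have M1 : 0 < M + 1 by rewrite ltr_wpDl.
pose rho : R := Num.min 1 (Num.min (eta / (2 * (C * A) + 1)) (eta / (M + 1))).
have rho0 : 0 < rho by rewrite !lt_min ltr01 !divr_gt0.
have rho1 : rho <= 1 by rewrite ge_min lexx.
have rhoA : rho * (2 * (C * A) + 1) <= eta by rewrite -ler_pdivlMr // !ge_min lexx !orbT.
have rhoM : rho * (M + 1) <= eta by rewrite -ler_pdivlMr // !ge_min lexx !orbT.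
exists rho => // dx dt /andP[dx0 dxr] /andP[dt0 dtr] mesh n.
have dx1 : dx <= 1 by exact: le_trans (ltW dxr) rho1.
have dt1 : dt <= 1 by exact: le_trans (ltW dtr) rho1.
have eta0' := ltW eta0.
have mesh1 : M * dx ^+ 2 <= eta * dt.
  apply: (@le_trans _ _ (M * (rho * dt))); first exact: ler_wpM2l.
  rewrite mulrA ler_wpM2r ?(ltW dt0) //; move: rhoM (ltW rho0); lra_goal.
have A_dt : 2 * (C * A) * dt <= eta.
  have : 2 * (C * A) * dt <= 2 * (C * A) * rho by rewrite ler_wpM2l // ltW.
  by move: rhoA (ltW rho0); lra_goal.
have F_vertex' i j t : 0 <= t <= T -> F i t 0 = F j t 0.
  by move=> /andP[t0 tT]; case: (F_vertex i j t); rewrite ?tT ?andbT // (le_trans _ t0) // mulr_le0_ge0 // ?oppr_le0.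
have far i t y : 0 <= t <= T -> 0 <= y <= r1 ->
    F i t y <= - (D + B * y) + (r2 - 1 - y) - (K + C * y).
  move=> /andP[t0 tT] /andP[y0 yr].
  have yr2 : 0 <= y <= r2 by rewrite y0 (le_trans yr).
  have := F_move i 0 y 0 t (lexx _) t0; rewrite add0r mul0r addr0 => /(_ tT yr2 yr2).
  rewrite /move_cost normr0 mulr0 mul0r addr0.
  have := initial_growth g0_lip i y0; rewrite -/(g0 i y); have := F_init i y yr2 => Fi.
  rewrite ler_norml => /andP[_]; move: Fi.
  have := up i y 0 y0; rewrite normr0 => /(_ ler01) /(ler_wpM2l t0).
  have c1 : C * y <= C * r1 by rewrite ler_wpM2l.
  have KC : 0 <= KU + C * r1 by rewrite addr_ge0 // mulr_ge0.
  have : t * (KU + C * y) <= T * (KU + C * r1).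
    apply: (@le_trans _ _ (t * (KU + C * r1))); first by rewrite ler_wpM2l // lerD2l.
    by rewrite ler_wpM2r.
  have : eta * t <= eta * T by rewrite ler_wpM2l.
  have : Lam * y <= Lam * r1 by rewrite ler_wpM2l.
  have : B * y <= B * r1 by rewrite ler_wpM2l.
  have := ler_norm D; have := ler_norm (u0 0); move: c1 yr r10; rewrite /r2 /Phi.
  lra_goal.
have key : n%:R * dt <= T -> forall j m, m%:R * dx <= r2 ->
    F j (n%:R * dt) (m%:R * dx) - (eta + 3 * eta * (n%:R * dt))
      <= discrete_solution e L L0 u0 dx dt n ((m%:R * dx) *: e j).
  elim: n => [_ j m mr|n IH nT j m mr].
    rewrite mul0r mulr0 addr0 /= lerBlDr; apply: F_init.
    by rewrite mr mulr_ge0 // ltW.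
  have nE : n.+1%:R * dt = n%:R * dt + dt by rewrite -natr1 mulrDl mul1r.
  have nT' : n%:R * dt <= T by apply: le_trans nT; rewrite nE lerDl ltW.
  have n0 : 0 <= n%:R * dt by rewrite mulr_ge0 // ltW.
  have m0 : 0 <= m%:R * dx by rewrite mulr_ge0 // ltW.
  have E0 : 0 <= eta + 3 * eta * (n%:R * dt).
    by rewrite addr_ge0 // mulr_ge0 // mulr_ge0.
  (* Beyond [r1] no step is estimated: there [F] is below the a priori lower bound of the scheme, by
     the choice of [B1]. *)
  have [mr1|mr1] := leP (m%:R * dx) r1.
    have mi : 0 <= m%:R * dx <= r1 by rewrite m0.
    rewrite nE in nT *.
    have := @scheme_step_ge F Ft Fx M T r1 r2 eta dx dt D B K KM A (n%:R * dt) _ _ dx0 dx1 dt0 dt1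
      eta0 E0 F_smooth F_derive F_vertex' F_move F_stay B0 K0' K0L (vl _ _ _ dx0 dt0 nT') low low_M
      (lexx _) A_dt n0 nT mesh1 r10 r12 far (IH nT') j m mi.
    by rewrite /=; lra_goal.
  have ni : 0 <= n.+1%:R * dt <= T by rewrite nT mulr_ge0 // ltW.
  have mi : r1 <= m%:R * dx <= r2 by rewrite mr ltW.
  have := F_far j _ _ ni mi; have := vl _ _ _ dx0 dt0 nT j m.
  have : 0 <= 3 * eta * (n.+1%:R * dt).
    by apply: mulr_ge0; [exact: mulr_ge0|case/andP: ni].
  have := mulr_ge0 (normr_ge0 D) m0; have := ler_norm D; rewrite /B1; move: B0.
  lra_goal.
move=> j m nT mr.
have n0 : 0 <= n%:R * dt by rewrite mulr_ge0 // ltW.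
have m0 : 0 <= m%:R * dx by rewrite mulr_ge0 // ltW.
have ni : 0 <= n%:R * dt <= T by rewrite n0.
have mi : 0 <= m%:R * dx <= r by rewrite m0.
have := F_value j _ _ ni mi; have := key nT j m (le_trans mr (le_trans rr1 r12')).
have : eta * (n%:R * dt) <= eta * T by rewrite ler_wpM2l.
by move: etaE; lra_goal.
Qed.

End SchemeValue.
End SchemeLower.

(** * The value function is a solution *)

Section TestFunctions.
Context {R : realType} {V : normedModType R} {N : nat} (e : 'I_N -> V) (T : R).
Hypothesis e_unit : unit_directions e.
Implicit Types (i j : 'I_N) (t s x y a k l h rho eps del : R).

Lemma branch_continuous i (f : R * V -> R) t k eps :
  {within `]0, T[ `*` branch e i, continuous f} -> 0 < t < T -> 0 <= k -> 0 < eps ->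
  exists2 del : R, 0 < del & forall s l, 0 < s < T -> 0 <= l -> `|s - t| < del ->
    `|l - k| < del -> `|f (s, l *: e i) - f (t, k *: e i)| <= eps.
Proof.
move=> /subspace_continuousP cf tT k0 eps0.
have zA : (`]0, T[ `*` branch e i) (t, k *: e i).
  by split=> /=; [rewrite in_itv /=|exact: branch_point].
have /cvgrPdist_le/(_ _ eps0) := cf _ zA.
move=> [[B1 B2] /= [/nbhs_ballP[r1 r10 b1] /nbhs_ballP[r2 r20 b2]] H].
exists (Num.min r1 r2); first by rewrite lt_min r10.
move=> s l sT l0; rewrite !lt_min => /andP[s1 _] /andP[_ l1].
rewrite distrC; apply: (H (s, l *: e i)); last first.
  by split=> /=; [rewrite in_itv /=|exact: branch_point].
split; first by apply: b1; rewrite /ball /= distrC.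
apply: b2; rewrite -ball_normE /= distrC -scalerBl normrZ.
by case: e_unit => _ ->; rewrite mulr1.
Qed.

Section Increment.
Context (phi phit : R -> V -> R) (phix : 'I_N -> R -> V -> R).
Hypothesis test : test_function e T phi phit phix.

Lemma test_derive_branch i t k : 0 < t < T -> 0 < k ->
  is_derive k (1 : R) (fun l => phi t (l *: e i)) (phix i t (k *: e i)).
Proof.
move=> tT k0; case: test => _ /(_ i)[_ /(_ t k tT (ltW k0)) H _ _].
have cvg : h^-1 *: (phi t ((h *: (1 : R) + k) *: e i) - phi t (k *: e i)) @[h --> (0 : R)^']
    --> phix i t (k *: e i).
  apply/cvgrPdist_le => eps eps0; move/cvgrPdist_le: H => /(_ _ eps0) H.
  have kn : \forall h \near (0 : R)^', 0 <= k + h.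
    near=> h; rewrite -lerBlDl sub0r.
    have : `|h| <= k by near: h; exact: dnbhs0_le.
    by rewrite ler_norml => /andP[].
  near=> h; rewrite /GRing.scale /= mulr1 [h + k]addrC.
  have kh : 0 <= k + h by near: h.
  by move: kh; near: h.
apply: DeriveDef; first by apply/cvg_ex; exists (phix i t (k *: e i)).
exact/cvg_lim.
Unshelve. all: by end_near. Qed.

Lemma test_increment_branch i t l l' : 0 < t < T -> 0 <= l -> l <= l' ->
  exists2 z : R, l <= z <= l' &
    phi t (l' *: e i) - phi t (l *: e i) = phix i t (z *: e i) * (l' - l).
Proof.
move=> tT l0 ll'.
have cphi : {within `]0, T[ `*` branch e i, continuous (fun z : R * V => phi z.1 z.2)}.
  case: test => c _; apply: continuous_subspaceW c => z [z1 z2]; split=> //.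
  by exists i.
have [||z] := @MVT_segment _ (fun l => phi t (l *: e i)) (fun l => phix i t (l *: e i)) _ _ ll'.
- move=> z; rewrite in_itv /= => /andP[z1 _].
  by apply: test_derive_branch => //; exact: le_lt_trans z1.
- apply/subspace_continuousP => z; rewrite /= in_itv /= => /andP[z1 z2].
  have z0 : 0 <= z by exact: le_trans z1.
  apply/cvgrPdist_le => eps eps0.
  have [del del0 H] := branch_continuous cphi tT z0 eps0.
  exists del => //= y; rewrite /ball /= => zy; rewrite in_itv /= => /andP[y1 _].
  rewrite distrC; apply: (H t y) => //; [exact: le_trans y1|by rewrite subrr normr0|].
  by rewrite distrC.
- by rewrite in_itv /= => zi E; exists z.
Qed.

(* C^1 regularity up to the vertex makes phi strictly differentiable. *)
Lemma test_increment i t k eps : 0 < t < T -> 0 <= k -> 0 < eps ->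
  exists2 del : R, 0 < del & forall s s' l l', `|s - t| < del -> `|s' - t| < del ->
    0 <= l -> 0 <= l' -> `|l - k| < del -> `|l' - k| < del ->
    `|phi s' (l' *: e i) - phi s (l *: e i)
       - ((s' - s) * phit t (k *: e i) + (l' - l) * phix i t (k *: e i))|
      <= eps * (`|s' - s| + `|l' - l|).
Proof.
move=> tT k0 eps0; case: (test) => _ /(_ i)[dt _ ct cx].
have [d1 d10 H1] := branch_continuous ct tT k0 eps0.
have [d2 d20 H2] := branch_continuous cx tT k0 eps0.
have /andP[t0 tT'] := tT.
pose del := Num.min (Num.min d1 d2) (Num.min t (T - t)).
have del0 : 0 < del by rewrite !lt_min d10 d20 t0 subr_gt0.
have /and4P[dd1 dd2 dd3 dd4] : [&& del <= d1, del <= d2, del <= t & del <= T - t].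
  by rewrite /del !ge_min !lexx !orbT.
have sT s : `|s - t| < del -> 0 < s < T.
  rewrite ltr_norml => /andP[s1 s2].
  have h1 := lt_le_trans s2 dd4; rewrite ltrD2r in h1; rewrite h1 andbT.
  have h2 : t - del < s by move: s1; rewrite ltrBrDl addrC.
  by apply: le_lt_trans h2; rewrite subr_ge0.
exists del => // s s' l l' sd s'd l0 l'0 ld l'd.
have between u v w c : `|u - c| < del -> `|v - c| < del -> u <= w <= v -> `|w - c| < del.
  rewrite !ltr_norml => /andP[u1 _] /andP[_ v1] /andP[uw wv].
  by rewrite (lt_le_trans u1) ?lerB //= (le_lt_trans _ v1) // lerB.
have [ta Eta tb] : exists2 u, `|u - t| < del &
    phi s' (l' *: e i) - phi s (l' *: e i) = (s' - s) * phit u (l' *: e i).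
  have lb : branch e i (l' *: e i) by exact: branch_point.
  have key u v : u <= v -> `|u - t| < del -> `|v - t| < del -> exists2 w, `|w - t| < del &
      phi v (l' *: e i) - phi u (l' *: e i) = (v - u) * phit w (l' *: e i).
    move=> uv ud vd.
    have D w : u <= w <= v -> is_derive w (1 : R) (phi^~ (l' *: e i)) (phit w (l' *: e i)).
      by move=> wi; apply: dt => //; apply: sT; exact: (between u v).
    have [||w] := @MVT_segment _ (phi^~ (l' *: e i)) (phit^~ (l' *: e i)) _ _ uv.
    - by move=> w; rewrite in_itv /= => /andP[w1 w2]; apply: D; rewrite !ltW.
    - apply: derivable_within_continuous => w; rewrite in_itv /= => wi.
      by case: (D w wi).
    - rewrite in_itv /= => wi ->; exists w; [exact: (between u v)|exact: mulrC].
  have [ss'|/ltW ss'] := leP s s'; first exact: key.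
  have [w wd E] := key _ _ ss' s'd sd; exists w => //.
  by rewrite -[LHS]opprB E -mulNr opprB.
have [ka Eka kb] : exists2 u, 0 <= u /\ `|u - k| < del &
    phi s (l' *: e i) - phi s (l *: e i) = (l' - l) * phix i s (u *: e i).
  have sT' := sT s sd.
  have [ll'|/ltW ll'] := leP l l'.
    have [z zi E] := test_increment_branch i sT' l0 ll'.
    exists z; last by rewrite E mulrC.
    by split; [case/andP: zi => zi _; exact: le_trans zi|exact: (between l l')].
  have [z zi E] := test_increment_branch i sT' l'0 ll'.
  exists z; last by rewrite -[LHS]opprB E -mulrN opprB mulrC.
  by split; [case/andP: zi => zi _; exact: le_trans zi|exact: (between l' l)].
case: Eka => ka0 kad.
have -> : phi s' (l' *: e i) - phi s (l *: e i)
    - ((s' - s) * phit t (k *: e i) + (l' - l) * phix i t (k *: e i))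
  = (s' - s) * (phit ta (l' *: e i) - phit t (k *: e i))
    + (l' - l) * (phix i s (ka *: e i) - phix i t (k *: e i)).
  by rewrite !mulrBr -tb -kb; ring.
apply: le_trans (ler_normD _ _) _; rewrite !normrM mulrDr; apply: lerD; rewrite mulrC ler_wpM2r //.
- by apply: (H1 ta l') => //; [exact: sT|exact: lt_le_trans dd1|exact: lt_le_trans dd1].
- by apply: (H2 s ka) => //; [exact: sT|exact: lt_le_trans dd2|exact: lt_le_trans dd2].
Qed.

End Increment.
End TestFunctions.

Section ValueSubsolution.
Context {R : realType} {V : normedModType R} {N : nat} (e : 'I_N -> V).
Context (L : 'I_N -> R -> R -> R) (L0 C T : R) (g0 : 'I_N -> R -> R) (Lam : R).
Hypothesis e_unit : unit_directions e.
Hypotheses (C0 : 0 <= C) (L_lip : lipschitz_position L C).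
Hypotheses (L_conv : convex_lipschitz_lagrangian L).
Hypotheses (L_super : superlinear_lagrangian L).
Hypotheses (g0_lip : lipschitz_data Lam g0).
Context (phi phit : R -> V -> R) (phix : 'I_N -> R -> V -> R).
Hypothesis test : test_function e T phi phit phix.
Implicit Types (i j : 'I_N) (t s x y a k l h rho eps del : R).

Let U := value_function L L0 C g0.

Section Touching.
Context (i : 'I_N) (t k rho : R).
Hypotheses (tT : 0 < t < T) (k0 : 0 <= k) (rho0 : 0 < rho).
Hypothesis touch : forall j s l, 0 < s < T -> `|t - s| < rho -> 0 <= l ->
  jclose rho i k j l -> U j s l - phi s (l *: e j) <= U i t k - phi t (k *: e i).

Let U_glue j : k = 0 -> U j t k = U i t k.
Proof.
move=> ->; have [glue _ _] := value_suboptimal (L0 := L0) C0 L_lip L_conv L_super g0_lip t.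
by apply: glue; case/andP: tT => t0 _; rewrite ltW //=.
Qed.

(** Runs and stays are treated alike: the increase of [U] along a short piece that arrives at the
    contact point is at most [rate] per unit of time up to [c * h ^+ 2], contact passes this on to
    [phi], and [test_increment] expands [phi]. At the vertex the piece may come from any branch. *)
Lemma touching_rate j a rate c :
  j = i \/ k = 0 -> 0 < k \/ a <= 0 -> 0 <= c ->
  (forall h, 0 < h -> h <= t -> 0 <= k - a * h ->
     U j t k <= U j (t - h) (k - a * h) + h * rate + c * h ^+ 2) ->
  phit t (k *: e j) + a * phix j t (k *: e j) <= rate.
Proof.
have marker : True by [].
move=> ji ka c0 HU; apply/ler_addgt0Pr => eps eps0; have /andP[t0 tT'] := tT.
pose q : R := 1 + `|a| + c.
have q0 : 0 < q by rewrite ltr_wpDr // ltr_wpDr.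
pose eps1 : R := eps / q.
have eps10 : 0 < eps1 by rewrite divr_gt0.
have epsE : eps1 * q = eps by rewrite /eps1 divfK // gt_eqF.
have [del del0 Hdel] := test_increment e_unit test j tT k0 eps10.
pose kk : R := if 0 < k then k else 1.
have kk0 : 0 < kk by rewrite /kk; case: ifP.
have a1 : 0 < `|a| + 1 by rewrite ltr_wpDl.
pose m : R := Num.min (Num.min rho del) kk.
have m0 : 0 < m by rewrite !lt_min rho0 del0.
have /and3P[mrho mdel mkk] : [&& m <= rho, m <= del & m <= kk].
  by rewrite /m !ge_min !lexx !orbT.
pose h : R := Num.min (Num.min (t / 2) eps1) (m / (2 * (`|a| + 1))).
have h0 : 0 < h by rewrite !lt_min eps10 !divr_gt0 // mulr_gt0.
have /and3P[ht he] : [&& h <= t / 2, h <= eps1 & h <= m / (2 * (`|a| + 1))].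
  by rewrite /h !ge_min !lexx !orbT.
rewrite ler_pdivlMr ?mulr_gt0 // => hm.
have ah0 : 0 <= `|a| * h by rewrite mulr_ge0 // ltW.
have ahm : `|a| * h < m by move: hm h0 ah0 m0; lra_goal.
have hm' : h < m by move: hm h0 ah0 m0; lra_goal.
have l0 : 0 <= k - a * h.
  case: ka => [kp|a0].
    have := ler_norm a => /(ler_wpM2r (ltW h0)); move: mkk ahm; rewrite /kk kp; lra_goal.
  by rewrite subr_ge0; apply: le_trans k0; rewrite mulr_le0_ge0 // ltW.
have lk : `|k - a * h - k| = `|a| * h.
  by rewrite addrAC subrr add0r normrN normrM (gtr0_norm h0).
have th : `|t - h - t| = h by rewrite addrAC subrr add0r normrN gtr0_norm.
have ht' : h <= t by move: ht t0; lra_goal.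
have sT : 0 < t - h < T by apply/andP; split; move: ht t0 tT' h0; lra_goal.
have cl : jclose rho i k j (k - a * h).
  case: ji => [->|kE].
    by left; split=> //; rewrite distrC lk (lt_le_trans ahm).
  right; case: ka => [|a0]; first by rewrite kE ltxx.
  rewrite kE sub0r add0r -mulNr -(ler0_norm a0); exact: lt_le_trans mrho.
have ts : `|t - (t - h)| < rho by rewrite distrC th (lt_le_trans hm').
have := touch sT ts l0 cl.
have -> : U i t k - phi t (k *: e i) = U j t k - phi t (k *: e j).
  by case: ji => [->//|kE]; rewrite (U_glue j kE) kE !scale0r.
have := HU h h0 ht' l0.
have := Hdel (t - h) t (k - a * h) k.
rewrite th lk !subrr !normr0 => /(_ (lt_le_trans hm' mdel) del0 l0 k0 (lt_le_trans ahm mdel) del0).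
have e1 : t - (t - h) = h by ring.
have e2 : k - (k - a * h) = a * h by ring.
rewrite e1 e2 normrM (gtr0_norm h0) ler_norml => /andP[D _] HUh tch.
have he2 : c * h ^+ 2 <= h * (c * eps1).
  rewrite expr2 mulrA [leRHS]mulrC; apply: ler_wpM2r; first exact: ltW.
  exact: ler_wpM2l.
have goal : h * (phit t (k *: e j) + a * phix j t (k *: e j)) <= h * (rate + eps).
  by rewrite -epsE /q; move: D HUh tch he2; lra_goal.
by rewrite ler_pM2l in goal.
Qed.

Lemma touching_move j a : j = i \/ k = 0 -> 0 < k \/ a <= 0 ->
  phit t (k *: e j) + a * phix j t (k *: e j) <= L j k a.
Proof.
have marker : True by [].
move=> ji ka; apply: (touching_rate (c := 2 * (C * `|a|))) => //; first by rewrite !mulr_ge0.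
move=> h h0 ht l0; have /andP[t0 _] := tT.
have [_ mv _] := value_suboptimal (L0 := L0) C0 L_lip L_conv L_super g0_lip t.
have th0 : 0 <= t - h by rewrite subr_ge0.
have := mv j (t - h) (k - a * h) a h th0 (ltW h0); rewrite !subrK => /(_ (lexx _) l0 k0).
have := L_lip j a l0 k0; rewrite addrAC subrr add0r normrN normrM (gtr0_norm h0) ler_norml.
by move=> /andP[_ /(ler_wpM2l (ltW h0))]; rewrite /move_cost expr2; lra_goal.
Qed.

Lemma touching_stay : k = 0 -> phit t 0 <= L0.
Proof.
move=> kE; have := @touching_rate i 0 L0 0 (or_introl erefl) (or_intror (lexx _)) (lexx _).
rewrite kE scale0r mul0r addr0; apply=> h h0 ht _; have /andP[t0 _] := tT.
rewrite mul0r !subr0 mul0r addr0.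
have [_ _ st] := value_suboptimal (L0 := L0) C0 L_lip L_conv L_super g0_lip t.
have th0 : 0 <= t - h by rewrite subr_ge0.
by have := st i (t - h) h th0 (ltW h0); rewrite subrK => /(_ (lexx _)).
Qed.

Lemma value_subsolution_at :
  (0 < k -> phit t (k *: e i) + hamiltonian L i k (phix i t (k *: e i)) <= 0) /\
  (k = 0 -> phit t 0 + flux_limiter L L0 (fun j => phix j t 0) <= 0).
Proof.
split=> [kp|kE]; rewrite -lerBrDl sub0r.
  apply: hamiltonian_le => a; have := touching_move (a := a) (or_introl erefl) (or_introl kp).
  lra.
apply: flux_limiter_le => [|j]; first by rewrite lerN2; exact: touching_stay.
apply: hamiltonian_dec_le => a a0.
have := touching_move (j := j) (or_intror kE) (or_intror a0); rewrite kE scale0r; lra.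
Qed.

End Touching.
End ValueSubsolution.

(** * Adding a bump to the value function *)

Section Bump.
Context {R : realType} {N : nat} (L : 'I_N -> R -> R -> R) (L0 C : R).
Context (g0 : 'I_N -> R -> R) (Lam : R).
Hypotheses (C0 : 0 <= C) (L_lip : lipschitz_position L C).
Hypotheses (L_conv : convex_lipschitz_lagrangian L).
Hypotheses (L_super : superlinear_lagrangian L).
Hypotheses (g0_lip : lipschitz_data Lam g0).
Implicit Types (i j : 'I_N) (s l h a p q : R).

Let U := value_function L L0 C g0.

(** The uniform gap [th] and the gap [|a| - (|q| + |K|)] from superlinear growth are combined with
    the weights [1 - mu] and [mu]; the denominator [D] of [mu] makes the constants match. *)
Lemma superlinear_gap (f : R -> R) (p q th K : R) : 0 < th ->
  (forall a, q + a * p + th <= f a) -> (forall a, (`|p| + 1) * `|a| - K <= f a) ->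
  exists2 mu : R, 0 < mu & forall a, q + a * p + mu * (1 + `|a|) <= f a.
Proof.
have marker : True by [].
move=> th0 f1 f2; pose D : R := 1 + `|q| + `|K| + th.
have qK : 0 <= `|q| + `|K| by rewrite addr_ge0.
have D0 : 0 < D by move: th0 qK; rewrite /D; lra_goal.
pose mu : R := th / D.
have mu0 : 0 < mu by rewrite divr_gt0.
have muE : mu * D = th by rewrite /mu divfK // gt_eqF.
have mu1 : mu <= 1 by rewrite ler_pdivrMr // mul1r; move: qK; rewrite /D; lra_goal.
exists mu => // a.
have g1 : `|a| - (`|q| + `|K|) <= f a - (q + a * p).
  have := f2 a; have := ler_norm (a * p); rewrite normrM.
  have := ler_norm q; have := ler_norm K; lra_goal.
have g2 : th <= f a - (q + a * p) by have := f1 a; lra_goal.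
have mu1' : 0 <= 1 - mu by rewrite subr_ge0.
have := ler_wpM2l (ltW mu0) g1; have := ler_wpM2l mu1' g2; move: muE; rewrite /D.
lra_goal.
Qed.

Context (P : pred 'I_N) (psi : 'I_N -> R -> R -> R) (t k rho : R).
Hypotheses (rho0 : 0 < rho) (rho_t : rho < t).

(** Its sublevel sets are neighbourhoods of [(t, k)] within the times up to [t]. It is linear in the
    time because [t] is the final time of the competitor. *)
Definition bump_gauge s l : R := (t - s) + (l - k) ^+ 2.

Let G := bump_gauge.

Hypothesis psi_boundary : forall j s l, P j -> 0 <= s <= t -> 0 <= l -> G s l = rho ->
  psi j s l <= U j s l.
Hypothesis psi_move : forall j s l a h, P j -> 0 <= s -> 0 <= h -> s + h <= t -> 0 <= l ->
  0 <= l + a * h -> G s l <= rho -> G (s + h) (l + a * h) <= rho ->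
  psi j (s + h) (l + a * h) <= psi j s l + move_cost L C j l a h.
Hypothesis psi_vertex : (forall s, s <= t -> rho < G s 0) \/
  [/\ k = 0, forall j, P j, forall i j s, psi i s 0 = psi j s 0 &
      forall j s h, 0 <= s -> 0 <= h -> s + h <= t -> G s 0 <= rho ->
        psi j (s + h) 0 <= psi j s 0 + h * L0].

Let z j s l : R := if P j && (G s l <= rho) then Num.max (U j s l) (psi j s l) else U j s l.

Let Usub : suboptimal L L0 C 0 t U.
Proof. exact: (value_suboptimal (L0 := L0) C0 L_lip L_conv L_super g0_lip t). Qed.

Let Uz j s l : U j s l <= z j s l.
Proof. by rewrite /z; case: ifP => // _; rewrite le_max lexx. Qed.

Let psiz j s l : P j -> G s l <= rho -> psi j s l <= z j s l.
Proof. by move=> Pj Gs; rewrite /z Pj Gs le_max lexx orbT. Qed.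

Lemma gauge_crossing s l a h : 0 <= h -> rho < G s l -> G (s + h) (l + a * h) <= rho ->
  exists2 h', 0 <= h' <= h & G (s + h') (l + a * h') = rho.
Proof.
move=> h0 Gs Gh.
have cG : continuous (fun h' : R => G (s + h') (l + a * h')).
  move=> u; rewrite /G /bump_gauge; apply: cvgD.
    by apply: cvgB; [exact: cvg_cst|apply: cvgD; [exact: cvg_cst|exact: cvg_id]].
  have c1 : (l + a * x - k) @[x --> u] --> (l + a * u - k).
    apply: cvgB; last exact: cvg_cst.
    by apply: cvgD; [exact: cvg_cst|apply: cvgM; [exact: cvg_cst|exact: cvg_id]].
  by under eq_fun do rewrite expr2; rewrite expr2; exact: cvgM.
have [||c] := @IVT _ (fun h' : R => G (s + h') (l + a * h')) 0 h rho h0.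
- exact: continuous_subspaceT.
- by rewrite mulr0 !addr0 ge_min le_max Gh (ltW Gs) orbT.
- by rewrite in_itv /= => ci cE; exists c.
Qed.

(** A run or stay that enters the region [G <= rho] crosses [G = rho], where [psi] is at most [U];
    it is cut there, with the suboptimality of [U] used before and that of [psi] after. By
    [psi_vertex] the region either avoids the vertex or is centred at it and contains a part of
    every branch. *)
Lemma bump_suboptimal : suboptimal L L0 C 0 t z.
Proof.
have [Uglue Umove Ustay] := Usub.
split=> [i j s si|j s l a h s0 h0 st l0 la|j s h s0 h0 st].
- have /andP[s0 st] := si; rewrite /z (Uglue i j s si).
  case: psi_vertex => [no|[_ Pall glue _]]; last by rewrite !Pall (glue i j).
  by rewrite (lt_geF (no s st)) !andbF.
- have zU : U j (s + h) (l + a * h) <= z j s l + move_cost L C j l a h.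
    by apply: le_trans (Umove j s l a h s0 h0 st l0 la) _; rewrite lerD2r.
  rewrite {1}/z; case: ifP => // /andP[Pj Gh]; rewrite ge_max zU /=.
  have [Gs|Gs] := leP (G s l) rho.
    by apply: le_trans (psi_move Pj s0 h0 st l0 la Gs Gh) _; rewrite lerD2r psiz.
  have [h' /andP[h'0 h'h] GE] := gauge_crossing h0 Gs Gh.
  have hh : 0 <= h - h' by rewrite subr_ge0.
  have la' : 0 <= l + a * h'.
    have [a0|a0] := leP 0 a; first by rewrite addr_ge0 // mulr_ge0.
    by apply: (le_trans la); rewrite lerD2l ler_wnM2l // ltW.
  have sh' : s + h' <= t by apply: le_trans st; rewrite lerD2l.
  have sh0 : 0 <= s + h' by rewrite addr_ge0.
  have e1 : s + h' + (h - h') = s + h by ring.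
  have e2 : l + a * h' + a * (h - h') = l + a * h by ring.
  have := @psi_move j (s + h') (l + a * h') a (h - h') Pj sh0 hh.
  rewrite e1 e2 GE => /(_ st la' la (lexx _) Gh) m1.
  have shi : 0 <= s + h' <= t by rewrite sh0.
  have m2 := psi_boundary Pj shi la' GE.
  have m3 := Umove j s l a h' s0 h'0 sh' l0 la'.
  have := move_cost_split C0 L_lip j h'0 hh l0 la'.
  rewrite (_ : h' + (h - h') = h); last by ring.
  have := Uz j s l; lra.
- have zU : U j (s + h) 0 <= z j s 0 + h * L0.
    by apply: le_trans (Ustay j s h s0 h0 st) _; rewrite lerD2r.
  rewrite {1}/z; case: ifP => // /andP[Pj Gh]; rewrite ge_max zU /=.
  case: psi_vertex => [no|[kE _ _ stay]].
    by have := lt_le_trans (no _ st) Gh; rewrite ltxx.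
  have [Gs|Gs] := leP (G s 0) rho.
    by apply: le_trans (stay j s h s0 h0 st Gs) _; rewrite lerD2r psiz.
  have GE s' : G s' 0 = t - s' by rewrite /G /bump_gauge kE subrr expr0n addr0.
  rewrite !GE in Gs Gh.
  have u0 : 0 <= t - rho by rewrite subr_ge0 ltW.
  have h1 : 0 <= t - rho - s by lra.
  have h2 : 0 <= s + h - (t - rho) by lra.
  have e1 : s + (t - rho - s) = t - rho by ring.
  have e2 : t - rho + (s + h - (t - rho)) = s + h by ring.
  have := stay j (t - rho) _ u0 h2; rewrite e2 GE subKr => /(_ st (lexx _)) m1.
  have ui : 0 <= t - rho <= t by rewrite u0 gerBl ltW.
  have := @psi_boundary j (t - rho) 0 Pj ui (lexx _); rewrite GE subKr => /(_ erefl) m2.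
  have ut : t - rho <= t by case/andP: ui.
  have := Ustay j s _ s0 h1; rewrite e1 => /(_ ut) m3.
  have := Uz j s 0; lra.
Qed.

(** As [rho < t], the region misses the initial time, so the competitor has the same data as [U] and
    maximality applies. *)
Lemma bump_le_value i : P i -> 0 <= k -> psi i t k <= U i t k.
Proof.
move=> Pi k0; have t0 : 0 < t by exact: lt_trans rho_t.
have ti : 0 <= t <= t by rewrite (ltW t0) lexx.
have := value_max C0 L_lip L_conv L_super g0_lip bump_suboptimal _ i ti k0.
move=> H; apply: le_trans (psiz Pi _) (H _).
  by rewrite /G /bump_gauge !subrr expr0n addr0 ltW.
move=> j x x0; rewrite /z; case: ifP => [/andP[_]|_].
  by rewrite /G /bump_gauge subr0 leNgt (lt_le_trans rho_t) // lerDl sqr_ge0.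
by rewrite /U (value_init C0 L_lip L_conv L_super g0_lip).
Qed.

End Bump.

Section ValueSupersolution.
Context {R : realType} {V : normedModType R} {N : nat} (e : 'I_N -> V).
Context (L : 'I_N -> R -> R -> R) (L0 C T : R) (g0 : 'I_N -> R -> R) (Lam : R).
Hypothesis e_unit : unit_directions e.
Hypotheses (C0 : 0 <= C) (L_lip : lipschitz_position L C).
Hypotheses (L_conv : convex_lipschitz_lagrangian L).
Hypotheses (L_super : superlinear_lagrangian L).
Hypotheses (g0_lip : lipschitz_data Lam g0).
Context (phi phit : R -> V -> R) (phix : 'I_N -> R -> V -> R).
Hypothesis test : test_function e T phi phit phix.
Implicit Types (i j : 'I_N) (t s x y a k l h p q rho eps del mu sig D : R).

Let U := value_function L L0 C g0.

Lemma gauge_small t k s l sig : 0 <= sig -> s <= t -> sig <= 1 ->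
  bump_gauge t k s l <= sig ^+ 2 -> t - s <= sig /\ `|l - k| <= sig.
Proof.
move=> sig0 st sig1 G; have ts : 0 <= t - s by rewrite subr_ge0.
have l2 := sqr_ge0 (l - k); have s2 : sig ^+ 2 <= sig by rewrite expr2 ler_piMl.
rewrite /bump_gauge in G; split; first by lra.
rewrite -ler_sqr ?nnegrE // real_normK ?num_real //; lra.
Qed.

(** The gap [mu * (1 + |a|)] pays for the change of position in [L], for the expansion error of the
    test function and for the variation of the gauge, to which the small coefficient [mu / 8] is
    adapted. *)
Lemma penalized_increment j k l a h p q mu sig D : 0 <= h -> 0 < mu -> sig <= 1 ->
  C * sig <= mu / 4 -> 0 <= k -> 0 <= l -> `|l - k| <= sig -> `|l + a * h - k| <= sig ->
  (forall a, q + a * p + mu * (1 + `|a|) <= L j k a) ->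
  D <= h * q + a * h * p + mu / 4 * (h + `|a| * h) ->
  D + mu / 8 * (h + (l - k) ^+ 2 - (l + a * h - k) ^+ 2) <= move_cost L C j l a h.
Proof.
have marker : True by [].
move=> h0 mu0 sig1 Csig k0 l0 lk lk' gap DD.
have b1 : (l - k) ^+ 2 - (l + a * h - k) ^+ 2 <= 2 * (`|a| * h).
  have -> : (l - k) ^+ 2 - (l + a * h - k) ^+ 2 = - (a * h) * ((l - k) + (l + a * h - k)) by ring.
  apply: le_trans (ler_norm _) _; rewrite normrM normrN normrM (ger0_norm h0) mulrC.
  rewrite ler_wpM2r ?mulr_ge0 //; apply: le_trans (ler_normD _ _) _.
  by move: lk lk' sig1; lra_goal.
have b2 := ler_wpM2l h0 (gap a).
have b3 : L j k a <= L j l a + mu / 4.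
  have := L_lip j a k0 l0; rewrite (distrC k l) ler_norml => /andP[_].
  have := ler_wpM2l C0 lk; move: Csig; lra_goal.
have b4 := ler_wpM2l h0 b3.
have b5 : 0 <= mu * (`|a| * h) by rewrite mulr_ge0 ?(ltW mu0) // mulr_ge0.
have b6 : 0 <= C * `|a| * h ^+ 2 by rewrite mulr_ge0 ?sqr_ge0 // mulr_ge0.
have b7 : mu / 8 * (h + (l - k) ^+ 2 - (l + a * h - k) ^+ 2) <= mu / 8 * (h + 2 * (`|a| * h)).
  by rewrite ler_wpM2l ?divr_ge0 ?(ltW mu0) // -addrA lerD2l.
have b8 : 0 <= mu * h by rewrite mulr_ge0 // ltW.
by rewrite /move_cost; move: b2 b4 b5 b6 b7 b8 DD; lra_goal.
Qed.

Lemma lagrangian_gap j k p q th : 0 <= k -> 0 < th ->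
  (forall a, q + a * p + th <= L j k a) ->
  exists2 mu : R, 0 < mu & forall a, q + a * p + mu * (1 + `|a|) <= L j k a.
Proof.
move=> k0 th0 f1; have [K _ HK] := lagrangian_lower L0 L_conv L_super C0 L_lip (`|p| + 1).
apply: (superlinear_gap th0 f1 (K := K + C * k)) => a.
by have := HK j k a k0; lra.
Qed.

Section Touching.
Context (i : 'I_N) (t k rho : R).
Hypotheses (tT : 0 < t < T) (k0 : 0 <= k) (rho0 : 0 < rho).
Hypothesis touch : forall j s l, 0 < s < T -> `|t - s| < rho -> 0 <= l ->
  jclose rho i k j l -> U i t k - phi t (k *: e i) <= U j s l - phi s (l *: e j).

Let m := U i t k - phi t (k *: e i).

Lemma touching_edge : 0 < k -> 0 <= phit t (k *: e i) + hamiltonian L i k (phix i t (k *: e i)).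
Proof.
have marker : True by [].
move=> kp; rewrite leNgt; apply/negP => neg; have /andP[t0 tT'] := tT.
set q := phit t _ in neg; set p := phix i t _ in neg.
pose th := - (q + hamiltonian L i k p).
have th0 : 0 < th by rewrite oppr_gt0.
have [|mu mu0 gap] := @lagrangian_gap i k p q th k0 th0.
  move=> a; have := hamiltonian_ge L0 C0 L_lip L_conv L_super i p a k0; rewrite /th; lra_goal.
have mu4 : 0 < mu / 4 by rewrite divr_gt0.
have [del del0 Hdel] := test_increment e_unit test i tT k0 mu4.
pose sig : R := Num.min (Num.min (Num.min 1 (del / 2)) (Num.min (rho / 2) (k / 2)))
  (Num.min (mu / 4 / (C + 1)) (t / 2)).
have C1 : 0 < C + 1 by rewrite ltr_wpDl.
have sig0 : 0 < sig by rewrite !lt_min ltr01 !divr_gt0.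
have /and3P[sig1 sigd sigr] : [&& sig <= 1, sig <= del / 2 & sig <= rho / 2].
  by rewrite /sig !ge_min !lexx !orbT.
have /and3P[sigk sigC sigt] : [&& sig <= k / 2, sig <= mu / 4 / (C + 1) & sig <= t / 2].
  by rewrite /sig !ge_min !lexx !orbT.
have Csig : C * sig <= mu / 4.
  by move: sigC; rewrite ler_pdivlMr //; move: sig0; lra_goal.
(* The bump vanishes on the boundary of the region, where the contact condition gives [psi <= U],
   and has the height [mu / 8 * sig ^+ 2] at the contact point. The bound [sig <= k / 2] keeps the
   vertex outside. *)
pose psi j s l := phi s (l *: e j) + m + mu / 8 * (sig ^+ 2 - bump_gauge t k s l).
have sig2 : 0 < sig ^+ 2 by rewrite exprn_gt0.
have sig2s : sig ^+ 2 <= sig by rewrite expr2 ler_piMl // ltW.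
have sig2t : sig ^+ 2 < t by move: sig2s sigt t0; lra_goal.
have small s l : 0 <= s <= t -> bump_gauge t k s l <= sig ^+ 2 ->
    [/\ 0 < s < T, `|s - t| < del, `|t - s| < rho & `|l - k| <= sig].
  move=> /andP[s0 st] G; have [ts lk] := gauge_small (ltW sig0) st sig1 G.
  rewrite (distrC s) (ger0_norm (_ : 0 <= t - s)) ?subr_ge0 //; split=> //.
  - by apply/andP; split; move: ts st sigt t0 tT'; lra_goal.
  - by move: ts sigd del0; lra_goal.
  - by move: ts sigr rho0; lra_goal.
have psiU : psi i t k <= U i t k.
  apply: (@bump_le_value R N L L0 C g0 Lam C0 L_lip L_conv L_super g0_lip (pred1 i) psi t k
    (sig ^+ 2) sig2 sig2t) => //=; last first.
  - left=> s st; rewrite /bump_gauge sub0r sqrrN.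
    have : sig ^+ 2 < k ^+ 2.
      by rewrite ltr_pXn2r ?nnegrE ?(ltW sig0) //; move: sigk kp; lra_goal.
    by move: st; lra_goal.
  - move=> j s l a h /eqP -> s0 h0 st l0 la Gs Gh.
    have sh0 : 0 <= s + h by rewrite addr_ge0.
    have si : 0 <= s <= t by rewrite s0 (le_trans _ st) // lerDl.
    have shi : 0 <= s + h <= t by rewrite sh0.
    have [_ sd _ lk] := small s l si Gs; have [_ sd' _ lk'] := small _ _ shi Gh.
    have lkd : `|l - k| < del by move: lk sigd del0; lra_goal.
    have lkd' : `|l + a * h - k| < del by move: lk' sigd del0; lra_goal.
    have := Hdel s (s + h) l (l + a * h) sd sd' l0 la lkd lkd'.
    rewrite -/q -/p (_ : s + h - s = h) 1?(_ : l + a * h - l = a * h); [|by ring|by ring].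
    rewrite normrM (ger0_norm h0) ler_norml => /andP[_ D].
    have := penalized_increment h0 mu0 sig1 Csig k0 l0 lk lk' gap (lexx _).
    by rewrite /psi /bump_gauge; move: D; lra_goal.
  - move=> j s l /eqP -> si l0 GE.
    have [sT _ ts lk] : [/\ 0 < s < T, `|s - t| < del, `|t - s| < rho & `|l - k| <= sig].
      by apply: small => //; rewrite GE.
    have := touch sT ts l0 (_ : jclose rho i k i l); rewrite /psi GE subrr mulr0 addr0 /m.
    have cl : jclose rho i k i l.
      by left; split=> //; rewrite distrC; move: lk sigr rho0; lra_goal.
    by move=> /(_ cl); lra_goal.
move: psiU; rewrite /psi /bump_gauge !subrr expr0n addr0 subr0 /m.
have : 0 < mu / 8 * sig ^+ 2 by rewrite mulr_gt0 // divr_gt0.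
by lra_goal.
Qed.

Lemma touching_vertex : k = 0 -> 0 <= phit t 0 + flux_limiter L L0 (fun j => phix j t 0).
Proof.
have marker : True by [].
move=> kE; rewrite leNgt; apply/negP => neg; have /andP[t0 tT'] := tT.
set q := phit t 0 in neg; set FA := flux_limiter _ _ _ in neg.
pose p j := phix j t 0.
pose th := - (q + FA).
have th0 : 0 < th by rewrite oppr_gt0.
have q_stay : q + th <= L0.
  by have := flux_limiter_ge L L0 p; rewrite -/FA /th; lra_goal.
have dec j a : a <= 0 -> q + a * p j + th <= L j 0 a.
  move=> a0; have := hamiltonian_dec_ge L0 C0 L_lip L_conv L_super j (p j) (lexx 0) a0.
  by have := flux_limiter_ge_branch L L0 p j; rewrite -/FA /th; lra_goal.
have [sub Hsub] := choice (fun j => convex_subgradient (lagrangian_convex L_conv j (lexx 0))).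
(* With the slope lowered to the subgradient, the inequality extends to a > 0. *)
pose p' j := Num.min (p j) (sub j).
have all_a j a : q + a * p' j + th <= L j 0 a.
  have d0 := dec j 0 (lexx 0); have s0 := Hsub j a; have p'g : p' j <= sub j by rewrite ge_min lexx orbT.
  have [a0|a0] := leP a 0.
    rewrite /p'; have [_|_] := leP (p j) (sub j); first exact: dec.
    by move: d0 s0; lra_goal.
  have := ler_wpM2l (ltW a0) p'g; move: d0 s0; lra_goal.
have [mu mu0 gap'] : exists2 mu : R, 0 < mu &
    forall j, mu <= th /\ forall a, q + a * p' j + mu * (1 + `|a|) <= L j 0 a.
  have [|mu mu0 H] := @ord_uniform_small R N (fun j mu =>
      mu <= th /\ forall a, q + a * p' j + mu * (1 + `|a|) <= L j 0 a).
    move=> j; have [mu mu0 H] := lagrangian_gap (lexx 0) th0 (all_a j).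
    exists (Num.min mu th); first by rewrite lt_min mu0.
    move=> mu' mu'0; rewrite le_min => /andP[mm mth]; split=> // a; apply: le_trans (H a).
    by rewrite lerD2l ler_wpM2r // addr_ge0.
  by exists mu.
have mu_th : mu <= th := (gap' i).1.
have gap j := (gap' j).2.
have mu4 : 0 < mu / 4 by rewrite divr_gt0.
have [del del0 Hdel] : exists2 del : R, 0 < del & forall j s s' l l',
    `|s - t| < del -> `|s' - t| < del ->
    0 <= l -> 0 <= l' -> `|l - 0| < del -> `|l' - 0| < del ->
    `|phi s' (l' *: e j) - phi s (l *: e j) - ((s' - s) * q + (l' - l) * p j)|
      <= mu / 4 * (`|s' - s| + `|l' - l|).
  have [|del del0 H] := @ord_uniform_small R N (fun j del => forall s s' l l',
    `|s - t| < del -> `|s' - t| < del ->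
    0 <= l -> 0 <= l' -> `|l - 0| < del -> `|l' - 0| < del ->
    `|phi s' (l' *: e j) - phi s (l *: e j) - ((s' - s) * q + (l' - l) * p j)|
      <= mu / 4 * (`|s' - s| + `|l' - l|)).
    move=> j; have := test_increment e_unit test j tT (lexx 0) mu4.
    rewrite scale0r => -[del del0 H]; exists del => // del' _ dd s s' l l' s1 s2 l0 l0' l1 l2.
    by apply: H => //; apply: lt_le_trans dd.
  by exists del.
pose sig : R := Num.min (Num.min (Num.min 1 (del / 2)) (rho / 2))
  (Num.min (mu / 4 / (C + 1)) (t / 2)).
have C1 : 0 < C + 1 by rewrite ltr_wpDl.
have sig0 : 0 < sig by rewrite !lt_min ltr01 !divr_gt0.
have /and3P[sig1 sigd sigr] : [&& sig <= 1, sig <= del / 2 & sig <= rho / 2].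
  by rewrite /sig !ge_min !lexx !orbT.
have /andP[sigC sigt] : (sig <= mu / 4 / (C + 1)) && (sig <= t / 2).
  by rewrite /sig !ge_min !lexx !orbT.
have Csig : C * sig <= mu / 4.
  by move: sigC; rewrite ler_pdivlMr //; move: sig0; lra_goal.
(* In space [phi] is replaced by an affine function with the lowered slope [p' j]. The further
   [mu / 4] absorbs the expansion error, so that [psi] stays below [phi + m] on the boundary of the
   region. *)
pose psi j s l := phi s 0 + m + (p' j - mu / 4) * l + mu / 8 * (sig ^+ 2 - bump_gauge t 0 s l).
have sig2 : 0 < sig ^+ 2 by rewrite exprn_gt0.
have sig2s : sig ^+ 2 <= sig by rewrite expr2 ler_piMl // ltW.
have sig2t : sig ^+ 2 < t by move: sig2s sigt t0; lra_goal.
have small s l : 0 <= s <= t -> bump_gauge t 0 s l <= sig ^+ 2 ->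
    [/\ 0 < s < T, `|s - t| < del, `|t - s| < rho & `|l - 0| <= sig].
  move=> /andP[s0 st] G; have [ts lk] := gauge_small (ltW sig0) st sig1 G.
  rewrite (distrC s) (ger0_norm (_ : 0 <= t - s)) ?subr_ge0 //; split=> //.
  - by apply/andP; split; move: ts st sigt t0 tT'; lra_goal.
  - by move: ts sigd del0; lra_goal.
  - by move: ts sigr rho0; lra_goal.
have time s h : 0 <= h -> `|s - t| < del -> `|s + h - t| < del ->
    phi (s + h) 0 - phi s 0 <= h * q + mu / 4 * h.
  move=> h0 sd sd'; have := Hdel i s (s + h) 0 0 sd sd' (lexx _) (lexx _).
  rewrite !subrr normr0 scale0r (_ : s + h - s = h); last by ring.
  rewrite (ger0_norm h0) mul0r !addr0.
  by move=> /(_ del0 del0); rewrite ler_norml => /andP[_]; lra_goal.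
have psiU : psi i t 0 <= U i t 0.
  apply: (@bump_le_value R N L L0 C g0 Lam C0 L_lip L_conv L_super g0_lip predT psi t 0
    (sig ^+ 2) sig2 sig2t) => //=; last first.
  - right; split=> // [j j' s|j s h s0 h0 st Gs]; first by rewrite /psi !mulr0.
    have sh0 : 0 <= s + h by rewrite addr_ge0.
    have si : 0 <= s <= t by rewrite s0 (le_trans _ st) // lerDl.
    have shi : 0 <= s + h <= t by rewrite sh0.
    have Gh : bump_gauge t 0 (s + h) 0 <= sig ^+ 2.
      by apply: le_trans Gs; rewrite /bump_gauge; move: h0; lra_goal.
    have [_ sd _ _] := small s 0 si Gs; have [_ sd' _ _] := small _ 0 shi Gh.
    have := time s h h0 sd sd'; have := ler_wpM2l h0 q_stay.
    have := ler_wpM2l h0 mu_th; have := mulr_ge0 (ltW mu0) h0.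
    by rewrite /psi /bump_gauge; lra_goal.
  - move=> j s l a h _ s0 h0 st l0 la Gs Gh.
    have sh0 : 0 <= s + h by rewrite addr_ge0.
    have si : 0 <= s <= t by rewrite s0 (le_trans _ st) // lerDl.
    have shi : 0 <= s + h <= t by rewrite sh0.
    have [_ sd _ lk] := small s l si Gs; have [_ sd' _ lk'] := small _ _ shi Gh.
    have D := time s h h0 sd sd'.
    have := penalized_increment h0 mu0 sig1 Csig (lexx 0) l0 lk lk' (gap j) (lexx _).
    have aah : - (a * h) <= `|a| * h by rewrite -mulNr ler_wpM2r // -normrN ler_norm.
    have := ler_wpM2l (ltW mu4) aah.
    by rewrite /psi /bump_gauge; move: D; lra_goal.
  - move=> j s l _ si l0 GE.
    have [sT sd ts lk] : [/\ 0 < s < T, `|s - t| < del, `|t - s| < rho & `|l - 0| <= sig].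
      by apply: small => //; rewrite GE.
    have cl : jclose rho i k j l.
      by right; rewrite kE add0r; move: lk; rewrite subr0 (ger0_norm l0); move: sigr rho0; lra_goal.
    have := touch sT ts l0 cl; rewrite /psi GE subrr mulr0 addr0 /m.
    have ld : `|l - 0| < del by move: lk sigd del0; lra_goal.
    have := Hdel j s s 0 l sd sd (lexx _) l0 _ ld; rewrite subrr normr0 scale0r => /(_ del0).
    rewrite !subr0 (ger0_norm l0) subrr mul0r !add0r normr0 add0r ler_norml => /andP[D _].
    have p'p : p' j <= p j by rewrite ge_min lexx.
    by have := ler_wpM2l l0 p'p; move: D; lra_goal.
move: psiU; rewrite /psi /bump_gauge !subrr expr0n addr0 subr0 mulr0 addr0 /m kE scale0r.
have : 0 < mu / 8 * sig ^+ 2 by rewrite mulr_gt0 // divr_gt0.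
by lra_goal.
Qed.

End Touching.
End ValueSupersolution.

(** * Existence and uniqueness of the flux-limited solution *)

Section ValueSolution.
Context {R : realType} {V : normedModType R} {N : nat} (e : 'I_N -> V).
Context (L : 'I_N -> R -> R -> R) (L0 C T : R) (u0 : V -> R) (Lam : R) (i0 : 'I_N).
Hypothesis e_unit : unit_directions e.
Hypotheses (C0 : 0 <= C) (L_lip : lipschitz_position L C).
Hypotheses (L_conv : convex_lipschitz_lagrangian L).
Hypotheses (L_super : superlinear_lagrangian L).
Hypotheses (T0 : 0 < T) (Lam0 : 0 <= Lam).

Let g0 (i : 'I_N) (k : R) := u0 (k *: e i).
Hypothesis g0_lip : lipschitz_data Lam g0.

Implicit Types (i j : 'I_N) (m n : nat) (t x y a c h s dx dt k l rho eps : R).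

Let U := value_function L L0 C g0.

Definition junction_value : R -> V -> R := junction_fun e i0 U.

Lemma junction_valueE i t k : 0 <= t -> 0 <= k -> junction_value t (k *: e i) = U i t k.
Proof.
move=> t0 k0; apply: junction_funE => // j j'.
have [glue _ _] := value_suboptimal (L0 := L0) C0 L_lip L_conv L_super g0_lip t.
by apply: glue; rewrite t0 /=.
Qed.

Lemma junction_value_growth : exists B : R, forall t (x : V), 0 <= t < T -> junction e x ->
  `|junction_value t x| <= B * (1 + `|x|).
Proof.
have marker : True by [].
have [KU [KU0 _] up] := lagrangian_upper L0 L_conv L_lip.
have [K [K0 _] [_ bar]] := barrier_exists L0 C0 L_lip L_conv L_super Lam T.
exists (`|u0 0| + Lam + T * (KU + K + C)) => t x /andP[t0 tT] /(junctionE e_unit)[i xE].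
rewrite {1}xE; move: (normr_ge0 x); set k := `|x| => k0; rewrite junction_valueE //.
have h1 := initial_growth g0_lip i k0; rewrite -/(g0 i k) ler_norml in h1; case/andP: h1 => h1 h2.
have h3 := value_rest (L0 := L0) C0 L_lip L_conv L_super g0_lip i t0 k0.
have h4 := ler_wpM2l t0 (up i k 0 k0 (_ : `|0 : R| <= 1)); rewrite normr0 in h4.
have {}h4 := h4 ler01.
have h5 : barrier C g0 K i t k <= U i t k.
  apply: (value_max C0 L_lip L_conv L_super g0_lip (bar 0 t g0 Lam (lexx _) g0_lip _ (ltW tT))) => //.
  - by rewrite oppr_le0 ltW.
  - by move=> j y _; rewrite /barrier mulr0 subr0.
  - by rewrite t0 lexx.
have key M : 0 <= M -> t * (M + C * k) <= T * (M + C) * (1 + k).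
  move=> M0; rewrite -mulrA; apply: ler_pM => //; [by rewrite addr_ge0 // mulr_ge0|exact: ltW|].
  by have := mulr_ge0 M0 k0; move: C0; lra_goal.
have k1 := key _ KU0; have k2 := key _ K0.
have n0 := mulr_ge0 (normr_ge0 (u0 0)) k0.
have TK : 0 <= T * K * (1 + k) by rewrite mulr_ge0 ?addr_ge0 // mulr_ge0 // ltW.
have TKU : 0 <= T * KU * (1 + k) by rewrite mulr_ge0 ?addr_ge0 // mulr_ge0 // ltW.
have TC : 0 <= T * C * (1 + k) by rewrite mulr_ge0 ?addr_ge0 // mulr_ge0 // ltW.
have n1 := ler_norm (u0 0); have n2 := ler_norm (- u0 0); rewrite normrN in n2.
have Lam0' := Lam0; rewrite /barrier in h5.
rewrite ler_norml; apply/andP; split.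
  by move: h1 h5 k2 n0 TKU TC n2 Lam0'; lra_goal.
by move: h2 h3 h4 k1 n0 TK TC n1 Lam0'; lra_goal.
Qed.

Lemma value_continuous i t k eps : 0 <= t <= T -> 0 <= k -> 0 < eps ->
  exists2 rho : R, 0 < rho & forall s j l, 0 <= s <= T -> `|t - s| < rho -> 0 <= l ->
    jclose rho i k j l -> `|U i t k - U j s l| <= eps.
Proof.
have marker : True by [].
move=> tT k0 eps0; have k1 : 0 <= k + 1 by rewrite addr_ge0.
have [M M0 H] := value_lipschitz (L0 := L0) C0 L_lip L_conv L_super Lam0 g0_lip (ltW T0) k1.
have M1 : 0 < 2 * (M + 1) by rewrite mulr_gt0 // ltr_wpDl.
pose rho := Num.min 1 (eps / (2 * (M + 1))).
have rho0 : 0 < rho by rewrite lt_min ltr01 divr_gt0.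
have rho1 : rho <= 1 by rewrite ge_min lexx.
have rhoE : rho * (2 * (M + 1)) <= eps by rewrite -ler_pdivlMr // ge_min lexx orbT.
have kk : 0 <= k <= k + 1 by rewrite k0 lerDl ler01.
have k00 : 0 <= (0 : R) <= k + 1 by rewrite lexx k1.
exists rho => // s j l sT ts l0 cl.
have lk : 0 <= l <= k + 1.
  rewrite l0 /=; case: cl => [[_]|]; last by move: k0 rho1; lra_goal.
  by rewrite ltr_norml => /andP[+ _]; move: rho1; lra_goal.
have bound d : d <= rho -> 0 <= d -> M * (`|t - s| + d) <= eps.
  move=> dr d0; have : `|t - s| + d <= 2 * rho by move: ts dr; lra_goal.
  by move=> /(ler_wpM2l M0); move: rhoE (ltW rho0); lra_goal.
case: cl => [[<- kl]|kl]; first by apply: le_trans (H _ _ _ _ _ tT sT kk lk) _; apply: bound => //; exact: ltW.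
have := H i t s k 0 tT sT kk k00; have := H j s s 0 l sT sT k00 lk.
rewrite subrr normr0 add0r subr0 sub0r normrN (ger0_norm l0) (ger0_norm k0) -/U.
have -> : U i s 0 = U j s 0.
  have [glue _ _] := value_suboptimal (L0 := L0) C0 L_lip L_conv L_super g0_lip T.
  exact: glue.
move=> h1 h2.
have := ler_normD (U i t k - U j s 0) (U j s 0 - U j s l); rewrite addrA subrK.
have := bound (k + l) (ltW kl) (addr_ge0 k0 l0).
by move: h1 h2; lra_goal.
Qed.

Let in_closed t : 0 <= t < T -> 0 <= t <= T.
Proof. by move=> /andP[-> /ltW]. Qed.

Lemma upper_envelope_value i t k : 0 <= t < T -> 0 <= k ->
  upper_envelope e T junction_value (t, k *: e i) = (U i t k)%:E.
Proof.
move=> tT k0; have /andP[t0 _] := tT; rewrite (upper_envelope_cont e_unit k0 tT) ?junction_valueE //.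
move=> eta eta0; have [rho rho0 H] := value_continuous i (in_closed tT) k0 eta0.
exists rho => // s j l sT ts l0 cl; have /andP[s0 _] := sT; rewrite /= !junction_valueE //.
by have := H s j l (in_closed sT) ts l0 cl; rewrite ler_norml => /andP[]; lra.
Qed.

Lemma lower_envelope_value i t k : 0 <= t < T -> 0 <= k ->
  lower_envelope e T junction_value (t, k *: e i) = (U i t k)%:E.
Proof.
move=> tT k0; have /andP[t0 _] := tT; rewrite lower_envelopeE.
rewrite (upper_envelope_cont e_unit k0 tT); first by rewrite -EFinN opprK junction_valueE.
move=> eta eta0; have [rho rho0 H] := value_continuous i (in_closed tT) k0 eta0.
exists rho => // s j l sT ts l0 cl; have /andP[s0 _] := sT; rewrite /= !junction_valueE //.
have := H s j l (in_closed sT) ts l0 cl; rewrite ler_norml => /andP[]; lra.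
Qed.

Let in_half t : 0 < t < T -> 0 <= t < T.
Proof. by move=> /andP[/ltW ->]. Qed.

Lemma junction_value_subsolution : subsolution e L L0 T u0 junction_value.
Proof.
split=> [phi phit phix test t x xD vmax|x /(junctionE e_unit)[i ->]]; last first.
  rewrite upper_envelope_value ?lexx ?T0 // lee_fin.
  by rewrite /U (value_init C0 L_lip L_conv L_super g0_lip).
move: (xD) => [/=]; rewrite in_itv /= => tT _.
have touch i k : 0 <= k -> x = k *: e i ->
    (0 < k -> phit t (k *: e i) + hamiltonian L i k (phix i t (k *: e i)) <= 0) /\
    (k = 0 -> phit t 0 + flux_limiter L L0 (fun j => phix j t 0) <= 0).
  move=> k0 xE; move: vmax; rewrite xE /local_max => /(near_withinP e_unit _ _ _ _ k0)[rho rho0 H].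
  apply: (value_subsolution_at e_unit C0 L_lip L_conv L_super g0_lip test tT k0 rho0).
  move=> j s l sT ts l0 cl.
  have sI : [set` `]0, T[] s by rewrite /= in_itv.
  have := H s j l sI ts l0 cl.
  by rewrite !upper_envelope_value ?in_half // -!EFinB lee_fin.
split=> [i [[k k0 xE] /eqP x0]|x0].
  have kp : 0 < k by rewrite lt_neqAle k0 andbT eq_sym; apply: contraNneq x0 => kE; rewrite xE kE scale0r.
  by have [H _] := touch i k k0 xE; rewrite xE norm_point //; exact: H.
by have [_ H] := touch i0 0 (lexx 0) (etrans x0 (esym (scale0r _))); rewrite x0; exact: H.
Qed.

Lemma junction_value_supersolution : supersolution e L L0 T u0 junction_value.
Proof.
split=> [phi phit phix test t x xD vmin|x /(junctionE e_unit)[i ->]]; last first.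
  rewrite lower_envelope_value ?lexx ?T0 // lee_fin.
  by rewrite /U (value_init C0 L_lip L_conv L_super g0_lip).
move: (xD) => [/=]; rewrite in_itv /= => tT _.
have touch i k : 0 <= k -> x = k *: e i ->
    (0 < k -> 0 <= phit t (k *: e i) + hamiltonian L i k (phix i t (k *: e i))) /\
    (k = 0 -> 0 <= phit t 0 + flux_limiter L L0 (fun j => phix j t 0)).
  move=> k0 xE; move: vmin; rewrite xE /local_min => /(near_withinP e_unit _ _ _ _ k0)[rho rho0 H].
  have tch j s l : 0 < s < T -> `|t - s| < rho -> 0 <= l -> jclose rho i k j l ->
      U i t k - phi t (k *: e i) <= U j s l - phi s (l *: e j).
    move=> sT ts l0 cl.
    have sI : [set` `]0, T[] s by rewrite /= in_itv.
    have := H s j l sI ts l0 cl.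
    by rewrite !lower_envelope_value ?in_half // -!EFinB lee_fin.
  split=> kc.
    exact: (touching_edge e_unit C0 L_lip L_conv L_super g0_lip test tT k0 rho0 tch).
  exact: (touching_vertex e_unit C0 L_lip L_conv L_super g0_lip test tT rho0 tch).
split=> [i [[k k0 xE] /eqP x0]|x0].
  have kp : 0 < k by rewrite lt_neqAle k0 andbT eq_sym; apply: contraNneq x0 => kE; rewrite xE kE scale0r.
  by have [H _] := touch i k k0 xE; rewrite xE norm_point //; exact: H.
by have [_ H] := touch i0 0 (lexx 0) (etrans x0 (esym (scale0r _))); rewrite x0; exact: H.
Qed.

(** The chain is [v <= v^* <= U <= v_* <= v]: the outer inequalities hold for envelopes in general,
    the inner ones are the two comparisons with the value function. *)
Lemma junction_value_unique (v : R -> V -> R) : flux_limited_solution e L L0 T u0 v ->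
  linear_growth e T v -> forall t (x : V), closed_domain e T (t, x) -> v t x = junction_value t x.
Proof.
move=> [vsub vsuper] [B vB] t x [/=]; rewrite in_itv /= => tT /(junctionE e_unit)[i ->].
have k0 := normr_ge0 x; have /andP[t0 _] := tT; rewrite junction_valueE //.
apply/eqP; rewrite eq_le; apply/andP; split.
  apply: le_trans (envelope_ge e_unit vB i tT k0) _.
  exact: (subsolution_le_value e_unit C0 L_lip L_conv L_super vB vsub i g0_lip tT k0).
have nvB (s : R) (y : V) : 0 <= s < T -> junction e y -> `|- v s y| <= B * (1 + `|y|).
  by rewrite normrN; exact: vB.
have H := value_le_supersolution e_unit C0 L_lip L_conv L_super Lam0 g0_lip i vB vsuper tT k0.
apply: le_trans H _; rewrite lerNl; exact: (envelope_ge e_unit nvB i tT k0).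
Qed.

End ValueSolution.

(** * Convergence *)

Section Convergence.
Context {R : realType} {V : normedModType R} {N : nat} (e : 'I_N -> V).
Context (L : 'I_N -> R -> R -> R) (L0 C T : R) (u0 : V -> R) (Lam : R) (i0 : 'I_N).
Hypothesis e_unit : unit_directions e.
Hypotheses (C0 : 0 <= C) (L_lip : lipschitz_position L C).
Hypotheses (L_conv : convex_lipschitz_lagrangian L).
Hypotheses (L_super : superlinear_lagrangian L).
Hypotheses (T0 : 0 < T) (Lam0 : 0 <= Lam).

Let g0 (i : 'I_N) (k : R) := u0 (k *: e i).
Hypothesis g0_lip : lipschitz_data Lam g0.

Implicit Types (i j : 'I_N) (m n : nat) (t x y a c h s dx dt k l rho eps : R).

Let U := value_function L L0 C g0.
Let u := junction_value e L L0 C u0 i0.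
Let W := discrete_solution e L L0 u0.

(** The upper bound is known relative to the limit point [(t, k)] and is carried to the grid point
    by continuity of [U]; the lower bound is uniform on bounded sets and applies at the grid point
    directly. *)
Lemma scheme_value_near i t k eps : 0 <= t <= T -> 0 <= k -> 0 < eps ->
  exists2 rho : R, 0 < rho & forall dx dt, 0 < dx < rho -> 0 < dt < rho ->
    dx ^+ 2 <= rho * dt -> forall n j m, n%:R * dt <= T -> `|t - n%:R * dt| < rho ->
    jclose rho i k j (m%:R * dx) ->
    `|W dx dt n ((m%:R * dx) *: e j) - U j (n%:R * dt) (m%:R * dx)| <= eps.
Proof.
have marker : True by [].
move=> tT k0 eps0; have eps2 : 0 < eps / 2 by rewrite divr_gt0.
have k1 : 0 <= k + 1 by rewrite addr_ge0.
have /andP[t0 _] := tT.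
have [r1 r10 up] := scheme_near_le_value L0 e_unit C0 L_lip L_conv L_super (ltW T0) Lam0 g0_lip
  i t0 k0 eps2.
have [r2 r20 low] := scheme_ge_value L0 e_unit C0 L_lip L_conv L_super (ltW T0) Lam0 g0_lip k1 eps0.
have [r3 r30 cont] := value_continuous L0 C0 L_lip L_conv L_super T0 Lam0 g0_lip i tT k0 eps2.
pose rho := Num.min (Num.min 1 r1) (Num.min r2 r3).
have rho0 : 0 < rho by rewrite !lt_min ltr01 r10 r20.
have /and4P[q1 q2 q3 q4] : [&& rho <= 1, rho <= r1, rho <= r2 & rho <= r3].
  by rewrite /rho !ge_min !lexx !orbT.
exists rho => // dx dt /andP[dx0 dxr] /andP[dt0 dtr] mesh n j m nT tn cl.
have m0 : 0 <= m%:R * dx by rewrite mulr_ge0 // ltW.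
have n0 : 0 <= n%:R * dt by rewrite mulr_ge0 // ltW.
have mk : m%:R * dx <= k + 1.
  case: cl => [[_]|]; last by move: k0 q1; lra_goal.
  by rewrite ltr_norml => /andP[+ _]; move: q1; lra_goal.
have sub r : rho <= r -> [/\ 0 < dx < r, 0 < dt < r & dx ^+ 2 <= r * dt].
  move=> rr; rewrite dx0 dt0 !(lt_le_trans _ rr) //; split=> //.
  by apply: le_trans mesh _; rewrite ler_wpM2r // ltW.
have [a1 a2 a3] := sub _ q2; have [b1 b2 b3] := sub _ q3.
have := up dx dt a1 a2 a3 n j m nT (lt_le_trans tn q2) (jclose_le q2 cl).
have := low dx dt b1 b2 b3 n j m nT mk.
have nT' : 0 <= n%:R * dt <= T by rewrite n0.
have := cont _ j _ nT' (lt_le_trans tn q4) m0 (jclose_le q4 cl).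
rewrite -/W -/g0 -/U !ler_norml => /andP[h1 h2] h3 h4; apply/andP; split.
  by move: h3; lra_goal.
by move: h1 h2 h3 h4; lra_goal.
Qed.

(** The local estimates are glued by the near-covering form of compactness, with the mesh as the
    parameter running along [F]. *)
Lemma grid_error_small (K : set (R * V)) (F : set_system (R * R)) eps :
  ProperFilter F -> admissible_meshes F -> compact K -> K `<=` open_domain e T -> 0 < eps ->
  \forall d \near F, (grid_error e L L0 T u0 K u d.1 d.2 <= eps%:E)%E.
Proof.
move=> FF [mesh_pos mesh_x mesh_t mesh_q] Kc KD eps0.
pose P (d : R * R) (z : R * V) := forall n j m, n%:R * d.2 <= T ->
  z = (n%:R * d.2, (m%:R * d.1) *: e j) ->
  `|W d.1 d.2 n ((m%:R * d.1) *: e j) - U j (n%:R * d.2) (m%:R * d.1)| <= eps.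
have cover : \forall d \near F, K `<=` P d.
  apply: ((compact_near_coveringP K).1 Kc) => -[t x] /KD [/=]; rewrite in_itv /= => tT.
  move=> /(junctionE e_unit)[i ->]; move: (normr_ge0 x); set k := `|x| => k0.
  have tT' : 0 <= t <= T by case/andP: tT => t1 t2; rewrite !ltW.
  have [rho rho0 H] := scheme_value_near i tT' k0 eps0.
  have [c c0 Hc] := norm_jclose e_unit.
  exists ([set z : R * V | `|t - z.1| < rho /\ `|k *: e i - z.2| < c * rho],
          [set d : R * R | [/\ 0 < d.1 < rho, 0 < d.2 < rho & d.1 ^+ 2 <= rho * d.2]]); first split=> /=.
  - exists (ball t rho, ball (k *: e i) (c * rho)).
      by split; apply: nbhsx_ballx => //; exact: mulr_gt0.
    by move=> [s y] [/= h1 h2]; split=> //; move: h2; rewrite -ball_normE.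
  - have nx : \forall d \near F, `|d.1| < rho by apply: cvgr0_norm_lt mesh_x _ rho0.
    have nt : \forall d \near F, `|d.2| < rho by apply: cvgr0_norm_lt mesh_t _ rho0.
    have nq : \forall d \near F, `|d.1 ^+ 2 / d.2| < rho by apply: cvgr0_norm_lt mesh_q _ rho0.
    near=> d.
    have [d1 d2] : 0 < d.1 /\ 0 < d.2 by near: d.
    have h1 : `|d.1| < rho by near: d.
    have h2 : `|d.2| < rho by near: d.
    have h3 : `|d.1 ^+ 2 / d.2| < rho by near: d.
    split; [by rewrite d1 -(gtr0_norm d1)|by rewrite d2 -(gtr0_norm d2)|].
    by rewrite -ler_pdivrMr // (le_trans (ler_norm _)) // ltW.
  - move=> [[s y] d] /= [[ts xy] [dx1 dt1 dq]] n j m nT [sE yE].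
    rewrite sE yE in ts xy *; apply: (H d.1 d.2) => //.
    have m0 : 0 <= m%:R * d.1 by case/andP: dx1 => d1 _; rewrite mulr_ge0 // ltW.
    exact: Hc.
near=> d.
have KP : K `<=` P d by near: d.
have [d1 d2] : 0 < d.1 /\ 0 < d.2 by near: d.
apply: ge_ereal_sup => _ [->|[n [x [nT [j [m xE]] Kx ->]]]].
  by rewrite lee_fin ltW.
have m0 : 0 <= m%:R * d.1 by rewrite mulr_ge0 // ltW.
have n0 : 0 <= n%:R * d.2 by rewrite mulr_ge0 // ltW.
have nT' : n%:R * d.2 <= T.
  rewrite -ler_pdivlMr //; apply: (@le_trans _ _ (Num.truncn (T / d.2))%:R); first by rewrite ler_nat.
  by rewrite truncn_le // divr_ge0 // ltW.
rewrite lee_fin xE /u (junction_valueE L0 i0 e_unit C0 L_lip L_conv L_super g0_lip j n0 m0).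
by apply: (KP _ Kx) => //; rewrite xE.
Unshelve. all: by end_near. Qed.

Lemma junction_value_converges (F : set_system (R * R)) : ProperFilter F ->
  admissible_meshes F -> scheme_converges e L L0 T u0 F u.
Proof.
move=> FF meshF K Kc KD; apply/eqP; rewrite eq_le; apply/andP; split.
  apply/lee_addgt0Pr => eps eps0; rewrite add0e.
  apply: ge_ereal_inf.
  exists (ereal_sup [set grid_error e L L0 T u0 K u d.1 d.2 | d in
    [set d : R * R | (grid_error e L L0 T u0 K u d.1 d.2 <= eps%:E)%E]]).
    by exists [set d : R * R | (grid_error e L L0 T u0 K u d.1 d.2 <= eps%:E)%E] => //;
      exact: grid_error_small.
  by apply: ge_ereal_sup => _ [d dS <-].
(* Each set of the proper filter contains a mesh, and the value 0 included in [grid_error] bounds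
   its error from below. *)
apply: le_ereal_inf_tmp => _ [S FS <-].
have [d Sd] := filter_ex FS.
apply: le_trans (ereal_sup_ubound _); last by exists d.
by apply: ereal_sup_ubound; left.
Qed.

End Convergence.

Theorem theorem3 (R : realType) (V : normedModType R) (N : nat)
    (e : 'I_N -> V) (L : 'I_N -> R -> R -> R) (L0 T : R) (u0 : V -> R)
    (N_gt0 : (0 < N)%N) (e_unit : unit_directions e)
    (L_conv : convex_lipschitz_lagrangian L) (L_super : superlinear_lagrangian L)
    (T_gt0 : 0 < T) (u0_lip : jlipschitz e u0) :
  exists u : R -> V -> R,
    [/\ flux_limited_solution e L L0 T u0 u /\ linear_growth e T u,
        forall v : R -> V -> R,
          flux_limited_solution e L L0 T u0 v -> linear_growth e T v ->
          forall t x, closed_domain e T (t, x) -> v t x = u t x &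
        forall F : set_system (R * R), ProperFilter F -> admissible_meshes F ->
          scheme_converges e L L0 T u0 F u].
Proof.
have [C L_lip] : exists C : R, lipschitz_position L C by exact: L_conv.2.
have {}L_lip : lipschitz_position L `|C|.
  move=> i x y a x0 y0; apply: le_trans (L_lip i x y a x0 y0) _.
  by rewrite ler_wpM2r // ler_norm.
have C0 := normr_ge0 C; case: u0_lip => M u0M; have M0 := normr_ge0 M.
have g0_lip : lipschitz_data `|M| (fun i k => u0 (k *: e i)).
  split=> [i j|i x y x0 y0]; first by rewrite !scale0r.
  have xy : jdist e (x *: e i) (y *: e i) = `|x - y|.
    rewrite /jdist; case: asboolP => [_|[]]; last by exists i; split; exact: branch_point.
    by case: e_unit => _ eu; rewrite -scalerBl normrZ eu mulr1.
  apply: le_trans (u0M _ _ (junction_point e i x0) (junction_point e i y0)) _.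
  by rewrite xy ler_wpM2r // ler_norm.
pose i0 := Ordinal N_gt0.
exists (junction_value e L L0 `|C| u0 i0); split.
- split; last exact: (junction_value_growth L0 i0 e_unit C0 L_lip L_conv L_super T_gt0 M0 g0_lip).
  split.
    exact: (junction_value_subsolution L0 i0 e_unit C0 L_lip L_conv L_super T_gt0 M0 g0_lip).
  exact: (junction_value_supersolution L0 i0 e_unit C0 L_lip L_conv L_super T_gt0 M0 g0_lip).
- exact: (junction_value_unique i0 e_unit C0 L_lip L_conv L_super M0 g0_lip).
- move=> F FF meshF.
  by apply: (junction_value_converges L0 i0 e_unit C0 L_lip L_conv L_super T_gt0 M0 g0_lip).
Qed.
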